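(* Fix integers $k\ge1$ and $1\le q_1<\dots<q_k$ (not depending on $n$), and for each $n\ge1$ let $F^{(n)}=\sum_{i=1}^k F_i^{(n)}$ with $F_i^{(n)}=I_{q_i}(f_i^{(n)})$, where each $f_i^{(n)}$ is a nonzero symmetric square-integrable kernel and, for each $n$, the family $\{f_i^{(n)}:i=1,\dots,k\}$ satisfies the technical assumptions (i)–(iii) listed in the context (the underlying Poisson measure and its control measure $\mu=\mu_n$ may depend on $n$). Let $\sigma_i^2(n)=E[(F_i^{(n)})^2]$ and $\sigma^2(n)=E[(F^{(n)})^2]$, and assume that $\sigma^2(n)\to\sigma^2$ for some $\sigma^2>0$ ($\sigma>0$). Suppose that $B_3(F^{(n)};\sigma)\to0$ as $n\to\infty$. For each $n$, let $N_{n,1},\dots,N_{n,k}$ be independent with $N_{n,i}\sim\mathscr N(0,\sigma_i^2(n))$, $i=1,\dots,k$. Then, for every thrice differentiable function $\varphi:\mathbb R^k\to\mathbb R$ such that $\|\varphi''\|_\infty<\infty$ and $\|\varphi'''\|_\infty<\infty$, $$E[\varphi(F_1^{(n)},\dots,F_k^{(n)})]-E[\varphi(N_{n,1},\dots,N_{n,k})]\longrightarrow0,\qquad n\to\infty.$$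
   Context: $(Z,\mathscr Z,\mu)$ is a Borel space with its Borel $\sigma$-field and a $\sigma$-finite measure $\mu$ without atoms. $\eta$ is a Poisson measure on $Z$ with control $\mu$: $\eta(B)$ is Poisson with mean $\mu(B)$ whenever $\mu(B)<\infty$, and $\eta(B),\eta(C)$ are independent for disjoint $B,C$; $\hat\eta=\eta-\mu$. $L^2_s(\mu^q)$ is the space of $\mu^q$-a.e. symmetric functions in $L^2(\mu^q)$, and $I_q(f)$ is the multiple Wiener–Itô integral of order $q$ of $f\in L^2_s(\mu^q)$ with respect to $\hat\eta$, normalized so that $E[I_q(f)I_m(g)]=q!\langle f,g\rangle_{L^2(\mu^q)}\mathbf 1_{q=m}$. For $\varphi:\mathbb R^k\to\mathbb R$ thrice differentiable, $\|\varphi''\|_\infty=\max_{1\le i_1\le i_2\le k}\sup_{x\in\mathbb R^k}\big|\frac{\partial^2\varphi}{\partial x_{i_1}\partial x_{i_2}}(x)\big|$ and $\|\varphi'''\|_\infty=\max_{1\le i_1\le i_2\le i_3\le k}\sup_{x\in\mathbb R^k}\big|\frac{\partial^3\varphi}{\partial x_{i_1}\partial x_{i_2}\partial x_{i_3}}(x)\big|$. Contractions: for $f$ and $g$ symmetric functions of $p$ and $q$ variables, $0\le l\le r\le p\wedge q$, $$f\star_r^l g(\gamma_1,\dots,\gamma_{r-l},t_1,\dots,t_{p-r},s_1,\dots,s_{q-r})=\int_{Z^l}f(z_1,\dots,z_l,\gamma_1,\dots,\gamma_{r-l},t_1,\dots,t_{p-r})\,g(z_1,\dots,z_l,\gamma_1,\dots,\gamma_{r-l},s_1,\dots,s_{q-r})\,\mu^l(dz_1,\dots,dz_l),$$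 with no integration when $l=0$. For $F=\sum_{i=1}^kI_{q_i}(f_i)$ and $s>0$, $$B_3(F;s)=\frac1s\Big\{\max_1\|f_i\star_r^l f_i\|_{L^2(\mu^{2q_i-r-l})}+\max_2\|f_i\star_r^l f_j\|_{L^2(\mu^{q_i+q_j-r-l})}+\max_{i=1,\dots,k}\|f_i\|^2_{L^4(\mu^{q_i})}\Big\},$$ where $\max_1$ ranges over all $1\le i\le k$ with $q_i>1$ and all $(r,l)$ with $r\in\{1,\dots,q_i\}$, $1\le l\le r\wedge(q_i-1)$, and $\max_2$ ranges over all $1\le i<j\le k$ and all $(r,l)$ with $r\in\{1,\dots,q_i\}$, $l\in\{1,\dots,r\}$ (a maximum over an empty set is $0$). Technical assumptions on $\{f_i:i=1,\dots,k\}$: (i) for every $i$ and every $r=1,\dots,q_i$, the kernel $f_i\star_{q_i}^{q_i-r}f_i$ is in $L^2(\mu^r)$; (ii) for every $i$ with $q_i\ge2$, every $r=1,\dots,q_i$ and $l=1,\dots,r$, the contraction $|f_i|\star_r^l|f_i|(z_1,\dots,z_{2q_i-r-l})$ is well defined and finite at every $(z_1,\dots,z_{2q_i-r-l})\in Z^{2q_i-r-l}$; (iii) for every $i,j$ with $\max(q_i,q_j)>1$, every integer $m$ with $|q_i-q_j|\vee1\le m\le q_i+q_j-2$, and every $(r,l)$ (with $0\le l\le r\le q_i\wedge q_j-1$) such that $m=q_i+q_j-2-r-l$, $$\int_Z\Big[\int_{Z^m}(f_i(z,\cdot)\star_r^l f_j(z,\cdot))^2\,d\mu^m\Big]^{1/2}\mu(dz)<\infty,$$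 where $f_i(z,\cdot)$ is the function of $q_i-1$ variables obtained by fixing one argument equal to $z$. *)

(* Defs.v *)
From HB Require Import structures.
From mathcomp Require Import all_boot all_order all_algebra perm.
From mathcomp Require Import all_classical all_reals all_analysis.
From mathcomp Require Import measurable_realfun.

Set Implicit Arguments.
Unset Strict Implicit.
Unset Printing Implicit Defensive.

Import Order.TTheory GRing.Theory Num.Theory.
Import numFieldNormedType.Exports.

Local Open Scope classical_set_scope.
Local Open Scope ring_scope.

(* Borel space, in the sense of a measurable space that is isomorphic to a     *)
(* Borel subset of the line.                                                   *)
Definition borel_space (R : realType) d (Z : measurableType d) : Prop :=
  exists f : Z -> R, [/\ measurable_fun [set: Z] f, injective f &
    forall A : set Z, measurable A -> measurable (f @` A)].

Definition atomless d (Z : measurableType d) (R : realType)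
    (mu : set Z -> \bar R) : Prop :=
  forall A, measurable A -> (0 < mu A)%E ->
    exists B, [/\ measurable B, B `<=` A, (0 < mu B)%E & (mu B < mu A)%E].

Section tuple_cons_measure.
Context d (Z : measurableType d) (R : realType) (n : nat).
Variables (mu : {sigma_finite_measure set Z -> \bar R})
  (nu : {sigma_finite_measure set (n.-tuple Z) -> \bar R}).

Let tcons (x : Z * n.-tuple Z) : n.+1.-tuple Z := [tuple of x.1 :: x.2].

Let measurable_tcons : measurable_fun [set: Z * n.-tuple Z] tcons.
Proof. exact: measurable_cons. Qed.

(* The product of mu and nu, carried over from Z * Z^n to Z^(n+1). *)
Definition tuple_cons_measure : set (n.+1.-tuple Z) -> \bar R :=
  pushforward (mu \x nu)%E tcons.

Let tuple_cons0 : tuple_cons_measure set0 = 0%E.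
Proof. by rewrite /tuple_cons_measure /pushforward preimage_set0 measure0. Qed.

Let tuple_cons_ge0 A : (0 <= tuple_cons_measure A)%E.
Proof. exact: measure_ge0. Qed.

Let tuple_cons_sigma_additive : semi_sigma_additive tuple_cons_measure.
Proof.
move=> F mF tF mUF; rewrite /tuple_cons_measure /pushforward preimage_bigcup.
apply: measure_semi_sigma_additive.
- by move=> i; rewrite -[X in measurable X]setTI; exact: measurable_tcons.
- apply/trivIsetP => /= i j _ _ ij; rewrite -preimage_setI.
  by move/trivIsetP : tF => /(_ _ _ _ _ ij) ->//; rewrite preimage_set0.
- by rewrite -preimage_bigcup -[X in measurable X]setTI; exact: measurable_tcons.
Qed.

HB.instance Definition _ := isMeasure.Build _ _ _ tuple_cons_measure
  tuple_cons0 tuple_cons_ge0 tuple_cons_sigma_additive.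

Let tuple_cons_sigma_finite : sigma_finite [set: n.+1.-tuple Z] tuple_cons_measure.
Proof.
have [F [UF ndF Foo]] := (sigma_finiteP _ _).1 (sigma_finiteT mu).
have [G [UG ndG Goo]] := (sigma_finiteP _ _).1 (sigma_finiteT nu).
pose untcons (t : n.+1.-tuple Z) : Z * n.-tuple Z :=
  (thead t, [tuple of behead t]).
have tconsK : cancel tcons untcons.
  by case=> z t; rewrite /untcons /tcons theadE; congr (_, _); exact/val_inj.
have m_untcons : measurable_fun [set: n.+1.-tuple Z] untcons.
  apply/measurable_fun_pairP; split; first exact: measurable_tnth.
  exact: measurable_behead.
exists (fun i => untcons @^-1` (F i `*` G i)).
  rewrite -preimage_bigcup; apply/seteqP; split => // t _ /=.
  have [i _ Fi] : (\bigcup_i F i) (untcons t).1 by rewrite -UF.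
  have [j _ Gj] : (\bigcup_i G i) (untcons t).2 by rewrite -UG.
  exists (maxn i j) => //; split.
  - by move: Fi; exact/subsetPset/ndF/leq_maxl.
  - by move: Gj; exact/subsetPset/ndG/leq_maxr.
move=> i; have [mFi Fioo] := Foo i; have [mGi Gioo] := Goo i; split.
  rewrite -[X in measurable X]setTI; apply: m_untcons => //.
  exact: measurableX.
rewrite /tuple_cons_measure /pushforward -comp_preimage.
rewrite (_ : untcons \o tcons = id); last by apply/funext => x /=; exact: tconsK.
by rewrite preimage_id product_measure1E// lte_mul_pinfty// ge0_fin_numE.
Qed.

HB.instance Definition _ := Measure_isSigmaFinite.Build _ _ _
  tuple_cons_measure tuple_cons_sigma_finite.

End tuple_cons_measure.

(* mu^n on Z^n; Z^0 is a point of mass 1. *)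
Fixpoint tuple_measure d (Z : measurableType d) (R : realType)
    (mu : {sigma_finite_measure set Z -> \bar R}) (n : nat) :
    {sigma_finite_measure set (n.-tuple Z) -> \bar R} :=
  match n return {sigma_finite_measure set (n.-tuple Z) -> \bar R} with
  | 0%N => \d_([tuple] : 0.-tuple Z)
  | m.+1 => tuple_cons_measure mu (tuple_measure mu m)
  end.

Section poisson_measure.
Context dO (Omega : measurableType dO) d (Z : measurableType d) (R : realType).
Variables (P : probability Omega R) (mu : {sigma_finite_measure set Z -> \bar R}).

(* [poisson_prob] is used rather than [poisson_pmf] because the latter is      *)
(* constantly 1 at rate 0; the second argument of [poisson_prob] is not used   *)
(* by the library.                                                             *)
Record poisson_measure (eta : Omega -> {measure set Z -> \bar R}) : Prop :=
  PoissonMeasure {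
    poisson_measurable : forall B, measurable B ->
      measurable_fun [set: Omega] (eta ^~ B) ;
    poisson_law : forall B, measurable B -> (mu B < +oo)%E -> forall k : nat,
      P [set w | eta w B = k%:R%:E] = poisson_prob (fine (mu B)) k [set k] ;
    poisson_independent : forall B C, measurable B -> measurable C ->
      B `&` C = set0 ->
      forall U V : set (\bar R), measurable U -> measurable V ->
        P ([set w | U (eta w B)] `&` [set w | V (eta w C)]) =
        (P [set w | U (eta w B)] * P [set w | V (eta w C)])%E
  }.

End poisson_measure.

Section multiple_integral.
Context dO (Omega : measurableType dO) d (Z : measurableType d) (R : realType).
Variables (P : probability Omega R) (mu : {sigma_finite_measure set Z -> \bar R}).
Variables (eta : Omega -> {measure set Z -> \bar R}) (q : nat).

(* A list of pairs (c, A) stands for the elementary kernel which is the sum of *)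
(* the c * 1_(A_0 x ... x A_(q-1)).                                            *)
Definition elementary : Type := seq (R * ('I_q -> set Z)).

(* The sides of each rectangle are pairwise disjoint, so that an elementary    *)
(* kernel vanishes on the diagonals.                                           *)
Definition elementary_ok (s : elementary) : Prop :=
  forall i, (i < size s)%N ->
    let A := (nth (0, fun=> set0) s i).2 in
    (forall j, measurable (A j) /\ (mu (A j) < +oo)%E) /\ trivIset setT A.

Definition elementary_kernel (s : elementary) (x : q.-tuple Z) : R :=
  \sum_(cA <- s) cA.1 * \prod_(j < q) \1_(cA.2 j) (tnth x j).

Definition elementary_integral (s : elementary) (w : Omega) : R :=
  \sum_(cA <- s)
     cA.1 * \prod_(j < q) (fine (eta w (cA.2 j)) - fine (mu (cA.2 j))).

(* X is a version of I_q(f): the map I_q, defined on elementary kernels by     *)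
(* multiplying the values of the compensated measure, is extended to L^2(mu^q) *)
(* by density and continuity. It sends a kernel to the integral of its         *)
(* symmetrization, so that E[I_q(f)^2] = q! ||f||^2 for symmetric f.           *)
Definition is_multiple_integral (f : q.-tuple Z -> R) (X : Omega -> R) : Prop :=
  exists s : nat -> elementary, [/\ forall n, elementary_ok (s n),
    ('N[tuple_measure mu q]_2%:E[(fun x =>
      (elementary_kernel (s n) x - f x)%:E)])%E @[n --> \oo] --> 0%E &
    ('N[P]_2%:E[(fun w =>
      (elementary_integral (s n) w - X w)%:E)])%E @[n --> \oo] --> 0%E].

End multiple_integral.

Section kernels.
Context d (Z : measurableType d) (R : realType).
Variable mu : {sigma_finite_measure set Z -> \bar R}.

Definition ae_symmetric (q : nat) (f : q.-tuple Z -> R) : Prop :=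
  forall s : 'S_q, {ae tuple_measure mu q,
    forall x, f [tuple tnth x (s i) | i < q] = f x}.

(* f applied to a list of arguments whose length is p by arithmetic; the       *)
(* default value 0 is never reached below.                                     *)
Definition kernel_at (p : nat) (f : p.-tuple Z -> R) (s : seq Z) : R :=
  oapp f 0 (insub s).

(* With x = (gamma, t, s) of respective lengths r - l, p - r, q - r, the list  *)
(* take (p - l) x is (gamma, t), take (r - l) x is gamma, drop (p - l) x is s. *)
Definition star_contraction (p q : nat) (f : p.-tuple Z -> R) (g : q.-tuple Z -> R)
    (r l : nat) (x : (p + q - r - l).-tuple Z) : \bar R :=
  (\int[tuple_measure mu l]_z
     (kernel_at f (z ++ take (p - l) x) *
      kernel_at g (z ++ take (r - l) x ++ drop (p - l) x))%:E)%E.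
Arguments star_contraction {p q} f g r l x.

Definition star_contraction_norm (p q : nat) (f : p.-tuple Z -> R)
    (g : q.-tuple Z -> R) (r l : nat) : \bar R :=
  'N[tuple_measure mu (p + q - r - l)]_2%:E[star_contraction f g r l]%E.

Definition kernel_section (q : nat) (f : q.-tuple Z -> R) (z : Z) :
    q.-1.-tuple Z -> R :=
  fun x => kernel_at f (z :: x).

Variables (k : nat) (q : 'I_k -> nat) (f : forall i, (q i).-tuple Z -> R).
Arguments f : clear implicits.

Record technical_assumptions : Prop := TechnicalAssumptions {
  technical_i : forall i r, (1 <= r <= q i)%N ->
    (star_contraction_norm (f i) (f i) (q i) (q i - r) < +oo)%E ;
  technical_ii : forall i r l, (2 <= q i)%N -> (1 <= r <= q i)%N ->
    (1 <= l <= r)%N ->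
    forall x, (star_contraction (fun y => `|f i y|%R) (fun y => `|f i y|%R)
      r l x < +oo)%E ;
  technical_iii : forall i j m r l, (1 < maxn (q i) (q j))%N ->
    (maxn `|(q i)%:Z - (q j)%:Z|%N 1 <= m <= q i + q j - 2)%N ->
    (l <= r <= minn (q i) (q j) - 1)%N ->
    m = (q i + q j - 2 - r - l)%N ->
    (\int[mu]_z star_contraction_norm (kernel_section (f i) z)
       (kernel_section (f j) z) r l < +oo)%E
}.

Definition B3 (s : R) : \bar R :=
  ((s^-1)%:E *
   (\big[maxe/0]_(i < k | (1 < q i)%N)
      \big[maxe/0]_(1 <= r < (q i).+1)
        \big[maxe/0]_(1 <= l < (minn r (q i - 1)).+1)
          star_contraction_norm (f i) (f i) r l
    + \big[maxe/0]_(i < k) \big[maxe/0]_(j < k | (i < j)%N)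
        \big[maxe/0]_(1 <= r < (q i).+1) \big[maxe/0]_(1 <= l < r.+1)
          star_contraction_norm (f i) (f j) r l
    + \big[maxe/0]_(i < k)
        'N[tuple_measure mu (q i)]_4%:E[EFin \o f i] ^+ 2))%E.

End kernels.

Section smooth_functions.
Context (R : realType) (k : nat).
Implicit Types phi : 'rV[R]_k -> R.

Definition partial (i : 'I_k) phi : 'rV[R]_k -> R := 'D_(delta_mx 0 i) phi.

(* A differentiable map has a differentiable derivative iff its partial        *)
(* derivatives are differentiable.                                             *)
Definition thrice_differentiable phi : Prop :=
  [/\ forall x, differentiable phi x,
      forall i x, differentiable (partial i phi) x &
      forall i j x, differentiable (partial i (partial j phi)) x].

Definition norm_D2 phi : \bar R :=
  \big[maxe/0%E]_(i1 < k) \big[maxe/0%E]_(i2 < k | (i1 <= i2)%N)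
    ereal_sup (range (fun x => `|partial i1 (partial i2 phi) x|%:E)).

Definition norm_D3 phi : \bar R :=
  \big[maxe/0%E]_(i1 < k) \big[maxe/0%E]_(i2 < k | (i1 <= i2)%N)
    \big[maxe/0%E]_(i3 < k | (i2 <= i3)%N)
      ereal_sup (range (fun x =>
        `|partial i1 (partial i2 (partial i3 phi)) x|%:E)).

End smooth_functions.

(* Taking some of the A i to be setT gives the product rule for subfamilies. *)
Definition independent_RVs dO (Omega : measurableType dO) (R : realType)
    (P : probability Omega R) (k : nat) (X : 'I_k -> Omega -> R) : Prop :=
  forall A : 'I_k -> set R, (forall i, measurable (A i)) ->
    P [set w | forall i, A i (X i w)] = (\prod_(i < k) P (X i @^-1` A i))%E.

(* The second parameter of [normal_prob] is the standard deviation; when it is *)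
(* 0, [normal_prob] is not a point mass, so this is only meaningful for a      *)
(* positive variance.                                                          *)
Definition centered_gaussian dO (Omega : measurableType dO) (R : realType)
    (P : probability Omega R) (X : Omega -> R) (variance : R) : Prop :=
  forall A : set R, measurable A ->
    P (X @^-1` A) = normal_prob 0 (Num.sqrt variance) A.

(* Main.v *)
(* Fix n. Cut a set of finite measure into many cells of small mass, which is   *)
(* possible because mu has no atom, and replace the Poisson measure by the      *)
(* indicators that a cell is hit. These are independent Bernoulli variables,    *)
(* and I_q(f) is approximated in L^2 by a homogeneous polynomial of degree q in *)
(* centered Bernoulli variables, whose discrete contractions are controlled by  *)
(* those of f; assumption (i) makes the contractions continuous along the       *)
(* approximation. In the Bernoulli model the number operator and the discrete   *)
(* gradient give an approximate Stein identity: its main term is the variance   *)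
(* of the carre du champ, which the product formula bounds by the norms of the  *)
(* contractions with l >= 1, and its remainder is the third moment of the       *)
(* gradient, bounded by the fourth moment, hence by the contractions and the    *)
(* L^4 norms of the kernels. Any two laws satisfying an approximate Stein       *)
(* identity with the same variances are then compared by running a discrete     *)
(* Ornstein-Uhlenbeck semigroup; the Gaussian law satisfies it exactly.         *)

From mathcomp Require Import all_boot all_order all_algebra.
From mathcomp Require Import boolp.
From mathcomp Require Import ring lra zify.
Set Implicit Arguments.
Unset Strict Implicit.
Unset Printing Implicit Defensive.
Import Order.TTheory GRing.Theory Num.Theory.
Local Open Scope ring_scope.

(** For a fixed n every F_i is close in L^2 to a polynomial chaos in finitely many independent
    two-valued variables X_j, one per small cell of Z, recording only whether the Poisson measure
    charges the cell. In this finite model the theorem is an explicit computation. The L^2 error is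
    sent to 0 for each n separately, so the only requirement on the model is that its estimates
    depend on the kernels through B_3.

    In the model, X_j^2 = m_j + w_j X_j yields a product formula whose coefficients are discrete
    contractions ([chaos_mul]). The sum of X_j D_j multiplies a homogeneous chaos by its degree
    ([sum_var_deriv]), so E[F_i G_i(F)] equals, up to the third moment of the gradient, 1/q_i times
    the sum over l of E[H_il(F) Gamma(F_i, F_l)], where Gamma is the carre du champ ([stein_coord]).
    The kernel of Gamma carries the number l of integrated variables as a factor, so contractions
    with l = 0 disappear. Its mean is q_i Var F_i if l = i and 0 otherwise, because the degrees are
    distinct; its variance is bounded by the contractions with l >= 1 ([gamma_variance]). The third
    moment of the gradient is interpolated between the second, which is a variance, and the fourth,
    which the product formula bounds by contractions and by the integral of f^4 ([deriv_fourth]).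
    Altogether the Gaussian Stein identity holds up to a constant times B_3 ([chaos_gap]).

    The identity is turned into a comparison of expectations by iterating a discrete
    Ornstein-Uhlenbeck step on the test function. One step changes an expectation by the Stein
    defect plus a cubic remainder, the constants of the test function decay geometrically, and the
    limit is a number that does not depend on the law ([stein_comparison]). The Gaussian vector
    satisfies the identity exactly, by integration by parts in one coordinate at a time
    ([gaussian_gap]).

    The passage from the kernels to the model is [discrete_approximation]. Closeness of kernels in
    L^2 does not control contractions; [contraction_le] bounds their change by the quantities
    [sqr_block], which assumption (i) makes finite. The kernels are truncated to be bounded with
    support of finite measure, where L^2 does control [sqr_block] ([exists_truncation]), and are
    then replaced by elementary kernels and step functions. On the probabilistic side, absence of
    atoms gives partitions with small sum of squared masses ([fine_partition]), void probabilities
    give the independence of the hits ([pattern_law]), and cells hit more than once contribute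
    little ([elementary_approx]).

    For each n this gives a bound by a constant times B_3 and 1 + sigma^2(n)
    ([chaos_gaussian_comparison]), which tends to 0. *)

Lemma sqr_sum_le (R : realFieldType) (I : finType) (P : pred I) (F : I -> R) :
  (\sum_(i | P i) F i) ^+ 2 <= #|P|%:R * \sum_(i | P i) F i ^+ 2.
Proof.
rewrite expr2 mulr_suml.
apply: (@le_trans _ _ (\sum_(i | P i) \sum_(j | P j) (2^-1 * F i ^+ 2 + 2^-1 * F j ^+ 2))).
  apply: ler_sum => i _; rewrite mulr_sumr; apply: ler_sum => j _.
  by have := sqr_ge0 (F i - F j); rewrite sqrrB => h; lra.
have E : \sum_(i | P i) \sum_(j | P j) 2^-1 * F i ^+ 2
    = 2^-1 * (#|P|%:R * \sum_(i | P i) F i ^+ 2).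
  rewrite mulr_sumr mulr_sumr; apply: eq_bigr => i _.
  by rewrite sumr_const -[_ *+ #|P|]mulr_natl mulrCA.
under eq_bigr do rewrite big_split /=.
rewrite big_split /= E [X in _ + X]exchange_big /= E; lra.
Qed.

Section sets.
Context (R : realFieldType) (T : finType).

Lemma sum_setU1 (j : T) (f : {set T} -> R) :
  \sum_(L : {set T} | j \notin L) f (j |: L)%SET = \sum_(L : {set T} | j \in L) f L.
Proof.
rewrite [RHS](reindex_onto (fun L => (j |: L)%SET) (fun L => (L :\ j)%SET)) /=; last first.
  by move=> L jL; rewrite setD1K.
apply: eq_bigl => L; rewrite setU11 /=.
apply/idP/eqP => [jL|<-]; first by rewrite setU1K.
by rewrite setD11.
Qed.

End sets.

(** * Polynomial chaos in independent Bernoulli variables: product formula, carre du champ, fourth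
    moments *)

Section bernoulli.
Context (R : realFieldType) (T : finType).
Variables (p x1 x0 m w : T -> R).
Implicit Types (A B C L S U b : {set T}) (g h : {set T} -> R).

(* A point of the cube is the set b of the coordinates j that succeed, which   *)
(* happens with probability p j; X j takes the value x1 j on success and x0 j  *)
(* on failure. With the hypotheses below, X j is centered with variance m j,   *)
(* and X^2 = m + w X.                                                          *)
Definition bern_weight b : R := \prod_j (if j \in b then p j else 1 - p j).
Definition Ex (u : {set T} -> R) : R := \sum_b bern_weight b * u b.
Definition bern_var j b : R := if j \in b then x1 j else x0 j.
Definition weight (v : T -> R) U : R := \prod_(j in U) v j.
Definition mon S b : R := \prod_(j in S) bern_var j b.
Definition chaos g b : R := \sum_S g S * mon S b.
(** The discrete gradient: the kernel of the coefficient of X_j when the chaos, affine in each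
    variable, is decomposed as in [chaos_split]. *)
Definition deriv j g S : R := if j \in S then 0 else g (j |: S)%SET.
(** Such a function does not see the state of coordinate j and is therefore independent of X_j. The
    target is arbitrary because vector-valued functions occur as well. *)
Definition free (V : Type) j (u : {set T} -> V) :=
  forall b, u (j |: b)%SET = u (b :\ j)%SET.

Local Notation W := bern_weight.
Local Notation X := bern_var.
Local Notation mu := (weight m).

Lemma ExD u v : Ex (fun b => u b + v b) = Ex u + Ex v.
Proof. by rewrite /Ex -big_split; apply: eq_bigr => b _; rewrite mulrDr. Qed.

Lemma ExZ c u : Ex (fun b => c * u b) = c * Ex u.
Proof. by rewrite /Ex mulr_sumr; apply: eq_bigr => b _; rewrite mulrCA. Qed.

Lemma ExN u : Ex (fun b => - u b) = - Ex u.
Proof. by rewrite -mulN1r -ExZ; congr Ex; apply/funext => b; rewrite mulN1r. Qed.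

Lemma Ex_sum (I : Type) (r : seq I) (P : pred I) (u : I -> {set T} -> R) :
  Ex (fun b => \sum_(i <- r | P i) u i b) = \sum_(i <- r | P i) Ex (u i).
Proof.
by rewrite /Ex exchange_big; apply: eq_bigr => b _; rewrite mulr_sumr.
Qed.

Lemma Ex_prod u v :
  Ex (fun b => \prod_j (if j \in b then u j else v j)) =
  \prod_j (p j * u j + (1 - p j) * v j).
Proof.
rewrite bigA_distr /Ex; apply: eq_bigr => b _.
by rewrite /W -big_split; apply: eq_bigr => j _ /=; case: ifP.
Qed.

Lemma Ex_cst c : Ex (fun=> c) = c.
Proof.
have -> : (fun=> c) = (fun b : {set T} => c * \prod_j (if j \in b then 1 else 1)).
  by apply/funext => b; rewrite big1 ?mulr1// => j _; case: ifP.
by rewrite ExZ Ex_prod big1 ?mulr1// => j _; ring.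
Qed.

Lemma Ex_split j u :
  Ex u = Ex (fun b => p j * u (j |: b)%SET + (1 - p j) * u (b :\ j)%SET).
Proof.
rewrite /Ex.
pose W' b := \prod_(i | i != j) (if i \in b then p i else 1 - p i).
have WE b : W b = (if j \in b then p j else 1 - p j) * W' b.
  by rewrite /W (bigD1 j).
have W'U b : W' (j |: b)%SET = W' b.
  by apply: eq_bigr => i /negPf ij; rewrite !inE ij.
have sp (f : {set T} -> R) :
  \sum_b f b = \sum_(b : {set T} | j \notin b) (f (j |: b)%SET + f b).
  rewrite (bigID (fun b : {set T} => j \in b)) /= -sum_setU1 -big_split /=.
  by [].
rewrite sp [RHS]sp; apply: eq_bigr => b jb.
rewrite !WE W'U !setU11 (negPf jb) setU1K// setUA setUid.
have -> : (b :\ j)%SET = b by apply/setP => i; rewrite !inE; case: eqVneq => // ->; rewrite (negPf jb).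
by ring.
Qed.

Lemma Ex_free (h : R -> R) j u : free j u ->
  Ex (fun b => h (X j b) * u b) = (p j * h (x1 j) + (1 - p j) * h (x0 j)) * Ex u.
Proof.
move=> uj; rewrite (Ex_split j) [in RHS](Ex_split j) -ExZ.
congr Ex; apply/funext => b.
by rewrite /X setU11 !inE eqxx /= uj; ring.
Qed.

Lemma free_mon j S : j \notin S -> free j (mon S).
Proof.
move=> jS b; apply: eq_bigr => i iS; rewrite /X !inE.
by have /negPf -> : i != j by apply: contraNneq jS => <-.
Qed.

Lemma mon_setU1 j S b : j \notin S -> mon (j |: S)%SET b = X j b * mon S b.
Proof. by move=> jS; rewrite /mon big_setU1. Qed.

Lemma weight_setU1 v j S : j \notin S -> weight v (j |: S)%SET = v j * weight v S.
Proof. by move=> jS; rewrite /weight big_setU1. Qed.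

Lemma weight_setU v A B : [disjoint A & B] ->
  weight v (A :|: B)%SET = weight v A * weight v B.
Proof.
move=> AB; rewrite /weight -bigU//=; apply: eq_bigl => i.
by rewrite !inE.
Qed.

Lemma free_deriv j g : free j (chaos (deriv j g)).
Proof.
move=> b; apply: eq_bigr => S _; rewrite /deriv.
by case: ifPn => jS; rewrite ?mul0r// free_mon.
Qed.

Definition without j g S : R := if j \in S then 0 else g S.

Lemma free_without j g : free j (chaos (without j g)).
Proof.
move=> b; apply: eq_bigr => S _; rewrite /without.
by case: ifPn => jS; rewrite ?mul0r// free_mon.
Qed.

Lemma chaos_split j g b :
  chaos g b = chaos (without j g) b + X j b * chaos (deriv j g) b.
Proof.
rewrite /chaos (bigID (fun S : {set T} => j \in S)) /= addrC; congr (_ + _).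
  rewrite [RHS](bigID (fun S : {set T} => j \in S)) /= [X in _ = X + _]big1 ?add0r.
    by apply: eq_bigr => S jS; rewrite /without (negPf jS).
  by move=> S jS; rewrite /without jS mul0r.
rewrite -(sum_setU1 j (fun S => g S * mon S b)).
rewrite [in RHS](bigID (fun S : {set T} => j \in S)) /= [X in X + _]big1 ?add0r.
  rewrite mulr_sumr; apply: eq_bigr => S jS; rewrite /deriv (negPf jS) mon_setU1//.
  by ring.
by move=> S jS; rewrite /deriv jS mul0r.
Qed.

Lemma chaos_sum (I : Type) (r : seq I) (P : pred I) (g : I -> {set T} -> R) b :
  chaos (fun S => \sum_(i <- r | P i) g i S) b = \sum_(i <- r | P i) chaos (g i) b.
Proof.
by rewrite /chaos exchange_big; apply: eq_bigr => S _; rewrite mulr_suml.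
Qed.

Lemma chaosZ c g b : chaos (fun S => c * g S) b = c * chaos g b.
Proof. by rewrite /chaos mulr_sumr; apply: eq_bigr => S _; rewrite mulrA. Qed.

Lemma chaosB g h b : chaos (fun S => g S - h S) b = chaos g b - chaos h b.
Proof.
rewrite /chaos -sumrN -big_split; apply: eq_bigr => S _.
by rewrite mulrBl.
Qed.

(** The number operator as divergence of the gradient: the monomial of S is recovered once for each
    j in S. On a homogeneous chaos it is multiplication by the degree, so no inverse operator is
    needed. *)
Lemma sum_var_deriv g b :
  \sum_j X j b * chaos (deriv j g) b = chaos (fun S => #|S|%:R * g S) b.
Proof.
transitivity (\sum_j \sum_(S : {set T} | j \in S) g S * mon S b).
  apply: eq_bigr => j _; rewrite -(sum_setU1 j (fun S => g S * mon S b)) mulr_sumr.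
  rewrite (bigID (fun S : {set T} => j \in S)) /= big1 ?add0r.
    by apply: eq_bigr => S jS; rewrite /deriv (negPf jS) mon_setU1//; ring.
  by move=> S jS; rewrite /deriv jS mul0r mulr0.
rewrite (exchange_big_dep xpredT)//=; apply: eq_bigr => S _.
by rewrite sumr_const -[_ *+ #|S|]mulr_natl mulrA.
Qed.

Definition homogeneous (q : nat) g := forall S, #|S| != q -> g S = 0.

Hypothesis p01 : forall j, 0 <= p j <= 1.
Hypothesis X_mean : forall j, p j * x1 j + (1 - p j) * x0 j = 0.
Hypothesis x1E : forall j, x1 j ^+ 2 = m j + w j * x1 j.
Hypothesis x0E : forall j, x0 j ^+ 2 = m j + w j * x0 j.

Lemma bern_varE j b : X j b ^+ 2 = m j + w j * X j b.
Proof. by rewrite /X; case: ifP. Qed.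

Lemma ler_Ex u v : (forall b, u b <= v b) -> Ex u <= Ex v.
Proof.
move=> uv; apply: ler_sum => b _; rewrite ler_wpM2l// prodr_ge0// => j _.
by case/andP: (p01 j) => ? ?; case: ifP; rewrite // subr_ge0.
Qed.

Lemma Ex_ge0 u : (forall b, 0 <= u b) -> 0 <= Ex u.
Proof. by move=> u0; rewrite -[leLHS](Ex_cst 0) ler_Ex. Qed.

Lemma ler_norm_Ex u : `|Ex u| <= Ex (fun b => `|u b|).
Proof.
rewrite ler_norml -ExN !ler_Ex// => b; first by rewrite ler_norm.
by rewrite lerNl -normrN ler_norm.
Qed.

Lemma var_second_moment j : p j * x1 j ^+ 2 + (1 - p j) * x0 j ^+ 2 = m j.
Proof. by rewrite x1E x0E; have := X_mean j => h; transitivity (m j + w j * (p j * x1 j + (1 - p j) * x0 j)); [ring|rewrite h; ring]. Qed.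

Lemma m_ge0 j : 0 <= m j.
Proof.
rewrite -var_second_moment; case/andP: (p01 j) => ? ?.
by rewrite addr_ge0// mulr_ge0 ?sqr_ge0// subr_ge0.
Qed.

Lemma mu_ge0 U : 0 <= mu U.
Proof. by apply: prodr_ge0 => j _; exact: m_ge0. Qed.

Lemma Ex_var j u : free j u -> Ex (fun b => X j b * u b) = 0.
Proof. by move=> uj; rewrite (Ex_free id)// X_mean mul0r. Qed.

Lemma Ex_var2 j u : free j u -> Ex (fun b => X j b ^+ 2 * u b) = m j * Ex u.
Proof. by move=> uj; rewrite (Ex_free (fun x => x ^+ 2))// var_second_moment. Qed.

Lemma mon_orthogonal S S' :
  Ex (fun b => mon S b * mon S' b) = (if S == S' then mu S else 0).
Proof.
have -> : (fun b => mon S b * mon S' b) = (fun b => \prod_j (if j \in b then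
    (if j \in S then x1 j else 1) * (if j \in S' then x1 j else 1) else
    (if j \in S then x0 j else 1) * (if j \in S' then x0 j else 1))).
  apply/funext => b; rewrite /mon big_mkcond [X in _ * X]big_mkcond -big_split /=.
  by apply: eq_bigr => j _; rewrite /X; do 3 case: ifP.
rewrite Ex_prod; case: eqVneq => [<-|SS'].
  rewrite /weight [RHS]big_mkcond; apply: eq_bigr => j _.
  by case: ifP => _; rewrite -?expr2 ?var_second_moment//; ring.
have [j Sj] : exists j, (j \in S) != (j \in S').
  apply/existsP; apply: contraNT SS'; rewrite negb_exists => /forallP h.
  by apply/eqP/setP => j; have := h j; rewrite negbK => /eqP.
rewrite (bigD1 j)//= [X in X * _](_ : _ = 0) ?mul0r//.
by move: Sj; do 2 case: ifP => //; rewrite ?mulr1 ?mul1r X_mean.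
Qed.

Lemma chaos_inner g h :
  Ex (fun b => chaos g b * chaos h b) = \sum_S mu S * g S * h S.
Proof.
under eq_fun => b do rewrite /chaos mulr_suml.
rewrite Ex_sum; apply: eq_bigr => S _.
under eq_fun => b do rewrite mulr_sumr.
rewrite Ex_sum (bigD1 S)//= big1 ?addr0.
  transitivity (Ex (fun b => (g S * h S) * (mon S b * mon S b))).
    by congr Ex; apply/funext => b; ring.
  by rewrite ExZ mon_orthogonal eqxx; ring.
move=> S' S'S.
transitivity (Ex (fun b => (g S * h S') * (mon S b * mon S' b))).
  by congr Ex; apply/funext => b; ring.
by rewrite ExZ mon_orthogonal eq_sym (negPf S'S) mulr0.
Qed.

Lemma chaos_sqr g : Ex (fun b => chaos g b ^+ 2) = \sum_S mu S * g S ^+ 2.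
Proof.
under eq_fun => b do rewrite expr2.
by rewrite chaos_inner; apply: eq_bigr => S _; rewrite expr2 mulrA.
Qed.

Lemma chaos_mean g : Ex (chaos g) = g set0.
Proof.
have := chaos_inner g (fun S => (S == set0)%:R).
rewrite (bigD1 set0)//= eqxx big1 ?addr0; last by move=> S /negPf ->; rewrite mulr0.
rewrite /weight big_set0 mul1r mulr1 => <-.
congr Ex; apply/funext => b; rewrite /chaos [X in _ = _ * X](bigD1 set0)//= eqxx.
rewrite [X in 1 * _ + X]big1 ?addr0; last by move=> S /negPf ->; rewrite mul0r.
by rewrite /mon big_set0 !mulr1.
Qed.

(** Only the coordinates common to S and S' produce squares X_j^2 = m_j + w_j X_j; L is the set of
    those where the constant m_j is chosen when the product is expanded. *)
Lemma mon_mul S S' b : mon S b * mon S' b =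
  \sum_(L : {set T} | L \subset S :&: S')
     mu L * weight w (S :&: S' :\: L)%SET * mon ((S :|: S') :\: L)%SET b.
Proof.
pose f j := if (j \in S) && (j \in S') then m j else 0.
pose e j := if (j \in S) && (j \in S') then w j * X j b
            else if (j \in S) || (j \in S') then X j b else 1.
transitivity (\prod_j (f j + e j)).
  rewrite /mon big_mkcond [X in _ * X]big_mkcond -big_split; apply: eq_bigr => j _ /=.
  rewrite /f /e; case: ifP => _; case: ifP => _ /=; rewrite -?expr2 ?bern_varE//; ring.
(* L is where the summand [f] is picked; if L is not contained in S :&: S', some factor [f j] is
   0. *)
rewrite bigA_distr (bigID (fun L : {set T} => L \subset S :&: S')) /= addrC big1 ?add0r.
  apply: eq_bigr => L /subsetP LS; rewrite -mulrA.
  rewrite /weight /mon (big_mkcond (fun j => j \in L)).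
  rewrite (big_mkcond (fun j => j \in S :&: S' :\: L)%SET).
  rewrite (big_mkcond (fun j => j \in (S :|: S') :\: L)%SET) /= -!big_split.
  apply: eq_bigr => j _ /=.
  have := LS j; rewrite /f /e !inE; case: (j \in L); case: (j \in S); case: (j \in S') => //=;
    move=> hh; rewrite ?mulr1 ?mul1r//; by have := hh isT.
move=> L /subsetPn [j jL]; rewrite !inE => jS.
by rewrite (bigD1 j)//= jL /f (negPf jS) mul0r.
Qed.

(* The contraction star_r^l in which L, C, A, B carry the variables z, gamma,  *)
(* t, s: |L| = l, |C| = r - l, |A| = q - r, |B| = q' - r.                      *)
Definition contr g h A C B : R :=
  \sum_(L : {set T} | [disjoint L & A :|: C :|: B])
     mu L * g (L :|: C :|: A)%SET * h (L :|: C :|: B)%SET.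

(** A comes from [g] alone, C is the common part that keeps a factor w_j per coordinate, and the
    remainder of U comes from [h] alone. *)
Definition prodc g h U : R :=
  \sum_(A : {set T} | A \subset U) \sum_(C : {set T} | C \subset U :\: A)
     weight w C * contr g h A C (U :\: A :\: C)%SET.

(** For a given output set U, the triples (S, S', L) of [mon_mul] that produce U correspond to
    triples (A, C, L) with A and C disjoint inside U and L disjoint from U. *)
Lemma chaos_mul g h b : chaos g b * chaos h b = chaos (prodc g h) b.
Proof.
transitivity (\sum_(x : {set T} * {set T} * {set T} | x.2 \subset x.1.1 :&: x.1.2)
   g x.1.1 * h x.1.2 * mu x.2 * weight w (x.1.1 :&: x.1.2 :\: x.2)%SET
   * mon ((x.1.1 :|: x.1.2) :\: x.2)%SET b).
  rewrite -(pair_big_dep xpredT (fun (y : {set T} * {set T}) L => L \subset y.1 :&: y.2)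
    (fun y L => g y.1 * h y.2 * mu L * weight w (y.1 :&: y.2 :\: L)%SET
     * mon ((y.1 :|: y.2) :\: L)%SET b)) /=.
  rewrite -(pair_bigA _ (fun S S' => \sum_(L : {set T} | L \subset S :&: S')
     g S * h S' * mu L * weight w (S :&: S' :\: L)%SET * mon ((S :|: S') :\: L)%SET b)) /=.
  rewrite /chaos mulr_suml; apply: eq_bigr => S _.
  rewrite mulr_sumr; apply: eq_bigr => S' _.
  rewrite mulrACA mon_mul mulr_sumr; apply: eq_bigr => L _.
  by rewrite !mulrA.
rewrite (partition_big (fun x : {set T} * {set T} * {set T} => (x.1.1 :|: x.1.2) :\: x.2)%SET
   xpredT)//=.
apply: eq_bigr => U _; rewrite /prodc mulr_suml.
under [RHS]eq_bigr do rewrite mulr_suml.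
transitivity (\sum_(y : {set T} * {set T} * {set T} | (y.1.1 \subset U)
   && (y.1.2 \subset U :\: y.1.1) && [disjoint y.2 & U])
   weight w y.1.2 * (mu y.2 * g (y.2 :|: y.1.2 :|: y.1.1)%SET
      * h (y.2 :|: y.1.2 :|: (U :\: y.1.1 :\: y.1.2))%SET) * mon U b).
  rewrite (reindex_onto (fun y : {set T} * {set T} * {set T} =>
     (y.2 :|: y.1.2 :|: y.1.1, y.2 :|: y.1.2 :|: (U :\: y.1.1 :\: y.1.2), y.2)%SET)
     (fun x => (x.1.1 :\: x.1.2, x.1.1 :&: x.1.2 :\: x.2, x.2)%SET)) /=; last first.
    case=> [[S S'] L] /= /andP[/subsetP LS /eqP UE].
    congr (_, _, _); apply/setP => j; move: (LS j); rewrite -?UE !inE;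
      by case: (j \in L); case: (j \in S); case: (j \in S') => //= hh; have := hh isT.
  apply: eq_big => [[[A C] L]|[[A C] L]] /=.
    apply/andP/andP => [[/andP[/subsetP h1 /eqP h2] /eqP [h3 h4]]|[/andP[/subsetP h1 /subsetP h2] h3]].
      move/setP: h2 => h2; move/setP: h3 => h3; move/setP: h4 => h4.
      split; [apply/andP; split|].
      - apply/subsetP => j; move: (h2 j) (h3 j) (h4 j); rewrite !inE.
        by case: (j \in L); case: (j \in A); case: (j \in C); case: (j \in U).
      - apply/subsetP => j; move: (h2 j) (h3 j) (h4 j); rewrite !inE.
        by case: (j \in L); case: (j \in A); case: (j \in C); case: (j \in U).
      - rewrite disjoint_subset; apply/subsetP => j; rewrite !inE.
        move: (h2 j) (h3 j) (h4 j); rewrite !inE.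
        by case: (j \in L); case: (j \in A); case: (j \in C); case: (j \in U).
    have d j : j \in L -> j \in U -> false.
      by move=> jL jU; move/pred0P: h3 => /(_ j) /=; rewrite jL jU.
    split; [apply/andP; split|].
    - by apply/subsetP => j jL; rewrite !inE jL.
    - apply/eqP/setP => j; rewrite !inE.
      move: (h1 j) (h2 j) (d j); rewrite !inE.
      by case: (j \in L); case: (j \in A); case: (j \in C); case: (j \in U) => //= a b' c;
       first [by have := a isT|by have := b' isT|by have := c isT isT].
    - apply/eqP; congr (_, _, _); apply/setP => j; rewrite !inE;
      move: (h1 j) (h2 j) (d j); rewrite !inE;
      by case: (j \in L); case: (j \in A); case: (j \in C); case: (j \in U) => //= a b' c;
       first [by have := a isT|by have := b' isT|by have := c isT isT].
  move=> /andP[/andP[/subsetP h1 /eqP h2] /eqP [h3 h4]].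
  by rewrite h4 h2; ring.
transitivity (\sum_(z : {set T} * {set T} | (z.1 \subset U) && (z.2 \subset U :\: z.1))
   weight w z.2 * contr g h z.1 z.2 (U :\: z.1 :\: z.2)%SET * mon U b); last first.
  by rewrite (pair_big_dep (fun A : {set T} => A \subset U)
    (fun A C => C \subset U :\: A)
    (fun A C => weight w C * contr g h A C (U :\: A :\: C)%SET * mon U b)).
rewrite -(pair_big_dep (fun z : {set T} * {set T} => (z.1 \subset U) && (z.2 \subset U :\: z.1))
  (fun _ L => [disjoint L & U])
  (fun z L => weight w z.2 * (mu L * g (L :|: z.2 :|: z.1)%SET
      * h (L :|: z.2 :|: (U :\: z.1 :\: z.2))%SET) * mon U b)) /=.
apply: eq_bigr => [[A C]] /= /andP[/subsetP AU /subsetP CU].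
rewrite /contr mulr_sumr mulr_suml; apply: eq_bigl => L.
rewrite (_ : A :|: C :|: U :\: A :\: C = U)%SET//; apply/setP => j.
move: (AU j) (CU j); rewrite !inE.
by case: (j \in A); case: (j \in C); case: (j \in U) => //= a b'; first [by have := a isT|by have := b' isT].
Qed.

Implicit Types (x : {set T} * {set T} * {set T}).

Definition disj3 x := [&& [disjoint x.1.1 & x.1.2], [disjoint x.1.1 & x.2] & [disjoint x.1.2 & x.2]].
Definition mu3 x := mu x.1.1 * mu x.1.2 * mu x.2.
Definition union3 x := (x.1.1 :|: x.1.2 :|: x.2)%SET.

Lemma mu3_ge0 x : 0 <= mu3 x.
Proof. by rewrite !mulr_ge0// mu_ge0. Qed.

Lemma disjointP (A B : {set T}) : reflect (forall j, j \in A -> j \in B -> false) [disjoint A & B].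
Proof.
apply: (iffP pred0P) => [h j jA jB|h j /=]; first by have := h j; rewrite /= jA jB.
by apply/negP => /andP[jA jB]; have := h j jA jB.
Qed.

(** A set with two disjoint subsets is the same datum as three disjoint sets, the third being the
    remainder. *)
Lemma sum_triples (PU : pred {set T}) (Psi : {set T} -> {set T} -> {set T} -> R) :
  \sum_(U | PU U) \sum_(A : {set T} | A \subset U) \sum_(C : {set T} | C \subset U :\: A)
    Psi A C (U :\: A :\: C)%SET =
  \sum_(x | disj3 x && PU (union3 x)) Psi x.1.1 x.1.2 x.2.
Proof.
under eq_bigr do rewrite pair_big_dep.
rewrite pair_big_dep /=.
rewrite (reindex_onto (fun x => (union3 x, (x.1.1, x.1.2)))
  (fun y => (y.2.1, y.2.2, (y.1 :\: y.2.1 :\: y.2.2)%SET))) /=; last first.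
  move=> [U [A C]] /= /andP[_ /andP[/subsetP AU /subsetP CU]]; congr (_, _).
  apply/setP => j; move: (AU j) (CU j); rewrite !inE.
  by case: (j \in A); case: (j \in C); case: (j \in U) => //= a b';
    first [by have := a isT|by have := b' isT].
apply: eq_big => [[[A C] B]|[[A C] B]] /=; last first.
  by move=> /andP[_ /eqP[->]].
rewrite /disj3 /union3 /=; apply/idP/idP.
  move=> /andP[/andP[-> /andP[/subsetP h1 /subsetP h2]] /eqP[/setP h3]]; rewrite andbT.
  apply/and3P; split; apply/disjointP => j; move: (h1 j) (h2 j) (h3 j); rewrite !inE;
  by case: (j \in A); case: (j \in C); case: (j \in B) => //= a b' c _;
    first [by have := a isT|by have := b' isT].
move=> /andP[/and3P[/disjointP h1 /disjointP h2 /disjointP h3] ->] /=.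
apply/andP; split; [apply/andP; split|].
- by apply/subsetP => j jA; rewrite !inE jA.
- apply/subsetP => j jC; rewrite !inE jC orbT andbT.
  by apply/negP => jA; have := h1 j jA jC.
- apply/eqP; congr (_, _, _); apply/setP => j; move: (h1 j) (h2 j) (h3 j); rewrite !inE.
  by case: (j \in A); case: (j \in C); case: (j \in B) => //= a b' c;
    first [by have := a isT isT|by have := b' isT isT|by have := c isT isT].
Qed.

Hypothesis w3 : forall j, `|w j| <= 3.

(** Cauchy-Schwarz twice. Only sets U with at most n elements matter, so there are at most 2^n
    choices of A and 2^n of C, and the squared weight of C is at most 9^n since |w_j| <= 3; this
    gives 36^n. *)
Lemma coef_bound (kap : {set T} -> {set T} -> {set T} -> R) (n : nat) (PU : pred {set T}) :
  (forall A C B, kap A C B != 0 -> (#|A :|: C :|: B| <= n)%N) ->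
  \sum_(U | PU U) mu U * (\sum_(A : {set T} | A \subset U)
     \sum_(C : {set T} | C \subset U :\: A) weight w C * kap A C (U :\: A :\: C)%SET) ^+ 2
  <= 36 ^+ n * \sum_(x | disj3 x && PU (union3 x)) mu3 x * kap x.1.1 x.1.2 x.2 ^+ 2.
Proof.
move=> kn.
have pw (U V : {set T}) : V \subset U -> (#|[pred A : {set T} | A \subset V]| <= 2 ^ #|U|)%N.
  move=> VU; rewrite -(card_powerset U) subset_leq_card//; apply/subsetP => A.
  by rewrite !inE => AV; exact: fintype.subset_trans AV VU.
rewrite -(sum_triples PU (fun A C B => mu A * mu C * mu B * kap A C B ^+ 2)) mulr_sumr.
apply: ler_sum => U _.
case: (leqP #|U| n) => [Un|nU]; last first.
  rewrite [X in X ^+ 2]big1 ?expr0n ?mulr0//=.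
    rewrite mulr_ge0 ?exprn_ge0// sumr_ge0// => A _; rewrite sumr_ge0// => C _.
    by rewrite mulr_ge0 ?sqr_ge0// !mulr_ge0// mu_ge0.
  move=> A /subsetP AU; rewrite big1// => C /subsetP CU.
  case: (eqVneq (kap A C (U :\: A :\: C)%SET) 0) => [->|/kn]; rewrite ?mulr0//.
  have -> : (A :|: C :|: U :\: A :\: C)%SET = U.
    apply/setP => j; move: (AU j) (CU j); rewrite !inE.
    by case: (j \in A); case: (j \in C); case: (j \in U) => //= a b';
    first [by have := a isT|by have := b' isT].
  by rewrite leqNgt nU.
have le2 : (2 ^ #|U|)%N%:R <= 2 ^+ n :> R.
  by rewrite natrX ler_weXn2l// ler1n.
have wC (C : {set T}) : C \subset U -> weight w C ^+ 2 <= 9 ^+ n.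
  move=> CU; rewrite /weight -prodrXl.
  apply: (@le_trans _ _ (9 ^+ #|C|)); last first.
    by rewrite ler_weXn2l ?ler1n// (leq_trans (subset_leq_card CU)).
  rewrite -prodr_const; apply: ler_prod => j _; rewrite sqr_ge0 /=.
  rewrite -real_normK ?num_real// (_ : 9 = 3 ^+ 2 :> R); last by rewrite expr2; ring.
  by rewrite lerXn2r ?nnegrE//.
apply: (@le_trans _ _ (mu U * (2 ^+ n * (\sum_(A : {set T} | A \subset U)
  (2 ^+ n * \sum_(C : {set T} | C \subset U :\: A) 9 ^+ n * kap A C (U :\: A :\: C)%SET ^+ 2))))).
  rewrite ler_wpM2l ?mu_ge0//.
  apply: le_trans (sqr_sum_le _ _) _.
  apply: ler_pM => //; first by rewrite sumr_ge0// => A _; rewrite sqr_ge0.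
    by apply: le_trans le2; rewrite ler_nat pw.
  apply: ler_sum => A AU; apply: le_trans (sqr_sum_le _ _) _.
  apply: ler_pM => //; first by rewrite sumr_ge0// => C _; rewrite sqr_ge0.
    by apply: le_trans le2; rewrite ler_nat pw// subsetDl.
  apply: ler_sum => C CU; rewrite exprMn ler_wpM2r ?sqr_ge0//.
  by apply: wC; exact: fintype.subset_trans CU (subsetDl _ _).
have -> : 36 ^+ n = 2 ^+ n * (2 ^+ n * 9 ^+ n) :> R.
  by rewrite -!exprMn; congr (_ ^+ n); ring.
rewrite le_eqVlt; apply/orP; left; apply/eqP.
rewrite mulrCA -[RHS]mulrA; congr (_ * _); rewrite !mulr_sumr; apply: eq_bigr => A AU.
rewrite mulrCA -[RHS]mulrA; congr (_ * _); rewrite !mulr_sumr; apply: eq_bigr => C CU.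
have -> : mu U = mu A * mu C * mu (U :\: A :\: C)%SET.
  rewrite -!weight_setU.
  - congr weight; apply/setP => j; move/subsetP: AU => /(_ j); move/subsetP: CU => /(_ j).
    rewrite !inE; by case: (j \in A); case: (j \in C); case: (j \in U) => //= a b';
    first [by have := a isT|by have := b' isT].
  - by apply/disjointP => j; rewrite !inE => /orP[] ->; rewrite ?andbF.
  - apply/disjointP => j jA /(subsetP CU); by rewrite !inE jA.
by ring.
Qed.

Definition energy g h (P : pred ({set T} * {set T} * {set T})) : R :=
  \sum_(x | disj3 x && P x) mu3 x * contr g h x.1.1 x.1.2 x.2 ^+ 2.

(** The discrete counterpart of the squared L^2 norm of a contraction star_r^l, summed over
    unordered sets of cells instead of ordered arguments. *)
Definition contr_energy g h (q q' r l : nat) : R :=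
  energy g h (fun x => [&& #|x.1.1| == (q - r)%N, #|x.1.2| == (r - l)%N & #|x.2| == (q' - r)%N]).

(** A nonvanishing summand forces L :|: C :|: A and L :|: C :|: B to have the sizes prescribed by
    homogeneity. *)
Lemma contr_neq0 g h q q' A C B : homogeneous q g -> homogeneous q' h ->
  [disjoint A & C] -> [disjoint C & B] -> contr g h A C B != 0 ->
  exists l, (l + #|C| + #|A| = q)%N /\ (l + #|C| + #|B| = q')%N.
Proof.
move=> hg hh AC CB.
case: (pselect (exists l, (l + #|C| + #|A| = q)%N /\ (l + #|C| + #|B| = q')%N)) => // nl.
move/eqP; case; rewrite /contr big1// => L /disjointP LU.
have LC : [disjoint L & C].
  by apply/disjointP => j jL jC; apply: (LU j jL); rewrite !inE jC orbT.
have LCA : [disjoint L :|: C & A].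
  apply/disjointP => j; rewrite inE => /orP[jL jA|jC jA].
    by apply: (LU j jL); rewrite !inE jA.
  by move/disjointP: AC => /(_ j jA jC).
have LCB : [disjoint L :|: C & B].
  apply/disjointP => j; rewrite inE => /orP[jL jB|jC jB].
    by apply: (LU j jL); rewrite !inE jB !orbT.
  by move/disjointP: CB => /(_ j jC jB).
have cU (V W : {set T}) : [disjoint V & W] -> #|V :|: W| = (#|V| + #|W|)%N.
  by move=> VW; apply/eqP; rewrite (leq_card_setU V W).2.
case: (eqVneq (#|L| + #|C| + #|A|)%N q) => [e1|e1]; last first.
  by rewrite hg ?mulr0 ?mul0r// !cU.
case: (eqVneq (#|L| + #|C| + #|B|)%N q') => [e2|e2]; last first.
  by rewrite hh ?mulr0// !cU.
by case: nl; exists #|L|.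
Qed.

(** A triple with nonzero contraction determines its pair (r, l), and at most (q + 1)^2 pairs occur;
    [good] singles out the pairs for which a bound is available. *)
Lemma energy_le g h q q' e (P : pred ({set T} * {set T} * {set T})) (good : nat -> nat -> bool) :
  homogeneous q g -> homogeneous q' h -> 0 <= e ->
  (forall r l, (l <= r)%N -> (r <= q)%N -> (r <= q')%N -> good r l ->
     contr_energy g h q q' r l <= e) ->
  (forall A C B r l, disj3 (A, C, B) -> P (A, C, B) -> (l <= r)%N -> (r <= q)%N -> (r <= q')%N ->
     #|A| = (q - r)%N -> #|C| = (r - l)%N -> #|B| = (q' - r)%N -> good r l) ->
  energy g h P <= (q.+1)%:R ^+ 2 * e.
Proof.
move=> hg hh e0 le_e Pgood.
pose cnd (r l : nat) := [&& (l <= r)%N, (r <= q)%N, (r <= q')%N & good r l].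
pose crd (r l : nat) x := [&& #|x.1.1| == (q - r)%N, #|x.1.2| == (r - l)%N & #|x.2| == (q' - r)%N].
apply: (@le_trans _ _ (\sum_(r < q.+1) \sum_(l < q.+1)
   if cnd r l then contr_energy g h q q' r l else 0)); last first.
  apply: (@le_trans _ _ (\sum_(r < q.+1) \sum_(l < q.+1) e)).
    apply: ler_sum => r _; apply: ler_sum => l _; case: ifP => // /and4P[*].
    exact: le_e.
  by rewrite !sumr_const !card_ord -mulrnA -[_ *+ (_ * _)]mulr_natl natrM expr2.
rewrite /energy.
have -> : \sum_(r < q.+1) \sum_(l < q.+1) (if cnd r l then contr_energy g h q q' r l else 0)
  = \sum_(x | disj3 x) \sum_(r < q.+1) \sum_(l < q.+1)
     (if cnd r l && crd r l x then mu3 x * contr g h x.1.1 x.1.2 x.2 ^+ 2 else 0).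
  rewrite [RHS]exchange_big; apply: eq_bigr => r _ /=.
  rewrite [RHS]exchange_big; apply: eq_bigr => l _ /=.
  rewrite /contr_energy /energy; case: (cnd r l) => /=; last by rewrite big1.
  by rewrite -big_mkcondr.
rewrite big_mkcondr; apply: ler_sum => [[[A C] B]] dx.
have t0 x : 0 <= mu3 x * contr g h x.1.1 x.1.2 x.2 ^+ 2.
  by rewrite mulr_ge0 ?mu3_ge0 ?sqr_ge0.
have s0 : 0 <= \sum_(r < q.+1) \sum_(l < q.+1)
   (if cnd r l && crd r l (A, C, B) then mu3 (A, C, B) * contr g h A C B ^+ 2 else 0).
  by rewrite sumr_ge0// => r _; rewrite sumr_ge0// => l _; case: ifP => // _; exact: (t0 (A, C, B)).
case: ifP => // PABC.
case: (eqVneq (contr g h A C B) 0) => [c0|c0].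
  by rewrite {1}c0 expr0n mulr0.
have [d1 _ d3] := and3P dx.
have [l [e1 e2]] := contr_neq0 hg hh d1 d3 c0.
have rq : (l + #|C| < q.+1)%N by rewrite ltnS -e1 leq_addr.
have lq : (l < q.+1)%N by rewrite ltnS -e1 -addnA leq_addr.
have A1 : #|A| = (q - (l + #|C|))%N by rewrite -e1 addKn.
have C1 : #|C| = (l + #|C| - l)%N by rewrite addKn.
have B1 : #|B| = (q' - (l + #|C|))%N by rewrite -e2 addKn.
have r' : (l + #|C| <= q')%N by rewrite -e2 leq_addr.
rewrite (bigD1 (Ordinal rq))//= (bigD1 (Ordinal lq))//=.
have -> : cnd (l + #|C|)%N l && crd (l + #|C|)%N l (A, C, B).
  rewrite /cnd /crd /= leq_addr -ltnS rq r' /= -A1 -C1 -B1 !eqxx !andbT.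
  by apply: (Pgood A C B) => //; rewrite ?leq_addr.
rewrite -addrA lerDl addr_ge0//.
  by rewrite sumr_ge0// => i _; case: ifP => // _; exact: (t0 (A, C, B)).
by rewrite sumr_ge0// => r _; rewrite sumr_ge0// => i _; case: ifP => // _; exact: (t0 (A, C, B)).
Qed.

(* The carre du champ, which replaces <DF, -DL^-1 G> of Malliavin calculus.    *)
Definition gamma g h b : R :=
  \sum_j m j * (chaos (deriv j g) b * chaos (deriv j h) b).

(** The product formula weighted by the number of integrated variables |L| = q - |A| - |C|, which
    suppresses the contractions with l = 0. *)
Definition gammac q g h U : R :=
  \sum_(A : {set T} | A \subset U) \sum_(C : {set T} | C \subset U :\: A)
     weight w C * ((q - #|A| - #|C|)%:R * contr g h A C (U :\: A :\: C)%SET).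

(** Moving j into the integrated set turns a pair (j, L) into a set with a marked element; each set
    L is thus counted |L| times, and homogeneity fixes |L|. *)
Lemma sum_contr_deriv q g h A C B : homogeneous q g -> [disjoint A & C] ->
  \sum_j m j * contr (deriv j g) (deriv j h) A C B
    = (q - #|A| - #|C|)%:R * contr g h A C B.
Proof.
move=> hg AC.
pose f L := if [disjoint L & A :|: C :|: B] then
  mu L * g (L :|: C :|: A)%SET * h (L :|: C :|: B)%SET else 0.
transitivity (\sum_j \sum_(L : {set T} | j \notin L) f (j |: L)%SET).
  apply: eq_bigr => j _; rewrite /contr big_mkcond mulr_sumr [RHS]big_mkcond.
  apply: eq_bigr => L _; rewrite /f /deriv.
  case: ifPn => [/disjointP LU|LU]; last first.
    rewrite mulr0; case: ifP => // _; case: ifPn => // /disjointP LU'.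
    by case/negP: LU; apply/disjointP => i iL; apply: LU'; rewrite inE iL orbT.
  have [jL|jL] := boolP (j \in L); first by rewrite !inE jL !(mulr0, mul0r).
  rewrite !inE (negPf jL) /=.
  case: (boolP [disjoint j |: L & A :|: C :|: B]) => [/disjointP jU|jU].
    have := jU j; rewrite !inE eqxx /= => /(_ isT) jU'.
    have /norP[/norP[/negPf jA /negPf jC] /negPf jB] :
      ~~ ((j \in A) || (j \in C) || (j \in B)) by apply/negP => /jU'.
    rewrite jA jC jB.
    by rewrite /= weight_setU1// !finset.setUA; ring.
  have : j \in (A :|: C :|: B)%SET.
    apply: contraNT jU => jU; apply/disjointP => i; rewrite !inE => /orP[/eqP ->|iL].
      by move: jU; rewrite !inE => /negPf ->.
    by move=> iU; apply: (LU i iL); rewrite !inE.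
  by rewrite !inE; case: (j \in A); case: (j \in B); case: (j \in C) => //= _; rewrite !(mulr0, mul0r).
transitivity (\sum_j \sum_(L : {set T} | j \in L) f L).
  by apply: eq_bigr => j _; rewrite sum_setU1.
rewrite (exchange_big_dep xpredT)//= /contr mulr_sumr [RHS]big_mkcond.
apply: eq_bigr => L _; rewrite sumr_const -[_ *+ #|L|]mulr_natl /f.
case: ifPn => [/disjointP LU|]; last by rewrite mulr0.
case: (eqVneq #|L :|: C :|: A| q) => [e|e]; last by rewrite hg// !(mulr0, mul0r).
congr (_%:R * _); rewrite -e.
have LC : [disjoint L & C].
  by apply/disjointP => j jL jC; apply: (LU j jL); rewrite !inE jC orbT.
have LCA : [disjoint L :|: C & A].
  apply/disjointP => j; rewrite inE => /orP[jL jA|jC jA].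
    by apply: (LU j jL); rewrite !inE jA.
  by move/disjointP: AC => /(_ j jA jC).
have cU (V W : {set T}) : [disjoint V & W] -> #|V :|: W| = (#|V| + #|W|)%N.
  by move=> VW; apply/eqP; rewrite (leq_card_setU V W).2.
by rewrite cU// cU// addnK addnK.
Qed.

Lemma gammaE q g h b : homogeneous q g -> gamma g h b = chaos (gammac q g h) b.
Proof.
move=> hg; rewrite /gamma.
under eq_bigr do rewrite chaos_mul -chaosZ.
rewrite -chaos_sum; congr (chaos _ b); apply/funext => U.
rewrite /prodc /gammac.
under eq_bigr do rewrite mulr_sumr.
rewrite exchange_big; apply: eq_bigr => A AU /=.
under eq_bigr do rewrite mulr_sumr.
rewrite exchange_big; apply: eq_bigr => C /subsetP CU /=.
rewrite -(sum_contr_deriv _ _ hg); last first.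
  by apply/disjointP => j jA /CU; rewrite inE jA.
by rewrite mulr_sumr; apply: eq_bigr => j _; rewrite mulrCA.
Qed.

(** Over the empty set only the full contraction survives; this constant term is the mean of
    [gamma]. *)
Lemma gammac0 q g h : gammac q g h set0 = q%:R * \sum_S mu S * g S * h S.
Proof.
rewrite /gammac (big_pred1 set0); last by move=> A; rewrite subset0.
rewrite (big_pred1 set0); last by move=> A; rewrite setD0 subset0.
rewrite /weight big_set0 mul1r cards0 !subn0 !setD0; congr (_ * _).
rewrite /contr; apply: eq_big => L; last by rewrite !setU0.
by rewrite !setU0; apply/disjointP => j _; rewrite inE.
Qed.

(** Centering removes the empty set U, that is the full contraction r = l = q = q', and the weight
    in [gammac] removes l = 0. The factor q^2 bounds the square of that weight and (q + 1)^2 counts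
    the pairs (r, l). *)
Lemma gamma_variance q q' g h e : homogeneous q g -> homogeneous q' h -> 0 <= e ->
  (forall r l, (0 < l)%N -> (l <= r)%N -> (r <= q)%N -> (r <= q')%N -> 
     ~~ [&& r == q, l == q & q' == q] -> contr_energy g h q q' r l <= e) ->
  Ex (fun b => (gamma g h b - q%:R * \sum_S mu S * g S * h S) ^+ 2)
    <= 36 ^+ (q + q') * q%:R ^+ 2 * q.+1%:R ^+ 2 * e.
Proof.
move=> hg hh e0 he.
pose G U := if U == set0 then 0 else gammac q g h U.
have E b : gamma g h b - q%:R * (\sum_S mu S * g S * h S) = chaos G b.
  rewrite (gammaE _ _ hg) -gammac0 /chaos (bigD1 set0)//= [RHS](bigD1 set0)//=.
  rewrite {1}/G eqxx mul0r add0r /mon big_set0 mulr1 addrAC subrr add0r.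
  by apply: eq_bigr => U U0; rewrite /G (negPf U0).
under eq_fun => b do rewrite E.
rewrite chaos_sqr (bigD1 set0)//= {1}/G eqxx expr0n mulr0 add0r.
rewrite (eq_bigr (fun U => mu U * gammac q g h U ^+ 2)); last first.
  by move=> U U0; rewrite /G (negPf U0).
pose kap A C B := (q - #|A| - #|C|)%:R * contr g h A C B.
(* [coef_bound] wants the size condition for all triples; [contr_neq0] supplies it only when C is
   disjoint from A and B, so [kap] is set to 0 elsewhere. *)
pose kap' A C B := if [disjoint A & C] && [disjoint C & B] then kap A C B else 0.
have kapE U : gammac q g h U = \sum_(A : {set T} | A \subset U)
    \sum_(C : {set T} | C \subset U :\: A) weight w C * kap' A C (U :\: A :\: C)%SET.
  apply: eq_bigr => A AU; apply: eq_bigr => C /subsetP CU; congr (_ * _).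
  rewrite /kap' ifT//; apply/andP; split; apply/disjointP => j; first by move=> jA /CU; rewrite inE jA.
  by rewrite !inE => ->.
under eq_bigr do rewrite kapE.
apply: le_trans (coef_bound (n := q + q') _ _) _.
  move=> A C B; rewrite /kap' /kap; case: ifP => [/andP[AC CB]|]; last by rewrite eqxx.
  rewrite mulf_eq0 negb_or => /andP[_ c0].
  have [l [<- <-]] := contr_neq0 hg hh AC CB c0.
  apply: leq_trans (leq_card_setU _ _).1 _; apply: leq_trans (leq_add (leq_card_setU _ _).1 (leqnn _)) _.
  by lia.
rewrite -(mulrA (36 ^+ _)) -mulrA ler_wpM2l ?exprn_ge0//.
pose P x := (union3 x != set0) && (0 < q - #|x.1.1| - #|x.1.2|)%N.
apply: (@le_trans _ _ (q%:R ^+ 2 * energy g h P)).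
  rewrite /energy mulr_sumr big_mkcond [leRHS]big_mkcond; apply: ler_sum => x _.
  case: ifP => [/andP[dx ux]|_]; last first.
    by case: ifP => // _; rewrite mulr_ge0 ?sqr_ge0// mulr_ge0 ?sqr_ge0// mu3_ge0.
  have [d1 d2 d3] := and3P dx; rewrite dx /P ux /kap' d1 d3 /kap /=.
  case: posnP => [->|_]; first by rewrite mul0r expr0n mulr0.
  rewrite exprMn mulrCA; apply: ler_wpM2r; first by rewrite mulr_ge0 ?sqr_ge0 ?mu3_ge0.
  by rewrite lerXn2r ?nnegrE// ler_nat -subnDA leq_subr.
rewrite -[leRHS]mulrA; apply: ler_wpM2l; first exact: sqr_ge0.
apply: (energy_le (q' := q') (good := fun r l => (0 < l)%N && ~~ [&& r == q, l == q & q' == q])) => //.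
  by move=> r l lr rq rq' /andP[l0 nn]; exact: he.
move=> A C B r l dx /andP[ux l0] lr rq rq' A1 C1 B1; rewrite /= in l0.
have l1 : (0 < l)%N by move: l0; rewrite A1 C1; lia.
rewrite l1 /=; apply: contraNN ux => /and3P[/eqP rE /eqP lE /eqP qE].
rewrite /union3 /= -cards_eq0 -leqn0.
apply: leq_trans (leq_card_setU _ _).1 _; apply: leq_trans (leq_add (leq_card_setU _ _).1 (leqnn _)) _.
by rewrite A1 C1 B1; lia.
Qed.

(** The square of a derivative is a chaos by the product formula, and adding j to the common part C
    makes its contractions those of [g] with C nonempty, so l < r. For l > 0 they are bounded by
    hypothesis. For l = 0 the contraction is a plain product, and summing it over A and B is
    dominated by a contraction with r = q, or by the sum of g^4 when |C| = q. *)
Lemma deriv_fourth q g e : homogeneous q g -> 0 <= e ->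
  (forall r l, (0 < l)%N -> (l <= r)%N -> (r <= q)%N -> (l < q)%N ->
     contr_energy g g q q r l <= e) ->
  \sum_C mu C * g C ^+ 4 <= e ->
  \sum_j m j * Ex (fun b => chaos (deriv j g) b ^+ 4)
    <= 36 ^+ (q + q) * (q%:R * (3 * (q.+1%:R ^+ 2 * e))).
Proof.
move=> hg e0 he h4.
pose kap j A C B := if [disjoint A & C] && [disjoint C & B] then
   contr (deriv j g) (deriv j g) A C B else 0.
have hgd j : homogeneous q.-1 (deriv j g).
  move=> S Sq; rewrite /deriv; case: ifPn => // jS; apply: hg.
  by apply: contraNN Sq => /eqP <-; rewrite cardsU1 jS.
pose Psi A C B := if [disjoint A & C] && [disjoint A & B] && [disjoint C & B]
  then mu A * mu C * mu B * contr g g A C B ^+ 2 else 0.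
have Psi0 A C B : 0 <= Psi A C B.
  by rewrite /Psi; case: ifP => // _; rewrite mulr_ge0 ?sqr_ge0// !mulr_ge0// mu_ge0.
apply: (@le_trans _ _ (36 ^+ (q + q) * \sum_j \sum_(A : {set T}) \sum_(B : {set T})
    \sum_(C : {set T} | j \notin C) Psi A (j |: C)%SET B)).
  rewrite mulr_sumr; apply: ler_sum => j _.
  rewrite (_ : (fun b => _) = (fun b => chaos (prodc (deriv j g) (deriv j g)) b ^+ 2)); last first.
    by apply/funext => b; rewrite -chaos_mul -expr2 -exprM.
  rewrite chaos_sqr.
  have kapE U : prodc (deriv j g) (deriv j g) U = \sum_(A : {set T} | A \subset U)
      \sum_(C : {set T} | C \subset U :\: A) weight w C * kap j A C (U :\: A :\: C)%SET.
    apply: eq_bigr => A AU; apply: eq_bigr => C /subsetP CU; congr (_ * _).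
    rewrite /kap ifT//; apply/andP; split; apply/disjointP => i; first by move=> iA /CU; rewrite inE iA.
    by rewrite !inE => ->.
  under eq_bigr do rewrite kapE.
  apply: (@le_trans _ _ (m j * (36 ^+ (q + q) * 
     \sum_(x | disj3 x && true) mu3 x * kap j x.1.1 x.1.2 x.2 ^+ 2))).
    rewrite ler_wpM2l ?m_ge0//; apply: (@coef_bound (kap j) (q + q)%N xpredT).
    move=> A C B; rewrite /kap; case: ifP => [/andP[AC CB]|]; last by rewrite eqxx.
    move=> c0; have [l [e1 e2]] := contr_neq0 (hgd j) (hgd j) AC CB c0.
    apply: leq_trans (leq_card_setU _ _).1 _; apply: leq_trans (leq_add (leq_card_setU _ _).1 (leqnn _)) _.
    by lia.
  rewrite mulrCA ler_wpM2l ?exprn_ge0// mulr_sumr.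
  have -> : \sum_(A : {set T}) \sum_(B : {set T}) \sum_(C : {set T} | j \notin C) Psi A (j |: C)%SET B
    = \sum_(x : {set T} * {set T} * {set T}) (if j \notin x.1.2 then Psi x.1.1 (j |: x.1.2)%SET x.2 else 0).
    rewrite -(pair_bigA _ (fun (y : {set T} * {set T}) B => if j \notin y.2 then Psi y.1 (j |: y.2)%SET B else 0)) /=.
    rewrite -(pair_bigA _ (fun A C => \sum_(B : {set T}) if j \notin C then Psi A (j |: C)%SET B else 0)) /=.
    apply: eq_bigr => A _; rewrite [RHS]exchange_big; apply: eq_bigr => B _ /=.
    by rewrite big_mkcond.
  rewrite big_mkcond; apply: ler_sum => [[[A C] B]] _ /=; rewrite andbT.
  have rhs0 : 0 <= (if j \notin C then Psi A (j |: C)%SET B else 0) by case: ifP.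
  case: ifP => // dx; have [d1 d2 d3] := and3P dx; rewrite /= in d1 d2 d3.
  rewrite /kap d1 d3 /= /mu3 /=.
  have [jC|jC] := boolP (j \in C).
    rewrite [contr _ _ _ _ _]big1 ?expr0n ?mulr0// => L _.
    by rewrite /deriv !inE jC !orbT /= mulr0.
  have rhs1 := Psi0 A (j |: C)%SET B; rewrite /=.
  have [jA|jA] := boolP (j \in A).
    rewrite [contr _ _ _ _ _]big1 ?expr0n ?mulr0// => L _.
    by rewrite /deriv !inE jA !orbT mulr0 mul0r.
  have [jB|jB] := boolP (j \in B).
    rewrite [contr _ _ _ _ _]big1 ?expr0n ?mulr0// => L _.
    by rewrite /deriv !inE jB !orbT mulr0.
  (* With j outside A, B, C and L, differentiating both kernels in j amounts to adding j to C. *)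
  have E : contr (deriv j g) (deriv j g) A C B = contr g g A (j |: C)%SET B.
    rewrite /contr [LHS]big_mkcond [RHS]big_mkcond; apply: eq_bigr => L _.
    have [jL|jL] := boolP (j \in L).
      rewrite /deriv !inE jL /= !(mulr0, mul0r) if_same.
      by case: ifP => // /disjointP /(_ j jL); rewrite !inE eqxx !orbT => /(_ isT).
    have -> : [disjoint L & A :|: (j |: C) :|: B] = [disjoint L & A :|: C :|: B].
      apply/disjointP/disjointP => h i iL; have := h i iL; rewrite !inE.
        by move=> hh iU; apply: hh; move: iU => /orP[/orP[->//|->]|->]; rewrite ?orbT.
      have /negPf -> : i != j by apply: contraNneq jL => <-.
      by [].
    case: ifP => // _; rewrite /deriv !inE (negPf jL) (negPf jC) (negPf jA) (negPf jB) /=.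
    by rewrite !finset.setUA (finset.setUC L [set j]).
  rewrite /Psi E ifT; last first.
    rewrite d2 andbT; apply/andP; split.
      apply/disjointP => i iA; rewrite !inE => /orP[/eqP ij|iC]; first by move: jA; rewrite -ij iA.
      by move/disjointP : d1 => /(_ i iA iC).
    apply/disjointP => i; rewrite !inE => /orP[/eqP -> jB'|iC iB]; first by rewrite jB' in jB.
    by move/disjointP : d3 => /(_ i iC iB).
  by rewrite weight_setU1// le_eqVlt; apply/orP; left; apply/eqP; ring.
rewrite ler_wpM2l ?exprn_ge0//.
have -> : \sum_j \sum_(A : {set T}) \sum_(B : {set T})
    \sum_(C : {set T} | j \notin C) Psi A (j |: C)%SET B =
  \sum_(x | disj3 x && (0 < #|x.1.2|)%N) #|x.1.2|%:R * (mu3 x * contr g g x.1.1 x.1.2 x.2 ^+ 2).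
  transitivity (\sum_(A : {set T}) \sum_(B : {set T}) \sum_(C : {set T}) #|C|%:R * Psi A C B).
    rewrite exchange_big; apply: eq_bigr => A _ /=.
    rewrite exchange_big; apply: eq_bigr => B _ /=.
    under eq_bigr do rewrite (sum_setU1 _ (fun C => Psi A C B)).
    rewrite (exchange_big_dep xpredT)//=; apply: eq_bigr => C _.
    by rewrite sumr_const -[_ *+ #|C|]mulr_natl.
  transitivity (\sum_(x : {set T} * {set T} * {set T}) #|x.1.2|%:R * Psi x.1.1 x.1.2 x.2).
    rewrite -(pair_bigA _ (fun (y : {set T} * {set T}) B => #|y.2|%:R * Psi y.1 y.2 B)) /=.
    rewrite -(pair_bigA _ (fun A C => \sum_(B : {set T}) #|C|%:R * Psi A C B)) /=.
    by apply: eq_bigr => A _; rewrite exchange_big.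
  rewrite [RHS]big_mkcond; apply: eq_bigr => [[[A C] B]] _ /=; rewrite /Psi /disj3 /= -andbA.
  set dd := [&& _, _ & _]; case: dd => /=; last by rewrite mulr0.
  by case: posnP => [->|]; rewrite ?mul0r.
apply: (@le_trans _ _ (q%:R * energy g g (fun x => (0 < #|x.1.2|)%N))).
  rewrite /energy mulr_sumr; apply: ler_sum => [[[A C] B]] /andP[dx C0].
  have [d1 d2 d3] := and3P dx; rewrite /= in d1 d2 d3.
  case: (eqVneq (contr g g A C B) 0) => [/= ->|c0]; first by rewrite expr0n !mulr0.
  have [l [e1 _]] := contr_neq0 hg hg d1 d3 c0.
  apply: ler_wpM2r; first by rewrite mulr_ge0 ?mu3_ge0 ?sqr_ge0.
  by rewrite ler_nat /= -e1 -addnA addnCA leq_addr.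
rewrite ler_wpM2l//.
have part1 : energy g g (fun x => (0 < #|x.1.2|)%N && (#|x.1.1| + #|x.1.2| < q)%N) <= q.+1%:R ^+ 2 * e.
  apply: (energy_le (q' := q) (good := fun r l => (0 < l)%N && (l < q)%N)) => //.
    by move=> r l lr rq _ /andP[*]; exact: he.
  by move=> A C B r l dx /andP[/= C0 ACq] lr rq _ A1 C1 B1; lia.
have part2 : energy g g (fun x => [&& x.1.1 == set0, x.2 == set0, (0 < #|x.1.2|)%N & (#|x.1.2| < q)%N]) <= q.+1%:R ^+ 2 * e.
  apply: (energy_le (q' := q) (good := fun r l => (0 < l)%N && (l < q)%N)) => //.
    by move=> r l lr rq _ /andP[*]; exact: he.
  move=> A C B r l dx /and4P[/eqP /= A0 /eqP B0 C0 Cq] lr rq _ A1 C1 B1.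
  by rewrite A0 cards0 in A1; lia.
have contr0 A C B : [disjoint A & C] -> [disjoint C & B] -> (q <= #|A| + #|C|)%N ->
   contr g g A C B = g (C :|: A)%SET * g (C :|: B)%SET.
  move=> AC CB qAC; rewrite /contr (bigD1 set0) /=; last by apply/disjointP => j; rewrite inE.
  rewrite /weight big_set0 mul1r !finset.set0U big1 ?addr0// => L /andP[/disjointP LU L0].
  rewrite (hg (L :|: C :|: A)%SET) ?mulr0 ?mul0r//.
  rewrite gtn_eqF//; apply: leq_ltn_trans qAC _.
  have cU (V W : {set T}) : [disjoint V & W] -> #|V :|: W| = (#|V| + #|W|)%N.
    by move=> VW; apply/eqP; rewrite (leq_card_setU V W).2.
  have LC : [disjoint L & C].
    by apply/disjointP => j jL jC; apply: (LU j jL); rewrite !inE jC orbT.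
  have LCA : [disjoint L :|: C & A].
    apply/disjointP => j; rewrite inE => /orP[jL jA|jC jA].
      by apply: (LU j jL); rewrite !inE jA.
    by move/disjointP: AC => /(_ j jA jC).
  by rewrite !cU//; move: L0; rewrite -card_gt0; lia.
(* Here l = 0. Forgetting that A and B are disjoint makes the double sum over them a square. *)
have part3 : energy g g (fun x => (0 < #|x.1.2|)%N && (q <= #|x.1.1| + #|x.1.2|)%N)
   <= q.+1%:R ^+ 2 * e + e.
  apply: (@le_trans _ _ (\sum_(C : {set T} | (0 < #|C|)%N) mu C *
     (\sum_(A : {set T} | [disjoint A & C]) mu A * g (C :|: A)%SET ^+ 2) ^+ 2)).
    rewrite /energy.
    have -> : \sum_(C : {set T} | (0 < #|C|)%N) mu C *
     (\sum_(A : {set T} | [disjoint A & C]) mu A * g (C :|: A)%SET ^+ 2) ^+ 2 =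
     \sum_(x : {set T} * {set T} * {set T} | [&& (0 < #|x.1.2|)%N, [disjoint x.1.1 & x.1.2] & [disjoint x.2 & x.1.2]])
       mu3 x * (g (x.1.2 :|: x.1.1)%SET * g (x.1.2 :|: x.2)%SET) ^+ 2.
      rewrite [RHS]big_mkcond.
      rewrite -(pair_bigA _ (fun (y : {set T} * {set T}) B =>
        if [&& (0 < #|y.2|)%N, [disjoint y.1 & y.2] & [disjoint B & y.2]] then
        mu y.1 * mu y.2 * mu B * (g (y.2 :|: y.1)%SET * g (y.2 :|: B)%SET) ^+ 2 else 0)) /=.
      rewrite -(pair_bigA _ (fun A C => \sum_(B : {set T})
        if [&& (0 < #|C|)%N, [disjoint A & C] & [disjoint B & C]] then
        mu A * mu C * mu B * (g (C :|: A)%SET * g (C :|: B)%SET) ^+ 2 else 0)) /=.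
      rewrite exchange_big big_mkcond; apply: eq_bigr => C _ /=.
      case: ifP => C0; last by rewrite big1// => A _; rewrite big1// => B _.
      rewrite expr2 mulr_suml mulr_sumr big_mkcond; apply: eq_bigr => A _.
      case: ifP => AC /=; last by rewrite big1.
      rewrite mulr_sumr mulr_sumr big_mkcond; apply: eq_bigr => B _.
      by case: ifP => // _; ring.
    rewrite big_mkcond [leRHS]big_mkcond; apply: ler_sum => [[[A C] B]] _ /=.
    case: ifP => [/andP[dx /andP[C0 qAC]]|_]; last first.
      by case: ifP => // _; rewrite mulr_ge0 ?sqr_ge0 ?mu3_ge0.
    have [d1 d2 d3] := and3P dx; rewrite /= in d1 d2 d3.
    by rewrite C0 d1 disjoint_sym d3 /= contr0.
  (* The inner sum is a contraction with r = q whose only free variables are those of C. [part2]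
     treats |C| < q, and the remaining C are covered by [h4]. *)
  have sE (C : {set T}) : \sum_(A : {set T} | [disjoint A & C]) mu A * g (C :|: A)%SET ^+ 2 = contr g g set0 C set0.
    rewrite /contr; apply: eq_big => [A|A _]; first by rewrite finset.set0U finset.setU0.
    by rewrite !finset.setU0 finset.setUC expr2 mulrA.
  under eq_bigr do rewrite sE.
  rewrite (bigID (fun C : {set T} => #|C| < q)%N) /= lerD//.
    apply: le_trans part2; rewrite /energy.
    rewrite [leRHS](_ : _ = \sum_(C : {set T} | (0 < #|C|)%N && (#|C| < q)%N) mu C * contr g g set0 C set0 ^+ 2)//.
    rewrite (reindex_onto (fun C => (set0, C, set0)) (fun x => x.1.2)) /=; last first.
      by move=> [[A C] B] /= /andP[_ /and4P[/eqP -> /eqP -> _ _]].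
    apply: eq_big => [C|C _]; last by rewrite /mu3 /weight /= big_set0 mul1r mulr1.
    rewrite !eqxx /= andbT andbC -[RHS]andbT; congr (_ && _); rewrite /disj3 /=.
    by apply/and3P; split; apply/disjointP => j; rewrite !inE.
  apply: le_trans h4; rewrite big_mkcond; apply: ler_sum => C _.
  case: ifP => [/andP[C0]|_]; last by rewrite mulr_ge0 ?mu_ge0// exprn_even_ge0.
  rewrite -leqNgt => qC; rewrite contr0 ?finset.setU0//.
  - by rewrite -expr2 -exprM.
  - by apply/disjointP => j; rewrite inE.
  - by apply/disjointP => j; rewrite inE.
  - by rewrite cards0.
have -> : energy g g (fun x => (0 < #|x.1.2|)%N) =
    energy g g (fun x => (0 < #|x.1.2|)%N && (#|x.1.1| + #|x.1.2| < q)%N) +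
    energy g g (fun x => (0 < #|x.1.2|)%N && (q <= #|x.1.1| + #|x.1.2|)%N).
  rewrite /energy (bigID (fun x => #|x.1.1| + #|x.1.2| < q)%N) /=; congr (_ + _).
    by apply: eq_bigl => x; rewrite andbA.
  by apply: eq_bigl => x; rewrite andbA -leqNgt.
apply: le_trans (lerD part1 part3) _.
have : e <= q.+1%:R ^+ 2 * e by rewrite ler_peMl// exprn_ege1// ler1n.
lra.
Qed.

End bernoulli.

(** * From sums over sets to sums over tuples *)

Lemma sum_le_fibers (R : realFieldType) (I J : finType) (P : pred I) (F : I -> R) (G : J -> R) (rho : J -> I) :
  (forall a, 0 <= G a) -> (forall x, P x -> exists2 a, rho a = x & F x <= G a) ->
  \sum_(x | P x) F x <= \sum_a G a.
Proof.
move=> G0 FG; rewrite [leRHS](bigID (fun a => P (rho a))) /=; apply: ler_wpDr; first exact: sumr_ge0.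
rewrite (partition_big rho P)//=; apply: ler_sum => x Px.
have [a ax Fa] := FG x Px.
rewrite (bigD1 a) /=; last by rewrite ax Px eqxx.
by rewrite ler_wpDr// sumr_ge0.
Qed.

Section tuple_sums.
Context (R : realFieldType) (T : finType) (m : T -> R).
Hypothesis m0 : forall t, 0 <= m t.
Implicit Types (g h : {set T} -> R) (s t : seq T).

Definition wseq s : R := \prod_(t <- s) m t.
(** A set function read as a symmetric function of several arguments that vanishes on the
    diagonals. *)
Definition coeff g s : R := if uniq s then g [set x in s] else 0.

Lemma wseq_ge0 s : 0 <= wseq s.
Proof. exact: prodr_ge0. Qed.

Lemma wseq_uniq s : uniq s -> wseq s = weight m [set x in s].
Proof. by move=> us; rewrite /wseq big_uniq//; apply: eq_bigl => x; rewrite inE. Qed.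

Lemma set_cat s t : [set x in s ++ t] = [set x in s] :|: [set x in t].
Proof. by apply/setP => x; rewrite !inE mem_cat. Qed.

Lemma set_enum (S : {set T}) : [set x in enum S] = S.
Proof. by apply/setP => x; rewrite inE mem_enum. Qed.

Lemma card_seq s : uniq s -> #|[set x in s]| = size s.
Proof. by move=> us; rewrite cardsE; exact/card_uniqP. Qed.

Lemma sum_uniq_tuples l (Phi : {set T} -> R) :
  \sum_(a : l.-tuple T | uniq a) Phi [set x in a] = l`!%:R * \sum_(L : {set T} | #|L| == l) Phi L.
Proof.
rewrite (partition_big (fun a : l.-tuple T => [set x in a]) (fun L : {set T} => #|L| == l)) /=; last first.
  by move=> a ua; rewrite card_seq// size_tuple.
rewrite mulr_sumr; apply: eq_bigr => L /eqP Ll.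
rewrite (eq_bigr (fun=> Phi L)); last by move=> a /andP[_ /eqP ->].
rewrite sumr_const mulr_natl; congr (_ *+ _).
apply: (@etrans _ _ #|[set t : l.-tuple T | all (mem L) t & uniq t]|); last first.
  by rewrite card_uniq_tuples Ll ffactnn.
apply: eq_card => a; rewrite !inE -topredE /=.
rewrite andbC; case ua: (uniq a); rewrite ?andbT ?andbF//.
apply/eqP/allP => [<- x xa|h]; first by have : x \in [set y in a] by rewrite inE.
apply/eqP; rewrite eqEcard card_seq// size_tuple Ll leqnn andbT.
by apply/subsetP => x; rewrite inE; exact: h.
Qed.

Lemma contr_tuples g h p l (c a b : seq T) : homogeneous p g ->
  uniq (c ++ a) -> uniq (c ++ b) -> (l + size c + size a)%N = p ->
  \sum_(z : l.-tuple T) wseq z * coeff g (z ++ c ++ a) * coeff h (z ++ c ++ b) =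
  l`!%:R * contr m g h [set x in a] [set x in c] [set x in b].
Proof.
move=> hg uca ucb lp.
pose D (L : {set T}) := [disjoint L & [set x in a] :|: [set x in c] :|: [set x in b]].
pose Phi L := if D L then weight m L * g (L :|: [set x in c] :|: [set x in a]) *
   h (L :|: [set x in c] :|: [set x in b]) else 0.
have DE (z : seq T) : D [set x in z] = ~~ has (mem z) (c ++ a) && ~~ has (mem z) (c ++ b).
  apply/disjointP/andP => [H|[/hasPn H1 /hasPn H2] x].
    split; apply/hasPn => x; rewrite mem_cat => xx; apply/negP => /= xz;
    by have := H x; rewrite !inE xz; case/orP : xx => ->; rewrite ?orbT => /(_ isT isT).
  rewrite !inE => xz; have := H1 x; have := H2 x; rewrite !mem_cat /= xz.
  by case: (x \in a); case: (x \in c); case: (x \in b) => //= A1 A2; first [by have := A1 isT|by have := A2 isT].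
transitivity (\sum_(z : l.-tuple T | uniq z) Phi [set x in z]).
  rewrite [LHS](bigID (fun z : l.-tuple T => uniq z)) /= [X in _ + X]big1 ?addr0; last first.
    by move=> z /negPf uz; rewrite /coeff cat_uniq uz mulr0 mul0r.
  apply: eq_bigr => z uz; rewrite /Phi DE /coeff !(cat_uniq z) uz uca ucb !andbT /=.
  case: ifP => [h1|h1]; case: ifP => [h2|h2]; rewrite ?h1 ?h2 ?mulr0 ?mul0r//=.
  by rewrite !set_cat !setUA wseq_uniq.
rewrite sum_uniq_tuples; congr (_ * _); rewrite /contr [RHS]big_mkcond [LHS]big_mkcond.
apply: eq_bigr => L _; rewrite /Phi -/(D L); case: ifP => [//|Ll]; case: ifP => // DL.
rewrite hg ?mulr0 ?mul0r//.
have [Lc La] : [disjoint L & [set x in c]] /\ [disjoint L :|: [set x in c] & [set x in a]].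
  move/disjointP : DL => DL; split; apply/disjointP => x; rewrite !inE.
    by move=> xL xc; have := DL x; rewrite !inE xc orbT => /(_ xL isT).
  case/orP => [xL|xc] xa; first by have := DL x; rewrite !inE xa => /(_ xL isT).
  by move: uca; rewrite cat_uniq => /and3P[_ /hasPn/(_ x xa)]; rewrite /= xc.
move: uca; rewrite cat_uniq => /and3P[uc _ ua].
have cU (X Y : {set T}) : [disjoint X & Y] -> #|X :|: Y| = (#|X| + #|Y|)%N.
  by rewrite -setI_eq0 cardsU => /eqP ->; rewrite cards0 subn0.
rewrite !cU// !card_seq// -lp; apply/negP => /eqP E; move/eqP : Ll; apply; lia.
Qed.

(** One enumeration of each triple (A, C, B) suffices for an inequality. The factor l! counts the
    orderings of the integrated variables and is squared with the contraction. *)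
Lemma energy_tuples g h p q r l : homogeneous p g -> (l <= r)%N -> (r <= p)%N -> (r <= q)%N ->
  l`!%:R ^+ 2 * contr_energy m g h p q r l <=
  \sum_(b : (p + q - r - l).-tuple T) wseq b *
    (\sum_(z : l.-tuple T) wseq z * coeff g (z ++ take (p - l) b)
       * coeff h (z ++ take (r - l) b ++ drop (p - l) b)) ^+ 2.
Proof.
move=> hg lr rp rq; rewrite /contr_energy /energy mulr_sumr.
apply: (sum_le_fibers (rho := fun b : (p + q - r - l).-tuple T =>
   ([set x in take (p - r) (drop (r - l) b)], [set x in take (r - l) b], [set x in drop (p - l) b]))).
  by move=> b; rewrite mulr_ge0 ?wseq_ge0// sqr_ge0.
case=> [[A C] B] /= /andP[/and3P[/= AC AB CB] /and3P[/eqP cA /eqP cC /eqP cB]].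
have sz : size (enum C ++ enum A ++ enum B) == (p + q - r - l)%N.
  by rewrite !size_cat -!cardE cA cC cB; apply/eqP; lia.
have tC : take (r - l) (enum C ++ enum A ++ enum B) = enum C.
  by rewrite take_size_cat// -cardE.
have dC : drop (r - l) (enum C ++ enum A ++ enum B) = enum A ++ enum B.
  by rewrite drop_size_cat// -cardE.
have tCA : take (p - l) (enum C ++ enum A ++ enum B) = enum C ++ enum A.
  by rewrite catA take_size_cat// size_cat -!cardE cA cC; lia.
have dB : drop (p - l) (enum C ++ enum A ++ enum B) = enum B.
  by rewrite catA drop_size_cat// size_cat -!cardE cA cC; lia.
exists (Tuple sz) => /=.
  by rewrite tC dC dB take_size_cat ?set_enum -?cardE.
rewrite tC dB.
have hd (S S' : {set T}) : [disjoint S & S'] -> ~~ has (mem (enum S)) (enum S').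
  by move/disjointP => H; apply/hasPn => x xS'; apply/negP => xS; apply: (notF (H x _ _)); rewrite -mem_enum.
have CA : [disjoint C & A] by rewrite disjoint_sym.
rewrite tCA (@contr_tuples g h p l (enum C) (enum A) (enum B))//; last 3 first.
- by rewrite cat_uniq !enum_uniq hd.
- by rewrite cat_uniq !enum_uniq hd.
- by rewrite -!cardE cA cC; lia.
rewrite !set_enum.
have -> : wseq (enum C ++ enum A ++ enum B) = mu3 m (A, C, B).
  rewrite wseq_uniq; last first.
    by rewrite !cat_uniq !enum_uniq has_cat negb_or !hd.
  rewrite !set_cat !set_enum /mu3 /= !weight_setU//.
    by rewrite mulrA [weight m C * _]mulrC.
  apply/disjointP => x xC; rewrite inE => /orP[xA|xB].
    by move/disjointP : CA => /(_ x xC xA).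
  by move/disjointP : CB => /(_ x xC xB).
by rewrite exprMn mulrCA.
Qed.

Lemma moment_tuples g q (Phi : R -> R) : homogeneous q g -> Phi 0 = 0 ->
  \sum_(a : q.-tuple T) wseq a * Phi (coeff g a) = q`!%:R * \sum_S weight m S * Phi (g S).
Proof.
move=> hg Phi0; transitivity (\sum_(a : q.-tuple T | uniq a) weight m [set x in a] * Phi (g [set x in a])).
  rewrite [RHS]big_mkcond; apply: eq_bigr => a _; rewrite /coeff; case: ifP => ua; last by rewrite Phi0 mulr0.
  by rewrite wseq_uniq.
rewrite (sum_uniq_tuples q (fun S => weight m S * Phi (g S))); congr (_ * _).
by rewrite [LHS]big_mkcond; apply: eq_bigr => S _; case: eqP => // /eqP Sq; rewrite hg// Phi0 mulr0.
Qed.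

End tuple_sums.

From HB Require Import structures.
Require Import Defs.
From mathcomp Require Import perm.
From mathcomp Require Import all_classical all_reals all_analysis.
From mathcomp Require Import measurable_realfun.
Import numFieldNormedType.Exports.
Local Open Scope classical_set_scope.

(** * Comparison of laws by a discrete Ornstein-Uhlenbeck semigroup *)

Section stein_method.
Context (R : realType) (k : nat).
Implicit Types (x y : 'rV[R]_k) (phi : 'rV[R]_k -> R) (A a b : R).

Definition norm1 x : R := \sum_i `|x 0 i|.

Lemma norm1_ge0 x : 0 <= norm1 x.
Proof. by apply: sumr_ge0. Qed.

Lemma norm1D x y : norm1 (x + y) <= norm1 x + norm1 y.
Proof. by rewrite /norm1 -big_split; apply: ler_sum => i _; rewrite mxE ler_normD. Qed.

Lemma norm1Z a x : norm1 (a *: x) = `|a| * norm1 x.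
Proof. by rewrite /norm1 mulr_sumr; apply: eq_bigr => i _; rewrite mxE normrM. Qed.

Lemma norm1_coord x i : `|x 0 i| <= norm1 x.
Proof. by rewrite /norm1 (bigD1 i)//= lerDl sumr_ge0. Qed.

(* g and H stand for the gradient and the Hessian of phi. Stating the class    *)
(* through Taylor remainders makes it stable under the averages [ou_step],     *)
(* without any differentiation under an expectation.                           *)
Definition stein_class A phi (g : 'I_k -> 'rV[R]_k -> R)
    (H : 'I_k -> 'I_k -> 'rV[R]_k -> R) : Prop :=
  [/\ forall i l x, `|H i l x| <= A,
      forall i l x y, `|H i l (x + y) - H i l x| <= A * norm1 y,
      forall i x y,
        `|g i (x + y) - g i x - \sum_l H i l x * y 0 l| <= A * norm1 y ^+ 2 &
      forall x y,
        `|phi (x + y) - phi x - \sum_i g i x * y 0 i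
          - 2^-1 * \sum_i \sum_l H i l x * y 0 i * y 0 l| <= A * norm1 y ^+ 3].

(** Coordinates have no second-order part, hence constant 0; an approximate Stein identity then
    forces their means to vanish exactly, as used in [exf_coord]. *)
Lemma stein_class_coord i :
  stein_class 0 (fun x => x 0 i) (fun l _ => (l == i)%:R) (fun _ _ _ => 0).
Proof.
split => [j l x|j l x y|j x y|x y].
- by rewrite normr0.
- by rewrite subrr normr0 mul0r.
- by rewrite subrr sub0r normrN mul0r big1 ?normr0// => l _; rewrite mul0r.
- rewrite mul0r (bigD1 i)//= eqxx mul1r big1; last first.
    by move=> j /negPf ->; rewrite mul0r.
  rewrite big1; last by move=> j _; rewrite big1// => l _; rewrite !mul0r.
  by rewrite !mxE mulr0 addr0 (addrC (x 0 i)) addrK !subrr normr0.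
Qed.

Definition avg (u : {ffun 'I_k -> bool} -> R) : R := (2 ^+ k)^-1 * \sum_e u e.

Lemma avgD u v : avg (fun e => u e + v e) = avg u + avg v.
Proof. by rewrite /avg big_split mulrDr. Qed.

Lemma avgZ c u : avg (fun e => c * u e) = c * avg u.
Proof. by rewrite /avg -mulr_sumr mulrCA. Qed.

Lemma avgN u : avg (fun e => - u e) = - avg u.
Proof. by rewrite /avg sumrN mulrN. Qed.

Lemma avg_sum (I : finType) (F : I -> {ffun 'I_k -> bool} -> R) :
  avg (fun e => \sum_i F i e) = \sum_i avg (F i).
Proof. by rewrite /avg exchange_big /= mulr_sumr. Qed.

Lemma avg_cst c : avg (fun=> c) = c.
Proof.
rewrite /avg sumr_const card_ffun card_bool card_ord -(mulr_natl c) natrX.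
by rewrite mulrA mulVf ?mul1r// expf_neq0.
Qed.

Lemma ler_avg u v : (forall e, u e <= v e) -> avg u <= avg v.
Proof.
by move=> uv; rewrite /avg ler_wpM2l// ?invr_ge0 ?exprn_ge0//; exact: ler_sum.
Qed.

Lemma ler_norm_avg u c : (forall e, `|u e| <= c) -> `|avg u| <= c.
Proof.
move=> uc; rewrite ler_norml -(avg_cst c) -avgN !ler_avg// => e;
  by have := uc e; rewrite ler_norml => /andP[].
Qed.

Definition sgn (e : {ffun 'I_k -> bool}) (i : 'I_k) : R := (-1) ^+ (e i).

Definition flip (i : 'I_k) (e : {ffun 'I_k -> bool}) : {ffun 'I_k -> bool} :=
  [ffun j => (j == i) (+) e j].

Lemma flipK i : involutive (flip i).
Proof. by move=> e; apply/ffunP => j; rewrite !ffunE addKb. Qed.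

Lemma avg_flip i u : avg (fun e => u (flip i e)) = avg u.
Proof.
by rewrite /avg [in RHS](reindex_inj (can_inj (flipK i))).
Qed.

Lemma avg_odd i u : (forall e, u (flip i e) = - u e) -> avg u = 0.
Proof.
move=> hu; have := avg_flip i u; under [X in avg X]eq_fun do rewrite hu.
by rewrite avgN => h; lra.
Qed.

Lemma avg_sgn i : avg (sgn ^~ i) = 0.
Proof.
apply: (avg_odd (i := i)) => e; rewrite /sgn ffunE eqxx /=.
by case: (e i); rewrite ?expr1 ?expr0 ?opprK.
Qed.

Lemma avg_sgn2 i j : avg (fun e => sgn e i * sgn e j) = (i == j)%:R.
Proof.
case: eqVneq => [<-|ij].
  rewrite -[RHS](avg_cst 1); congr avg; apply/funext => e.
  by rewrite /sgn -expr2 sqrr_sign.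
apply: (avg_odd (i := i)) => e; rewrite /sgn !ffunE eqxx /= eq_sym (negPf ij) /=.
by case: (e i); rewrite ?expr1 ?expr0 ?mulN1r ?mul1r ?opprK.
Qed.

Variable s : 'I_k -> R.

Definition noise (e : {ffun 'I_k -> bool}) : 'rV[R]_k := \row_i (s i * sgn e i).

Lemma norm1_noise e : norm1 (noise e) = \sum_i `|s i|.
Proof.
apply: eq_bigr => i _; rewrite mxE normrM /sgn.
by case: (e i); rewrite ?normrN1 ?normr1 mulr1.
Qed.

(* A step of the Ornstein-Uhlenbeck semigroup with Rademacher noise. *)
Definition ou_step a b phi x : R := avg (fun e => phi (a *: x + b *: noise e)).

(** Each derivative brings a factor a <= 1. The Hessian gains exactly a^2 and the Taylor remainders
    at least that, which makes the errors of successive steps a geometric series. *)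
Lemma stein_class_ou A a b phi g H : 0 <= a <= 1 -> 0 <= A ->
  stein_class A phi g H ->
  stein_class (a ^+ 2 * A) (ou_step a b phi)
    (fun i x => a * ou_step a b (g i) x)
    (fun i l x => a ^+ 2 * ou_step a b (H i l) x).
Proof.
move=> /andP[a0 a1] A0 [c1 c2 c3 c4].
have E (x y : 'rV[R]_k) e : a *: (x + y) + b *: noise e = (a *: x + b *: noise e) + a *: y.
  by rewrite scalerDr addrAC.
split => [i l x|i l x y|i x y|x y].
- by rewrite normrM ger0_norm ?sqr_ge0// ler_wpM2l ?sqr_ge0// ler_norm_avg.
- rewrite -mulrBr normrM ger0_norm ?sqr_ge0// -mulrA ler_wpM2l ?sqr_ge0//.
  rewrite /ou_step -avgN -avgD; apply: ler_norm_avg => e; rewrite E.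
  apply: le_trans (c2 _ _ _ _) _; rewrite norm1Z ger0_norm// ler_wpM2l//.
  by rewrite ler_piMl// norm1_ge0.
- rewrite [X in `|X|](_ : _ = avg (fun e => a * (g i (a *: (x + y) + b *: noise e)
    - g i (a *: x + b *: noise e) - \sum_l H i l (a *: x + b *: noise e) * (a *: y) 0 l))).
    apply: ler_norm_avg => e; rewrite E normrM ger0_norm//.
    apply: (@le_trans _ _ (a * (A * (a * norm1 y) ^+ 2))).
      rewrite ler_wpM2l//; apply: le_trans (c3 _ _ _) _.
      by rewrite norm1Z ger0_norm.
    rewrite exprMn [leLHS](_ : _ = a * (a ^+ 2 * A * norm1 y ^+ 2)); last by ring.
    by rewrite ler_piMl// !mulr_ge0// ?norm1_ge0.
  rewrite avgZ avgD avgD !avgN avg_sum /ou_step mulrBr mulrBr; congr (_ - _).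
  rewrite mulr_sumr; apply: eq_bigr => l _; rewrite mxE.
  by under [in RHS]eq_fun do rewrite mulrC; rewrite avgZ; ring.
- rewrite [X in `|X|](_ : _ = avg (fun e => phi (a *: (x + y) + b *: noise e)
    - phi (a *: x + b *: noise e) - \sum_i g i (a *: x + b *: noise e) * (a *: y) 0 i
    - 2^-1 * \sum_i \sum_l H i l (a *: x + b *: noise e) * (a *: y) 0 i * (a *: y) 0 l)).
    apply: ler_norm_avg => e; rewrite E.
    apply: le_trans (c4 _ _) _; rewrite norm1Z ger0_norm//.
    rewrite exprMn [leLHS](_ : _ = a * (a ^+ 2 * A * norm1 y ^+ 3)); last by ring.
    by rewrite ler_piMl// !mulr_ge0// ?exprn_ge0// ?norm1_ge0.
  rewrite !avgD !avgN avgZ !avg_sum /ou_step; congr (_ - _ - _ - _ * _).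
    apply: eq_bigr => i _; rewrite mxE.
    by under [in RHS]eq_fun do rewrite mulrC; rewrite avgZ; ring.
  apply: eq_bigr => i _; rewrite avg_sum; apply: eq_bigr => l _; rewrite !mxE.
  by under [in RHS]eq_fun do rewrite -mulrA mulrC; rewrite avgZ; ring.
Qed.

(** Taylor expansion at x with increment - th^2 x + b noise. Its mean is - th^2 x and the noise has
    independent coordinates of variance b^2 s_i^2 with b^2 / 2 = th^2 up to th^4, so a step moves
    [phi] by th^2 times the Ornstein-Uhlenbeck generator, with a remainder of order th^3. *)
Lemma ou_step_bound A th phi g H x : 0 <= A -> 0 <= th <= 1 ->
  let a := 1 - th ^+ 2 in let b := Num.sqrt (1 - a ^+ 2) in
  stein_class A phi g H ->
  `|ou_step a b phi x - phi x
    - th ^+ 2 * (\sum_i s i ^+ 2 * H i i x - \sum_i x 0 i * g i x)|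
  <= A * th ^+ 3 * (4 * (1 + norm1 x + 2 * \sum_i `|s i|) ^+ 3).
Proof.
move=> A0 /andP[t0 t1] a b [c1 c2 c3 c4].
have th1 : th ^+ 2 <= 1 by rewrite expr_le1.
have tt0 : 0 <= th ^+ 2 by rewrite sqr_ge0.
have b2 : b ^+ 2 = 2 * th ^+ 2 - th ^+ 4.
  rewrite sqr_sqrtr; first by rewrite /a; ring.
  by rewrite subr_ge0 expr_le1// /a; lra.
have b0 : 0 <= b by rewrite sqrtr_ge0.
have bt : b <= 2 * th.
  rewrite -(ler_pXn2r (n := 2))// ?nnegrE ?mulr_ge0// b2 exprMn.
  have := exprn_ge0 4 t0; have : 0 <= 2 ^+ 2 * th ^+ 2 - 2 * th ^+ 2 by lra.
  lra.
set S := \sum_i `|s i|; have S0 : 0 <= S by rewrite sumr_ge0.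
pose y e := - th ^+ 2 *: x + b *: noise e.
have yE e : a *: x + b *: noise e = x + y e.
  by rewrite /y /a scalerBl scale1r scaleNr addrA.
have ny e : norm1 (y e) <= th * (norm1 x + 2 * S).
  apply: le_trans (norm1D _ _) _; rewrite !norm1Z normrN !ger0_norm// norm1_noise -/S.
  rewrite mulrDr mulrA (mulrC th 2) lerD//; last by rewrite ler_wpM2r.
  by rewrite expr2 -mulrA ler_wpM2l// ler_piMl ?norm1_ge0.
pose Q e := 2^-1 * \sum_i \sum_l H i l x * y e 0 i * y e 0 l.
pose L e := \sum_i g i x * y e 0 i.
have avgL : avg L = - th ^+ 2 * \sum_i x 0 i * g i x.
  rewrite /L avg_sum mulr_sumr; apply: eq_bigr => i _; rewrite avgZ.
  rewrite [X in avg X](_ : _ = fun e => (- th ^+ 2 * x 0 i) + (b * s i) * sgn e i).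
    by rewrite avgD avg_cst avgZ avg_sgn; ring.
  by apply/funext => e; rewrite !mxE; ring.
have avgQ : avg Q = 2^-1 * th ^+ 4 * (\sum_i \sum_l H i l x * x 0 i * x 0 l)
     + 2^-1 * b ^+ 2 * \sum_i s i ^+ 2 * H i i x.
  rewrite /Q avgZ avg_sum -(mulrA _ (th ^+ 4)) -(mulrA _ (b ^+ 2)) -mulrDr; congr (_ * _).
  rewrite !mulr_sumr -big_split; apply: eq_bigr => i _ /=.
  rewrite avg_sum.
  rewrite (eq_bigr (fun l => th ^+ 4 * (H i l x * x 0 i * x 0 l)
     + b ^+ 2 * ((i == l)%:R * (s i * s l * H i l x)))); last first.
    move=> l _; rewrite [X in avg X](_ : _ = fun e => th ^+ 4 * (H i l x * x 0 i * x 0 l)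
      + ((- th ^+ 2 * b * H i l x * x 0 i * s l) * sgn e l
      + ((- th ^+ 2 * b * H i l x * x 0 l * s i) * sgn e i
      + (b ^+ 2 * (s i * s l * H i l x)) * (sgn e i * sgn e l)))).
      by rewrite !avgD avg_cst !avgZ !avg_sgn avg_sgn2; ring.
    by apply/funext => e; rewrite !mxE; ring.
  rewrite big_split /= -!mulr_sumr; congr (_ + _ * _).
  rewrite (bigD1 i)//= eqxx mul1r big1 ?addr0; first by ring.
  by move=> l; rewrite eq_sym => /negPf ->; rewrite mul0r.
set T := (X in `|X|).
(* The terms of order th^2 cancel against the generator; what remains of the quadratic part has
   order th^4. *)
have TE : T = avg (fun e => phi (x + y e) - phi x - L e - Q e)
   + 2^-1 * th ^+ 4 * (\sum_i \sum_l H i l x * x 0 i * x 0 l)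
   - 2^-1 * th ^+ 4 * (\sum_i s i ^+ 2 * H i i x).
  rewrite !avgD !avgN avg_cst avgL avgQ b2 /T /ou_step.
  under eq_fun do rewrite yE.
  set U := \sum_i _; set V := \sum_i _; set W := \sum_i _; set N := avg _.
  by field.
set N := norm1 x; have N0 : 0 <= N := norm1_ge0 x.
have i1 : `|avg (fun e => phi (x + y e) - phi x - L e - Q e)|
    <= A * th ^+ 3 * (N + 2 * S) ^+ 3.
  apply: ler_norm_avg => e; apply: le_trans (c4 _ _) _.
  rewrite -mulrA -exprMn ler_wpM2l// lerXn2r// ?nnegrE ?norm1_ge0//.
  by rewrite mulr_ge0// addr_ge0// mulr_ge0.
have i2 : `|\sum_i \sum_l H i l x * x 0 i * x 0 l| <= A * N ^+ 2.
  apply: le_trans (ler_norm_sum _ _ _) _.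
  rewrite expr2 {1}/N /norm1 mulr_suml mulr_sumr; apply: ler_sum => i _.
  apply: le_trans (ler_norm_sum _ _ _) _.
  rewrite /N /norm1 !mulr_sumr; apply: ler_sum => l _.
  by rewrite !normrM -!mulrA ler_wpM2r// mulr_ge0.
have i3 : `|\sum_i s i ^+ 2 * H i i x| <= A * S ^+ 2.
  apply: le_trans (ler_norm_sum _ _ _) _.
  apply: (@le_trans _ _ (\sum_i A * (`|s i| * S))).
    apply: ler_sum => i _; rewrite normrM normrX mulrC ler_pM// ?sqr_ge0//.
    by rewrite expr2 ler_wpM2l// /S (bigD1 i)//= lerDl sumr_ge0.
  by rewrite -mulr_sumr -mulr_suml expr2.
have t34 : th ^+ 4 <= th ^+ 3 by rewrite exprS ler_piMl// exprn_ge0.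
have At3 : 0 <= A * th ^+ 3 by rewrite mulr_ge0// exprn_ge0.
have h4 (v w : R) : `|v| <= A * w -> 0 <= w -> `|2^-1 * th ^+ 4 * v| <= A * th ^+ 3 * w.
  move=> vw w0; rewrite normrM ger0_norm ?mulr_ge0// ?exprn_ge0//.
  rewrite (mulrC A) -mulrA.
  apply: (@le_trans _ _ (th ^+ 4 * `|v|)).
    rewrite (mulrC 2^-1) -mulrA ler_wpM2l// ?exprn_ge0//.
    by have := normr_ge0 v; lra.
  by have := ler_wpM2l (exprn_ge0 4 t0) vw; have := ler_wpM2r (mulr_ge0 A0 w0) t34; lra.
rewrite TE; apply: le_trans (ler_normB _ _) _.
apply: le_trans (lerD (ler_normD _ _) (lexx _)) _.
have j2 := h4 _ _ i2 (sqr_ge0 N); have j3 := h4 _ _ i3 (sqr_ge0 S).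
apply: le_trans (lerD (lerD i1 j2) j3) _.
rewrite -!mulrDr ler_wpM2l//.
set M := 1 + N + 2 * S.
have M1 : 1 <= M by rewrite /M; lra.
have k1 : (N + 2 * S) ^+ 3 <= M ^+ 3.
  by rewrite lerXn2r// ?nnegrE /M; clear - N0 S0; lra.
have k2 (v : R) : 0 <= v -> v <= M -> v ^+ 2 <= M ^+ 3.
  move=> v0 vM; apply: (@le_trans _ _ (M ^+ 2)); first by rewrite lerXn2r// nnegrE; lra.
  by rewrite [leRHS]exprS ler_peMl// sqr_ge0.
have k3 := k2 N N0; have k4 := k2 S S0.
have : 0 <= M ^+ 3 by rewrite exprn_ge0//; lra.
have : N <= M by rewrite /M; lra.
have : S <= M by rewrite /M; lra.
move=> /k4 + /k3; lra.
Qed.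

(* E is an expectation on a class D of integrable functions. *)
Record expectation_functional (D : ('rV[R]_k -> R) -> Prop)
    (E : ('rV[R]_k -> R) -> R) : Prop := ExpectationFunctional {
  exf_lin : forall u v c, D u -> D v -> D (fun x => u x + c * v x) ;
  exf_linE : forall u v c, D u -> D v -> E (fun x => u x + c * v x) = E u + c * E v ;
  exf_mono : forall u v, D u -> D v -> (forall x, u x <= v x) -> E u <= E v ;
  exf_D1 : D (fun=> 1) ;
  exf_1 : E (fun=> 1) = 1 ;
  exf_class : forall A phi g H, 0 <= A -> stein_class A phi g H ->
    [/\ D phi, forall i, D (fun x => x 0 i * g i x) & forall i l, D (H i l)] ;
  exf_cube : forall c, 0 <= c -> D (fun x => (c + norm1 x) ^+ 3)
}.

(** The Ornstein-Uhlenbeck generator written with gradient and Hessian; its mean vanishes under the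
    centered Gaussian law with independent coordinates of standard deviations s_i. *)
Definition stein_gap (g : 'I_k -> 'rV[R]_k -> R) (H : 'I_k -> 'I_k -> 'rV[R]_k -> R) x :=
  \sum_i s i ^+ 2 * H i i x - \sum_i x 0 i * g i x.

Section comparison.
Variables (D : ('rV[R]_k -> R) -> Prop) (E : ('rV[R]_k -> R) -> R) (kappa : R).
Hypothesis DE : expectation_functional D E.

Lemma exf_D0 : D (fun=> 0).
Proof.
have := exf_lin DE (-1) (exf_D1 DE) (exf_D1 DE).
by congr D; apply/funext => x; ring.
Qed.

Lemma exf_sum (I : Type) (r : seq I) (u : I -> 'rV[R]_k -> R) :
  (forall i, D (u i)) -> D (fun x => \sum_(i <- r) u i x).
Proof.
move=> Du; elim: r => [|i r IH].
  by under [X in D X]eq_fun do rewrite big_nil; exact: exf_D0.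
under [X in D X]eq_fun do rewrite big_cons -(mul1r (\sum_(_ <- _) _)).
exact: (exf_lin DE).
Qed.

Lemma exf_Z u c : D u -> D (fun x => c * u x).
Proof.
move=> Du; have := exf_lin DE c exf_D0 Du.
by congr D; apply/funext => x; ring.
Qed.

Lemma exf_ZE u c : D u -> E (fun x => c * u x) = c * E u.
Proof.
move=> Du.
have := exf_linE DE c exf_D0 Du; under [in LHS]eq_fun do rewrite add0r.
move=> ->; have := exf_linE DE (-1) exf_D0 exf_D0.
under [in LHS]eq_fun do rewrite mulr0 addr0.
by move=> h; lra.
Qed.

Lemma exf_E0 : E (fun=> 0) = 0.
Proof. by have := exf_ZE 0 (exf_D1 DE); rewrite !mul0r. Qed.

Lemma exf_B u v : D u -> D v -> D (fun x => u x - v x).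
Proof.
move=> Du Dv; have := exf_lin DE (-1) Du Dv.
by congr D; apply/funext => x; ring.
Qed.

Lemma exf_BE u v : D u -> D v -> E (fun x => u x - v x) = E u - E v.
Proof.
move=> Du Dv; have := exf_linE DE (-1) Du Dv.
rewrite mulN1r => <-; congr E; by apply/funext => x; ring.
Qed.

Lemma exf_norm u v : D u -> D v -> (forall x, `|u x| <= v x) -> `|E u| <= E v.
Proof.
move=> Du Dv uv.
have h1 : E u <= E v.
  by apply: (exf_mono DE) => // x; exact: le_trans (ler_norm _) (uv x).
have h2 : E (fun x => -1 * v x) <= E u.
  apply: (exf_mono DE) => //; first exact: exf_Z.
  by move=> x; have := uv x; rewrite ler_norml => /andP[]; rewrite mulN1r.
by rewrite ler_norml h1 -mulN1r -exf_ZE// h2.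
Qed.

Hypothesis kappa0 : 0 <= kappa.
Hypothesis gapE : forall A phi g H, 0 <= A -> stein_class A phi g H ->
  `|E (stein_gap g H)| <= kappa * A.

Definition noise_size : R := \sum_i `|s i|.
Local Notation S := noise_size.

Let D_gap A phi g H : 0 <= A -> stein_class A phi g H -> D (stein_gap g H).
Proof.
move=> A0 c; have [_ h1 h2] := exf_class DE A0 c.
apply: exf_B; apply: exf_sum => i; [exact: exf_Z|exact: h1].
Qed.

Lemma exf_coord i : D (fun x => x 0 i) /\ E (fun x => x 0 i) = 0.
Proof.
have c := stein_class_coord i; split; first by have [] := exf_class DE (lexx 0) c.
have := gapE (lexx 0) c; rewrite mulr0 normr_le0 => /eqP.
rewrite [stein_gap _ _](_ : _ = fun x => -1 * x 0 i).
  rewrite exf_ZE; last by have [] := exf_class DE (lexx 0) c.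
  by move=> h; lra.
apply/funext => x; rewrite /stein_gap big1; last by move=> j _; rewrite mulr0.
rewrite (bigD1 i)//= eqxx mulr1 big1 ?addr0 ?sub0r ?mulN1r//.
by move=> j /negPf ->; rewrite mulr0.
Qed.

Definition cube_moment := E (fun x => (1 + 2 * S + norm1 x) ^+ 3).

Let S0 : 0 <= S. Proof. by rewrite sumr_ge0. Qed.

(** Integration of [ou_step_bound]: the generator is paid by kappa and the remainder by the cube
    moment. *)
Lemma exf_ou_step A th phi g H : 0 <= A -> 0 <= th <= 1 ->
  let a := 1 - th ^+ 2 in let b := Num.sqrt (1 - a ^+ 2) in
  stein_class A phi g H ->
  `|E (ou_step a b phi) - E phi| <= A * (th ^+ 2 * kappa + th ^+ 3 * (4 * cube_moment)).
Proof.
move=> A0 t01 a b c.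
have a01 : 0 <= a <= 1.
  move: t01 => /andP[t0 t1]; have : th ^+ 2 <= 1 by rewrite expr_le1.
  have : 0 <= th ^+ 2 by rewrite sqr_ge0.
  by rewrite /a; lra.
have a2A : 0 <= a ^+ 2 * A by rewrite mulr_ge0// sqr_ge0.
have [Dou _ _] := exf_class DE a2A (stein_class_ou b a01 A0 c).
have [Dphi _ _] := exf_class DE A0 c.
have Dgap := D_gap A0 c.
have S1 : 0 <= 1 + 2 * S by rewrite addr_ge0// mulr_ge0.
have Dc := exf_cube DE S1.
have h1 : `|E (fun x => (ou_step a b phi x - phi x) - th ^+ 2 * stein_gap g H x)|
   <= E (fun x => (A * th ^+ 3 * 4) * (1 + 2 * S + norm1 x) ^+ 3).
  apply: exf_norm.
  - by apply: exf_B; [exact: exf_B|exact: exf_Z].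
  - exact: exf_Z.
  - move=> x; apply: le_trans (ou_step_bound x A0 t01 c) _.
    by rewrite !mulrA (addrAC 1).
rewrite exf_BE in h1; [|exact: exf_B|exact: exf_Z].
rewrite (exf_BE Dou Dphi) (exf_ZE _ Dgap) (exf_ZE _ Dc) in h1.
have h2 := gapE A0 c.
have t2 : 0 <= th ^+ 2 by rewrite sqr_ge0.
rewrite -(subrK (th ^+ 2 * E (stein_gap g H)) (_ - _)).
apply: le_trans (ler_normD _ _) _.
rewrite mulrDr addrC lerD//.
  by rewrite normrM ger0_norm// mulrCA ler_wpM2l// mulrC.
by apply: le_trans h1 _; rewrite /cube_moment; lra.
Qed.

Fixpoint ou_iter a b n phi :=
  if n is n'.+1 then ou_step a b (ou_iter a b n' phi) else phi.

Lemma stein_class_ou_iter A a b phi g H n : 0 <= a <= 1 -> 0 <= A ->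
  stein_class A phi g H ->
  exists g' H', stein_class (a ^+ (2 * n) * A) (ou_iter a b n phi) g' H'.
Proof.
move=> a01 A0 c; elim: n => [|n [g' [H' c']]].
  by exists g, H; rewrite muln0 expr0 mul1r.
have A'0 : 0 <= a ^+ (2 * n) * A by rewrite mulr_ge0// exprn_ge0; case/andP: a01.
have := stein_class_ou b a01 A'0 c'; rewrite mulrA -exprD -mulnS.
by move=> c''; do 2 eexists; exact: c''.
Qed.

(** Telescoping over the steps bounds the change of the expectation; after n steps the class
    constant is a^(2n) A, so the iterate is nearly affine and its mean is close to its value at
    0. *)
Lemma exf_ou_iter A th phi g H n : 0 <= A -> 0 < th <= 1 ->
  let a := 1 - th ^+ 2 in let b := Num.sqrt (1 - a ^+ 2) in
  stein_class A phi g H ->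
  `|E phi - ou_iter a b n phi 0|
    <= A * (kappa + th * (4 * cube_moment)) + a ^+ (2 * n) * A * (2 * cube_moment).
Proof.
move=> A0 /andP[t0 t1] a b c.
have t2 : 0 < th ^+ 2 by rewrite exprn_gt0.
have t21 : th ^+ 2 <= 1 by rewrite expr_le1// ltW.
have a0 : 0 <= a by rewrite /a; lra.
have a1 : a <= 1 by rewrite /a; lra.
have a01 : 0 <= a <= 1 by rewrite a0.
set e := th ^+ 2 * kappa + th ^+ 3 * (4 * cube_moment).
have S1 : 0 <= 1 + 2 * S by rewrite addr_ge0// mulr_ge0.
have Dc := exf_cube DE S1.
have cm0 : 0 <= cube_moment.
  rewrite -exf_E0.
  apply: (exf_mono DE) => //; first exact: exf_D0.
  by move=> x; rewrite exprn_ge0// addr_ge0// norm1_ge0.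
have e0 : 0 <= e by rewrite /e !addr_ge0// ?mulr_ge0// ?exprn_ge0// ltW.
have step m : `|E (ou_iter a b m phi) - E phi| <= A * e * \sum_(j < m) a ^+ (2 * j).
  elim: m => [|m IH]; first by rewrite big_ord0 mulr0 subrr normr0.
  have [g' [H' c']] := stein_class_ou_iter b m a01 A0 c.
  have A'0 : 0 <= a ^+ (2 * m) * A by rewrite mulr_ge0// exprn_ge0.
  have t01 : 0 <= th <= 1 by rewrite ltW.
  have := exf_ou_step A'0 t01 c'; rewrite -/a -/b -/e => h.
  rewrite -(subrK (E (ou_iter a b m phi)) (E (ou_iter a b m.+1 phi))) -addrA.
  apply: le_trans (ler_normD _ _) _; rewrite big_ord_recr /= mulrDr [leRHS]addrC lerD//.
  by rewrite (_ : A * e * _ = a ^+ (2 * m) * A * e)//; ring.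
(* Since 1 - a^2 >= th^2, the series of ratio a^2 sums to at most th^-2, which absorbs the th^2 in
   the cost [e] of a step. *)
have geo m : th ^+ 2 * \sum_(j < m) a ^+ (2 * j) <= 1.
  have : (1 - a ^+ 2) * (\sum_(j < m) a ^+ (2 * j)) = 1 - (a ^+ 2) ^+ m.
    under eq_bigr do rewrite exprM.
    by rewrite -[1 - a ^+ 2]opprB mulNr -subrX1 opprB.
  have p0 : 0 <= (a ^+ 2) ^+ m by rewrite !exprn_ge0.
  have s0 : 0 <= \sum_(j < m) a ^+ (2 * j) by rewrite sumr_ge0// => j _; rewrite exprn_ge0.
  have : th ^+ 2 <= 1 - a ^+ 2.
    rewrite /a; have : 0 <= th ^+ 2 * (1 - th ^+ 2) by rewrite mulr_ge0//; lra.
    lra.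
  move=> /(ler_wpM2r s0) h1 h2; lra.
have h1 : `|E (ou_iter a b n phi) - E phi| <= A * (kappa + th * (4 * cube_moment)).
  apply: le_trans (step n) _; rewrite -mulrA ler_wpM2l//.
  have -> : e = th ^+ 2 * (kappa + th * (4 * cube_moment)) by rewrite /e; ring.
  rewrite mulrAC ler_piMl// addr_ge0// !mulr_ge0//; exact: ltW.
have [g' [H' c']] := stein_class_ou_iter b n a01 A0 c.
set An := a ^+ (2 * n) * A in c' *.
have An0 : 0 <= An by rewrite /An mulr_ge0// exprn_ge0.
have [Dn _ _] := exf_class DE An0 c'.
have Dlin : D (fun x => \sum_i g' i 0 * x 0 i).
  by apply: exf_sum => i; apply: exf_Z; case: (exf_coord i).
have Elin : E (fun x => \sum_i g' i 0 * x 0 i) = 0.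
  rewrite (_ : (fun x => _) = (fun x => \sum_(i <- index_enum 'I_k) g' i 0 * x 0 i))//.
  elim: (index_enum 'I_k) => [|j r IH].
    by under eq_fun do rewrite big_nil; exact: exf_E0.
  under eq_fun do rewrite big_cons -(mul1r (\sum_(_ <- _) _)).
  rewrite (exf_linE DE); first by rewrite IH exf_ZE; case: (exf_coord j) => // _ ->; ring.
  - by apply: exf_Z; case: (exf_coord j).
  - by apply: exf_sum => i; apply: exf_Z; case: (exf_coord i).
have D0c : D (fun=> ou_iter a b n phi 0).
  have := exf_Z (ou_iter a b n phi 0) (exf_D1 DE).
  by under [X in D X]eq_fun do rewrite mulr1.
have E0c : E (fun=> ou_iter a b n phi 0) = ou_iter a b n phi 0.
  have := exf_ZE (ou_iter a b n phi 0) (exf_D1 DE).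
  by under [in LHS]eq_fun do rewrite mulr1; rewrite (exf_1 DE) mulr1.
(* Taylor at 0; the linear part integrates to 0 by [exf_coord]. *)
have h2 : `|E (ou_iter a b n phi) - ou_iter a b n phi 0| <= An * (2 * cube_moment).
  rewrite -E0c -exf_BE// -[E _]subr0 -Elin -exf_BE//; last exact: exf_B.
  rewrite mulrA -exf_ZE//.
  apply: exf_norm; [by apply: exf_B => //; exact: exf_B|exact: exf_Z|].
  move=> x; case: c' => d1 _ _ /(_ 0 x); rewrite add0r => h.
  have q2 : `|\sum_i \sum_l H' i l 0 * x 0 i * x 0 l| <= An * norm1 x ^+ 2.
    apply: le_trans (ler_norm_sum _ _ _) _.
    rewrite expr2 {1}/norm1 mulr_suml mulr_sumr; apply: ler_sum => i _.
    apply: le_trans (ler_norm_sum _ _ _) _.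
    rewrite /norm1 !mulr_sumr; apply: ler_sum => l _.
    by rewrite !normrM -(mulrA `|_|) ler_wpM2r// mulr_ge0.
  set Q := \sum_i \sum_l _ in h q2.
  rewrite -(subrK (2^-1 * Q) (_ - _ - _)).
  apply: le_trans (ler_normD _ _) _.
  have N0 := norm1_ge0 x; set N := norm1 x in h q2 N0 *.
  set M := 1 + 2 * S + N.
  have M1 : 1 <= M by rewrite /M -addrA lerDl addr_ge0// mulr_ge0.
  have NM : N <= M by rewrite /M lerDr.
  have k1 : N ^+ 3 <= M ^+ 3 by rewrite lerXn2r// nnegrE; lra.
  have k2 : N ^+ 2 <= M ^+ 3.
    apply: (@le_trans _ _ (M ^+ 2)); first by rewrite lerXn2r// nnegrE; lra.
    by rewrite [leRHS]exprS ler_peMl// sqr_ge0.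
  have k3 := ler_wpM2l An0 k1; have k4 := ler_wpM2l An0 k2.
  have Q0 := normr_ge0 Q.
  rewrite normrM (@ger0_norm _ 2^-1)//.
  lra.
rewrite -(subrK (E (ou_iter a b n phi)) (E phi)) -addrA.
by apply: le_trans (ler_normD _ _) _; rewrite lerD// distrC.
Qed.

End comparison.

(* Two laws that (almost) satisfy the Stein identity with the same variances   *)
(* are compared through the value at the origin of the iterated step, which    *)
(* does not depend on the law.                                                 *)
Lemma stein_comparison D1 E1 D2 E2 kappa1 kappa2 A phi g H :
  expectation_functional D1 E1 -> expectation_functional D2 E2 ->
  0 <= kappa1 -> 0 <= kappa2 ->
  (forall A phi g H, 0 <= A -> stein_class A phi g H ->
    `|E1 (stein_gap g H)| <= kappa1 * A) ->
  (forall A phi g H, 0 <= A -> stein_class A phi g H ->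
    `|E2 (stein_gap g H)| <= kappa2 * A) ->
  0 <= A -> stein_class A phi g H ->
  `|E1 phi - E2 phi| <= A * (kappa1 + kappa2).
Proof.
move=> DE1 DE2 k10 k20 g1 g2 A0 c.
set c1 := cube_moment E1; set c2 := cube_moment E2.
(* For a fixed step size the number of steps tends to infinity, which removes the last term of
   [exf_ou_iter]; afterwards th tends to 0, which removes the cube moments. *)
have key th : 0 < th <= 1 -> `|E1 phi - E2 phi|
    <= A * (kappa1 + kappa2) + th * (A * (4 * `|c1| + 4 * `|c2|)).
  move=> t01; pose a := 1 - th ^+ 2; pose b := Num.sqrt (1 - a ^+ 2).
  have [t0 t1] := andP t01.
  have t2 : 0 < th ^+ 2 by rewrite exprn_gt0.
  have t21 : th ^+ 2 <= 1 by rewrite expr_le1// ltW.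
  have a0 : 0 <= a by rewrite /a; lra.
  have a1 : a < 1 by rewrite /a; lra.
  have hn n : `|E1 phi - E2 phi| <= A * (kappa1 + kappa2) + th * (A * (4 * `|c1| + 4 * `|c2|))
      + (A * (2 * `|c1| + 2 * `|c2|)) * (a ^+ 2) ^+ n.
    have h1 := exf_ou_iter DE1 k10 g1 n A0 t01 c.
    have h2 := exf_ou_iter DE2 k20 g2 n A0 t01 c.
    rewrite /= -/a -/b -/c1 -/c2 exprM in h1 h2.
    set P := (a ^+ 2) ^+ n in h1 h2 *.
    have P0 : 0 <= P by rewrite !exprn_ge0.
    set o := ou_iter a b n phi 0 in h1 h2.
    have -> : E1 phi - E2 phi = (E1 phi - o) - (E2 phi - o) by ring.
    apply: le_trans (ler_normB _ _) _; apply: le_trans (lerD h1 h2) _.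
    have n1 := ler_norm c1; have n2 := ler_norm c2.
    have tA : 0 <= th * A by rewrite mulr_ge0// ltW.
    have PA : 0 <= P * A by rewrite mulr_ge0.
    have := ler_wpM2l tA n1; have := ler_wpM2l tA n2.
    have := ler_wpM2l PA n1; have := ler_wpM2l PA n2.
    lra.
  apply/ler_addgt0Pr => e e0.
  set X := A * (2 * `|c1| + 2 * `|c2|) in hn.
  have X0 : 0 <= X by rewrite /X mulr_ge0// addr_ge0// mulr_ge0.
  have ca : (a ^+ 2) ^+ n @[n --> \oo] --> 0.
    by apply: cvg_expr; rewrite ger0_norm ?sqr_ge0// expr_lt1.
  have : X * (a ^+ 2) ^+ n @[n --> \oo] --> X * 0 by apply: cvgMr; exact: ca.
  rewrite mulr0 => /cvgrPdist_le /(_ _ e0) [n _ /(_ n (leqnn n))] /=.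
  rewrite sub0r normrN ger0_norm ?mulr_ge0// ?exprn_ge0// => h.
  by apply: le_trans (hn n) _; rewrite lerD2l.
apply/ler_addgt0Pr => e e0.
set X := A * (4 * `|c1| + 4 * `|c2|) in key.
have X0 : 0 <= X by rewrite /X mulr_ge0// addr_ge0// mulr_ge0.
pose th := Num.min 1 (e / (X + 1)).
have X1 : 0 < X + 1 by lra.
have t01 : 0 < th <= 1 by rewrite lt_min ltr01 divr_gt0//= ge_min lexx.
apply: le_trans (key th t01) _; rewrite lerD2l.
apply: (@le_trans _ _ (e / (X + 1) * X)).
  by rewrite ler_wpM2r// ge_min lexx orbT.
by rewrite mulrAC ler_pdivrMr// ler_wpM2l ?ltW//; lra.
Qed.

End stein_method.

(** * Smooth test functions: symmetry of derivatives and Taylor remainders *)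

Section taylor.
Context (R : realType) (k : nat).
Implicit Types (f : 'rV[R]_k -> R) (x y : 'rV[R]_k).

Lemma mvt_right (u du : R -> R) (s : R) : 0 < s -> (forall t : R, is_derive t 1 u (du t)) ->
  exists2 c, 0 < c < s & u s - u 0 = du c * s.
Proof.
move=> s0 h.
have cu : {within `[0, s], continuous u}.
  apply: continuous_subspaceT => t; apply: differentiable_continuous.
  by apply/derivable1_diffP; have := h t => -[].
have [c] := MVT s0 (fun t _ => h t) cu.
by rewrite in_itv subr0 => cs e; exists c.
Qed.

Lemma is_derive_line f x y (t : R) : differentiable f (x + t *: y) ->
  is_derive t 1 (fun t => f (x + t *: y)) ('D_y f (x + t *: y)).
Proof.
move=> df; have dv : derivable f (x + t *: y) y by exact: diff_derivable.
have e : (fun h : R => h^-1 *: (((fun t => f (x + t *: y)) \o shift t) (h *: 1) - f (x + t *: y)))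
  = (fun h => h^-1 *: ((f \o shift (x + t *: y)) (h *: y) - f (x + t *: y))).
  apply/funext => h /=; congr (_ *: (f _ - _)).
  have -> : h%:A = h :> R by rewrite /GRing.scale /= mulr1.
  by rewrite scalerDl addrCA.
by apply: DeriveDef; rewrite /derivable /derive e.
Qed.

Lemma derive_partial f x y : differentiable f x ->
  'D_y f x = \sum_i y 0 i * partial i f x.
Proof.
move=> df; rewrite deriveE// [in LHS](row_sum_delta y) linear_sum.
by apply: eq_bigr => i _; rewrite linearZ /= /partial deriveE.
Qed.

Lemma mvt_line f x y : (forall z, differentiable f z) ->
  exists2 c, 0 < c < 1 & f (x + y) - f x = \sum_i y 0 i * partial i f (x + c *: y).
Proof.
move=> df.
have [c c01 e] := mvt_right ltr01 (fun t => is_derive_line (df (x + t *: y))).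
exists c => //; move: e; rewrite scale1r scale0r addr0 mulr1 => ->.
exact: derive_partial.
Qed.

(* The second difference quotient along e_i and e_j tends to both mixed        *)
(* partial derivatives.                                                        *)
Lemma second_difference f i j x (e : R) : (forall z, differentiable f z) ->
  (forall z, differentiable (partial i f) z) -> 0 < e ->
  \forall s \near (0:R)^'+,
   `|(f (x + s *: delta_mx 0 i + s *: delta_mx 0 j) - f (x + s *: delta_mx 0 i)
      - f (x + s *: delta_mx 0 j) + f x) - s ^+ 2 * partial j (partial i f) x| <= e * s ^+ 2.
Proof.
move=> df dpf e0.
pose ei : 'rV[R]_k := delta_mx 0 i; pose ej : 'rV[R]_k := delta_mx 0 j.
pose psi := partial i f; pose K := 1 + 2 * (`|ei| + `|ej|).
have K0 : 0 < K by rewrite /K; have := normr_ge0 ei; have := normr_ge0 ej; lra.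
have /eqaddoP := diff_locally (dpf x).
move=> /(_ (e / K)) /=; rewrite divr_gt0// => /(_ isT) /nbhs_norm0P[d /= d0 hd].
have near0 : \forall s \near (0:R)^'+, s * K < d.
  near=> s; rewrite -ltr_pdivlMr//; near: s; exact: nbhs_right_lt (divr_gt0 d0 K0).
near=> s.
have s0 : 0 < s by near: s; exact: nbhs_right_gt.
have sd : s * K < d by near: s.
(* The mean value theorem along e_i turns the second difference into s times a difference of
   [partial i f] at two points near x, and differentiability at x linearizes it. *)
pose u t := f (x + s *: ej + t *: ei) - f (x + t *: ei).
have du (t : R) : is_derive t 1 u (psi (x + s *: ej + t *: ei) - psi (x + t *: ei)).
  apply: is_deriveB; [exact: (is_derive_line (f := f))|exact: (is_derive_line (f := f))].
have [c /andP[c0 cs] uE] := mvt_right s0 du.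
rewrite /u !scale0r !addr0 in uE.
have small v : `|v| <= s * (`|ei| + `|ej|) -> `|psi (x + v) - psi x - 'd psi x v| <= e / K * (s * (`|ei| + `|ej|)).
  move=> vs; have := hd v; rewrite /=.
  have vd : `|v| < d.
    apply: le_lt_trans vs _; apply: le_lt_trans sd; rewrite ler_pM2l// /K.
    have := normr_ge0 ei; have := normr_ge0 ej; lra.
  move=> /(_ vd); rewrite !fctE /= /shift /= (addrC v x) => h.
  rewrite -addrA -opprD; apply: le_trans h _.
  by rewrite ler_wpM2l// divr_ge0// ltW.
have n1 : `|s *: ej + c *: ei| <= s * (`|ei| + `|ej|).
  apply: le_trans (ler_normD _ _) _; rewrite !normrZ !gtr0_norm// mulrDr addrC lerD//.
  by rewrite ler_wpM2r// ltW.
have n2 : `|c *: ei| <= s * (`|ei| + `|ej|).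
  rewrite normrZ gtr0_norm// mulrDr; apply: (@le_trans _ _ (s * `|ei|)).
    by rewrite ler_wpM2r// ltW.
  by rewrite lerDl mulr_ge0// ltW.
have := small _ n1; have := small _ n2.
rewrite linearD /= => h2 h1.
have dE : 'd psi x (s *: ej) = s * 'd psi x ej by rewrite linearZ.
have pE : 'd psi x ej = partial j psi x by rewrite /partial deriveE//; exact: dpf.
rewrite dE pE in h1.
set a1 := psi (x + (s *: ej + c *: ei)) in h1; set a2 := psi (x + c *: ei) in h2.
have -> : f (x + s *: ei + s *: ej) - f (x + s *: ei) - f (x + s *: ej) + f x - s ^+ 2 * partial j (partial i f) x
  = s * ((a1 - psi x - (s * partial j psi x + 'd psi x (c *: ei))) - (a2 - psi x - 'd psi x (c *: ei))).
  have e1 : x + s *: ei + s *: ej = x + s *: ej + s *: ei by rewrite addrAC.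
  have e2 : x + s *: ej + c *: ei = x + (s *: ej + c *: ei) by rewrite addrA.
  rewrite e2 -/a1 -/a2 -e1 in uE.
  move: uE; rewrite -/ei -/ej -/psi.
  move: (f (x + s *: ei + s *: ej)) (f (x + s *: ei)) (f (x + s *: ej)) (f x) (partial j psi x)
    ('d psi x (c *: ei)) (psi x) (a1) (a2) => b1 b2 b3 b4 D1 D2 D3 a1' a2' uE.
  have -> : b1 - b2 - b3 + b4 = (a1' - a2') * s by rewrite -uE; ring.
  ring.
rewrite normrM gtr0_norm// expr2 mulrCA ler_pM2l//.
apply: le_trans (ler_normB _ _) _; apply: le_trans (lerD h1 h2) _.
set S := `|ei| + `|ej|; have S0 : 0 <= S by rewrite addr_ge0.
have -> : e / K * (s * S) + e / K * (s * S) = e * s * ((2 * S) / K).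
  by field; rewrite gt_eqF.
rewrite ler_piMr ?mulr_ge0 ?(ltW e0) ?(ltW s0)// ler_pdivrMr// mul1r /K -/S; lra.
Unshelve. all: by end_near. Qed.

(** Both mixed derivatives approximate the same second difference, which is symmetric in i and j;
    differentiability of the first derivatives is enough for this, without continuity of the second
    ones. *)
Lemma young f i j x : (forall z, differentiable f z) ->
  (forall l z, differentiable (partial l f) z) ->
  partial i (partial j f) x = partial j (partial i f) x.
Proof.
move=> df dpf; apply/eqP; rewrite -subr_eq0 -normr_le0; apply/ler_addgt0Pr => e e0.
rewrite add0r; have e2 : 0 < e / 2 by rewrite divr_gt0.
have [s [s0 [h1 h2]]] : exists s, 0 < s /\
   (`|(f (x + s *: delta_mx 0 i + s *: delta_mx 0 j) - f (x + s *: delta_mx 0 i)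
      - f (x + s *: delta_mx 0 j) + f x) - s ^+ 2 * partial j (partial i f) x| <= e / 2 * s ^+ 2 /\
   `|(f (x + s *: delta_mx 0 j + s *: delta_mx 0 i) - f (x + s *: delta_mx 0 j)
      - f (x + s *: delta_mx 0 i) + f x) - s ^+ 2 * partial i (partial j f) x| <= e / 2 * s ^+ 2).
  have h1 := second_difference j x df (dpf i) e2.
  have h2 := second_difference i x df (dpf j) e2.
  have h0 : \forall s \near (0:R)^'+, 0 < s := nbhs_right_gt (0:R).
  have [s [s0 [h1' h2']]] := filter_ex (filterI h0 (filterI h1 h2)).
  exact: (ex_intro _ s (conj s0 (conj h1' h2'))).
have s20 : 0 < s ^+ 2 by rewrite exprn_gt0.
rewrite -(ler_pM2r s20); set a := f (x + _ + _) in h1; set b := f (x + _ + _) in h2.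
have ab : b = a by rewrite /a /b addrAC.
rewrite -[X in _ * X](ger0_norm (ltW s20)) -normrM.
have -> : (partial i (partial j f) x - partial j (partial i f) x) * s ^+ 2 =
  (a - f (x + s *: delta_mx 0 i) - f (x + s *: delta_mx 0 j) + f x - s ^+ 2 * partial j (partial i f) x)
  - (b - f (x + s *: delta_mx 0 j) - f (x + s *: delta_mx 0 i) + f x - s ^+ 2 * partial i (partial j f) x).
  rewrite ab; move: (partial i (partial j f) x) (partial j (partial i f) x) (f (x + s *: delta_mx 0 i))
    (f (x + s *: delta_mx 0 j)) (f x) (a) => D1 D2 D3 D4 D5 D6; ring.
apply: le_trans (ler_normB _ _) _; apply: le_trans (lerD h1 h2) _.
by rewrite -mulrDl -splitr.
Qed.

Lemma norm_D2_bound f : (norm_D2 f < +oo)%E -> exists2 A : R, 0 <= A &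
  forall (i j : 'I_k) x, (i <= j)%N -> `|partial i (partial j f) x| <= A.
Proof.
move=> h; have h0 : (0 <= norm_D2 f)%E by exact: bigmax_ge_id.
have fi : norm_D2 f \is a fin_num by rewrite ge0_fin_numE.
exists (fine (norm_D2 f)); first exact: fine_ge0.
move=> i j x ij; rewrite -lee_fin fineK//.
apply: (@le_trans _ _ (ereal_sup (range (fun x => `|partial i (partial j f) x|%:E)))).
  by apply: ereal_sup_ubound; exists x.
rewrite /norm_D2; apply: le_trans (le_bigmax_cond _ _ (isT : xpredT i)).
exact: (le_bigmax_cond _ (fun i2 : 'I_k => ereal_sup (range (fun x => `|partial i (partial i2 f) x|%:E)))).
Qed.

Lemma norm_D3_bound f : (norm_D3 f < +oo)%E -> exists2 A : R, 0 <= A &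
  forall (i j l : 'I_k) x, (i <= j)%N -> (j <= l)%N -> `|partial i (partial j (partial l f)) x| <= A.
Proof.
move=> h; have h0 : (0 <= norm_D3 f)%E by exact: bigmax_ge_id.
have fi : norm_D3 f \is a fin_num by rewrite ge0_fin_numE.
exists (fine (norm_D3 f)); first exact: fine_ge0.
move=> i j l x ij jl; rewrite -lee_fin fineK//.
apply: (@le_trans _ _ (ereal_sup (range (fun x => `|partial i (partial j (partial l f)) x|%:E)))).
  by apply: ereal_sup_ubound; exists x.
rewrite /norm_D3; apply: le_trans (le_bigmax_cond _ _ (isT : xpredT i)).
apply: le_trans (le_bigmax_cond _ _ (ij : (fun j : 'I_k => (i <= j)%N) j)).
exact: (le_bigmax_cond _ (fun i3 : 'I_k => ereal_sup (range (fun x => `|partial i (partial j (partial i3 f)) x|%:E)))).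
Qed.

(** The norms run over nondecreasing indices only, and Young's theorem extends the bounds to all
    indices. Bounded third derivatives make the Hessian Lipschitz, and the mean value theorem gives
    the remainders. *)
Lemma smooth_stein_class f : thrice_differentiable f ->
  (norm_D2 f < +oo)%E -> (norm_D3 f < +oo)%E ->
  exists2 A : R, 0 <= A &
    stein_class A f (fun i => partial i f) (fun i l => partial l (partial i f)).
Proof.
move=> [d0 d1 d2] /norm_D2_bound[A2 A20 h2] /norm_D3_bound[A3 A30 h3].
have sym2 i j : partial i (partial j f) = partial j (partial i f).
  by apply/funext => x; exact: young.
have sym3 i j l : partial i (partial j (partial l f)) = partial j (partial i (partial l f)).
  by apply/funext => x; apply: young.
have b2 i j x : `|partial i (partial j f) x| <= A2.
  by case: (leqP i j) => [|/ltnW] ij; [|rewrite sym2]; exact: h2.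
have b3 i j l x : `|partial i (partial j (partial l f)) x| <= A3.
  wlog ij : i j / (i <= j)%N.
    by move=> hw; case: (leqP i j) => [|/ltnW] ij; [|rewrite sym3]; exact: hw.
  case: (leqP j l) => [|/ltnW] jl; first exact: h3.
  rewrite (sym2 j l); case: (leqP i l) => [|/ltnW] il; first exact: h3.
  by rewrite sym3; exact: h3.
exists (Num.max A2 A3); first by rewrite le_max A20.
have A3m : A3 <= Num.max A2 A3 by rewrite le_max lexx orbT.
have lip i l x y : `|partial l (partial i f) (x + y) - partial l (partial i f) x| <= A3 * norm1 y.
  have [c _ ->] := mvt_line x y (fun z => d2 l i z).
  apply: le_trans (ler_norm_sum _ _ _) _; rewrite mulr_sumr; apply: ler_sum => j _.
  by rewrite normrM mulrC ler_wpM2r.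
have tay i x y (t : R) : 0 <= t <= 1 ->
  `|partial i f (x + t *: y) - partial i f x - t * \sum_l partial l (partial i f) x * y 0 l|
   <= A3 * norm1 y ^+ 2.
  move=> /andP[t0 t1].
  have [c /andP[c0 c1] ->] := mvt_line x (t *: y) (fun z => d1 i z).
  rewrite mulr_sumr -sumrB; apply: le_trans (ler_norm_sum _ _ _) _.
  rewrite expr2 mulrA /norm1 mulr_sumr -/(norm1 y); apply: ler_sum => l _.
  rewrite mxE [X in `|X|](_ : _ = t * (y 0 l * (partial l (partial i f) (x + c *: (t *: y)) - partial l (partial i f) x))); last first.
    by rewrite mulrBr mulrBr -mulrA; congr (_ - _); congr (_ * _); exact: mulrC.
  rewrite normrM ger0_norm//; apply: le_trans (ler_piMl _ t1) _ => //.
  rewrite normrM mulrC ler_wpM2r//; apply: le_trans (lip _ _ _ _) _.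
  rewrite ler_wpM2l// !norm1Z !ger0_norm ?(ltW c0)// mulrA ler_piMl ?norm1_ge0//.
  by rewrite -(mulr1 1) ler_pM// ltW.
split=> [i l x|i l x y|i x y|x y].
- by apply: le_trans (b2 _ _ _) _; rewrite le_max lexx.
- by apply: le_trans (lip _ _ _ _) _; rewrite ler_wpM2r ?norm1_ge0.
- have := tay i x y 1; rewrite ler01 lexx scale1r mul1r => /(_ isT) h.
  by apply: le_trans h _; rewrite ler_wpM2r ?sqr_ge0.
pose G := \sum_i partial i f x * y 0 i.
pose Q := \sum_i \sum_l partial l (partial i f) x * y 0 i * y 0 l.
(* The remainder along the segment. Its derivative is a combination of the gradient remainders
   bounded by [tay], so a single mean value step gives the cubic bound. *)
pose u t := f (x + t *: y) - t * G - t ^+ 2 * (2^-1 * Q).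
have du (t : R) : is_derive t 1 u ('D_y f (x + t *: y) - G - t * Q).
  rewrite /u; apply: is_deriveB.
    apply: is_deriveB; first exact: is_derive_line.
    by apply: is_derive_eq; rewrite /GRing.scale /= ?(mulr0, mul0r, add0r, addr0, mulr1).
  apply: is_derive_eq; rewrite /GRing.scale /= ?(mulr0, mul0r, add0r, addr0, mulr1) ?expr1.
  by rewrite -mulr_natr; field.
have [c /andP[c0 c1]] := mvt_right ltr01 du.
rewrite /u scale1r scale0r addr0 !mul0r expr0n /= !mul0r !subr0 expr1n !mul1r mulr1 => e.
have -> : f (x + y) - f x - \sum_i partial i f x * y 0 i -
   2^-1 * (\sum_i \sum_l partial l (partial i f) x * y 0 i * y 0 l) =
   'D_y f (x + c *: y) - G - c * Q by rewrite -e /G /Q; ring.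
rewrite derive_partial// /G /Q.
rewrite [X in `|X|](_ : _ = \sum_i y 0 i * (partial i f (x + c *: y) - partial i f x
   - c * \sum_l partial l (partial i f) x * y 0 l)).
  apply: le_trans (ler_norm_sum _ _ _) _.
  rewrite exprS mulrCA /norm1 mulr_suml -/(norm1 y); apply: ler_sum => i _.
  rewrite normrM ler_wpM2l//; apply: le_trans (tay _ _ _ _ _) _; first by rewrite !ltW.
  by rewrite ler_wpM2r ?sqr_ge0.
rewrite mulr_sumr -!sumrB; apply: eq_bigr => i _.
under [in LHS]eq_bigr do rewrite mulrAC.
by rewrite -mulr_suml; ring.
Qed.

End taylor.

(** * Approximate Stein identity for a vector of Bernoulli chaoses *)

Section chaos_stein.
Context (R : realType) (k : nat) (q : 'I_k -> nat).
Hypothesis q_gt0 : forall i, (0 < q i)%N.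

Let Q : nat := \sum_i q i.
Let qQ i : (q i <= Q)%N. Proof. by rewrite /Q (bigD1 i)//= leq_addr. Qed.

(* 36 ^ (2 Q) bounds the combinatorial constants of the product formula. *)
Definition chaos_constant : R := 36 ^+ (Q + Q) * (3 * Q.+1%:R ^+ 4).
Local Notation c1 := chaos_constant.
(** The first summand pays for the fluctuations of [gamma] over the k^2 pairs, the second for the
    third moment of the gradient; [chaos_gap] supplies a further factor 2. *)
Definition gap_constant : R :=
  k%:R ^+ 2 * (1 + c1) + 3 * k%:R * (k%:R * Q%:R + k%:R ^+ 4 * c1).

Context (T : finType) (p x1 x0 m w : T -> R).
Hypothesis p01 : forall j, 0 <= p j <= 1.
Hypothesis X_mean : forall j, p j * x1 j + (1 - p j) * x0 j = 0.
Hypothesis x1E : forall j, x1 j ^+ 2 = m j + w j * x1 j.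
Hypothesis x0E : forall j, x0 j ^+ 2 = m j + w j * x0 j.
Hypothesis w3 : forall j, `|w j| <= 3.
Hypothesis x13 : forall j, `|x1 j| <= 3.
Hypothesis x03 : forall j, `|x0 j| <= 3.

Local Notation Ex := (Ex p).
Local Notation X := (bern_var x1 x0).
Local Notation chaos := (chaos x1 x0).
Local Notation mu := (weight m).
Local Notation gamma := (gamma x1 x0 m).

Variables (g : 'I_k -> {set T} -> R) (beta : R).
Hypothesis hg : forall i, homogeneous (q i) (g i).
Hypothesis beta0 : 0 < beta.
Hypothesis energy_diag : forall i r l, (0 < l)%N -> (l <= r)%N -> (r <= q i)%N -> (l < q i)%N ->
  contr_energy m (g i) (g i) (q i) (q i) r l <= beta ^+ 2.
Hypothesis energy_offdiag : forall (i j : 'I_k) (r l : nat), (i < j)%N -> (0 < l)%N -> (l <= r)%N ->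
  (r <= q i)%N -> contr_energy m (g i) (g j) (q i) (q j) r l <= beta ^+ 2.
Hypothesis fourth : forall i, \sum_S mu S * g i S ^+ 4 <= beta ^+ 2.
Hypothesis q_inj : forall i j : 'I_k, (i < j)%N -> (q i < q j)%N.

Definition chaos_vec b : 'rV[R]_k := \row_i chaos (g i) b.
Definition chaos_var i : R := \sum_S mu S * g i S ^+ 2.

Let mj0 j : 0 <= m j. Proof. exact: m_ge0 p01 X_mean x1E x0E j. Qed.

Let c1_ge0 : 0 <= c1.
Proof. by rewrite mulr_ge0 ?exprn_ge0// mulr_ge0 ?exprn_ge0. Qed.

Lemma gap_constant_ge0 : 0 <= gap_constant.
Proof.
by rewrite addr_ge0// mulr_ge0 ?sqr_ge0// ?mulr_ge0// ?addr_ge0// ?mulr_ge0// exprn_ge0.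
Qed.

Let le_c1 (a n : nat) : (a <= Q + Q)%N -> (n <= Q)%N ->
  36 ^+ a * n%:R ^+ 2 * n.+1%:R ^+ 2 <= c1.
Proof.
move=> aQ nQ; rewrite /c1 -mulrA ler_pM ?exprn_ge0 ?mulr_ge0 ?exprn_ge0//.
  by rewrite ler_weXn2l// ler1n.
apply: (@le_trans _ _ (Q.+1%:R ^+ 2 * Q.+1%:R ^+ 2)).
  by rewrite ler_pM ?sqr_ge0// lerXn2r ?nnegrE// ler_nat//; lia.
rewrite -exprD; have : 0 <= Q.+1%:R ^+ (2 + 2) :> R by rewrite exprn_ge0.
by lra.
Qed.

(** The only case with l >= 1 that [energy_diag] omits is l = q i, which forces r = l = q i, the
    full contraction excluded in [gamma_variance]. *)
Lemma gamma_diag i : Ex (fun b => (gamma (g i) (g i) b - (q i)%:R * chaos_var i) ^+ 2)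
  <= c1 * beta ^+ 2.
Proof.
have e : \sum_S mu S * g i S * g i S = chaos_var i.
  by apply: eq_bigr => S _; rewrite -mulrA -expr2.
rewrite -e; apply: le_trans (gamma_variance p01 X_mean x1E x0E w3 (@hg i) (@hg i) (sqr_ge0 beta) _) _.
  move=> r l l0 lr rq _ nn; apply: energy_diag => //.
  by move: nn; lia.
by rewrite ler_wpM2r ?sqr_ge0// le_c1// leq_add.
Qed.

(** Kernels of different degrees are orthogonal, so [gamma] is already centered; symmetry reduces to
    i < j. *)
Lemma gamma_offdiag i j : i != j -> Ex (fun b => (gamma (g i) (g j) b) ^+ 2) <= c1 * beta ^+ 2.
Proof.
wlog ij : i j / (i < j)%N.
  move=> hw ij; case: (ltngtP i j) => [lt|gt|/val_inj e].
  - exact: hw.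
  - rewrite (_ : (fun b => _) = (fun b => gamma (g j) (g i) b ^+ 2)); first by apply: hw; rewrite // eq_sym.
    by apply/funext => b; congr (_ ^+ 2); apply: eq_bigr => l _; rewrite [_ * chaos _ _]mulrC.
  - by rewrite e eqxx in ij.
move=> _.
have e : \sum_S mu S * g i S * g j S = 0.
  apply: big1 => S _; case: (eqVneq #|S| (q i)) => [Sq|Sq]; last by rewrite hg// !(mulr0, mul0r).
  by rewrite (@hg j) ?mulr0// Sq; have := q_inj ij; rewrite neq_ltn => ->.
have -> : (fun b => gamma (g i) (g j) b ^+ 2) =
   (fun b => (gamma (g i) (g j) b - (q i)%:R * \sum_S mu S * g i S * g j S) ^+ 2).
  by apply/funext => b; rewrite e mulr0 subr0.
apply: le_trans (gamma_variance p01 X_mean x1E x0E w3 (@hg i) (@hg j) (sqr_ge0 beta) _) _.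
  by move=> r l l0 lr rq _ _; exact: energy_offdiag.
by rewrite ler_wpM2r ?sqr_ge0// le_c1// leq_add.
Qed.

Lemma deriv_fourth_sum i :
  \sum_j m j * Ex (fun b => chaos (deriv j (g i)) b ^+ 4) <= c1 * beta ^+ 2.
Proof.
apply: le_trans (deriv_fourth p01 X_mean x1E x0E w3 (@hg i) (sqr_ge0 beta) _ (fourth i)) _.
  by move=> r l l0 lr rq lq; exact: energy_diag.
rewrite /c1 -!(mulrA (36 ^+ _)) ler_pM ?exprn_ge0//.
- by rewrite mulr_ge0// mulr_ge0// mulr_ge0 ?sqr_ge0.
- by rewrite ler_weXn2l ?ler1n// leq_add.
rewrite mulrCA -mulrA ler_wpM2l// mulrA ler_wpM2r ?sqr_ge0//.
rewrite (exprD _ 2 2) ler_pM ?sqr_ge0//.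
  apply: (@le_trans _ _ (Q.+1%:R)); first by rewrite ler_nat ltnW// ltnS.
  by rewrite expr2 ler_peMl// ler1n.
by rewrite lerXn2r ?nnegrE// ler_nat ltnS.
Qed.

(** The left side is the mean of [gamma], hence its constant term. *)
Lemma chaos_var_gamma i : \sum_j m j * Ex (fun b => chaos (deriv j (g i)) b ^+ 2)
  = (q i)%:R * chaos_var i.
Proof.
have e : \sum_S mu S * g i S * g i S = chaos_var i.
  by apply: eq_bigr => S _; rewrite -mulrA -expr2.
rewrite -e -(@gammac0 _ _ m w) -(chaos_mean X_mean x1E x0E).
transitivity (Ex (gamma (g i) (g i))).
  by rewrite Ex_sum; apply: eq_bigr => j _; rewrite -ExZ.
congr Ex; apply/funext => b; exact: (gammaE x1E x0E).
Qed.

Definition dvec j b : 'rV[R]_k := \row_i chaos (deriv j (g i)) b.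
Definition wvec j b : 'rV[R]_k := \row_i chaos (without j (g i)) b.

Lemma chaos_vec_split j b : chaos_vec b = wvec j b + X j b *: dvec j b.
Proof. by apply/rowP => i; rewrite !mxE (chaos_split _ _ j). Qed.

Lemma free_dvec j : free j (dvec j).
Proof. by move=> b; apply/rowP => i; rewrite !mxE free_deriv. Qed.

Lemma free_wvec j : free j (wvec j).
Proof. by move=> b; apply/rowP => i; rewrite !mxE free_without. Qed.

Let X3 j b : `|X j b| <= 3. Proof. by rewrite /bern_var; case: ifP. Qed.

(** Interpolation n^3 <= (beta n^2 + n^4 / beta) / 2: the second moments sum to variances and the
    fourth ones to order beta^2, so both terms are of order beta. *)
Lemma dvec_cube :
  \sum_j m j * Ex (fun b => norm1 (dvec j b) ^+ 3)
    <= beta * (k%:R * Q%:R * (\sum_i chaos_var i) + k%:R ^+ 4 * c1).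
Proof.
have n2 j b : norm1 (dvec j b) ^+ 2 <= k%:R * \sum_i chaos (deriv j (g i)) b ^+ 2.
  apply: le_trans (sqr_sum_le _ _) _; rewrite card_ord ler_wpM2l//.
  by apply: ler_sum => i _; rewrite mxE real_normK ?num_real.
have n4 j b : norm1 (dvec j b) ^+ 4 <= k%:R ^+ 3 * \sum_i chaos (deriv j (g i)) b ^+ 4.
  rewrite (exprM _ 2 2); apply: (@le_trans _ _ ((k%:R * \sum_i chaos (deriv j (g i)) b ^+ 2) ^+ 2)).
    by rewrite lerXn2r ?nnegrE ?sqr_ge0// mulr_ge0// sumr_ge0// => i _; rewrite sqr_ge0.
  rewrite exprMn (exprSr _ 2) -mulrA ler_wpM2l ?sqr_ge0//.
  apply: le_trans (sqr_sum_le _ _) _; rewrite card_ord ler_wpM2l//.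
  by apply: ler_sum => i _; rewrite -exprM.
have v0 i : 0 <= chaos_var i.
  by apply: sumr_ge0 => S _; rewrite mulr_ge0 ?sqr_ge0// (mu_ge0 p01 X_mean x1E x0E).
apply: (@le_trans _ _ (\sum_j m j * (2^-1 * beta * (k%:R * \sum_i Ex (fun b => chaos (deriv j (g i)) b ^+ 2))
   + 2^-1 * beta^-1 * (k%:R ^+ 3 * \sum_i Ex (fun b => chaos (deriv j (g i)) b ^+ 4))))).
  apply: ler_sum => j _; rewrite ler_wpM2l//.
  apply: (@le_trans _ _ (Ex (fun b => (2^-1 * beta * k%:R) * (\sum_i chaos (deriv j (g i)) b ^+ 2)
    + (2^-1 * beta^-1 * k%:R ^+ 3) * (\sum_i chaos (deriv j (g i)) b ^+ 4)))).
    apply: (ler_Ex p01) => b.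
    apply: (@le_trans _ _ (2^-1 * beta * norm1 (dvec j b) ^+ 2 + 2^-1 * beta^-1 * norm1 (dvec j b) ^+ 4)).
      set n := norm1 _; have n0 : 0 <= n := norm1_ge0 _.
      have -> : 2^-1 * beta * n ^+ 2 + 2^-1 * beta^-1 * n ^+ 4
        = 2^-1 * beta^-1 * (n * (n - beta)) ^+ 2 + n ^+ 3.
        by field; rewrite gt_eqF.
      by rewrite lerDr mulr_ge0 ?sqr_ge0// mulr_ge0// invr_ge0 ltW.
    apply: lerD; rewrite -(mulrA (2^-1 * _)) ler_wpM2l// mulr_ge0// ?invr_ge0; exact: ltW.
  by rewrite ExD !ExZ !Ex_sum -!(mulrA (2^-1 * _)).
under eq_bigr do rewrite mulrDr.
rewrite big_split /= mulrDr lerD//.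
  have -> : \sum_j m j * (2^-1 * beta * (k%:R * \sum_i Ex (fun b => chaos (deriv j (g i)) b ^+ 2)))
     = 2^-1 * beta * k%:R * \sum_i (q i)%:R * chaos_var i.
    under [in RHS]eq_bigr do rewrite -chaos_var_gamma.
    rewrite exchange_big mulr_sumr; apply: eq_bigr => j _ /=.
    by rewrite -mulr_sumr; ring.
  apply: (@le_trans _ _ (2^-1 * beta * k%:R * \sum_i Q%:R * chaos_var i)).
    apply: ler_wpM2l; first by rewrite !mulr_ge0// ltW.
    apply: ler_sum => i _.
    by rewrite ler_wpM2r// ler_nat.
  rewrite -mulr_sumr; set s := \sum_i _; have s0 : 0 <= s by rewrite sumr_ge0.
  have : 0 <= beta * (k%:R * Q%:R * s) by apply: mulr_ge0; [exact: ltW|rewrite !mulr_ge0].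
  by lra.
have -> : \sum_j m j * (2^-1 * beta^-1 * (k%:R ^+ 3 * \sum_i Ex (fun b => chaos (deriv j (g i)) b ^+ 4)))
     = 2^-1 * beta^-1 * k%:R ^+ 3 * \sum_i \sum_j m j * Ex (fun b => chaos (deriv j (g i)) b ^+ 4).
  rewrite exchange_big mulr_sumr; apply: eq_bigr => j _ /=.
  by rewrite -mulr_sumr; ring.
apply: (@le_trans _ _ (2^-1 * beta^-1 * k%:R ^+ 3 * \sum_(i < k) c1 * beta ^+ 2)).
  rewrite ler_wpM2l ?mulr_ge0 ?invr_ge0 ?exprn_ge0 ?(ltW beta0)//.
  by apply: ler_sum => i _; exact: deriv_fourth_sum.
rewrite sumr_const card_ord -(mulr_natl (c1 * beta ^+ 2) k).
have -> : 2^-1 / beta * k%:R ^+ 3 * (k%:R * (c1 * beta ^+ 2)) = 2^-1 * (beta * (k%:R ^+ 4 * c1)).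
  by field; rewrite gt_eqF.
have : 0 <= beta * (k%:R ^+ 4 * c1).
  by apply: mulr_ge0; [exact: ltW|apply: mulr_ge0 => //; exact: exprn_ge0].
by lra.
Qed.

Section identity.
Variables (A : R) (phi : 'rV[R]_k -> R) (G : 'I_k -> 'rV[R]_k -> R)
  (H : 'I_k -> 'I_k -> 'rV[R]_k -> R).
Hypothesis cl : stein_class A phi G H.

Let A0 : forall i : 'I_k, 0 <= A.
Proof. by move=> i; case: cl => h _ _ _; exact: le_trans (normr_ge0 _) (h i i 0). Qed.

(** Writing F_i as 1/q_i times the sum of X_j D_j F_i, the function G_i is expanded around the part
    of the vector that is free of X_j; the linear term produces X_j^2, whose mean m_j reconstitutes
    [gamma]. *)
Lemma stein_coord i :
  `|Ex (fun b => chaos_vec b 0 i * G i (chaos_vec b))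
    - (q i)%:R^-1 * \sum_l Ex (fun b => H i l (chaos_vec b) * gamma (g i) (g l) b)|
  <= 6 * A * \sum_j m j * Ex (fun b => norm1 (dvec j b) ^+ 3).
Proof.
have [cH cL cG _] := cl; have Ai := A0 i.
have q0 : (q i)%:R != 0 :> R by rewrite pnatr_eq0 -lt0n.
have qi1 : (q i)%:R^-1 <= 1 :> R by rewrite invf_le1 ?ltr0n// ler1n.
have -> : Ex (fun b => chaos_vec b 0 i * G i (chaos_vec b)) =
   (q i)%:R^-1 * \sum_j Ex (fun b => X j b * dvec j b 0 i * G i (chaos_vec b)).
  rewrite -Ex_sum -ExZ; congr Ex; apply/funext => b.
  rewrite -mulr_suml mulrA; congr (_ * _); rewrite mxE.
  under eq_bigr do rewrite mxE.
  rewrite (sum_var_deriv x1 x0) /chaos mulr_sumr; apply: eq_bigr => S _.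
  rewrite mulrA mulrA; congr (_ * _); case: (eqVneq #|S| (q i)) => [->|/hg ->]; last by rewrite mulr0.
  by rewrite mulVf// mul1r.
rewrite -mulrBr normrM ger0_norm ?invr_ge0//.
apply: le_trans (ler_piMl (normr_ge0 _) qi1) _.
have -> : \sum_l Ex (fun b => H i l (chaos_vec b) * gamma (g i) (g l) b) =
   \sum_j m j * \sum_l Ex (fun b => dvec j b 0 i * dvec j b 0 l * H i l (chaos_vec b)).
  under [in RHS]eq_bigr do rewrite mulr_sumr.
  rewrite [RHS]exchange_big; apply: eq_bigr => l _ /=.
  under [in RHS]eq_bigr do rewrite -ExZ.
  rewrite -Ex_sum; congr Ex; apply/funext => b.
  rewrite /gamma mulr_sumr; apply: eq_bigr => j _; rewrite !mxE; ring.
rewrite -sumrB; apply: le_trans (ler_norm_sum _ _ _) _; rewrite mulr_sumr.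
apply: ler_sum => j _; rewrite mulrCA.
set n3 := Ex (fun b => norm1 (dvec j b) ^+ 3).
have n30 : 0 <= n3 by apply: (Ex_ge0 p01) => b; rewrite exprn_ge0// norm1_ge0.
have fn3 : free j (fun b => norm1 (dvec j b) ^+ 3) by move=> b; rewrite free_dvec.
pose Y := Ex (fun b => X j b ^+ 2 * \sum_l dvec j b 0 i * dvec j b 0 l * H i l (wvec j b)).
(* The zeroth-order term has mean 0 and the first-order one is Y. The remainder carries |X_j|^3, of
   which X_j^2 averages to m_j and the last factor is at most 3. *)
have step1 : `|Ex (fun b => X j b * dvec j b 0 i * G i (chaos_vec b)) - Y| <= 3 * A * (m j * n3).
  have z : Ex (fun b => X j b * (dvec j b 0 i * G i (wvec j b))) = 0.
    by apply: (Ex_var X_mean) => // b; rewrite free_dvec free_wvec.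
  rewrite -(subr0 (Ex _)) -z -!ExN -!ExD.
  apply: le_trans (ler_norm_Ex p01 _) _.
  rewrite -(Ex_var2 X_mean x1E x0E fn3) -ExZ; apply: (ler_Ex p01) => b.
  have -> : X j b * dvec j b 0 i * G i (chaos_vec b) + - (X j b * (dvec j b 0 i * G i (wvec j b)))
     + - (X j b ^+ 2 * \sum_l dvec j b 0 i * dvec j b 0 l * H i l (wvec j b))
     = X j b * dvec j b 0 i * (G i (chaos_vec b) - G i (wvec j b)
         - \sum_l H i l (wvec j b) * (X j b *: dvec j b) 0 l).
    rewrite !mulrBr mulrA; congr (_ - _); rewrite !mulr_sumr; apply: eq_bigr => l _.
    by rewrite !mxE; ring.
  rewrite !normrM (chaos_vec_split j b).
  apply: le_trans (ler_wpM2l _ (cG _ _ _)) _; first by rewrite mulr_ge0.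
  rewrite norm1Z; set d := dvec j b; set Xb := X j b.
  have d0 : `|d 0 i| <= norm1 d := norm1_coord _ _.
  have -> : `|Xb| * `|d 0 i| * (A * (`|Xb| * norm1 d) ^+ 2) =
     A * Xb ^+ 2 * `|Xb| * (`|d 0 i| * norm1 d ^+ 2).
    by rewrite -(real_normK (num_real Xb)); ring.
  have -> : 3 * A * (Xb ^+ 2 * norm1 d ^+ 3) = A * Xb ^+ 2 * 3 * (norm1 d * norm1 d ^+ 2) by ring.
  apply: ler_pM.
  - by rewrite mulr_ge0// mulr_ge0 ?sqr_ge0.
  - by rewrite mulr_ge0 ?sqr_ge0.
  - by apply: ler_wpM2l; [rewrite mulr_ge0 ?sqr_ge0|exact: X3].
  - by apply: ler_wpM2r; [exact: sqr_ge0|exact: d0].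
have YE : Y = m j * \sum_l Ex (fun b => dvec j b 0 i * dvec j b 0 l * H i l (wvec j b)).
  rewrite -Ex_sum -(Ex_var2 X_mean x1E x0E)// => b.
  by apply: eq_bigr => l _; rewrite free_dvec free_wvec.
(* Returning from [wvec] to the full vector costs the Lipschitz constant of the Hessian times |X_j|
   <= 3; together with [step1] this is the factor 6. *)
have step2 : `|Y - m j * \sum_l Ex (fun b => dvec j b 0 i * dvec j b 0 l * H i l (chaos_vec b))|
   <= 3 * A * (m j * n3).
  rewrite YE -mulrBr normrM ger0_norm// mulrCA ler_wpM2l//.
  rewrite -sumrB; under eq_bigr do rewrite -ExN -ExD.
  rewrite -Ex_sum; apply: le_trans (ler_norm_Ex p01 _) _.
  rewrite -ExZ; apply: (ler_Ex p01) => b; apply: le_trans (ler_norm_sum _ _ _) _.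
  set d := dvec j b.
  apply: (@le_trans _ _ (\sum_l norm1 d * `|d 0 l| * (3 * A * norm1 d))).
    apply: ler_sum => l _; rewrite -mulrBr !normrM ler_pM ?mulr_ge0//.
      by rewrite ler_wpM2r// norm1_coord.
    rewrite (chaos_vec_split j b) distrC; apply: le_trans (cL _ _ _ _) _.
    by rewrite norm1Z mulrA ler_wpM2r ?norm1_ge0// mulrC ler_wpM2r.
  by rewrite -mulr_suml -mulr_sumr le_eqVlt; apply/orP; left; apply/eqP; rewrite -/(norm1 d); ring.
rewrite -(subrK Y (Ex _)) -addrA; apply: le_trans (ler_normD _ _) _.
apply: le_trans (lerD step1 step2) _; lra.
Qed.

(** Replacing s_i^2 by the variance of the chaos costs their difference; the rest compares each
    [gamma] with its mean, through [gamma_diag] and [gamma_offdiag], and adds the error of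
    [stein_coord]. *)
Lemma chaos_gap (s : 'I_k -> R) :
  `|Ex (fun b => stein_gap s G H (chaos_vec b))|
   <= (gap_constant * beta * (1 + \sum_i chaos_var i) * 2
      + \sum_i `|s i ^+ 2 - chaos_var i|) * A.
Proof.
have [cH cL cG _] := cl.
(* For k = 0 the class does not force A to be nonnegative, but both sides are then 0. *)
case: (pselect (exists i : 'I_k, True)) => [[i0 _]|nk]; last first.
  have -> : (fun b => stein_gap s G H (chaos_vec b)) = (fun=> 0).
    apply/funext => b; rewrite /stein_gap !big1 ?subr0// => i; by case: nk; exists i.
  have A'0 : 0 <= \sum_i `|s i ^+ 2 - chaos_var i| by rewrite sumr_ge0.
  have k0 : k = 0%N by case: (k) nk => // k' nk; case: nk; exists ord0.
  rewrite (Ex_cst p) normr0 (_ : gap_constant = 0) ?mul0r ?add0r.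
    by rewrite big1 ?mul0r// => i; case: nk; exists i.
  by rewrite /gap_constant k0 expr0n !(mul0r, mulr0) addr0.
have Ai := A0 i0.
pose s2 := \sum_i chaos_var i.
have v0 i : 0 <= chaos_var i.
  by apply: sumr_ge0 => S _; rewrite mulr_ge0 ?sqr_ge0// (mu_ge0 p01 X_mean x1E x0E).
have s20 : 0 <= s2 by rewrite sumr_ge0.
(* From |y| <= beta + y^2 / beta, a second moment of order beta^2 gives a first absolute moment of
   order beta. *)
have EL1 (Y : {set T} -> R) : Ex (fun b => Y b ^+ 2) <= c1 * beta ^+ 2 ->
    Ex (fun b => `|Y b|) <= beta * (1 + c1).
  move=> hY.
  apply: (@le_trans _ _ (Ex (fun b => beta + beta^-1 * Y b ^+ 2))).
    apply: (ler_Ex p01) => b; rewrite -(real_normK (num_real (Y b))).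
    set y := `|Y b|; have y0 : 0 <= y := normr_ge0 _.
    have -> : beta + beta^-1 * y ^+ 2 = y + beta^-1 * ((beta - y) ^+ 2 + beta * y).
      by field; rewrite gt_eqF.
    by rewrite lerDl mulr_ge0 ?invr_ge0 ?(ltW beta0)// addr_ge0 ?sqr_ge0// mulr_ge0// ltW.
  rewrite ExD Ex_cst ExZ mulrDr mulr1 lerD2l.
  apply: (@le_trans _ _ (beta^-1 * (c1 * beta ^+ 2))); first by rewrite ler_wpM2l// invr_ge0 ltW.
  by rewrite le_eqVlt; apply/orP; left; apply/eqP; field; rewrite gt_eqF.
pose N3 := \sum_j m j * Ex (fun b => norm1 (dvec j b) ^+ 3).
have N3le : N3 <= beta * (k%:R * Q%:R * s2 + k%:R ^+ 4 * c1) := dvec_cube.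
have term i : `|s i ^+ 2 * Ex (fun b => H i i (chaos_vec b)) - Ex (fun b => chaos_vec b 0 i * G i (chaos_vec b))|
   <= A * `|s i ^+ 2 - chaos_var i| + k%:R * (A * (beta * (1 + c1))) + 6 * A * N3.
  have q0 : (q i)%:R != 0 :> R by rewrite pnatr_eq0 -lt0n.
  have qi1 : (q i)%:R^-1 <= 1 :> R by rewrite invf_le1 ?ltr0n// ler1n.
  have := stein_coord i; rewrite -/N3.
  set E1 := Ex (fun b => chaos_vec b 0 i * _); set E2 := _^-1 * _ => h1.
  have h2 : `|chaos_var i * Ex (fun b => H i i (chaos_vec b)) - E2| <= k%:R * (A * (beta * (1 + c1))).
    (* The means minus the [gamma]: the mean is q_i times the variance on the diagonal and 0 off
       it. *)
    pose Y l b := if l == i then (q i)%:R * chaos_var i - gamma (g i) (g i) b else - gamma (g i) (g l) b.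
    have -> : chaos_var i * Ex (fun b => H i i (chaos_vec b)) - E2
       = (q i)%:R^-1 * \sum_l Ex (fun b => H i l (chaos_vec b) * Y l b).
      rewrite /E2 -[X in X - _](mulKf q0) -mulrBr; congr (_ * _).
      rewrite (bigD1 i)//= [in RHS](bigD1 i)//= opprD addrA; congr (_ + _).
        rewrite /Y eqxx mulrA -!ExZ -ExN -ExD; congr Ex; apply/funext => b; ring.
      rewrite -sumrN; apply: eq_bigr => l /negPf li; rewrite /Y li -ExN.
      by congr Ex; apply/funext => b; rewrite mulrN.
    rewrite normrM ger0_norm ?invr_ge0//.
    apply: le_trans (ler_piMl (normr_ge0 _) qi1) _.
    apply: le_trans (ler_norm_sum _ _ _) _.
    rewrite mulr_natl -[X in _ *+ X]card_ord -sumr_const; apply: ler_sum => l _.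
    apply: le_trans (ler_norm_Ex p01 _) _.
    apply: (@le_trans _ _ (Ex (fun b => A * `|Y l b|))).
      by apply: (ler_Ex p01) => b; rewrite normrM ler_wpM2r.
    rewrite ExZ ler_wpM2l//; apply: EL1; rewrite /Y; case: eqVneq => [_|li].
      rewrite (_ : (fun b => _) = (fun b => (gamma (g i) (g i) b - (q i)%:R * chaos_var i) ^+ 2)).
        exact: gamma_diag.
      by apply/funext => b; rewrite -sqrrN opprB.
    rewrite (_ : (fun b => _) = (fun b => gamma (g i) (g l) b ^+ 2)).
      by apply: gamma_offdiag; rewrite eq_sym.
    by apply/funext => b; rewrite sqrrN.
  have h3 : `|(s i ^+ 2 - chaos_var i) * Ex (fun b => H i i (chaos_vec b))| <= A * `|s i ^+ 2 - chaos_var i|.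
    rewrite normrM mulrC ler_wpM2r//; apply: le_trans (ler_norm_Ex p01 _) _.
    by rewrite -[leRHS](Ex_cst p); exact: (ler_Ex p01).
  have -> : s i ^+ 2 * Ex (fun b => H i i (chaos_vec b)) - E1 =
     (s i ^+ 2 - chaos_var i) * Ex (fun b => H i i (chaos_vec b))
     + (chaos_var i * Ex (fun b => H i i (chaos_vec b)) - E2) - (E1 - E2) by ring.
  apply: le_trans (ler_normB _ _) _; rewrite lerD//.
  by apply: le_trans (ler_normD _ _) _; rewrite lerD.
have -> : Ex (fun b => stein_gap s G H (chaos_vec b)) =
  \sum_i (s i ^+ 2 * Ex (fun b => H i i (chaos_vec b)) - Ex (fun b => chaos_vec b 0 i * G i (chaos_vec b))).
  under [in RHS]eq_bigr do rewrite -ExZ -ExN -ExD.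
  rewrite -Ex_sum; congr Ex; apply/funext => b.
  by rewrite /stein_gap -sumrB.
apply: le_trans (ler_norm_sum _ _ _) _; apply: le_trans (ler_sum _ (fun i _ => term i)) _.
rewrite !big_split /= -mulr_sumr !sumr_const card_ord -[X in _ + X + _]mulr_natl -[X in _ + _ + X]mulr_natl.
set D := \sum_i `|_|.
have e1 : k%:R * (6 * A * N3) <= k%:R * (6 * A * (beta * (k%:R * Q%:R * s2 + k%:R ^+ 4 * c1))).
  by rewrite ler_wpM2l// ler_wpM2l// mulr_ge0.
apply: le_trans (lerD (lexx _) e1) _.
rewrite -/s2.
have kk : 0 <= k%:R :> R by [].
have QQ : 0 <= Q%:R :> R by [].
have B0 := ltW beta0.
have C0 : 0 <= c1 := c1_ge0.
rewrite -subr_ge0.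
have -> : (gap_constant * beta * (1 + s2) * 2 + D) * A - (A * D + k%:R * (k%:R * (A * (beta * (1 + c1))))
   + k%:R * (6 * A * (beta * (k%:R * Q%:R * s2 + k%:R ^+ 4 * c1)))) =
  A * beta * (k%:R ^+ 2 * (1 + c1) * (1 + 2 * s2) + 6 * k%:R * (k%:R * Q%:R + k%:R ^+ 4 * c1 * s2)).
  by rewrite /gap_constant; ring.
apply: mulr_ge0; first exact: mulr_ge0.
apply: addr_ge0; first by rewrite mulr_ge0 ?mulr_ge0 ?exprn_ge0 ?addr_ge0 ?mulr_ge0.
by rewrite mulr_ge0 ?mulr_ge0// addr_ge0 ?mulr_ge0 ?exprn_ge0.
Qed.

End identity.

End chaos_stein.

(** * Inequalities for integrals with values in the extended reals *)

Section integral_complements.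
Context d (X : measurableType d) (R : realType) (m : {measure set X -> \bar R}).

Lemma poweR2 (x : \bar R) : (0 <= x)%E -> (x `^ 2 = x * x)%E.
Proof.
case: x => [r| |]//=; last by rewrite /poweR/= pnatr_eq0.
by rewrite lee_fin => r0; rewrite powR_mulrn// expr2 EFinM.
Qed.

(** Squared norms are written as products, an identity that also holds when the norm is infinite. *)
Lemma Lnorm2_mul (f : X -> \bar R) :
  ('N[m]_2%:E[f] * 'N[m]_2%:E[f] = \int[m]_x (f x * f x))%E.
Proof.
rewrite -poweR2 ?Lnorm_ge0// poweR_Lnorm ?pnatr_eq0//.
apply: eq_integral => x _; rewrite poweR2// -abseM gee0_abs//.
by case: (f x) => [r| |]//; rewrite lee_fin -expr2 sqr_ge0.
Qed.

Lemma eq_Lnorm2_ae (f g : X -> \bar R) : measurable_fun setT f -> measurable_fun setT g ->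
  {ae m, forall x, f x = g x} -> 'N[m]_2%:E[f]%E = 'N[m]_2%:E[g]%E.
Proof.
move=> mf mg fg; rewrite unlock.
have m2 (h : X -> \bar R) : measurable_fun setT h -> measurable_fun setT (fun x => `|h x| `^ 2)%E.
  move=> mh; apply: (@measurableT_comp _ _ _ _ _ _ (fun y => y `^ 2)%E).
    exact: measurable_poweR.
  exact: measurableT_comp.
congr (_ `^ _)%E; apply: ae_eq_integral => //; [exact: m2|exact: m2|].
by apply: filterS fg => x ->.
Qed.

Lemma Lnorm4_mul (f : X -> R) :
  ('N[m]_4%:E[EFin \o f] ^+ 2 * 'N[m]_4%:E[EFin \o f] ^+ 2 = \int[m]_x (f x ^+ 4)%:E)%E.
Proof.
have powR4 (x : \bar R) : (0 <= x)%E -> (x `^ 4 = x ^+ 2 * x ^+ 2)%E.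
  case: x => [r| |]//=; last by rewrite /poweR/= pnatr_eq0.
  rewrite lee_fin => r0; rewrite powR_mulrn//.
  by rewrite -!EFinM -!expr2 -exprM.
rewrite -powR4 ?Lnorm_ge0// poweR_Lnorm ?pnatr_eq0//.
apply: eq_integral => x _; rewrite powR4//= -!EFinM -!expr2 -exprM.
by rewrite -normrX ger0_norm// exprn_even_ge0.
Qed.

(** Neither u nor v is assumed integrable, because contractions need not be finite everywhere. If
    the integral of w is infinite there is nothing to prove; otherwise u - v is integrable, and
    either v is integrable too or its integral is infinite. *)
Lemma abse_integral_le (u v : X -> R) (w : X -> \bar R) :
  measurable_fun setT u -> measurable_fun setT v -> measurable_fun setT w ->
  (forall x, (`|u x - v x|%:E <= w x)%E) ->
  (`|\int[m]_x (u x)%:E| <= `|\int[m]_x (v x)%:E| + \int[m]_x w x)%E.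
Proof.
move=> mu mv mw uvw.
have w0 x : (0 <= w x)%E by apply: le_trans (uvw x); rewrite lee_fin.
have [woo|wfin] := eqVneq (\int[m]_x w x)%E +oo%E.
  by rewrite woo addey ?leey//; case: (\int[m]_x (v x)%:E)%E.
have iuv : m.-integrable setT (EFin \o (fun x => u x - v x)).
  apply/integrableP; split; first by apply/measurable_EFinP; exact: measurable_funB.
  apply: (@le_lt_trans _ _ (\int[m]_x w x)%E); last by rewrite lt_neqAle wfin leey.
  apply: ge0_le_integral => //; last by move=> x _; exact: uvw.
  by apply/measurable_EFinP/measurableT_comp => //; exact: measurable_funB.
have [vfin|] := boolP ((\int[m]_x (v x)%:E)%E \is a fin_num); last first.
  move=> vinf; rewrite (_ : `|\int[m]_x (v x)%:E| = +oo)%E; last first.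
    by move: vinf; case: (\int[m]_x (v x)%:E)%E.
  by rewrite addye ?leey// gt_eqF// (lt_le_trans _ (integral_ge0 _ _)).
have iv : m.-integrable setT (EFin \o v).
  have mve : measurable_fun setT (EFin \o v) by apply/measurable_EFinP.
  apply/integrableP; split => //.
  move: vfin; rewrite integralE => /[dup] vfin.
  rewrite fin_numB => /andP[vp vn].
  rewrite (eq_integral (fun x => (EFin \o v)^\+ x + (EFin \o v)^\- x)%E); last first.
    by move=> x _; rewrite -[RHS]/(((EFin \o v)^\+ \+ (EFin \o v)^\-)%E x) -fune_abse.
  rewrite ge0_integralD//; last 2 first.
  - exact: measurable_funepos.
  - exact: measurable_funeneg.
  by rewrite ltey_eq fin_numD vp vn.
rewrite (_ : \int[m]_x (u x)%:E = \int[m]_x (v x)%:E + \int[m]_x (u x - v x)%:E)%E; last first.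
  rewrite -integralD//; apply: eq_integral => x _ /=.
  by rewrite -EFinD addrC subrK.
apply: (le_trans (lee_abs_add _ _)); rewrite leeD2l//.
apply: (le_trans (le_abse_integral m measurableT _)).
  by case/integrableP: iuv.
apply: ge0_le_integral => //; last by move=> x _; exact: uvw.
by apply/measurable_EFinP/measurableT_comp => //; exact: measurable_funB.
Qed.

Lemma cauchy_schwarz (u v : X -> R) : measurable_fun setT u -> measurable_fun setT v ->
  ((\int[m]_x `|u x * v x|%:E) * (\int[m]_x `|u x * v x|%:E) <=
   (\int[m]_x (u x ^+ 2)%:E) * (\int[m]_x (v x ^+ 2)%:E))%E.
Proof.
move=> mu mv.
have sqrE (f : X -> R) : (\int[m]_x (f x ^+ 2)%:E =
    'N[m]_2%:E[EFin \o f] * 'N[m]_2%:E[EFin \o f])%E.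
  by rewrite Lnorm2_mul; apply: eq_integral => x _; rewrite /= -EFinM expr2.
have := @hoelder _ _ _ m u v 2 2 mu mv (ltr0Sn _ _) (ltr0Sn _ _).
have -> : 2^-1 + 2^-1 = 1 :> R by lra.
move=> /(_ erefl); rewrite Lnorm1 => uv.
rewrite !sqrE muleACA; apply: lee_pmul => //; exact: integral_ge0.
Qed.

End integral_complements.

(** * Integration over lists of arguments: Tonelli and invariance under permutations *)

Section sequence_functions.
Context d (Z : measurableType d).

(** Lists of constant length with measurable entries. Contractions use [take], [drop] and [++],
    whose lengths agree only by arithmetic; working with lists avoids casts between tuple types. *)
Definition mseq d' (X : measurableType d') (n : nat) (h : X -> seq Z) : Prop :=
  (forall x, size (h x) = n) /\
  (forall i, (i < n)%N -> exists2 c : X -> Z, measurable_fun setT c &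
     forall z0 x, nth z0 (h x) i = c x).

(** Measurability at every length, so that it is stable under the reindexings of [mseq]. *)
Definition smeas d' (V : measurableType d') (F : seq Z -> V) : Prop :=
  forall n, measurable_fun [set: n.-tuple Z] (fun x => F (tval x)).

Section mseq_lemmas.
Context d' (X : measurableType d').
Implicit Types (h : X -> seq Z) (n : nat).

Lemma smeas_comp d2 (V : measurableType d2) (F : seq Z -> V) n h :
  smeas F -> mseq n h -> measurable_fun setT (fun x => F (h x)).
Proof.
move=> mF [sh mh].
pose t x : n.-tuple Z := tcast (sh x) (in_tuple (h x)).
have tE x : tval (t x) = h x by rewrite /t; case: _ / (sh x).
have mt : measurable_fun setT t.
  apply/measurable_fun_tnthP => i.
  have [c mc cE] := mh i (ltn_ord i).
  rewrite (_ : _ \o _ = c)//; apply/funext => x /=.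
  by rewrite (tnth_nth (tnth (t x) i)) tE cE.
rewrite (_ : (fun x => F (h x)) = (fun x : n.-tuple Z => F (tval x)) \o t).
  exact: (measurableT_comp (mF n) mt).
by apply/funext => x /=; rewrite tE.
Qed.

Lemma mseq_cat n m h h' : mseq n h -> mseq m h' -> mseq (n + m) (fun x => h x ++ h' x).
Proof.
move=> [sh mh] [sh' mh']; split=> [x|i im]; first by rewrite size_cat sh sh'.
case: (ltnP i n) => ni.
  by have [c mc cE] := mh i ni; exists c => // z0 x; rewrite nth_cat sh ni.
have [|c mc cE] := mh' (i - n)%N; first by rewrite ltn_subLR.
by exists c => // z0 x; rewrite nth_cat sh ltnNge ni /= cE.
Qed.

Lemma mseq_take n m h : mseq n h -> mseq (minn m n) (fun x => take m (h x)).
Proof.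
move=> [sh mh]; split=> [x|i]; first by rewrite size_take_min sh.
rewrite leq_min => /andP[im inn]; have [c mc cE] := mh i inn.
by exists c => // z0 x; rewrite nth_take.
Qed.

Lemma mseq_drop n m h : mseq n h -> mseq (n - m) (fun x => drop m (h x)).
Proof.
move=> [sh mh]; split=> [x|i im]; first by rewrite size_drop sh.
have [|c mc cE] := mh (m + i)%N; first by rewrite -ltn_subRL.
by exists c => // z0 x; rewrite nth_drop.
Qed.

Lemma mseq_tuple n (g : X -> n.-tuple Z) : measurable_fun setT g -> mseq n (fun x => tval (g x)).
Proof.
move=> mg; split=> [x|i ni]; first by rewrite size_tuple.
exists (fun x => tnth (g x) (Ordinal ni)).
  by move/measurable_fun_tnthP : mg => /(_ (Ordinal ni)).
by move=> z0 x; rewrite (tnth_nth z0).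
Qed.

Lemma mseq_cst (s : seq Z) : mseq (size s) (fun _ : X => s).
Proof.
split=> // i i_s.
case: s i_s => // z s i_s; exists (fun=> nth z (z :: s) i) => // z0 x.
exact: set_nth_default.
Qed.

End mseq_lemmas.

Context (R : realType) (mu : {sigma_finite_measure set Z -> \bar R}).
Local Notation tm := (tuple_measure mu).
Implicit Types (F G H : seq Z -> \bar R) (n : nat).

Lemma mseq_id n : mseq n (fun x : n.-tuple Z => tval x).
Proof. by apply: mseq_tuple; exact: measurable_id. Qed.

Lemma smeas_catr d' (V : measurableType d') (F : seq Z -> V) (s : seq Z) :
  smeas F -> smeas (fun x => F (s ++ x)).
Proof.
by move=> mF n; apply: smeas_comp mF _; apply: mseq_cat; [exact: mseq_cst|exact: mseq_id].
Qed.

Definition tuple_integral n F : \bar R := (\int[tm n]_x F (tval x))%E.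
Local Notation Iint := tuple_integral.

Lemma Iint_ge0 n F : (forall s, (0 <= F s)%E) -> (0 <= Iint n F)%E.
Proof. by move=> F0; exact: integral_ge0. Qed.

Lemma le_Iint n F G : smeas F -> smeas G -> (forall s, (0 <= F s)%E) ->
  (forall s, size s = n -> (F s <= G s)%E) -> (Iint n F <= Iint n G)%E.
Proof.
move=> mF mG F0 FG; apply: ge0_le_integral => //; [exact: mF|exact: mG|].
by move=> x _; apply: FG; rewrite size_tuple.
Qed.

Lemma eq_Iint n F G : (forall s, size s = n -> F s = G s) -> Iint n F = Iint n G.
Proof. by move=> FG; apply: eq_integral => x _; apply: FG; rewrite size_tuple. Qed.

Lemma Iint0 F : smeas F -> Iint 0 F = F [::].
Proof.
move=> mF; rewrite /tuple_integral integral_dirac//; last exact: mF.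
by rewrite diracT mul1e.
Qed.

Lemma IintS n F : smeas F -> (forall s, (0 <= F s)%E) ->
  Iint n.+1 F = (\int[mu]_z Iint n (fun s => F (z :: s)))%E.
Proof.
move=> mF F0; rewrite /tuple_integral /=.
have mc : measurable_fun [set: Z * n.-tuple Z] (fun x : Z * n.-tuple Z => [tuple of x.1 :: x.2]).
  exact: measurable_cons.
rewrite /tuple_cons_measure ge0_integral_pushforward//; last exact: mF.
rewrite preimage_setT fubini_tonelli1//.
  exact: (measurableT_comp (mF n.+1)).
by move=> x /=; exact: F0.
Qed.

Lemma measurable_Iint d' (X : measurableType d') n (F : X -> seq Z -> \bar R) :
  measurable_fun [set: X * n.-tuple Z] (fun y => F y.1 (tval y.2)) ->
  (forall x s, (0 <= F x s)%E) -> measurable_fun setT (fun x => Iint n (F x)).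
Proof.
move=> mF F0.
exact: (@measurable_fun_fubini_tonelli_F _ _ _ _ _ (tm n) (fun y => F y.1 (tval y.2)) mF).
Qed.

Lemma mseq_pair n m : mseq (n + m) (fun y : n.-tuple Z * m.-tuple Z => y.1 ++ y.2).
Proof. by apply: mseq_cat; apply: mseq_tuple. Qed.

Lemma smeas_Iint n F : smeas F -> (forall s, (0 <= F s)%E) ->
  smeas (fun x => Iint n (fun y => F (x ++ y))).
Proof.
move=> mF F0 m; apply: (@measurable_Iint _ _ n (fun (x : m.-tuple Z) y => F (x ++ y))) => //.
exact: smeas_comp mF (mseq_pair m n).
Qed.

Lemma smeas_Iintl n F : smeas F -> (forall s, (0 <= F s)%E) ->
  smeas (fun x => Iint n (fun y => F (y ++ x))).
Proof.
move=> mF F0 m; apply: (@measurable_Iint _ _ n (fun (x : m.-tuple Z) y => F (y ++ x))) => //.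
by apply: smeas_comp mF (_ : mseq (n + m) _); apply: mseq_cat; apply: mseq_tuple.
Qed.

Lemma IintD n m F : smeas F -> (forall s, (0 <= F s)%E) ->
  Iint (n + m) F = Iint n (fun x => Iint m (fun y => F (x ++ y))).
Proof.
elim: n F => [|n IH] F mF F0.
  by rewrite Iint0//; exact: smeas_Iint.
have mz z : smeas (fun s => F (z :: s)) by exact: (@smeas_catr _ _ F [:: z]).
rewrite addSn IintS// IintS//=.
- by apply: eq_integral => z _; rewrite IH.
- exact: smeas_Iint.
- by move=> s; exact: Iint_ge0.
Qed.

Lemma Iint_swap n m F : smeas F -> (forall s, (0 <= F s)%E) ->
  Iint n (fun x => Iint m (fun y => F (x ++ y))) =
  Iint m (fun y => Iint n (fun x => F (x ++ y))).
Proof.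
move=> mF F0.
apply: (@fubini_tonelli _ _ _ _ _ (tm n) (tm m) (fun y => F (y.1 ++ y.2))) => //.
exact: smeas_comp mF (mseq_pair n m).
Qed.

Lemma tuple_measure_rect n (A : 'I_n -> set Z) : (forall i, measurable (A i)) ->
  tm n [set x | forall i, A i (tnth x i)] = (\prod_(i < n) mu (A i))%E.
Proof.
elim: n A => [|n IH] A mA.
  rewrite big_ord0 /= diracE mem_set//; by move=> [].
rewrite /= /tuple_cons_measure /pushforward big_ord_recl -IH//.
rewrite -product_measure1E//; last first.
  rewrite (_ : mkset _ = \bigcap_(i in [set: 'I_n]) ((fun x => tnth x i) @^-1` A (lift ord0 i))).
    apply: fin_bigcap_measurable => [|i _]; first exact: finite_finset.
  rewrite -[X in measurable X]setTI.
    exact: measurable_tnth.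
  apply/seteqP; split => [x h i _|x h i]; [exact: h|exact: (h i I)].
congr ((mu \x _)%E _); apply/seteqP; split => [[z x] h|[z x] [h1 h2] i].
  split; first by have := h ord0; rewrite (tnth_nth z).
  by move=> i; have := h (lift ord0 i); rewrite tnthS.
case: (unliftP ord0 i) => [j ->|->]; first by rewrite tnthS; exact: h2.
by rewrite (tnth_nth z).
Qed.

Lemma measurable_rect n (A : 'I_n -> set Z) : (forall i, measurable (A i)) ->
  measurable [set x : n.-tuple Z | forall i, A i (tnth x i)].
Proof.
move=> mA.
rewrite (_ : mkset _ = \bigcap_(i in [set: 'I_n]) ((fun x => tnth x i) @^-1` A i)).
  apply: fin_bigcap_measurable => [|i _]; first exact: finite_finset.
  by rewrite -[X in measurable X]setTI; exact: measurable_tnth.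
apply/seteqP; split => [x h i _|x h i]; [exact: h|exact: (h i I)].
Qed.

Definition tperm_tuple n (s : 'S_n) (x : n.-tuple Z) : n.-tuple Z := [tuple tnth x (s i) | i < n].

Lemma measurable_tperm n (s : 'S_n) : measurable_fun setT (tperm_tuple s).
Proof.
apply/measurable_fun_tnthP => i.
rewrite (_ : _ \o _ = (fun x => tnth x (s i))); first exact: measurable_tnth.
by apply/funext => x /=; rewrite tnth_mktuple.
Qed.

HB.instance Definition _ n (s : 'S_n) :=
  isMeasurableFun.Build _ _ _ _ (tperm_tuple s) (measurable_tperm s).

Definition rectangles n := [set B : set (n.-tuple Z) | exists2 A : 'I_n -> set Z,
  (forall i, measurable (A i)) & B = [set x | forall i, A i (tnth x i)]].

(** A generating cylinder is a rectangle all of whose sides but one are the whole space. *)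
Lemma measurable_rectangles n : measurable = <<s @rectangles n >>.
Proof.
apply/seteqP; split.
  move=> B; apply: smallest_sub; first exact: smallest_sigma_algebra.
  case: n B => [|n] _; first by rewrite big_ord0.
  move=> C; rewrite -bigcup_mkord_ord => -[i Ii [A mA <-]].
  apply: sub_sigma_algebra; exists (fun j => if j == inord i then A else setT).
    by move=> j; case: ifP.
  rewrite setTI; apply/seteqP; split => [x Ax j|x /(_ (inord i))]; rewrite /= ?eqxx//.
  by case: eqP => [->|].
apply: smallest_sub; first exact: sigma_algebra_measurable.
by move=> _ [A mA ->]; exact: measurable_rect.
Qed.

(* A sigma-finite measure is determined by its values on rectangles, on which *)
(* both measures agree.                                                       *)
Lemma tuple_measure_perm n (s : 'S_n) (B : set (n.-tuple Z)) : measurable B ->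
  pushforward (tm n) (tperm_tuple s) B = tm n B.
Proof.
have [U [Ucov ndU Ufin]] := (sigma_finiteP _ _).1 (sigma_finiteT mu).
have mperm A : (forall i, measurable (A i)) ->
    pushforward (tm n) (tperm_tuple s) [set x | forall i, A i (tnth x i)] =
    (\prod_(i < n) mu (A i))%E.
  move=> mA; rewrite /pushforward.
  rewrite (_ : _ @^-1` _ = [set x | forall i, A (s^-1%g i) (tnth x i)]).
    rewrite (@tuple_measure_rect _ (fun i => A (s^-1%g i)))//.
    by rewrite (reindex_inj (@perm_inj _ s))/=; apply: eq_bigr => i _; rewrite permK.
  apply/seteqP; split => x /= h i.
    by have := h (s^-1%g i); rewrite tnth_mktuple permKV.
  by rewrite tnth_mktuple; have := h (s i); rewrite permK.
apply: (measure_unique (@rectangles n) (fun k => [set x | forall i, U k (tnth x i)])).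
- exact: measurable_rectangles.
- move=> _ _ [A mA ->] [A' mA' ->]; exists (fun i => A i `&` A' i).
    by move=> i; exact: measurableI.
  apply/seteqP; split => [x [h1 h2] i|x h]; first by split.
  by split=> i; have [] := h i.
- by move=> i; exists (fun=> U i) => // j; have [] := Ufin i.
- apply/seteqP; split => // x _.
  have /choice[k hk] : forall i, exists k, U k (tnth x i).
    move=> i; have [k _ ?] : (\bigcup_k U k) (tnth x i) by rewrite -Ucov.
    by exists k.
  exists (\max_i k i)%N => // i.
  by have := hk i; apply/subsetPset/ndU/leq_bigmax.
- by move=> _ [A mA ->]; apply: etrans (mperm A mA) _; apply/esym/tuple_measure_rect.
- move=> i; apply: (@le_lt_trans _ _ (\prod_(j < n) mu (U i))%E).
    by rewrite -(mperm (fun=> U i))// => j; have [] := Ufin i.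
  have [mU fU] := Ufin i; rewrite -ge0_fin_numE ?prode_fin_num//.
    by move=> j _; rewrite ge0_fin_numE.
  by apply: prode_ge0 => j _.
Qed.

Lemma integral_perm n (s : 'S_n) (F : n.-tuple Z -> \bar R) :
  measurable_fun setT F -> (forall x, (0 <= F x)%E) ->
  (\int[tm n]_x F (tperm_tuple s x) = \int[tm n]_x F x)%E.
Proof.
move=> mF F0; transitivity (\int[pushforward (tm n) (tperm_tuple s)]_x F x)%E.
  by rewrite ge0_integral_pushforward//; exact: measurable_tperm.
by apply: eq_measure_integral => A mA _; exact: tuple_measure_perm.
Qed.

End sequence_functions.

Ltac solve_mseq := repeat first
  [ exact: mseq_cst | apply: mseq_cat | apply: mseq_take | apply: mseq_drop
  | exact: mseq_id | (apply: mseq_tuple; exact: measurable_fst)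
  | (apply: mseq_tuple; exact: measurable_snd) ].

Lemma ge0_neqNy (R : realType) (x : \bar R) : (0 <= x)%E -> x != -oo%E.
Proof. by case: x. Qed.

(** The weight lets a large constant fall on the small factor; infinite values are allowed. *)
Lemma mule_amgm (R : realType) (lam : R) (x y : \bar R) : 0 < lam -> (0 <= x)%E -> (0 <= y)%E ->
  (x * y <= lam%:E * (x * x) + lam^-1%:E * (y * y))%E.
Proof.
move=> lam0; have lam0' : 0 < lam^-1 by rewrite invr_gt0.
have mulyyE (c : R) : 0 < c -> (c%:E * (+oo * +oo) = +oo :> \bar R)%E.
  by move=> c0; rewrite mulyy gt0_muley ?lte_fin.
have sq0 (c : R) (z : \bar R) : 0 < c -> (0 <= z)%E -> (0 <= c%:E * (z * z))%E.
  by move=> /ltW c0 z0; rewrite !mule_ge0.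
case: x => [x| |]//; last first.
  by move=> _ y0; rewrite mulyyE// addye ?leey//; apply/ge0_neqNy/sq0.
case: y => [y| |]//; last first.
  by move=> x0 _; rewrite (mulyyE _ lam0') addey ?leey//; apply/ge0_neqNy/sq0.
rewrite !lee_fin => x0 y0.
have := sqr_ge0 (lam * x - y / 2) => h.
have -> : lam * (x * x) + lam^-1 * (y * y) = x * y + lam^-1 * ((lam * x - y / 2) ^+ 2 + 3 / 4 * y ^+ 2).
  by field; rewrite gt_eqF.
by rewrite lerDl mulr_ge0 ?(ltW lam0')// addr_ge0// mulr_ge0// sqr_ge0.
Qed.

Lemma sqr_adde3_le (R : realType) (s a b c : \bar R) :
  (0 <= a)%E -> (0 <= b)%E -> (0 <= c)%E -> (`|s| <= a + b + c)%E ->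
  (s * s <= 3%:E * (a * a + b * b + c * c))%E.
Proof.
have oo3 : (3%:E * +oo = +oo :> \bar R)%E by rewrite gt0_muley ?lte_fin.
case: a => [a| |]//; last first.
  by move=> _ b0 c0 _; rewrite mulyy !addye ?oo3 ?leey//; apply/ge0_neqNy/mule_ge0.
case: b => [b| |]//; last first.
  move=> a0 _ c0 _; rewrite mulyy -EFinM addey// addye ?oo3 ?leey//.
  by apply/ge0_neqNy/mule_ge0.
case: c => [c| |]//; last first.
  by move=> a0 b0 _ _; rewrite mulyy -!EFinM -EFinD addey// oo3 leey.
case: s => [s| |]// a0 b0 c0; rewrite ?lee_fin.
rewrite !lee_fin in a0 b0 c0.
move=> s_le; have s2 : s * s <= (a + b + c) * (a + b + c).
  by rewrite -!expr2 -real_normK ?num_real// ler_pXn2r// nnegrE ?addr_ge0.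
have := sqr_ge0 (a - b); have := sqr_ge0 (a - c); have := sqr_ge0 (b - c).
by nra.
Qed.

(** * Continuity of contractions *)

Section contractions.
Context d (Z : measurableType d) (R : realType).
Variable mu : {sigma_finite_measure set Z -> \bar R}.
Local Notation tm := (tuple_measure mu).
Local Notation Iint := (tuple_integral mu).
Implicit Types (F G H : seq Z -> \bar R) (u v : seq Z -> R) (n : nat).

(** Symmetry at every point, not almost everywhere, so that arguments can be permuted inside a
    contraction. *)
Definition psym (V : Type) (F : seq Z -> V) := forall s t, perm_eq s t -> F s = F t.

Lemma smeas_IintG m F (h : seq Z -> seq Z -> seq Z) :
  smeas F -> (forall s, (0 <= F s)%E) ->
  (forall n, exists N, mseq N (fun y : n.-tuple Z * m.-tuple Z => h y.1 y.2)) ->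
  smeas (fun y => Iint m (fun z => F (h y z))).
Proof.
move=> mF F0 mh n; apply: (@measurable_Iint _ _ _ _ _ _ m (fun (y : n.-tuple Z) z => F (h y z))) => //.
by have [N mhN] := mh n; exact: smeas_comp mF mhN.
Qed.

Lemma smeas_mulE F G : smeas F -> smeas G -> smeas (fun s => F s * G s)%E.
Proof. by move=> mF mG n; exact: emeasurable_funM (mF n) (mG n). Qed.

Lemma smeas_addE F G : smeas F -> smeas G -> smeas (fun s => F s + G s)%E.
Proof. by move=> mF mG n; exact: emeasurable_funD (mF n) (mG n). Qed.

Lemma smeas_sqr u : smeas u -> smeas (fun s => (u s ^+ 2)%:E).
Proof. by move=> mu_ n; apply/measurable_EFinP/measurable_funX; exact: mu_. Qed.

Lemma smeas_sub u v : smeas u -> smeas v -> smeas (fun s => u s - v s).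
Proof. by move=> mu_ mv n; exact: measurable_funB (mu_ n) (mv n). Qed.

Lemma smeas_reindex (h : seq Z -> seq Z) d' (V : measurableType d') (F : seq Z -> V) :
  smeas F -> (forall n, exists N, mseq N (fun y : n.-tuple Z => h y)) -> smeas (fun s => F (h s)).
Proof. by move=> mF mh n; have [N mhN] := mh n; exact: smeas_comp mF mhN. Qed.

Lemma IintZl n c F : smeas F -> (forall s, (0 <= F s)%E) -> (0 <= c)%E ->
  Iint n (fun s => c * F s)%E = (c * Iint n F)%E.
Proof. by move=> mF F0 c0; rewrite /Iint ge0_integralZl//; exact: mF. Qed.

Lemma IintZr n c F : smeas F -> (forall s, (0 <= F s)%E) -> (0 <= c)%E ->
  Iint n (fun s => F s * c)%E = (Iint n F * c)%E.
Proof. by move=> mF F0 c0; rewrite /Iint ge0_integralZr//; exact: mF. Qed.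

Lemma Iint_add n F G : smeas F -> smeas G -> (forall s, (0 <= F s)%E) -> (forall s, (0 <= G s)%E) ->
  Iint n (fun s => F s + G s)%E = (Iint n F + Iint n G)%E.
Proof. by move=> mF mG F0 G0; rewrite /Iint ge0_integralD//; [exact: mF|exact: mG]. Qed.

(** [star_contraction] on lists of any length. *)
Definition star (p : nat) u v (r l : nat) (x : seq Z) : \bar R :=
  (\int[tm l]_z (u (z ++ take (p - l) x) * v (z ++ take (r - l) x ++ drop (p - l) x))%:E)%E.

(* The integral over the gamma-variables of the square of the integral over    *)
(* the others: for F = f^2 this is the norm of f star_q^(q - a) f in           *)
(* assumption (i), squared.                                                    *)
Definition block_energy (a b : nat) F : \bar R :=
  Iint a (fun y => Iint b (fun z => F (z ++ y)) * Iint b (fun z => F (z ++ y)))%E.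

Definition sqr_block a n u := block_energy a (n - a) (fun s => (u s ^+ 2)%:E).

Lemma smeas_star p u v r l : smeas u -> smeas v -> smeas (star p u v r l).
Proof.
move=> mu_ mv n.
pose W (y : n.-tuple Z * l.-tuple Z) :=
  (u (y.2 ++ take (p - l) y.1) * v (y.2 ++ take (r - l) y.1 ++ drop (p - l) y.1))%:E.
have mW : measurable_fun setT W.
  apply/measurable_EFinP; apply: measurable_funM; apply: smeas_comp; (try eassumption); solve_mseq.
rewrite (_ : (fun x => _) = (fun x : n.-tuple Z =>
    (\int[tm l]_z W^\+%E (x, z) - \int[tm l]_z W^\-%E (x, z))%E)).
  by apply: emeasurable_funB; apply: measurable_fun_fubini_tonelli_F => //;
    [exact: measurable_funepos|exact: measurable_funeneg].
apply/funext => x; rewrite /star integralE; congr (_ - _)%E; apply: eq_integral => z _.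
  by rewrite !funeposE.
by rewrite !funenegE.
Qed.

(** By Tonelli, the t-variables occur only in the first factor and the s-variables only in the
    second; integrating them out together with the z-variables leaves a single integral over
    gamma. *)
Lemma block_energy_mixed p q r l F G : (l <= r)%N -> (r <= p)%N -> (r <= q)%N ->
  smeas F -> smeas G -> (forall s, (0 <= F s)%E) -> (forall s, (0 <= G s)%E) ->
  psym F -> psym G ->
  Iint (p + q - r - l) (fun x => Iint l (fun z => F (z ++ take (p - l) x)) *
     Iint l (fun z => G (z ++ take (r - l) x ++ drop (p - l) x)))%E =
  Iint (r - l) (fun y => Iint (p - (r - l)) (fun z => F (z ++ y)) *
     Iint (q - (r - l)) (fun z => G (z ++ y)))%E.
Proof.
move=> lr rp rq mF mG F0 G0 sF sG.
have -> : (p + q - r - l = (r - l) + ((p - r) + (q - r)))%N by lia.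
have mI1 : smeas (fun x => Iint l (fun z => F (z ++ take (p - l) x))).
  by apply: smeas_IintG => // n; eexists; solve_mseq.
have mI2 : smeas (fun x => Iint l (fun z => G (z ++ take (r - l) x ++ drop (p - l) x))).
  by apply: smeas_IintG => // n; eexists; solve_mseq.
have I0 m H' (h : seq Z -> seq Z) : (forall s, (0 <= H' s)%E) -> (0 <= Iint m (fun z => H' (h z)))%E.
  by move=> H0; exact: Iint_ge0.
rewrite IintD; last 2 first.
- exact: smeas_mulE.
- by move=> s; rewrite mule_ge0// I0.
apply: eq_Iint => y sy; rewrite IintD; last 2 first.
- exact: (smeas_catr y (smeas_mulE mI1 mI2)).
- by move=> s; rewrite mule_ge0// I0.
transitivity (Iint (p - r) (fun t => Iint l (fun z => F (z ++ (y ++ t))) *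
    Iint (q - r) (fun s => Iint l (fun z => G (z ++ (y ++ s)))))%E).
  apply: eq_Iint => t st; rewrite -IintZl.
  - apply: eq_Iint => s ss; congr (_ * _)%E.
      apply: eq_Iint => z _; congr (F (_ ++ _)).
      by rewrite catA take_size_cat// size_cat sy st; lia.
    apply: eq_Iint => z _; congr (G (_ ++ (_ ++ _))); first by rewrite take_size_cat.
    by rewrite catA drop_size_cat// size_cat sy st; lia.
  - by apply: smeas_IintG => // n; eexists; solve_mseq.
  - by move=> s; exact: I0.
  - exact: I0.
rewrite IintZr; last 3 first.
- by apply: smeas_IintG => // n; eexists; solve_mseq.
- by move=> s; exact: I0.
- by apply: Iint_ge0 => s; exact: I0.
have key m H' : smeas H' -> (forall s, (0 <= H' s)%E) -> psym H' ->
    Iint m (fun t => Iint l (fun z => H' (z ++ y ++ t))) = Iint (l + m) (fun z => H' (z ++ y)).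
  move=> mH H0 sH.
  rewrite IintD; last 2 first.
  - by apply: smeas_reindex mH _ => n; eexists; solve_mseq.
  - by [].
  rewrite [RHS](@Iint_swap _ _ _ _ l m (fun s => H' (s ++ y))); last 2 first.
  - by apply: smeas_reindex mH _ => n; eexists; solve_mseq.
  - by [].
  apply: eq_Iint => t st; apply: eq_Iint => z sz; apply: sH.
  by rewrite -catA perm_cat2l perm_catC.
rewrite !key//; congr (Iint _ _ * Iint _ _)%E; lia.
Qed.

(** Telescoping into the old contraction, (u' - u) star v' and u star (v' - v); the 3 comes from
    squaring a sum of three terms. Each error is bounded by Cauchy-Schwarz and split with weight
    lam, so that the small difference may be multiplied by lam while the other factor is divided by
    it. *)
Lemma contraction_le p q r l u v u' v' lam : 0 < lam ->
  (l <= r)%N -> (r <= p)%N -> (r <= q)%N ->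
  smeas u -> smeas v -> smeas u' -> smeas v' ->
  psym u -> psym v -> psym u' -> psym v' ->
  (Iint (p + q - r - l) (fun x => star p u' v' r l x * star p u' v' r l x) <=
   3%:E * (Iint (p + q - r - l) (fun x => star p u v r l x * star p u v r l x)
     + (lam%:E * sqr_block (r - l) p (fun s => u' s - u s)%R + lam^-1%:E * sqr_block (r - l) q v')
     + (lam^-1%:E * sqr_block (r - l) p u + lam%:E * sqr_block (r - l) q (fun s => v' s - v s)%R)))%E.
Proof.
move=> lam0 lr rp rq mu_ mv mu' mv' su sv su' sv'; set be := sqr_block (r - l).
have lamV0 : 0 < lam^-1 by rewrite invr_gt0.
set n := (p + q - r - l)%N.
have sq0 w (s : seq Z) : (0 <= (w s ^+ 2)%:E :> \bar R)%E by rewrite lee_fin sqr_ge0.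
have sd (w w' : seq Z -> R) : psym w -> psym w' -> psym (fun s => w s - w' s) by move=> h h' s t /[dup] /h -> /h' ->.
have s2 (w : seq Z -> R) : psym w -> psym (fun s => (w s ^+ 2)%:E) by move=> h s t /h ->.
have be0 w m : (0 <= be m w)%E by apply: Iint_ge0 => s; rewrite mule_ge0//; exact: Iint_ge0.
pose U (w1 w2 : seq Z -> R) x := Iint l (fun z => `|w1 (z ++ take (p - l) x) * w2 (z ++ take (r - l) x ++ drop (p - l) x)|%:E).
have U0 (w1 w2 : seq Z -> R) x : (0 <= U w1 w2 x)%E by apply: Iint_ge0 => s; rewrite lee_fin.
have mU (w1 w2 : seq Z -> R) : smeas w1 -> smeas w2 -> smeas (U w1 w2).
  move=> m1 m2 k; apply: (@measurable_Iint _ _ _ _ _ _ l (fun (y : k.-tuple Z) z =>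
    `|w1 (z ++ take (p - l) y) * w2 (z ++ take (r - l) y ++ drop (p - l) y)|%:E)).
    by apply/measurable_EFinP; apply: measurableT_comp => //; apply: measurable_funM;
       apply: smeas_comp; (try eassumption); solve_mseq.
  by move=> *; rewrite lee_fin.
(* Cauchy-Schwarz in the integrated variables, separation by [block_energy_mixed], then the weighted
   inequality. *)
have UE (w1 w2 : seq Z -> R) (c : R) : 0 < c -> smeas w1 -> smeas w2 -> psym w1 -> psym w2 ->
    (Iint n (fun x => U w1 w2 x * U w1 w2 x) <= c%:E * be p w1 + c^-1%:E * be q w2)%E.
  move=> c0 m1 m2 p1 p2.
  have mI a (w : seq Z -> R) : smeas w -> smeas (fun y => Iint a (fun z => (w (z ++ y) ^+ 2)%:E)).
    move=> mw; apply: (@smeas_IintG a (fun s => (w s ^+ 2)%:E) (fun y z => z ++ y)) => //.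
      exact: smeas_sqr.
    by move=> k; eexists; solve_mseq.
  apply: (@le_trans _ _ (Iint n (fun x => Iint l (fun z => (w1 (z ++ take (p - l) x) ^+ 2)%:E) *
     Iint l (fun z => (w2 (z ++ take (r - l) x ++ drop (p - l) x) ^+ 2)%:E))%E)).
    apply: le_Iint.
    - by apply: smeas_mulE; exact: mU.
    - apply: smeas_mulE.
        apply: (@smeas_IintG l (fun s => (w1 s ^+ 2)%:E) (fun y z => z ++ take (p - l) y)) => //.
          exact: smeas_sqr.
        by move=> k; eexists; solve_mseq.
      apply: (@smeas_IintG l (fun s => (w2 s ^+ 2)%:E) (fun y z => z ++ take (r - l) y ++ drop (p - l) y)) => //.
        exact: smeas_sqr.
      by move=> k; eexists; solve_mseq.
    - by move=> s; rewrite mule_ge0.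
    - move=> s _; apply: (@cauchy_schwarz _ _ _ (tm l) (fun z => w1 (z ++ take (p - l) s))
        (fun z => w2 (z ++ take (r - l) s ++ drop (p - l) s))); apply: smeas_comp; (try eassumption); solve_mseq.
  rewrite (@block_energy_mixed p q r l (fun s => (w1 s ^+ 2)%:E) (fun s => (w2 s ^+ 2)%:E))//; try exact: smeas_sqr; try exact: s2.
  rewrite /be /sqr_block /block_energy -IintZl; last 3 first.
  - by apply: smeas_mulE; exact: mI.
  - by move=> s; rewrite mule_ge0//; exact: Iint_ge0.
  - by rewrite lee_fin ltW.
  rewrite -IintZl; last 3 first.
  - by apply: smeas_mulE; exact: mI.
  - by move=> s; rewrite mule_ge0//; exact: Iint_ge0.
  - by rewrite lee_fin invr_ge0 ltW.
  have mc (w : seq Z -> R) a (k : R) : smeas w -> smeas (fun s => k%:E * (Iint a (fun z => (w (z ++ s) ^+ 2)%:E) *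
       Iint a (fun z => (w (z ++ s) ^+ 2)%:E)))%E.
    move=> mw j; apply: emeasurable_funM => //.
    by apply: emeasurable_funM; exact: mI.
  have k0 (w : seq Z -> R) a (k : R) s : 0 <= k -> (0 <= k%:E * (Iint a (fun z => (w (z ++ s) ^+ 2)%:E) *
       Iint a (fun z => (w (z ++ s) ^+ 2)%:E)))%E.
    by move=> h; rewrite mule_ge0 ?mule_ge0 ?lee_fin//; exact: Iint_ge0.
  rewrite -Iint_add; last 4 first.
  - exact: mc.
  - exact: mc.
  - by move=> s; apply: k0; exact: ltW.
  - by move=> s; apply: k0; rewrite invr_ge0 ltW.
  apply: le_Iint.
  - by apply: smeas_mulE; exact: mI.
  - by apply: smeas_addE; exact: mc.
  - by move=> s; rewrite mule_ge0//; exact: Iint_ge0.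
  - by move=> s _; apply: mule_amgm => //; exact: Iint_ge0.
have mS (w1 w2 : seq Z -> R) : smeas w1 -> smeas w2 -> smeas (fun x => star p w1 w2 r l x * star p w1 w2 r l x)%E.
  by move=> m1 m2; apply: smeas_mulE; exact: smeas_star.
have S0 (w1 w2 : seq Z -> R) x : (0 <= star p w1 w2 r l x * star p w1 w2 r l x)%E.
  by case: (star p w1 w2 r l x) => [y| |]//; rewrite lee_fin -expr2 sqr_ge0.
have md1 : smeas (fun s => u' s - u s) by exact: smeas_sub.
have md2 : smeas (fun s => v' s - v s) by exact: smeas_sub.
have mUU (w1 w2 : seq Z -> R) : smeas w1 -> smeas w2 -> smeas (fun x => U w1 w2 x * U w1 w2 x)%E.
  by move=> m1 m2; apply: smeas_mulE; exact: mU.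
apply: (@le_trans _ _ (Iint n (fun x => 3%:E * (star p u v r l x * star p u v r l x
   + U (fun s => u' s - u s)%R v' x * U (fun s => u' s - u s)%R v' x
   + U u (fun s => v' s - v s)%R x * U u (fun s => v' s - v s)%R x)))%E).
  apply: le_Iint => //.
  - exact: mS.
  - move=> k; apply: emeasurable_funM => //.
    have m1 := mS _ _ mu_ mv; have m2 := mUU _ _ md1 mv'; have m3 := mUU _ _ mu_ md2.
    by apply: emeasurable_funD; [apply: emeasurable_funD|]; [exact: m1|exact: m2|exact: m3].
  - move=> x _.
    rewrite -[(star p u v r l x * _)%E]gee0_abs// abseM.
    apply: sqr_adde3_le => //.
    rewrite -addeA.
    apply: (@le_trans _ _ (`|star p u v r l x| + \int[tm l]_z
      (`|(u' (z ++ take (p - l) x) - u (z ++ take (p - l) x)) *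
          v' (z ++ take (r - l) x ++ drop (p - l) x)|%:E +
       `|u (z ++ take (p - l) x) * (v' (z ++ take (r - l) x ++ drop (p - l) x) -
          v (z ++ take (r - l) x ++ drop (p - l) x))|%:E))%E).
      have mm1 (w : seq Z -> R) : smeas w -> measurable_fun setT (fun z : l.-tuple Z => w (z ++ take (p - l) x)).
        by move=> mw; apply: smeas_comp mw _; solve_mseq.
      have mm2 (w : seq Z -> R) : smeas w -> measurable_fun setT (fun z : l.-tuple Z => w (z ++ take (r - l) x ++ drop (p - l) x)).
        by move=> mw; apply: smeas_comp mw _; solve_mseq.
      apply: abse_integral_le.
      - by apply: measurable_funM; [exact: mm1|exact: mm2].
      - by apply: measurable_funM; [exact: mm1|exact: mm2].
      - apply: emeasurable_funD; apply/measurable_EFinP; apply: measurableT_comp => //;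
          apply: measurable_funM; try exact: mm1; try exact: mm2; apply: measurable_funB; try exact: mm1; exact: mm2.
      - move=> z; rewrite -EFinD lee_fin.
        by apply: le_trans (ler_normD _ _); rewrite le_eqVlt; apply/orP; left; apply/eqP; congr (`|_|); ring.
    rewrite leeD2l// ge0_integralD//.
    - apply/measurable_EFinP; apply: measurableT_comp => //; apply: measurable_funM; [|apply: smeas_comp mv' _; solve_mseq].
      by apply: (smeas_comp md1 (n := (l + minn (p - l) (size x))%N)); solve_mseq.
    - apply/measurable_EFinP; apply: measurableT_comp => //; apply: measurable_funM; [apply: smeas_comp mu_ _; solve_mseq|].
      by apply: (smeas_comp md2); solve_mseq.
rewrite IintZl; last 3 first.
- by apply: smeas_addE; [apply: smeas_addE|]; [exact: mS|exact: mUU|exact: mUU].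
- by move=> s; rewrite !adde_ge0// mule_ge0.
- by rewrite lee_fin.
rewrite lee_pmul2l//.
rewrite Iint_add; last 4 first.
- by apply: smeas_addE; [exact: mS|exact: mUU].
- exact: mUU.
- by move=> s; rewrite !adde_ge0// mule_ge0.
- by move=> s; rewrite mule_ge0.
rewrite Iint_add; last 4 first.
- exact: mS.
- exact: mUU.
- by [].
- by move=> s; rewrite mule_ge0.
apply: leeD; first by rewrite leeD2l//; apply: UE => //; exact: sd.
by have := @UE u (fun s => v' s - v s) lam^-1; rewrite invrK; apply => //; exact: sd.
Qed.

End contractions.

(** * Everywhere symmetric versions of kernels *)

Section symmetric_versions.
Context d (Z : measurableType d) (R : realType).
Variable mu : {sigma_finite_measure set Z -> \bar R}.
Local Notation tm := (tuple_measure mu).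
Local Notation Iint := (tuple_integral mu).

Lemma kernel_atE q (f : q.-tuple Z -> R) (x : q.-tuple Z) : kernel_at f x = f x.
Proof. by rewrite /kernel_at valK. Qed.

Lemma kernel_at_size q (f : q.-tuple Z -> R) s : size s != q -> kernel_at f s = 0.
Proof. by move=> sq; rewrite /kernel_at insubN. Qed.

Lemma smeas_kernel_at q (f : q.-tuple Z -> R) : measurable_fun setT f -> smeas (kernel_at f).
Proof.
move=> mf n; have [nq|nq] := eqVneq n q.
  by case: q / nq f mf => f mf; under eq_fun do rewrite kernel_atE.
rewrite (_ : (fun x => _) = cst 0); first exact: measurable_cst.
by apply/funext => x; rewrite kernel_at_size// size_tuple.
Qed.

Definition symmetrize (A : Type) q (f : q.-tuple A -> R) (x : q.-tuple A) : R :=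
  (q`!%:R)^-1 * \sum_(s : 'S_q) f [tuple tnth x (s i) | i < q].

Lemma symmetrize_perm (A : Type) q (f : q.-tuple A -> R) (x : q.-tuple A) (s : 'S_q) :
  symmetrize f [tuple tnth x (s i) | i < q] = symmetrize f x.
Proof.
rewrite /symmetrize; congr (_ * _).
rewrite [RHS](reindex_inj (mulIg s)) /=; apply: eq_bigr => t _; congr f.
by apply: eq_from_tnth => i; rewrite !tnth_mktuple permM.
Qed.

Lemma psym_kernel_at q (f : q.-tuple Z -> R) :
  (forall s : 'S_q, forall x, f [tuple tnth x (s i) | i < q] = f x) -> psym (kernel_at f).
Proof.
move=> sf s t st; have [sq|sq] := eqVneq (size t) q; last first.
  by rewrite !kernel_at_size// (perm_size st).
case: q / sq f sf => f sf.
have /tuple_permP[p ->] : perm_eq s (in_tuple t) by [].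
by rewrite kernel_atE sf; apply/esym/(kernel_atE f (in_tuple t)).
Qed.

(** Averaging over the finitely many permutations alters f only on a finite union of null sets. *)
Lemma symmetric_version q (f : q.-tuple Z -> R) : measurable_fun setT f ->
  ae_symmetric mu f -> exists g : q.-tuple Z -> R, [/\ measurable_fun setT g,
    psym (kernel_at g) & {ae tm q, forall x, f x = g x}].
Proof.
move=> mf sf; exists (symmetrize f); split.
- apply: measurable_funM => //; apply: measurable_sum => s.
  exact: (measurableT_comp mf (measurable_tperm s)).
- by apply: psym_kernel_at => s x; exact: symmetrize_perm.
- have : {ae tm q, forall x, forall s : 'S_q, f [tuple tnth x (s i) | i < q] = f x}.
    by apply: filter_forall => s; exact: sf.
  apply: filterS => x h; rewrite /symmetrize.
  under eq_bigr do rewrite h.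
  rewrite sumr_const -[#|_|]/(#|'S_q|) card_Sn -[f x *+ _]mulr_natl mulrA mulVf ?mul1r//.
Qed.

Lemma ae_zeroP q (F : seq Z -> \bar R) : smeas F -> (forall s, (0 <= F s)%E) ->
  Iint q F = 0%E <-> {ae tm q, forall x, F (tval x) = 0%E}.
Proof.
move=> mF F0; have := @ae_eq_integral_abs _ _ _ (tm q) setT measurableT (fun x => F (tval x)) (mF q).
rewrite (eq_integral (fun x => F (tval x))); last by move=> x _; rewrite gee0_abs.
rewrite /Iint => ->; split; first by apply: filterS => x; exact.
by apply: filterS => x + _.
Qed.

Lemma ae_zero q (F : seq Z -> \bar R) : smeas F -> (forall s, (0 <= F s)%E) ->
  Iint q F = 0%E -> {ae tm q, forall x, F (tval x) = 0%E}.
Proof. by move=> mF F0; apply: (ae_zeroP q mF F0).1. Qed.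

Lemma Iint_zero n (F : seq Z -> \bar R) : (forall s, size s = n -> F s = 0%E) -> Iint n F = 0%E.
Proof. by move=> F0; rewrite (@eq_Iint _ _ _ _ _ _ (cst 0%E))// /Iint integral0. Qed.

(** By Tonelli the integral of |f - f'| over z and over the variables seen by f is 0 whatever the
    other variables are, and likewise for g; so for almost every x the two integrands agree for
    almost every z. *)
Lemma eq_star_norm p q r l (f f' : p.-tuple Z -> R) (g g' : q.-tuple Z -> R) :
  (l <= r)%N -> (r <= p)%N -> (r <= q)%N ->
  measurable_fun setT f -> measurable_fun setT f' ->
  measurable_fun setT g -> measurable_fun setT g' ->
  {ae tm p, forall x, f x = f' x} -> {ae tm q, forall x, g x = g' x} ->
  star_contraction_norm mu f g r l = star_contraction_norm mu f' g' r l.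
Proof.
move=> lr rp rq mf mf' mg mg' ff' gg'.
pose D m (h h' : m.-tuple Z -> R) (s : seq Z) : \bar R := `|kernel_at h s - kernel_at h' s|%:E.
have mD m (h h' : m.-tuple Z -> R) : measurable_fun setT h -> measurable_fun setT h' -> smeas (D m h h').
  move=> mh mh' k; apply/measurable_EFinP; apply: measurableT_comp => //.
  by apply: measurable_funB; exact: smeas_kernel_at.
have D0 m (h h' : m.-tuple Z -> R) s : (0 <= D m h h' s)%E by rewrite lee_fin.
have DI m (h h' : m.-tuple Z -> R) : measurable_fun setT h -> measurable_fun setT h' ->
    {ae tm m, forall x, h x = h' x} -> Iint m (D m h h') = 0%E.
  move=> mh mh' hh'; apply/ae_zeroP => //; first exact: mD.
  by apply: filterS hh' => x hx; rewrite /D !kernel_atE hx subrr normr0.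
set n := (p + q - r - l)%N.
have nE : n = (r - l + ((p - r) + (q - r)))%N by rewrite /n; lia.
have m1 : smeas (fun x => Iint l (fun z => D p f f' (z ++ take (p - l) x))).
  by apply: (@smeas_IintG _ _ _ _ l (D p f f') (fun x z => z ++ take (p - l) x)) => //; [exact: mD|move=> k; eexists; solve_mseq].
have m2 : smeas (fun x => Iint l (fun z => D q g g' (z ++ take (r - l) x ++ drop (p - l) x))).
  by apply: (@smeas_IintG _ _ _ _ l (D q g g') (fun x z => z ++ take (r - l) x ++ drop (p - l) x)) => //; [exact: mD|move=> k; eexists; solve_mseq].
have I1 s : (0 <= Iint l (fun z => D p f f' (z ++ take (p - l) s)))%E by exact: Iint_ge0.
have I2 s : (0 <= Iint l (fun z => D q g g' (z ++ take (r - l) s ++ drop (p - l) s)))%E by exact: Iint_ge0.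
have A1 : Iint n (fun x => Iint l (fun z => D p f f' (z ++ take (p - l) x))) = 0%E.
  rewrite (_ : n = ((p - l) + (q - r))%N); last by rewrite nE; lia.
  rewrite IintD//.
  rewrite (@Iint_swap _ _ _ _ _ _ (fun x => Iint l (fun z => D p f f' (z ++ take (p - l) x))))//.
  apply: Iint_zero => s _.
  transitivity (Iint (p - l) (fun y => Iint l (fun z => D p f f' (z ++ y)))).
    by apply: eq_Iint => y sy; apply: eq_Iint => z _; rewrite take_size_cat.
  rewrite -Iint_swap//; last exact: mD.
  by rewrite -IintD ?subnKC ?DI//; [exact: leq_trans lr rp|exact: mD].
have A2 : Iint n (fun x => Iint l (fun z => D q g g' (z ++ take (r - l) x ++ drop (p - l) x))) = 0%E.
  rewrite nE IintD//.
  have mc : smeas (fun y => Iint (q - r) (fun s => Iint l (fun z => D q g g' (z ++ (y ++ s))))).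
    apply: (@smeas_IintG _ _ _ _ (q - r) (fun x => Iint l (fun z => D q g g' (z ++ x))) (fun y s => y ++ s)).
    - by apply: smeas_Iintl => //; exact: mD.
    - by move=> s; exact: Iint_ge0.
    - by move=> k; eexists; solve_mseq.
  transitivity (Iint (r - l) (fun y => Iint (p - r) (fun t => Iint (q - r) (fun s =>
      Iint l (fun z => D q g g' (z ++ (take (r - l) (y ++ t) ++ s))))))).
    apply: eq_Iint => y sy; rewrite IintD; last 2 first.
    - exact: (smeas_catr y m2).
    - by move=> s; exact: Iint_ge0.
    apply: eq_Iint => t st; apply: eq_Iint => s ss; apply: eq_Iint => z _.
    congr (D _ _ _ (_ ++ (_ ++ _))); first by rewrite !take_size_cat.
    by rewrite catA drop_size_cat// size_cat sy st; lia.
  rewrite (@Iint_swap _ _ _ _ _ _ (fun x => Iint (q - r) (fun s =>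
      Iint l (fun z => D q g g' (z ++ (take (r - l) x ++ s)))))).
  - apply: Iint_zero => t st.
    transitivity (Iint (r - l) (fun y => Iint (q - r) (fun s => Iint l (fun z => D q g g' (z ++ (y ++ s)))))).
      apply: eq_Iint => y sy; apply: eq_Iint => s _; apply: eq_Iint => z _.
      by rewrite take_size_cat.
    rewrite -(@IintD _ _ _ _ _ _ (fun x => Iint l (fun z => D q g g' (z ++ x)))); last 2 first.
    - by apply: smeas_Iintl => //; exact: mD.
    - by move=> s; exact: Iint_ge0.
    rewrite -Iint_swap//; last exact: mD.
    rewrite -IintD//; last exact: mD.
    by rewrite (_ : (l + _)%N = q) ?DI//; lia.
  - by apply: (smeas_reindex mc (h := fun x => take (r - l) x)) => k; eexists; solve_mseq.
  - by move=> s; apply: Iint_ge0 => x; exact: Iint_ge0.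
have {}A1 := ae_zero m1 I1 A1.
have {}A2 := ae_zero m2 I2 A2.
have E : {ae tm n, forall x, star_contraction mu f g x = star_contraction mu f' g' x :> \bar R}.
  near=> x.
  have B1 : Iint l (fun z => D p f f' (z ++ take (p - l) x)) = 0%E by near: x; exact: A1.
  have B2 : Iint l (fun z => D q g g' (z ++ take (r - l) x ++ drop (p - l) x)) = 0%E by near: x; exact: A2.
  have c1 : smeas (fun z => D p f f' (z ++ take (p - l) x)).
    by apply: smeas_reindex; [exact: mD|move=> k; eexists; solve_mseq].
  have c2 : smeas (fun z => D q g g' (z ++ take (r - l) x ++ drop (p - l) x)).
    by apply: smeas_reindex; [exact: mD|move=> k; eexists; solve_mseq].
  have {}B1 := ae_zero c1 (fun s => D0 _ _ _ _) B1.
  have {}B2 := ae_zero c2 (fun s => D0 _ _ _ _) B2.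
  have mm (h1 : p.-tuple Z -> R) (h2 : q.-tuple Z -> R) : measurable_fun setT h1 -> measurable_fun setT h2 ->
      measurable_fun setT (fun z : l.-tuple Z => (kernel_at h1 (z ++ take (p - l) x) *
         kernel_at h2 (z ++ take (r - l) x ++ drop (p - l) x))%:E).
    move=> mh1 mh2; apply/measurable_EFinP; apply: measurable_funM;
      apply: smeas_comp; try (by apply: smeas_kernel_at; eassumption); solve_mseq.
  apply: ae_eq_integral => //; [exact: mm|exact: mm|].
  move: B1 B2; apply: filterS2 => z + + _.
  by move=> /eqP; rewrite eqe normr_eq0 subr_eq0 => /eqP -> /eqP; rewrite eqe normr_eq0 subr_eq0 => /eqP ->.
have mstar (h1 : p.-tuple Z -> R) (h2 : q.-tuple Z -> R) : measurable_fun setT h1 -> measurable_fun setT h2 ->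
    measurable_fun setT (fun x : n.-tuple Z => star_contraction mu h1 h2 x).
  by move=> mh1 mh2; apply: smeas_star; exact: smeas_kernel_at.
by apply: eq_Lnorm2_ae; [exact: mstar|exact: mstar|exact: E].
Unshelve. all: by end_near.
Qed.

End symmetric_versions.

Ltac solve_clip := repeat match goal with
  | |- context [Order.min ?a ?b] => case: (leP a b) => ?
  | |- context [Order.max ?a ?b] => case: (leP a b) => ?
  end; lra.

(** * Truncation of kernels and stability of contractions *)

Section truncation.
Context d (Z : measurableType d) (R : realType).
Variable mu : {sigma_finite_measure set Z -> \bar R}.
Local Notation tm := (tuple_measure mu).
Local Notation Iint := (tuple_integral mu).

Definition clip (c y : R) : R := Num.max (- c) (Num.min c y).

Lemma clip_le c y : 0 <= c -> `|clip c y| <= c.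
Proof.
move=> c0; rewrite /clip ler_norml le_max lexx/= ge_max ge_min lexx/=.
by rewrite andbT; lra.
Qed.

Lemma clip_id c y : `|y| <= c -> clip c y = y.
Proof. by rewrite ler_norml => /andP[h1 h2]; rewrite /clip min_r// max_r. Qed.

Lemma clip_lip c y y' : `|clip c y - clip c y'| <= `|y - y'|.
Proof.
have := ler_norm (y - y'); have := ler_norm (y' - y); rewrite (distrC y' y) /clip => h1 h2.
by rewrite ler_norml; apply/andP; split; solve_clip.
Qed.

Definition inV (V : set Z) (s : seq Z) : bool := all (fun z => z \in V) s.

Definition trunc c V (u : seq Z -> R) (s : seq Z) : R := if inV V s then clip c (u s) else 0.

Lemma inV_perm V s t : perm_eq s t -> inV V s = inV V t.
Proof. exact: perm_all. Qed.

Lemma psym_trunc c V u : psym u -> psym (trunc c V u).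
Proof. by move=> su s t st; rewrite /trunc (inV_perm _ st) (su _ _ st). Qed.

Lemma inVE n V (x : n.-tuple Z) : inV V x = (x \in [set x | forall i, V (tnth x i)]).
Proof.
apply/idP/idP; first by move/all_tnthP => h; apply: mem_set => i; exact: set_mem.
by rewrite inE => h; apply/all_tnthP => i; exact: mem_set.
Qed.

Lemma measurable_inV n V : measurable V -> measurable_fun setT (fun x : n.-tuple Z => inV V x).
Proof.
move=> mV; apply: (@measurable_fun_bool _ _ _ _ true).
rewrite setTI (_ : _ @^-1` _ = [set x : n.-tuple Z | forall i, V (tnth x i)]); last first.
  apply/seteqP; split => x /=.
    by move/all_tnthP => h i; exact: set_mem.
  by move=> h; apply/all_tnthP => i; exact: mem_set.
exact: (@measurable_rect _ _ _ (fun=> V)).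
Qed.

Lemma smeas_trunc c V u : measurable V -> smeas u -> smeas (trunc c V u).
Proof.
move=> mV mu_ n; apply: measurable_fun_ifT.
- exact: measurable_inV.
- by apply: measurable_maxr => //; apply: measurable_minr => //; exact: mu_.
- exact: measurable_cst.
Qed.

Lemma trunc_le c V u s : 0 <= c -> `|trunc c V u s| <= if inV V s then c else 0.
Proof. by move=> c0; rewrite /trunc; case: ifP; rewrite ?normr0// => _; exact: clip_le. Qed.

Lemma sub_trunc_norm (c : R) V (u : seq Z -> R) s : 0 <= c -> `|u s - trunc c V u s| <= `|u s|.
Proof.
move=> c0; rewrite /trunc; case: ifP; rewrite ?subr0// => _.
rewrite /clip; have := ler_norm (u s); have := ler_norm (- u s); rewrite normrN => h1 h2.
by rewrite ler_norml; apply/andP; split; solve_clip.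
Qed.

Let sq0 (w : seq Z -> R) (s : seq Z) : (0 <= (w s ^+ 2)%:E :> \bar R)%E.
Proof. by rewrite lee_fin sqr_ge0. Qed.

(** Written as a single integral, the block energy is accessible to dominated convergence in
    [trunc_cvg]. *)
Lemma sqr_block_expand a q u : smeas u -> sqr_block mu a q u =
  Iint (a + ((q - a) + (q - a))) (fun x =>
    (u (take (q - a) (drop a x) ++ take a x) ^+ 2 * u (drop (a + (q - a)) x ++ take a x) ^+ 2)%:E).
Proof.
move=> mu_; set b := (q - a)%N.
have m2 := smeas_sqr mu_.
have mW : smeas (fun x => ((u (take b (drop a x) ++ take a x) ^+ 2 * u (drop (a + b) x ++ take a x) ^+ 2)%:E)).
  move=> n; apply/measurable_EFinP; apply: measurable_funM; apply: measurable_funX;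
  apply: smeas_comp; try eassumption; solve_mseq.
rewrite IintD//; last by move=> s; rewrite lee_fin mulr_ge0 ?sqr_ge0.
apply: eq_Iint => y sy.
rewrite IintD; last 2 first.
- exact: (smeas_catr y mW).
- by move=> s; rewrite lee_fin mulr_ge0 ?sqr_ge0.
have my : smeas (fun z => (u (z ++ y) ^+ 2)%:E).
  by apply: (smeas_reindex m2 (h := fun z => z ++ y)) => k; eexists; solve_mseq.
rewrite -IintZr//; last exact: Iint_ge0.
apply: eq_Iint => z sz; rewrite -IintZl//.
apply: eq_Iint => t st; rewrite -EFinM; congr (_%:E).
rewrite take_size_cat// drop_size_cat// take_size_cat//.
by rewrite catA drop_size_cat// size_cat sy sz.
Qed.

Lemma sqr_block0E a q (u : seq Z -> R) : smeas u -> (a <= q)%N -> psym u ->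
  Iint q (fun s => (u s ^+ 2)%:E) = Iint a (fun y => Iint (q - a) (fun z => (u (z ++ y) ^+ 2)%:E)).
Proof.
move=> mu_ aq su; have m2 := smeas_sqr mu_.
transitivity (Iint (a + (q - a)) (fun s => (u s ^+ 2)%:E)); first by rewrite subnKC.
rewrite (@IintD _ _ _ mu a (q - a) _ m2 (sq0 u)); apply: eq_Iint => y _; apply: eq_Iint => z _.
by rewrite (su _ (z ++ y))// perm_catC.
Qed.

(** One of the two inner integrals is bounded by c^2 times the mass of V^(q - a); the other one
    integrates to the squared L^2 norm. *)
Lemma sqr_block_bounded a q (c : R) V (u : seq Z -> R) : 0 <= c -> measurable V -> (mu V < +oo)%E ->
  smeas u -> psym u -> (a <= q)%N -> (forall s, `|u s| <= if inV V s then c else 0) ->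
  (sqr_block mu a q u <= (c ^+ 2 * fine (mu V) ^+ (q - a))%:E * Iint q (fun s => (u s ^+ 2)%:E))%E.
Proof.
move=> c0 mV fV mu_ su aq ub; have m2 := smeas_sqr mu_.
have mI : smeas (fun y => Iint (q - a) (fun z => (u (z ++ y) ^+ 2)%:E)).
  by apply: smeas_Iintl m2 (sq0 u).
have I0 y : (0 <= Iint (q - a) (fun z => (u (z ++ y) ^+ 2)%:E))%E by exact: Iint_ge0.
rewrite (sqr_block0E mu_ aq su) -IintZl//; last first.
  by rewrite lee_fin mulr_ge0 ?sqr_ge0// exprn_ge0// fine_ge0.
apply: le_Iint => //.
- exact: smeas_mulE.
- by move=> n; apply: emeasurable_funM => //; exact: mI.
- by move=> s; rewrite mule_ge0.
move=> y _; apply: lee_wpmul2r => //.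
have mind : smeas (fun z => (c ^+ 2 * (inV V z)%:R)%:E).
  move=> n; apply/measurable_EFinP; apply: measurable_funM => //.
  rewrite (_ : (fun z => _) = (fun z : n.-tuple Z => if inV V z then 1 else 0)).
    by apply: measurable_fun_ifT => //; exact: measurable_inV.
  by apply/funext => z; case: inV.
apply: (@le_trans _ _ (Iint (q - a) (fun z => (c ^+ 2 * (inV V z)%:R)%:E))).
  apply: le_Iint => //.
    by apply: (smeas_reindex m2 (h := fun z => z ++ y)) => k; eexists; solve_mseq.
  move=> z _; rewrite lee_fin -real_normK ?num_real//.
  have := ub (z ++ y); rewrite /inV all_cat -!/(inV _ _).
  case: (inV V z) => /=; last first.
    by rewrite normr_le0 => /eqP ->; rewrite normr0 expr0n mulr0.
  rewrite mulr1 => h; rewrite lerXn2r ?nnegrE//; apply: (le_trans h).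
  by case: ifP.
rewrite /Iint (eq_integral (fun z => (c ^+ 2)%:E * (\1_[set x : (q - a).-tuple Z | forall i, V (tnth x i)] z)%:E)%E); last first.
  by move=> z _; rewrite -EFinM indicE inVE.
rewrite ge0_integralZl//; last 2 first.
- apply/measurable_EFinP/measurable_indic; exact: (@measurable_rect _ _ _ (fun=> V)).
- by rewrite lee_fin sqr_ge0.
rewrite integral_indic; [|exact: measurableT|exact: (@measurable_rect _ _ _ (fun=> V))].
rewrite setIT.
rewrite [X in (_ * X <= _)%E](_ : _ = (fine (mu V) ^+ (q - a))%:E); first by rewrite -EFinM.
apply: etrans (@tuple_measure_rect _ _ _ mu (q - a) (fun=> V) (fun=> mV)) _.
have -> : mu V = (fine (mu V))%:E by rewrite fineK// ge0_fin_numE.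
by rewrite prodEFin prodr_const card_ord.
Qed.

(** The inner integral of w^2 is at most twice the sum of the other two; squaring gives 3 from
    [sqr_adde3_le] with a zero third term and 4 from the doubling, hence 12. *)
Lemma block_add a q (w w1 w2 : seq Z -> R) : smeas w -> smeas w1 -> smeas w2 ->
  (forall s, `|w s| <= `|w1 s| + `|w2 s|) ->
  (sqr_block mu a q w <= 12%:E * (sqr_block mu a q w1 + sqr_block mu a q w2))%E.
Proof.
move=> mw mw1 mw2 ww; rewrite /sqr_block /block_energy; set b := (q - a)%N.
pose J (h : seq Z -> R) y := Iint b (fun z => (h (z ++ y) ^+ 2)%:E).
have mJ (h : seq Z -> R) : smeas h -> smeas (J h).
  by move=> mh; apply: smeas_Iintl (smeas_sqr mh) (sq0 h).
have J0 h y : (0 <= J h y)%E by exact: Iint_ge0.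
have JJ0 h y : (0 <= J h y * J h y)%E by rewrite mule_ge0.
have mJJ (h : seq Z -> R) : smeas h -> smeas (fun y => J h y * J h y)%E.
  by move=> mh; apply: smeas_mulE; exact: mJ.
have mA : smeas (fun y => J w1 y * J w1 y + J w2 y * J w2 y)%E.
  by apply: smeas_addE; exact: mJJ.
change (Iint a (fun y => J w y * J w y) <= 12%:E * (Iint a (fun y => J w1 y * J w1 y) +
  Iint a (fun y => J w2 y * J w2 y)))%E.
rewrite -Iint_add; [|exact: mJJ|exact: mJJ|by []|by []].
rewrite -IintZl//; last by move=> s; rewrite adde_ge0.
apply: le_Iint => //; first exact: mJJ.
  by move=> n; apply: emeasurable_funM => //; exact: mA.
move=> y _.
have Jle : (J w y <= 2%:E * J w1 y + 2%:E * J w2 y)%E.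
  have m2 (h : seq Z -> R) : smeas h -> smeas (fun z => (h (z ++ y) ^+ 2)%:E).
    by move=> mh; apply: (smeas_reindex (smeas_sqr mh) (h := fun z => z ++ y)) => k; eexists; solve_mseq.
  have m22 (h : seq Z -> R) : smeas h -> smeas (fun z => 2%:E * (h (z ++ y) ^+ 2)%:E)%E.
    by move=> mh n; apply: emeasurable_funM => //; exact: m2.
  have p22 (h : seq Z -> R) s : (0 <= 2%:E * (h (s ++ y) ^+ 2)%:E)%E by rewrite mule_ge0.
  rewrite /J -!IintZl//; [|exact: m2|exact: m2].
  rewrite -Iint_add//; [|exact: m22|exact: m22].
  apply: le_Iint => //; first exact: m2.
    by apply: smeas_addE; exact: m22.
  move=> z _; rewrite lee_fin -mulrDr.
  have h := ww (z ++ y); rewrite -(real_normK (num_real (w _))) -(real_normK (num_real (w1 _))) -(real_normK (num_real (w2 _))).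
  apply: (@le_trans _ _ ((`|w1 (z ++ y)| + `|w2 (z ++ y)|) ^+ 2)).
    by rewrite lerXn2r ?nnegrE ?addr_ge0.
  by have := sqr_ge0 (`|w1 (z ++ y)| - `|w2 (z ++ y)|); nra.
have h4 x : (2%:E * x * (2%:E * x) = 4%:E * (x * x) :> \bar R)%E.
  rewrite muleACA -EFinM; congr (_%:E * _)%E; ring.
have := @sqr_adde3_le _ (J w y) (2%:E * J w1 y) (2%:E * J w2 y) 0%E.
rewrite !mule_ge0// adde0 gee0_abs// => /(_ isT isT (lexx _) Jle) h.
apply: (le_trans h); rewrite mule0 adde0 !h4 -ge0_muleDr// muleA -EFinM.
by rewrite (_ : 3 * 4 = 12 :> R)//; ring.
Qed.

Lemma sqr_block_diag q (w : seq Z -> R) : smeas w ->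
  sqr_block mu q q w = Iint q (fun s => (w s ^+ 4)%:E).
Proof.
move=> mw; rewrite /sqr_block /block_energy subnn; apply: eq_Iint => y _.
rewrite Iint0; last first.
  by apply: (smeas_reindex (smeas_sqr mw) (h := fun z => z ++ y)) => k; eexists; solve_mseq.
by rewrite -EFinM -exprD.
Qed.

Lemma sqr_block_full q (w : seq Z -> R) : smeas w ->
  sqr_block mu 0 q w = (Iint q (fun s => (w s ^+ 2)%:E) * Iint q (fun s => (w s ^+ 2)%:E))%E.
Proof.
move=> mw; rewrite /sqr_block /block_energy subn0 Iint0.
  by congr (_ * _)%E; apply: eq_Iint => s _; rewrite cats0.
apply: smeas_mulE; apply: smeas_Iintl (smeas_sqr mw) (sq0 w).
Qed.

Lemma ecvg0_near (x : nat -> \bar R) (e : R) : x @ \oo --> 0%E -> 0 < e ->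
  \forall n \near \oo, (x n <= e%:E)%E.
Proof.
move=> /fine_cvgP[xfin xcv] e0; near=> n.
rewrite -(@fineK _ (x n)); last by near: n.
rewrite lee_fin (le_trans (ler_norm _))//.
by near: n; move/cvgr0_norm_le : xcv; apply.
Unshelve. all: by end_near.
Qed.

Lemma trunc_eventually (U : nat -> set Z) (u : seq Z -> R) s : \bigcup_n U n = setT -> nondecreasing_seq U ->
  \forall n \near \oo, u s - trunc n%:R (U n) u s = 0.
Proof.
move=> Ucov ndU.
have [N hN] : exists N, inV (U N) s.
  elim: s => [|z s [N hN]]; first by exists 0%N.
  have [M _ hM] : (\bigcup_n U n) z by rewrite Ucov.
  exists (maxn M N); rewrite /inV /=; apply/andP; split.
    by apply: mem_set; move: hM; apply/subsetPset/ndU/leq_maxl.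
  move: hN; apply: sub_all => y /set_mem hy; apply: mem_set; move: hy.
  exact/subsetPset/ndU/leq_maxr.
near=> n.
rewrite /trunc (_ : inV _ _); last first.
  move: hN; apply: sub_all => y /set_mem hy; apply: mem_set; move: hy.
  by apply/subsetPset/ndU; near: n; exact: nbhs_infty_ge.
rewrite clip_id ?subrr//.
by near: n; exact: nbhs_infty_ger.
Unshelve. all: by end_near.
Qed.

(** Dominated convergence: at each point the truncation is eventually inactive, and the difference
    is dominated by |u|. *)
Lemma trunc_cvg (U : nat -> set Z) a q (u : seq Z -> R) : \bigcup_n U n = setT -> nondecreasing_seq U ->
  (forall n, measurable (U n)) -> smeas u -> (sqr_block mu a q u < +oo)%E ->
  sqr_block mu a q (fun s => u s - trunc n%:R (U n) u s) @[n --> \oo] --> 0%E.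
Proof.
move=> Ucov ndU mU mu_ fin.
pose w n s := u s - trunc n%:R (U n) u s.
have mw n : smeas (w n) by apply: smeas_sub => //; exact: smeas_trunc.
set b := (q - a)%N.
pose W (h : seq Z -> R) (x : (a + (b + b)).-tuple Z) : \bar R :=
  (h (take b (drop a x) ++ take a x) ^+ 2 * h (drop (a + b) x ++ take a x) ^+ 2)%:E.
have mW h : smeas h -> measurable_fun setT (W h).
  by move=> mh; apply/measurable_EFinP; apply: measurable_funM; apply: measurable_funX;
    apply: smeas_comp; (try eassumption); solve_mseq.
rewrite (_ : (fun n => _) = (fun n => \int[tm (a + (b + b))]_x W (w n) x)%E); last first.
  by apply/funext => n; rewrite sqr_block_expand//; exact: mw.
rewrite -(@integral0 _ _ _ (tm (a + (b + b))) setT).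
apply: (@dominated_cvg _ _ _ _ setT measurableT (fun n => W (w n)) _ (W u)) => //.
- by move=> n; apply: mW; exact: mw.
- move=> x _; apply: cvg_near_cst.
  have h1 := trunc_eventually u (take b (drop a x) ++ take a x) Ucov ndU.
  by apply: filterS h1 => n h1; rewrite /W /w h1 expr0n mul0r.
- apply/integrableP; split; first exact: mW.
  rewrite (eq_integral (W u)); last first.
    by move=> x _; rewrite gee0_abs// lee_fin mulr_ge0 ?sqr_ge0.
  by rewrite (sqr_block_expand _ _ mu_) in fin.
- move=> n x _; rewrite gee0_abs; last by rewrite lee_fin mulr_ge0 ?sqr_ge0.
  rewrite lee_fin.
  have le2 s : w n s ^+ 2 <= u s ^+ 2.
    rewrite -(real_normK (num_real (w n s))) -(real_normK (num_real (u s))).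
    by rewrite lerXn2r ?nnegrE//; exact: sub_trunc_norm.
  exact: (ler_pM (sqr_ge0 _) (sqr_ge0 _) (le2 _) (le2 _)).
Qed.

(** L^2 closeness controls block energies only for functions bounded by c and supported on V, so the
    truncation level is fixed first and delta is chosen in terms of it. *)
Lemma exists_truncation (k : nat) (q : 'I_k -> nat) (u : 'I_k -> seq Z -> R) (e : R) :
  0 < e -> (forall i, smeas (u i)) -> (forall i, psym (u i)) ->
  (forall i a, (a <= q i)%N -> (sqr_block mu a (q i) (u i) < +oo)%E) ->
  exists (c : R) (V : set Z) (delta : R), [/\ 0 <= c, measurable V, (mu V < +oo)%E, 0 < delta &
   (forall i a, (a <= q i)%N -> (sqr_block mu a (q i) (fun s => u i s - trunc c V (u i) s)%R <= e%:E)%E) /\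
   forall v : 'I_k -> seq Z -> R, (forall i, smeas (v i)) -> (forall i, psym (v i)) ->
    (forall i s, `|v i s| <= if inV V s then c else 0) ->
    (forall i, (Iint (q i) (fun s => ((v i s - trunc c V (u i) s) ^+ 2)%:E) <= delta%:E)%E) ->
    forall i a, (a <= q i)%N -> (sqr_block mu a (q i) (fun s => v i s - u i s)%R <= e%:E)%E].
Proof.
move=> e0 mu_ su fin.
have [U [Ucov ndU Ufin]] := (sigma_finiteP _ _).1 (sigma_finiteT mu).
have e24 : 0 < e / 24 by rewrite divr_gt0.
have [n hn] : exists n : nat, forall i (a : 'I_(q i).+1),
    (sqr_block mu a (q i) (fun s => u i s - trunc n%:R (U n) (u i) s)%R <= (e / 24)%:E)%E.
  have : \forall n \near \oo, forall i (a : 'I_(q i).+1),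
    (sqr_block mu a (q i) (fun s => u i s - trunc n%:R (U n) (u i) s)%R <= (e / 24)%:E)%E.
    apply: filter_forall => i; apply: filter_forall => a.
    apply: ecvg0_near => //; apply: trunc_cvg => //.
    - by move=> n; have [] := Ufin n.
    - by apply: fin; rewrite -ltnS.
  by case=> n _ /(_ n (leqnn n)) h; exists n.
have [mV fV] := Ufin n.
set c : R := n%:R; set V := U n.
have c0 : 0 <= c by rewrite ler0n.
(* The sum dominates every constant of [sqr_block_bounded] that occurs; the bound is 2c because a
   difference of two truncated functions is estimated. *)
pose C : R := \sum_(i < k) \sum_(a < (q i).+1) (2 * c) ^+ 2 * fine (mu V) ^+ (q i - a).
have Ct0 i (a : nat) : 0 <= (2 * c) ^+ 2 * fine (mu V) ^+ (q i - a).
  by rewrite mulr_ge0 ?sqr_ge0// exprn_ge0// fine_ge0.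
have CE i a : (a <= q i)%N -> (2 * c) ^+ 2 * fine (mu V) ^+ (q i - a) <= C.
  rewrite -ltnS => aq; rewrite /C (bigD1 i)//= (bigD1 (Ordinal aq))//= -addrA lerDl.
  apply: addr_ge0; first by apply: sumr_ge0.
  by apply: sumr_ge0 => j _; apply: sumr_ge0.
have C0 : 0 <= C by apply: sumr_ge0 => i _; apply: sumr_ge0.
exists c, V, (e / 24 / (C + 1)); split => //.
  by rewrite divr_gt0// ltr_wpDl.
split.
  move=> i a aq; have := hn i (Ordinal (aq : (a < (q i).+1)%N)) => /= h.
  by apply: (le_trans h); rewrite lee_fin; lra.
move=> v mv sv vc vd i a aq.
have mt : smeas (trunc c V (u i)) by exact: smeas_trunc.
have := @block_add a (q i) (fun s => v i s - u i s) (fun s => v i s - trunc c V (u i) s)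
  (fun s => u i s - trunc c V (u i) s).
move=> /(_ (smeas_sub (mv i) (mu_ i)) (smeas_sub (mv i) mt) (smeas_sub (mu_ i) mt)) h.
apply: (le_trans (h _)).
  move=> s; set t := trunc c V (u i) s.
  have -> : v i s - u i s = (v i s - t) - (u i s - t) by ring.
  exact: ler_normB.
have h1 : (sqr_block mu a (q i) (fun s => v i s - trunc c V (u i) s)%R <= (e / 24)%:E)%E.
  apply: (le_trans (@sqr_block_bounded a (q i) (2 * c) V _ _ mV fV _ _ aq _)).
  - by rewrite mulr_ge0.
  - exact: smeas_sub.
  - by move=> s t st; rewrite (sv _ _ _ st) (psym_trunc _ _ (su i) st).
  - move=> s; apply: (le_trans (ler_normB _ _)).
    have := vc i s; have := trunc_le V (u i) s c0; case: ifP => _; lra.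
  apply: (@le_trans _ _ (C%:E * (e / 24 / (C + 1))%:E)%E).
    apply: lee_pmul; [by rewrite lee_fin|by apply: Iint_ge0 => s; rewrite lee_fin sqr_ge0|by rewrite lee_fin CE|exact: vd].
  rewrite -EFinM lee_fin mulrCA ler_piMr ?(ltW e24)// ler_pdivrMr ?ltr_wpDl// mul1r.
  by rewrite lerDl.
have h2 : (sqr_block mu a (q i) (fun s => u i s - trunc c V (u i) s)%R <= (e / 24)%:E)%E.
  exact: (hn i (Ordinal (aq : (a < (q i).+1)%N))).
apply: (@le_trans _ _ (12%:E * ((e / 24)%:E + (e / 24)%:E))%E).
  move: h1 h2; generalize (e / 24)%:E => e' h1 h2.
  by apply: lee_wpmul2l; [rewrite lee_fin ler0n|exact: leeD h1 h2].
by rewrite -EFinD -EFinM lee_fin; lra.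
Qed.

(** A uniform form of [contraction_le], with eta depending only on B and e. *)
Lemma contraction_approx (B e : R) : 0 <= B -> 0 < e -> exists2 eta : R, 0 < eta &
  forall p q r l (u v u' v' : seq Z -> R), (l <= r)%N -> (r <= p)%N -> (r <= q)%N ->
  smeas u -> smeas v -> smeas u' -> smeas v' ->
  psym u -> psym v -> psym u' -> psym v' ->
  (sqr_block mu (r - l) p u <= B%:E)%E -> (sqr_block mu (r - l) q v <= B%:E)%E ->
  (sqr_block mu (r - l) p (fun s => u' s - u s)%R <= eta%:E)%E ->
  (sqr_block mu (r - l) q (fun s => v' s - v s)%R <= eta%:E)%E ->
  (Iint (p + q - r - l) (fun x => star mu p u' v' r l x * star mu p u' v' r l x) <=
   3%:E * (Iint (p + q - r - l) (fun x => star mu p u v r l x * star mu p u v r l x) + e%:E))%E.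
Proof.
(* The terms divided by lam involve B for u and 12 (B + 1) for v', in total 13 B + 12; lam makes
   them at most e / 2, and eta is then small compared with 1 / lam. *)
move=> B0 e0; pose lam : R := 2 * (13 * B + 12) / e + 1.
have lam0 : 0 < lam by rewrite ltr_wpDl// divr_ge0 ?(ltW e0)//; lra.
have lamE : lam^-1 * (13 * B + 12) <= e / 2.
  rewrite ler_pdivrMl//.
  have -> : lam * (e / 2) = 13 * B + 12 + e / 2 by rewrite /lam; field; rewrite gt_eqF.
  by rewrite lerDl divr_ge0// ltW.
exists (Num.min 1 (e / (4 * lam))).
  by rewrite lt_min ltr01 divr_gt0// mulr_gt0.
set eta := Num.min _ _.
have eta1 : eta <= 1 by rewrite ge_min lexx.
have eta2 : lam * eta <= e / 4.
  apply: (@le_trans _ _ (lam * (e / (4 * lam)))); first by rewrite ler_pM2l// ge_min lexx orbT.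
  by rewrite le_eqVlt; apply/orP; left; apply/eqP; field; rewrite gt_eqF.
move=> p q r l u v u' v' lr rp rq mu_ mv mu' mv' su sv su' sv' bu bv eu ev.
apply: (le_trans (contraction_le mu lam0 lr rp rq mu_ mv mu' mv' su sv su' sv')).
have bv' : (sqr_block mu (r - l) q v' <= (12 * (B + 1))%:E)%E.
  apply: (le_trans (@block_add (r - l) q v' v (fun s => v' s - v s) mv' mv (smeas_sub mv' mv) _)).
    by move=> s; rewrite -[in leLHS](subrKC (v s) (v' s)); exact: ler_normD.
  rewrite EFinM lee_pmul2l ?lte_fin// EFinD leeD//.
  by apply: (le_trans ev); rewrite lee_fin.
rewrite lee_pmul2l ?lte_fin// -addeA leeD2l//.
apply: (@le_trans _ _ ((lam%:E * eta%:E + lam^-1%:E * (12 * (B + 1))%:E) +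
   (lam^-1%:E * B%:E + lam%:E * eta%:E))%E).
  by apply: leeD; apply: leeD; rewrite lee_pmul2l ?lte_fin ?invr_gt0.
rewrite -!EFinM -!EFinD lee_fin.
have -> : lam * eta + lam^-1 * (12 * (B + 1)) + (lam^-1 * B + lam * eta) =
  2 * (lam * eta) + lam^-1 * (13 * B + 12) by ring.
by lra.
Qed.

End truncation.

(** * Kernels that are constant on products of cells *)

Lemma measurable_finite_factor d (X : measurableType d) (I : finType) (h : X -> I)
    d' (V : measurableType d') (F : I -> V) :
  (forall i, measurable (h @^-1` [set i])) -> measurable_fun setT (fun x => F (h x)).
Proof.
move=> mh _ B mB; rewrite setTI.
rewrite (_ : _ @^-1` _ = \bigcup_(i in [set i | B (F i)]) h @^-1` [set i]).
  by apply: fin_bigcup_measurable => [|i _]; [exact: finite_finset|exact: mh].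
by apply/seteqP; split => [x Bx|x [i Bi /= ->]//]; exists (h x).
Qed.

Lemma sum_tuple_cons (R : realFieldType) (T : finType) n (F : n.+1.-tuple T -> R) :
  \sum_a F a = \sum_(t : T) \sum_(a : n.-tuple T) F [tuple of t :: a].
Proof.
rewrite pair_big /= (reindex (fun x : T * n.-tuple T => [tuple of x.1 :: x.2]))//=.
exists (fun a : n.+1.-tuple T => (thead a, [tuple of behead a])).
  by case=> t a _; rewrite theadE; congr (_, _); exact/val_inj.
by move=> a _; rewrite [RHS]tuple_eta.
Qed.

Section step_functions.
Context d (Z : measurableType d) (R : realType).
Variable mu : {sigma_finite_measure set Z -> \bar R}.
Local Notation tm := (tuple_measure mu).
Local Notation Iint := (tuple_integral mu).
Context (T : finType) (kap : Z -> option T).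
(** A finite partition is encoded by the map sending a point to the index of its cell; [None] stands
    for the points outside the partitioned set. *)
Definition cell t : set Z := [set z | kap z = Some t].
Hypothesis mcell : forall t, measurable (cell t).
Hypothesis fcell : forall t, (mu (cell t) < +oo)%E.
Definition cell_mass t : R := fine (mu (cell t)).
Local Notation m := cell_mass.

Lemma cell_massE t : mu (cell t) = (m t)%:E.
Proof. by rewrite /m fineK// ge0_fin_numE. Qed.

Lemma cell_mass_ge0 t : 0 <= m t.
Proof. exact: fine_ge0. Qed.

Lemma measurable_fiber o : measurable (kap @^-1` [set o]).
Proof.
case: o => [t|]; first exact: mcell.
rewrite (_ : _ @^-1` _ = ~` \bigcup_(t in [set: T]) cell t).
  by apply: measurableC; apply: fin_bigcup_measurable => [|t _]; [exact: finite_finset|exact: mcell].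
apply/seteqP; split => [z /= kz [t _]|z /= h]; first by rewrite /cell /= kz.
by case kz : (kap z) => [t|//]; exfalso; apply: h; exists t.
Qed.

Lemma smeas_step d' (V : measurableType d') (F : seq (option T) -> V) :
  smeas (fun s => F (map kap s)).
Proof.
move=> n.
apply: (@measurable_finite_factor _ _ _ (fun x : n.-tuple Z => [tuple of map kap x]) _ _ (fun a => F (tval a))).
move=> a; rewrite (_ : _ @^-1` _ = [set x : n.-tuple Z | forall i, (kap @^-1` [set tnth a i]) (tnth x i)]).
  apply: (@measurable_rect _ _ _ (fun i => kap @^-1` [set tnth a i])) => i.
  exact: measurable_fiber.
apply/seteqP; split => [x /= <- i|x /= h]; first by rewrite tnth_map.
by apply: eq_from_tnth => i; rewrite tnth_map h.
Qed.

Lemma cell_integral (G : option T -> R) : G None = 0 -> (forall o, 0 <= G o) ->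
  (\int[mu]_z (G (kap z))%:E = (\sum_t m t * G (Some t))%:E)%E.
Proof.
move=> G0 Gpos.
transitivity (\int[mu]_z (\sum_t (G (Some t))%:E * (\1_(cell t) z)%:E))%E.
  apply: eq_integral => z _; case kz : (kap z) => [t|]; last first.
    rewrite big1 ?G0// => t _; rewrite indicE memNset ?mule0//.
    by rewrite /cell /= kz.
  rewrite (bigD1 t)//= big1 ?adde0; last first.
    move=> t' t't; rewrite indicE memNset ?mule0// /cell /= kz => -[tt'].
    by rewrite tt' eqxx in t't.
  by rewrite indicE mem_set ?mule1// /cell /=.
have mi t : measurable_fun setT (fun z => (\1_(cell t) z)%:E : \bar R).
  exact/measurable_EFinP/measurable_indic.
rewrite ge0_integral_sum//; last 2 first.
- by move=> t; apply: emeasurable_funM.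
- by move=> t z _; rewrite mule_ge0// lee_fin.
rewrite -sumEFin; apply: eq_bigr => t _.
rewrite ge0_integralZl//; last by rewrite lee_fin.
rewrite (_ : (\int[mu]_x _)%E = (m t)%:E); first by rewrite -EFinM mulrC.
by rewrite integral_indic// setIT; exact: cell_massE.
Qed.

Lemma step_integral n (Psi : seq (option T) -> R) : (forall s, 0 <= Psi s) ->
  (forall s, None \in s -> Psi s = 0) ->
  Iint n (fun s => (Psi (map kap s))%:E) = (\sum_(a : n.-tuple T) wseq m a * Psi (map Some a))%:E.
Proof.
elim: n Psi => [|n IH] Psi Psi0 PsiN.
  rewrite Iint0; last exact: (@smeas_step _ (\bar R) (fun s => (Psi s)%:E)).
  rewrite (big_pred1 [tuple]); last by move=> a; apply/esym/eqP; exact: tuple0.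
  by rewrite /wseq big_nil mul1r.
rewrite IintS; last 2 first.
- exact: (@smeas_step _ (\bar R) (fun s => (Psi s)%:E)).
- by move=> s; rewrite lee_fin.
pose G (o : option T) := if o is Some t then \sum_(a : n.-tuple T) wseq m a * Psi (Some t :: map Some a) else 0.
rewrite (eq_integral (fun z => (G (kap z))%:E)); last first.
  move=> z _ /=; rewrite /G; case: (kap z) => [t|]; last first.
    transitivity (Iint n (cst 0%E)); last by rewrite /tuple_integral integral0.
    by apply: eq_Iint => s _; rewrite PsiN// mem_head.
  apply: (IH (fun s => Psi (Some t :: s))) => // s sN; apply: PsiN.
  by rewrite inE sN orbT.
rewrite cell_integral//; last first.
  by case=> [t|]//; apply: sumr_ge0 => a _; rewrite mulr_ge0// wseq_ge0//; exact: cell_mass_ge0.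
rewrite sum_tuple_cons; congr (_%:E); apply: eq_bigr => t _; rewrite /G mulr_sumr.
by apply: eq_bigr => a _; rewrite /wseq /= big_cons mulrA.
Qed.

Lemma step_integral_signed n (Psi : seq (option T) -> R) :
  (forall s, None \in s -> Psi s = 0) ->
  (\int[tm n]_x (Psi (map kap x))%:E = (\sum_(a : n.-tuple T) wseq m a * Psi (map Some a))%:E)%E.
Proof.
move=> PsiN; rewrite integralE.
have p1 := @step_integral n (fun s => Num.max (Psi s) 0).
have p2 := @step_integral n (fun s => Num.max (- Psi s) 0).
rewrite (_ : (\int[tm n]_x _^\+ x)%E = (\sum_(a : n.-tuple T) wseq m a * Num.max (Psi (map Some a)) 0)%:E); last first.
  rewrite -p1; first by apply: eq_integral => x _; rewrite funeposE EFin_max.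
    by move=> s; rewrite le_max lexx orbT.
  by move=> s /PsiN ->; rewrite maxxx.
rewrite (_ : (\int[tm n]_x _^\- x)%E = (\sum_(a : n.-tuple T) wseq m a * Num.max (- Psi (map Some a)) 0)%:E); last first.
  rewrite -p2; first by apply: eq_integral => x _; rewrite funenegE EFin_max EFinN.
    by move=> s; rewrite le_max lexx orbT.
  by move=> s /PsiN ->; rewrite oppr0 maxxx.
rewrite -EFinB -sumrB; congr (_%:E); apply: eq_bigr => a _.
rewrite -mulrBr; congr (_ * _); case: (leP (Psi (map Some a)) 0) => h.
  by rewrite max_l ?oppr_ge0// sub0r opprK.
by rewrite max_r ?subr0// oppr_le0 ltW.
Qed.

Lemma starE_step p r l n (phi psi : seq (option T) -> R) (x : seq Z) : size x = n ->
  (forall s, None \in s -> phi s = 0) ->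
  star mu p (fun s => phi (map kap s)) (fun s => psi (map kap s)) r l x =
  (\sum_(a : l.-tuple T) wseq m a * phi (map Some a ++ take (p - l) (map kap x)) *
     psi (map Some a ++ take (r - l) (map kap x) ++ drop (p - l) (map kap x)))%:E.
Proof.
move=> sx phiN; rewrite /star.
rewrite (eq_integral (fun z : l.-tuple Z => ((fun s => phi (s ++ take (p - l) (map kap x)) *
  psi (s ++ take (r - l) (map kap x) ++ drop (p - l) (map kap x))) (map kap z))%:E)); last first.
  by move=> z _; rewrite !map_cat !map_take map_drop.
rewrite (@step_integral_signed _ (fun s => phi (s ++ take (p - l) (map kap x)) *
  psi (s ++ take (r - l) (map kap x) ++ drop (p - l) (map kap x)))); last by move=> s sN; rewrite phiN ?mul0r// mem_cat sN.
by congr (_%:E); apply: eq_bigr => a _; rewrite mulrA.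
Qed.

Definition ocoeff (g : {set T} -> R) (s : seq (option T)) : R :=
  if None \in s then 0 else coeff g (pmap id s).

Lemma ocoeff_some g (s : seq T) : ocoeff g (map Some s) = coeff g s.
Proof.
rewrite /ocoeff ifF; last by apply/negP => /mapP[].
by congr (coeff g); elim: s => //= t s ->.
Qed.

Lemma ocoeff_none g s : None \in s -> ocoeff g s = 0.
Proof. by rewrite /ocoeff => ->. Qed.

Definition stepf g (s : seq Z) : R := ocoeff g (map kap s).

(** Contractions of step functions are step functions, so the right side is a sum over tuples of
    cells, which [energy_tuples] bounds from below. Discrete contractions are thus controlled by
    continuous ones. *)
Lemma step_energy g h p q r l : homogeneous p g -> (l <= r)%N -> (r <= p)%N -> (r <= q)%N ->
  ((l`!%:R ^+ 2 * contr_energy m g h p q r l)%:E <=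
   Iint (p + q - r - l) (fun x => star mu p (stepf g) (stepf h) r l x * star mu p (stepf g) (stepf h) r l x))%E.
Proof.
move=> hg lr rp rq.
pose S (y : seq (option T)) := \sum_(a : l.-tuple T) wseq m a * ocoeff g (map Some a ++ take (p - l) y) *
     ocoeff h (map Some a ++ take (r - l) y ++ drop (p - l) y).
rewrite (@eq_Iint _ _ _ _ _ _ (fun x => (S (map kap x) ^+ 2)%:E)); last first.
  move=> x sx; rewrite (@starE_step p r l (p + q - r - l) (ocoeff g) (ocoeff h) x)//.
  exact: ocoeff_none.
rewrite (@step_integral _ (fun y => S y ^+ 2)); last 2 first.
- by move=> s; exact: sqr_ge0.
- move=> s; rewrite -{1}(cat_take_drop (p - l) s) mem_cat => /orP[sN|sN]; rewrite /S big1 ?expr0n// => a _.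
    by rewrite ocoeff_none ?mulr0 ?mul0r// mem_cat sN orbT.
  by rewrite [X in _ * X]ocoeff_none ?mulr0// !mem_cat sN !orbT.
rewrite lee_fin; apply: (le_trans (energy_tuples cell_mass_ge0 h hg lr rp rq)).
apply: ler_sum => b _; rewrite le_eqVlt; apply/orP; left; apply/eqP; congr (_ * _ ^+ 2).
apply: eq_bigr => a _; rewrite -!map_take -map_drop -!map_cat !ocoeff_some//.
Qed.

Lemma step_moment g q (Phi : R -> R) : homogeneous q g -> Phi 0 = 0 -> (forall x, 0 <= Phi x) ->
  Iint q (fun s => (Phi (stepf g s))%:E) = (q`!%:R * \sum_S weight m S * Phi (g S))%:E.
Proof.
move=> hg Phi0 Phipos; rewrite (@step_integral _ (fun s => Phi (ocoeff g s)))//; last first.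
  by move=> s sN; rewrite ocoeff_none.
by congr EFin; rewrite -moment_tuples//; apply: eq_bigr => a _; rewrite ocoeff_some.
Qed.

Lemma step_moment_ge g q (Phi : R -> R) : homogeneous q g -> Phi 0 = 0 -> (forall x, 0 <= Phi x) ->
  ((\sum_S weight m S * Phi (g S))%:E <= Iint q (fun s => (Phi (stepf g s))%:E))%E.
Proof.
move=> hg Phi0 Phipos; rewrite step_moment// lee_fin ler_peMl ?ler1n ?fact_gt0//.
by apply: sumr_ge0 => S _; rewrite mulr_ge0//; apply: prodr_ge0 => t _; exact: cell_mass_ge0.
Qed.

(** A is a union of cells; the second clause keeps it inside the partitioned set. *)
Definition refines (A : set Z) := (forall z z', kap z = kap z' -> A z -> A z') /\ (forall z, A z -> kap z != None).
Definition cells_of (A : set Z) (t : T) : bool := `[< exists z, kap z = Some t /\ A z >].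

Lemma cells_ofP A z t : refines A -> kap z = Some t -> A z <-> cells_of A t.
Proof.
move=> [rA _] kz; split=> [Az|/asboolP[z' [kz' Az']]]; first by apply/asboolP; exists z.
by apply: rA Az'; rewrite kz kz'.
Qed.

Variable q : nat.
Implicit Types s : elementary Z R q.

Definition refines_elementary s := forall c A, List.In (c, A) s -> forall j, refines (A j).

Definition elementary_cells s (a : q.-tuple T) : R :=
  \sum_(cA <- s) cA.1 * \prod_(j < q) (cells_of (cA.2 j) (tnth a j))%:R.

(** The order given by [enum] is immaterial after symmetrization; sets whose size is not q get the
    default 0. *)
Definition sym_coeff s (S : {set T}) : R := oapp (symmetrize (elementary_cells s)) 0 (insub (enum S)).

Lemma homogeneous_sym_coeff s : homogeneous q (sym_coeff s).
Proof. by move=> S Sq; rewrite /sym_coeff insubN// -cardE. Qed.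

Lemma sym_coeff_tuple s (a : q.-tuple T) : uniq a ->
  sym_coeff s [set x in a]%SET = symmetrize (elementary_cells s) a.
Proof.
move=> ua; rewrite /sym_coeff.
have pa : perm_eq (enum [set x in a]%SET) a.
  apply: uniq_perm => //; first exact: enum_uniq.
  by move=> x; rewrite mem_enum inE.
case/tuple_permP : pa => sig ->; rewrite valK /=; exact: symmetrize_perm.
Qed.

(** The sides of a rectangle are disjoint unions of cells, so no cell lies in two of them. *)
Lemma elementary_cells_diag s : elementary_ok mu s -> refines_elementary s ->
  forall a : q.-tuple T, ~~ uniq a -> elementary_cells s a = 0.
Proof.
move=> sok rs a nua; rewrite /elementary_cells big_seq big1// => -[c A] cA /=.
have [i [j [ij aij]]] : exists i j : 'I_q, i != j /\ tnth a i = tnth a j.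
  apply/not_existsP => H; move/negP : nua; apply.
  rewrite -(map_tnth_enum a) map_inj_uniq ?enum_uniq// => i j aij; apply/eqP/negPn/negP => ij.
  by apply: (H i); exists j.
have sz : (index (c, A) s < size s)%N by rewrite index_mem.
have [_ tA] := sok _ sz; rewrite nth_index//= in tA.
have : ~~ (cells_of (A i) (tnth a i) && cells_of (A j) (tnth a i)).
  apply/negP => /andP[/asboolP[z [kz Az]] h].
  have rA : forall j', refines (A j').
    by apply: (rs c); elim: (s) cA => //= x s' IH; rewrite inE => /orP[/eqP ->|/IH]; [left|right].
  have Ajz : A j z by apply/(cells_ofP (rA j) kz).
  by move/trivIsetP : tA => /(_ i j Logic.I Logic.I ij); rewrite -subset0 => /(_ z); apply.
rewrite negb_and => /orP[/negPf h|/negPf h].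
  by rewrite (bigD1 i)//= h mul0r mulr0.
by rewrite (bigD1 j)//= -aij h mul0r mulr0.
Qed.

Lemma symmetrize_diag s (a : q.-tuple T) : elementary_ok mu s -> refines_elementary s ->
  ~~ uniq a -> symmetrize (elementary_cells s) a = 0.
Proof.
move=> sok rs nua; rewrite /symmetrize big1 ?mulr0// => sig _.
apply: elementary_cells_diag => //; rewrite (@perm_uniq _ _ a)//.
by apply/tuple_permP; exists sig.
Qed.

Lemma elementary_kernel_cells s (x : q.-tuple Z) (a : q.-tuple T) : refines_elementary s ->
  map kap x = map Some a -> elementary_kernel s x = elementary_cells s a.
Proof.
move=> rs xa; rewrite /elementary_kernel /elementary_cells big_seq [RHS]big_seq.
apply: eq_bigr => -[c A] cA /=; congr (_ * _); apply: eq_bigr => j _.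
have rA : refines (A j).
  by apply: (rs c); elim: (s) cA => //= y s' IH; rewrite inE => /orP[/eqP ->|/IH]; [left|right].
have kj : kap (tnth x j) = Some (tnth a j).
  have := congr1 (fun u => nth None u j) xa.
  by rewrite (nth_map (tnth x j)) ?size_tuple// (nth_map (tnth a j)) ?size_tuple// -!tnth_nth.
rewrite indicE; case hc: (cells_of (A j) (tnth a j)).
  by rewrite mem_set//; apply/(cells_ofP rA kj).
by rewrite memNset// => /(cells_ofP rA kj); rewrite hc.
Qed.

Lemma map_some_pmap (y : seq (option T)) : None \notin y -> y = map Some (pmap id y).
Proof. by elim: y => [//|[t|]//= y IH]; rewrite inE /= => /IH {1}->. Qed.

(** The symmetrized kernel depends only on the cells of its arguments, and vanishes if a cell is
    repeated or an argument lies in no cell. *)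
Lemma sym_kernel_step s (x : q.-tuple Z) : elementary_ok mu s -> refines_elementary s ->
  symmetrize (elementary_kernel s) x = stepf (sym_coeff s) x.
Proof.
move=> sok rs; rewrite /stepf /ocoeff; case: ifPn => xN.
  rewrite /symmetrize big1 ?mulr0// => sig _; rewrite /elementary_kernel big_seq big1// => -[c A] cA /=.
  have rA j : refines (A j).
    by apply: (rs c); elim: (s) cA => //= y s' IH; rewrite inE => /orP[/eqP ->|/IH]; [left|right].
  have [j kj] : exists j, kap (tnth x (sig j)) = None.
    move/mapP : xN => [z /tnthP[i ->] ki]; exists (sig^-1 i)%g.
    by rewrite permKV.
  rewrite (bigD1 j)//= tnth_mktuple indicE memNset ?mul0r ?mulr0// => /(rA j).2.
  by rewrite kj.
have xa := map_some_pmap xN; set a0 := pmap id (map kap x) in xa *.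
have sa : size a0 == q by rewrite -(size_map Some) -xa size_map size_tuple.
pose a : q.-tuple T := Tuple sa.
have kj j : kap (tnth x j) = Some (tnth a j).
  have := congr1 (fun u => nth None u j) xa; rewrite -[a0]/(tval a).
  by rewrite (nth_map (tnth x j)) ?size_tuple// (nth_map (tnth a j)) ?size_tuple// -!tnth_nth => ->.
transitivity (symmetrize (elementary_cells s) a).
  congr (_ * _); apply: eq_bigr => sig _; apply: elementary_kernel_cells => //.
  rewrite -!map_comp; apply: eq_map => i /=; exact: kj.
rewrite /coeff -[a0]/(tval a); case: ifPn => ua; last exact: symmetrize_diag.
by rewrite sym_coeff_tuple.
Qed.

(** Expanding the products gives a sum over sequences of distinct cells; each set of q cells arises
    from q! sequences, whence the factor. *)
Lemma elementary_chaos s (X : T -> R) : elementary_ok mu s -> refines_elementary s ->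
  \sum_(cA <- s) cA.1 * \prod_(j < q) \sum_t (cells_of (cA.2 j) t)%:R * X t =
  \sum_S (q`!%:R * sym_coeff s S) * \prod_(t in S) X t.
Proof.
move=> sok rs; pose M (S : {set T}) := \prod_(t in S) X t.
transitivity (\sum_(a : q.-tuple T) elementary_cells s a * \prod_(j < q) X (tnth a j)).
  rewrite (eq_bigr (fun cA : R * ('I_q -> set Z) => \sum_(a : q.-tuple T)
    cA.1 * (\prod_(j < q) (cells_of (cA.2 j) (tnth a j))%:R * \prod_(j < q) X (tnth a j)))); last first.
    move=> [c A] _ /=; rewrite -mulr_sumr; congr (_ * _).
    rewrite bigA_distr_bigA /=.
    rewrite (reindex (fun a : q.-tuple T => [ffun j => tnth a j])) /=; last first.
      exists (fun f : {ffun 'I_q -> T} => [tuple f j | j < q]).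
        by move=> a _; apply: eq_from_tnth => j; rewrite tnth_mktuple ffunE.
      by move=> f _; apply/ffunP => j; rewrite ffunE tnth_mktuple.
    by apply: eq_bigr => a _; rewrite -big_split; apply: eq_bigr => j _; rewrite ffunE.
  rewrite exchange_big; apply: eq_bigr => a _; rewrite /elementary_cells mulr_suml.
  by apply: eq_bigr => cA _; rewrite mulrA.
transitivity (\sum_(a : q.-tuple T) symmetrize (elementary_cells s) a * \prod_(j < q) X (tnth a j)).
  (* The product of the X is symmetric, so permuting the arguments of the kernel only relabels the
     tuples. *)
  have E (sig : 'S_q) : \sum_(a : q.-tuple T) elementary_cells s [tuple tnth a (sig i) | i < q] * \prod_(j < q) X (tnth a j) =
      \sum_(a : q.-tuple T) elementary_cells s a * \prod_(j < q) X (tnth a j).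
    rewrite [RHS](reindex_inj (h := fun a : q.-tuple T => [tuple tnth a (sig i) | i < q])); last first.
      move=> a b ab; apply: eq_from_tnth => i.
      by have := congr1 (fun u => tnth u ((sig^-1)%g i)) ab; rewrite !tnth_mktuple permKV.
    apply: eq_bigr => a _; congr (_ * _).
    rewrite (reindex_inj (@perm_inj _ sig)); apply: eq_bigr => j _.
    by rewrite tnth_mktuple.
  under [RHS]eq_bigr do rewrite /symmetrize -mulrA mulr_suml.
  rewrite -mulr_sumr exchange_big /=.
  rewrite (eq_bigr _ (fun sig _ => E sig)).
  rewrite sumr_const -[#|_|]/(#|'S_q|) card_Sn -[X in _ = _ * X]mulr_natl mulrA mulVf ?mul1r//.
rewrite (bigID (fun a : q.-tuple T => uniq a)) /= [X in _ + X]big1 ?addr0; last first.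
  by move=> a nua; rewrite symmetrize_diag ?mul0r.
transitivity (\sum_(a : q.-tuple T | uniq a) sym_coeff s [set x in a]%SET * M [set x in a]%SET).
  apply: eq_bigr => a ua; rewrite sym_coeff_tuple//; congr (_ * _).
  rewrite -(big_tuple _ _ _ xpredT) /M big_uniq//=.
  by apply: eq_bigl => t; rewrite inE.
rewrite (sum_uniq_tuples q (fun S => sym_coeff s S * M S)) mulr_sumr.
rewrite [RHS](bigID (fun S : {set T} => #|S| == q)) /= [X in _ = _ + X]big1 ?addr0; last first.
  by move=> S Sq; rewrite homogeneous_sym_coeff// mulr0 mul0r.
by apply: eq_bigr => S _; rewrite mulrA.
Qed.

End step_functions.

Lemma measure_fin_union d (X : measurableType d) (R : realType) (m : {measure set X -> \bar R})
    (I : finType) (F : I -> set X) : (forall i, measurable (F i)) -> trivIset setT F ->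
  m (\bigcup_i F i) = (\sum_i m (F i))%E.
Proof.
move=> mF tF; rewrite measure_fin_bigcup//; last exact: finite_finset.
rewrite [RHS]fsbig_seq ?index_enum_uniq// (_ : [set` index_enum I] = setT)//.
by apply/seteqP; split => // i _; rewrite /= mem_index_enum.
Qed.

(** * Law and exponential moments of the Poisson counts *)

Section poisson_law.
Context dO (Omega : measurableType dO) d (Z : measurableType d) (R : realType).
Variables (P : probability Omega R) (mu : {sigma_finite_measure set Z -> \bar R}).
Variables (eta : Omega -> {measure set Z -> \bar R}) (heta : poisson_measure P mu eta).
Variables (B : set Z) (mB : measurable B) (fB : (mu B < +oo)%E).
Let c : R := fine (mu B).
Let c0 : 0 <= c. Proof. exact: fine_ge0. Qed.

Let level k : set Omega := [set w | eta w B = k%:R%:E].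

Let mlevel k : measurable (level k).
Proof.
have := poisson_measurable heta mB measurableT (emeasurable_set1 (k%:R%:E)).
by rewrite setTI.
Qed.

Let tlevel : trivIset setT level.
Proof.
apply/trivIsetP => i j _ _ ij; rewrite -subset0 => w []; rewrite /level /= => -> -[/eqP].
by rewrite eqr_nat (negPf ij).
Qed.

(** In terms of [exp_coeff] the formula also covers mass 0, where [poisson_prob] is a point mass at
    0. *)
Lemma poisson_levelE k : P (level k) = (expR (- c) * exp_coeff c k)%:E.
Proof.
rewrite (poisson_law heta mB fB) -/c /poisson_prob; case: ifPn => c_gt0.
  by rewrite esum_set1 ?lee_fin ?poisson_pmf_ge0// /poisson_pmf c_gt0 /exp_coeff /= mulrC.
have -> : c = 0 by apply/eqP; rewrite eq_le c0 andbT leNgt.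
rewrite oppr0 expR0 mul1r diracE /exp_coeff /= expr0n.
case: k => [|k] /=; first by rewrite mem_set// fact0 divr1.
by rewrite memNset// mul0r.
Qed.

Lemma nneseries_exp (a : R) : 0 <= a -> (\sum_(k <oo) (exp_coeff a k)%:E = (expR a)%:E)%E.
Proof.
move=> a0; rewrite expRE -EFin_lim; last first.
  by rewrite /pseries/=; under eq_fun do rewrite mulrC; exact: is_cvg_series_exp_coeff.
apply/congr_lim/funext => n/=; rewrite /pseries/= /series/= -sumEFin//.
by apply: eq_bigr => i _; rewrite mulrC.
Qed.

Let mulZ (a b : R) : 0 <= a -> 0 <= b -> (\sum_(k <oo) (b * exp_coeff a k)%:E = (b * expR a)%:E)%E.
Proof.
move=> a0 b0; under eq_eseriesr do rewrite EFinM.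
rewrite nneseriesZl ?nneseries_exp//.
by move=> k _; rewrite lee_fin /exp_coeff /= divr_ge0// exprn_ge0.
Qed.

Let Plevel : P (\bigcup_k level k) = 1%E.
Proof.
have mU : measurable (\bigcup_k level k) by exact: bigcup_measurable.
have /(@cvg_lim _ _) <- // := @measure_semi_sigma_additive _ _ _ P _ mlevel tlevel mU.
transitivity (\sum_(k <oo) (expR (- c) * exp_coeff c k)%:E)%E.
  by apply/congr_lim/funext => n; apply: eq_bigr => k _; exact: poisson_levelE.
by rewrite mulZ ?expR_ge0// -expRD addNr expR0.
Qed.

(** The levels are disjoint and their probabilities add up to 1. *)
Lemma poisson_nat : {ae P, forall w, exists k : nat, eta w B = k%:R%:E}.
Proof.
have mU : measurable (\bigcup_k level k) by exact: bigcup_measurable.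
exists (~` \bigcup_k level k); split; first exact: measurableC.
  by rewrite probability_setC// Plevel subee.
by move=> w /= h [k _ hk]; apply: h; exists k.
Qed.

Lemma poisson_exp_moment (a : R) :
  (\int[P]_w (expR (a * fine (eta w B)))%:E = (expR (c * (expR a - 1)))%:E)%E.
Proof.
have mf : measurable_fun setT (fun w => (expR (a * fine (eta w B)))%:E : \bar R).
  apply/measurable_EFinP; apply: (@measurableT_comp _ _ _ _ _ _ (@expR R)) => //.
  apply: measurable_funM => //; apply: (@measurableT_comp _ _ _ _ _ _ fine).
    exact: fine_measurable.
  exact: (poisson_measurable heta mB).
have mU : measurable (\bigcup_k level k) by exact: bigcup_measurable.
have PC : P (~` \bigcup_k level k) = 0%E by rewrite probability_setC// Plevel subee.
rewrite (@ge0_negligible_integral _ _ _ P setT (~` \bigcup_k level k))//; last exact: measurableC.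
rewrite setDE setCK setTI ge0_integral_bigcup; [|exact: mlevel|exact: measurable_funTS mf|by move=> w _; rewrite lee_fin expR_ge0|exact: tlevel].
transitivity (\sum_(k <oo) (expR (- c) * exp_coeff (expR a * c) k)%:E)%E; last first.
  rewrite mulZ ?expR_ge0 ?mulr_ge0 ?expR_ge0// -expRD.
  by congr (expR _)%:E; ring.
apply: eq_eseriesr => k _.
rewrite (eq_integral (cst (expR a ^+ k)%:E)); last first.
  by move=> w; rewrite inE => /= ->; rewrite /= -expRM_natr.
rewrite integral_cst// [X in (_ * X)%E]poisson_levelE -EFinM; congr (_%:E).
by rewrite /exp_coeff /= exprMn; ring.
Qed.

Lemma poisson_void : P [set w | eta w B = 0%E] = (expR (- c))%:E.
Proof. by rewrite (poisson_levelE 0) /exp_coeff /= expr0 fact0 divr1 mulr1. Qed.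

End poisson_law.

(** * Partitions into cells of small mass *)

Section fine_partitions.
Context d (Z : measurableType d) (R : realType) (mu : {sigma_finite_measure set Z -> \bar R}).
Hypotheses (hZ : borel_space R Z) (hmu : atomless mu).

(** The injection into the line makes singletons measurable, and a singleton of positive mass has no
    subset of strictly smaller positive mass. *)
Lemma atomless_set1 (x : Z) : measurable [set x] /\ mu [set x] = 0%E.
Proof.
have [f [mf fi _]] := hZ.
have mx : measurable [set x].
  rewrite (_ : [set x] = f @^-1` [set f x]).
    by rewrite -[X in measurable X]setTI; exact: mf.
  by apply/seteqP; split => [y ->//|y /fi].
split=> //; apply/eqP; rewrite eq_le measure_ge0 andbT leNgt; apply/negP => /(hmu mx)[B [mB Bx B0 Bmu]].
have [xB|xB] := pselect (B x); last first.
  by move: B0; rewrite (_ : B = set0) ?measure0 ?ltxx// -subset0 => y By; have := Bx y By; rewrite /= => yx; rewrite yx in By.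
by move: Bmu; rewrite (_ : B = [set x]) ?ltxx//; apply/seteqP; split => // y ->.
Qed.

(** Cells are cut out by the sets A_i and by comparing [f] with the first N rationals. The sum of
    squared masses is the mass of the diagonal blocks in Z x Z, which decrease to a part of the
    diagonal, of mass 0. *)
Lemma fine_partition (U : set Z) (c : nat) (A : 'I_c -> set Z) (theta : R) :
  measurable U -> (mu U < +oo)%E -> (forall i, measurable (A i)) -> 0 < theta ->
  exists (T : finType) (kap : Z -> option T),
   [/\ forall t, measurable [set z | kap z = Some t],
       forall z, U z <-> kap z != None,
       forall i z z', kap z = kap z' -> kap z != None -> A i z -> A i z' &
       \sum_t fine (mu [set z | kap z = Some t]) ^+ 2 <= theta].
Proof.
move=> mU fU mA theta0; have [f [mf fi _]] := hZ.
pose r (j : nat) : R := ratr (odflt 0 (unpickle j : option rat)).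
pose T N := ({ffun 'I_c -> bool} * {ffun 'I_N -> bool})%type.
pose kap N z : option (T N) := if z \in U then Some ([ffun i => z \in A i], [ffun j : 'I_N => f z < r j]) else None.
pose cl N t := [set z | kap N z = Some t].
have mcl N t : measurable (cl N t).
  rewrite (_ : cl N t = U `&` (\bigcap_(i in [set: 'I_c]) (if t.1 i then A i else ~` A i)) `&`
    (\bigcap_(j in [set: 'I_N]) f @^-1` (if t.2 j then [set x | x < r j] else [set x | r j <= x]))).
    apply: measurableI; [apply: measurableI => //|].
      apply: fin_bigcap_measurable => [|i _]; first exact: finite_finset.
      by case: ifP => _ //; exact: measurableC.
    apply: fin_bigcap_measurable => [|j _]; first exact: finite_finset.
    rewrite -[X in measurable X]setTI; apply: mf => //; case: ifP => _.
      by rewrite -set_itvNyo; exact: measurable_itv.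
    by rewrite -set_itvcy; exact: measurable_itv.
  apply/seteqP; split => z; rewrite /cl /kap /=.
    case: ifPn => // /set_mem Uz [<-] /=; split; [split => // i _|move=> j _].
      by rewrite ffunE; case: ifPn => [/set_mem//|/negP h] Az; apply: h; exact: mem_set.
    by rewrite ffunE; case: ltP.
  move=> [[Uz h1] h2]; rewrite mem_set//; congr Some; case: t h1 h2 => t1 t2 /= h1 h2.
  congr (_, _); apply/ffunP => i; rewrite ffunE.
    by have := h1 i Logic.I; case: (t1 i) => h; [exact: mem_set|exact: memNset].
  by have := h2 i Logic.I; rewrite /=; case: (t2 i) => /= [->//|]; rewrite leNgt => /negPf.
pose Delta N := \bigcup_(t in [set: T N]) (cl N t `*` cl N t).
have mDelta N : measurable (Delta N).
  by apply: fin_bigcup_measurable => [|t _]; [exact: finite_finset|exact: measurableX].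
have DeltaE N x y : Delta N (x, y) <-> kap N x = kap N y /\ kap N x != None.
  split=> [[t _ [/= xt yt]]|[xy]]; first by rewrite xt yt.
  by case xt : (kap N x) => [t|//] _; exists t => //; split => //=; rewrite /cl /= -xy xt.
have DeltaS : nonincreasing_seq Delta.
  apply/nonincreasing_seqP => N; apply/subsetPset => -[x y] /DeltaE[xy x0]; apply/DeltaE.
  move: xy x0; rewrite /kap; case: ifPn => // _; case: ifPn => // _ [E1 E2] _.
  split=> //; congr (Some (_, _)); first by apply/ffunP => i; have := congr1 (fun g : {ffun _ -> _} => g i) E1; rewrite !ffunE.
  apply/ffunP => j; have := congr1 (fun g : {ffun _ -> _} => g (widen_ord (leqnSn N) j)) E2.
  by rewrite !ffunE.
(* Points separated by no rational have the same image under [f], which is injective. *)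
have DeltaD : \bigcap_N Delta N `<=` [set xy | xy.1 = xy.2].
  move=> [x y] h /=; apply: fi; apply/eqP; rewrite eq_le !leNgt; apply/andP.
  have key a b : f a < f b -> exists j, f a < r j /\ r j <= f b.
    move=> ab; have [q hq] := rat_in_itvoo ab; exists (pickle q).
    by rewrite /r pickleK /=; move: hq; rewrite in_itv /= => /andP[-> /ltW].
  have bit j : (f x < r j) = (f y < r j).
    have /DeltaE[] := h j.+1 Logic.I; rewrite /kap; case: ifPn => // _; case: ifPn => // _ [_ E] _.
    by have := congr1 (fun g : {ffun 'I_j.+1 -> bool} => g ord_max) E; rewrite !ffunE.
  split; apply/negP => /key[j [h1]]; rewrite leNgt => /negP; apply.
    by rewrite bit.
  by rewrite -bit.
have mcap : measurable (\bigcap_N Delta N) by exact: bigcapT_measurable.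
have cap0 : (mu \x mu)%E (\bigcap_N Delta N) = 0%E.
  rewrite /product_measure1; apply: integral0_eq => x _ /=.
  apply/eqP; rewrite eq_le measure_ge0 andbT -(atomless_set1 x).2.
  apply: le_measure; rewrite ?inE.
  - exact: measurable_xsection.
  - exact: (atomless_set1 x).1.
  - by move=> y /xsectionP /DeltaD /= ->.
have massE N : (mu \x mu)%E (Delta N) = (\sum_t fine (mu (cl N t)) ^+ 2)%:E.
  have fcl t : (mu (cl N t) < +oo)%E.
    apply: le_lt_trans fU; apply: le_measure; rewrite ?inE//.
    by move=> z; rewrite /cl /kap /=; case: ifPn => // /set_mem.
  rewrite /Delta measure_fin_union.
  - rewrite -sumEFin; apply: eq_bigr => t _; apply: etrans (product_measure1E _ _ (mcl N t) (mcl N t)) _.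
    by rewrite expr2 EFinM fineK// ge0_fin_numE.
  - by move=> t; exact: measurableX.
  - apply/trivIsetP => t t' _ _ tt'; rewrite -subset0 => -[x y] [[/= h _] [/= h' _]].
    by move: tt'; move: h; rewrite /cl /= h' => -[->]; rewrite eqxx.
have cv := @nonincreasing_cvg_mu _ _ _ (mu \x mu)%E Delta _ mDelta mcap DeltaS.
have cv0 : ((mu \x mu)%E (Delta N) @[N --> \oo] --> 0%E).
  have fin0 : ((mu \x mu)%E (Delta 0%N) < +oo)%E by rewrite massE ltry.
  by rewrite -cap0; exact: cv fin0.
have /fine_cvgP[_ /cvgr0_norm_le/(_ _ theta0)[N _ /(_ N (leqnn N))]] := cv0.
rewrite /= massE /= => hN.
exists (T N : finType), (kap N); split.
- exact: mcl.
- move=> z; rewrite /kap; split => [Uz|]; first by rewrite mem_set.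
  by case: ifPn => // /set_mem.
- move=> i z z'; rewrite /kap; case: ifPn => // _; case: ifPn => // _ [E _] _ Az.
  have := congr1 (fun g : {ffun 'I_c -> bool} => g i) E; rewrite !ffunE mem_set// => h.
  by apply: set_mem; rewrite -h.
- by apply: le_trans hN; rewrite ler_norm.
Qed.

End fine_partitions.

(** * Scaled indicators of a Poisson hit *)

Section bernoulli_parameters.
Context (R : realType).
Implicit Type m : R.

Definition hit_prob m : R := 1 - expR (- m).
(* The scale that makes scale * (1_hit - hit_prob) of variance m.              *)
Definition hit_scale m : R := if m == 0 then 1 else Num.sqrt (m / (hit_prob m * (1 - hit_prob m))).

Lemma expR_le_inv (x : R) : x < 1 -> expR x <= (1 - x)^-1.
Proof.
move=> x1; rewrite -[expR x]invrK -expRN lef_pV2 ?posrE ?subr_gt0 ?expR_gt0//.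
by have := expR_ge1Dx (- x).
Qed.

Lemma expR_le_quadratic (x : R) : 0 <= x <= 2^-1 -> expR x <= 1 + x + 2 * x ^+ 2.
Proof.
move=> /andP[x0 x1]; apply: (le_trans (expR_le_inv _)); first lra.
rewrite -[leLHS]mul1r ler_pdivrMr; [nra|lra].
Qed.

Lemma expRN_le_quadratic (x : R) : 0 <= x -> expR (- x) <= 1 - x + x ^+ 2.
Proof.
move=> x0; rewrite expRN; apply: (@le_trans _ _ (1 + x)^-1).
  by rewrite lef_pV2 ?posrE ?expR_gt0 ?expR_ge1Dx//; lra.
rewrite -[leLHS]mul1r ler_pdivrMr; last lra.
by have : 0 <= x ^+ 3 by [rewrite exprn_ge0]; rewrite !exprS expr0; nra.
Qed.

Lemma hit_prob01 m : 0 <= m -> 0 <= hit_prob m <= 1.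
Proof.
by move=> m0; rewrite /hit_prob subr_ge0 -expR0 ler_expR oppr_le0 m0 /= lerBlDr lerDl expR_ge0.
Qed.

Lemma hit_prob_le m : hit_prob m <= m.
Proof. by rewrite /hit_prob; have := expR_ge1Dx (- m); lra. Qed.

Lemma hit_prob_ge m : 0 <= m -> m - m ^+ 2 <= hit_prob m.
Proof. by move=> m0; rewrite /hit_prob; have := expRN_le_quadratic m0; lra. Qed.

Lemma hit_scaleE m : 0 <= m -> hit_scale m ^+ 2 * (hit_prob m * (1 - hit_prob m)) = m.
Proof.
move=> m0; rewrite /hit_scale; case: eqP => [->|/eqP mn0].
  by rewrite /hit_prob oppr0 expR0 subrr mul0r mulr0.
have m_gt0 : 0 < m by rewrite lt0r mn0.
have p0 : 0 < hit_prob m by rewrite /hit_prob subr_gt0 expR_lt1 oppr_lt0.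
have q0 : 0 < 1 - hit_prob m by rewrite /hit_prob subKr expR_gt0.
by rewrite sqr_sqrtr ?mulfVK ?gt_eqF ?mulr_gt0// divr_ge0// ltW// mulr_gt0.
Qed.

(** The squared scale lies between 1 and e^(2m), because hit_prob m <= m and e^m hit_prob m = e^m -
    1 >= m; finally e^m <= 1 / (1 - m) <= 1 + 2m. *)
Lemma hit_scale_bounds m : 0 <= m <= 2^-1 -> 1 <= hit_scale m <= 1 + 2 * m.
Proof.
move=> /andP[m0 m12]; rewrite {1 2}/hit_scale; case: eqP => [->|/eqP mn0].
  by rewrite mulr0 addr0 lexx.
have m_gt0 : 0 < m by rewrite lt0r mn0.
have p0 : 0 < hit_prob m by rewrite /hit_prob subr_gt0 expR_lt1 oppr_lt0.
have qE : 1 - hit_prob m = expR (- m) by rewrite /hit_prob subKr.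
have q0 := expR_gt0 (- m).
have Em : expR m * expR (- m) = 1 by rewrite -expRD subrr expR0.
have pE : expR m * hit_prob m = expR m - 1 by rewrite /hit_prob mulrBr mulr1 Em.
have em1 : m <= expR m - 1 by have := expR_ge1Dx m; lra.
apply/andP; split.
  rewrite -[leLHS]sqrtr1 ler_sqrt ?divr_ge0 ?mulr_ge0 ?(ltW p0) ?qE ?(ltW q0)//.
  rewrite ler_pdivlMr ?mulr_gt0// mul1r.
  apply: (@le_trans _ _ (hit_prob m * 1)); last by rewrite mulr1 hit_prob_le.
  by rewrite ler_pM2l// -expR0 ler_expR oppr_le0.
apply: (@le_trans _ _ (expR m)).
  rewrite -[leRHS]ger0_norm ?expR_ge0// -sqrtr_sqr ler_sqrt ?sqr_ge0//.
  rewrite ler_pdivrMr ?qE ?mulr_gt0//.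
  have -> : expR m ^+ 2 * (hit_prob m * expR (- m)) = (expR m * hit_prob m) * (expR m * expR (- m)) by ring.
  by rewrite Em mulr1 pE.
apply: (le_trans (expR_le_inv _)); first lra.
by rewrite -[leLHS]mul1r ler_pdivrMr; [nra|lra].
Qed.

Lemma hit_scale_prob m : 0 <= m <= 2^-1 -> `|hit_scale m * hit_prob m - m| <= 2 * m ^+ 2.
Proof.
move=> m012; have /andP[m0 m12] := m012.
have /andP[s1 s2] := hit_scale_bounds m012.
have /andP[p0 p1] := hit_prob01 m0; have pm := hit_prob_le m; have mp := hit_prob_ge m0.
have h1 : hit_scale m * hit_prob m <= (1 + 2 * m) * m by apply: ler_pM => //; lra.
have h2 : 1 * (m - m ^+ 2) <= hit_scale m * hit_prob m.
  apply: (@le_trans _ _ (1 * hit_prob m)); first by rewrite !mul1r.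
  by apply: ler_wpM2r.
by rewrite ler_norml; apply/andP; split; nra.
Qed.

End bernoulli_parameters.

(** * The Bernoulli model inside the Poisson space *)

Section pattern.
Context dO (Omega : measurableType dO) d (Z : measurableType d) (R : realType).
Variables (P : probability Omega R) (mu : {sigma_finite_measure set Z -> \bar R}).
Variables (eta : Omega -> {measure set Z -> \bar R}) (heta : poisson_measure P mu eta).
Context (T : finType) (kap : Z -> option T).
Local Notation cell := (cell kap).
Hypothesis mcell : forall t, measurable (cell t).
Hypothesis fcell : forall t, (mu (cell t) < +oo)%E.
Local Notation m := (cell_mass mu kap).

Let m0 t : 0 <= m t. Proof. exact: cell_mass_ge0. Qed.
Let mE t : mu (cell t) = (m t)%:E. Proof. exact: cell_massE. Qed.

Definition pattern (w : Omega) : {set T} := [set t | eta w (cell t) != 0%E]%SET.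
Definition pattern_prob t : R := hit_prob (m t).
Definition pattern_scale t : R := hit_scale (m t).
(** With [pattern_x0] the two values of the centered hit indicator scaled to variance m t;
    [pattern_w] is the coefficient in X^2 = m + w X. *)
Definition pattern_x1 t : R := pattern_scale t * (1 - pattern_prob t).
Definition pattern_x0 t : R := - (pattern_scale t * pattern_prob t).
Definition pattern_w t : R := pattern_scale t * (1 - 2 * pattern_prob t).
Local Notation p := pattern_prob.

Lemma pattern_prob01 t : 0 <= p t <= 1.
Proof. exact: hit_prob01. Qed.

Lemma pattern_mean t : p t * pattern_x1 t + (1 - p t) * pattern_x0 t = 0.
Proof. by rewrite /pattern_x1 /pattern_x0; ring. Qed.

Lemma pattern_x1E t : pattern_x1 t ^+ 2 = m t + pattern_w t * pattern_x1 t.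
Proof. by rewrite -{1}(hit_scaleE (m0 t)) /pattern_x1 /pattern_w /pattern_scale /p; ring. Qed.

Lemma pattern_x0E t : pattern_x0 t ^+ 2 = m t + pattern_w t * pattern_x0 t.
Proof. by rewrite -{1}(hit_scaleE (m0 t)) /pattern_x0 /pattern_w /pattern_scale /p; ring. Qed.

Lemma pattern_bounds t : m t <= 2^-1 ->
  [/\ `|pattern_w t| <= 3, `|pattern_x1 t| <= 3 & `|pattern_x0 t| <= 3].
Proof.
move=> mt; have /andP[s1 s2] : 1 <= pattern_scale t <= 1 + 2 * m t by apply: hit_scale_bounds; rewrite m0.
have /andP[p0 p1] := pattern_prob01 t.
rewrite /pattern_w /pattern_x1 /pattern_x0 !ler_norml.
by split; apply/andP; split; nra.
Qed.

Let Nul t : set Omega := [set w | eta w (cell t) = 0%E].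

Let mNul t : measurable (Nul t).
Proof.
have := poisson_measurable heta (mcell t) measurableT (emeasurable_set1 0%E).
by rewrite setTI.
Qed.

Let tcell : trivIset setT cell.
Proof.
apply/trivIsetP => t t' _ _ tt'; rewrite -subset0 => z []; rewrite /cell /= => -> [/eqP].
by rewrite (negPf tt').
Qed.

Lemma cells_union (m' : {measure set Z -> \bar R}) (W : pred T) :
  m' (\bigcup_(t in [set t | W t]) cell t) = (\sum_(t | W t) m' (cell t))%E.
Proof.
pose F t := if W t then cell t else set0.
rewrite (_ : \bigcup_(t in _) _ = \bigcup_t F t); last first.
  apply/seteqP; split => z [t Wt cz]; exists t => //; rewrite /F; first by rewrite [W t]Wt.
    by move: cz; rewrite /F; case: ifP.
  by move: cz; rewrite /F; case: ifP.
rewrite measure_fin_union.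
- by rewrite [RHS]big_mkcond; apply: eq_bigr => t _; rewrite /F; case: ifP => //; rewrite measure0.
- by move=> t; rewrite /F; case: ifP.
- apply/trivIsetP => t t' _ _ tt'; rewrite /F; case: ifP; case: ifP; rewrite ?set0I ?setI0// => _ _.
  by move/trivIsetP : tcell; apply.
Qed.

(** No cell of W is hit exactly when the union of these cells is void, and the count in the union is
    Poisson with the summed mass. The product form is what makes the hits jointly independent. *)
Lemma void_probability (W : pred T) :
  P (\bigcap_(t in [set t | W t]) Nul t) = (\prod_(t | W t) expR (- m t))%:E.
Proof.
rewrite -expR_sum sumrN.
set A := \bigcup_(t in [set t | W t]) cell t.
have mA : measurable A by apply: fin_bigcup_measurable => //; exact: finite_finset.
have muA : mu A = (\sum_(t | W t) m t)%:E.
  by rewrite cells_union -sumEFin; apply: eq_bigr => t _; exact: mE.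
rewrite (_ : \bigcap_(t in _) _ = [set w | eta w A = 0%E]).
  by rewrite (poisson_void heta mA) muA ?ltry.
apply/seteqP; split => [w h|w /=]; rewrite /= cells_union.
  by rewrite big1// => t Wt; exact: h.
move=> h t Wt; apply/eqP; rewrite eq_le measure_ge0 andbT -h (bigD1 t)//= leeDl//.
by apply: sume_ge0 => i _.
Qed.

Lemma measurable_pattern b : measurable (pattern @^-1` [set b]).
Proof.
rewrite (_ : _ @^-1` _ = \bigcap_(t in [set: T]) (if t \in b then ~` Nul t else Nul t)).
  apply: fin_bigcap_measurable => [|t _]; first exact: finite_finset.
  by case: ifP => _ //; exact: measurableC.
apply/seteqP; split => [w /= <- t _|w h].
  by rewrite inE; case: eqP.
apply/setP => t; rewrite inE; have := h t Logic.I; case: ifP => _; rewrite /Nul /=.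
  by move/eqP ->.
by move=> ->; rewrite eqxx.
Qed.

(** Inclusion-exclusion as in Renyi's theorem: the indicator of a pattern is a combination of
    indicators of void events, whose probabilities factor over the cells. *)
Lemma pattern_law (u : {set T} -> R) : (\int[P]_w (u (pattern w))%:E = (Ex p u)%:E)%E.
Proof.
(* The coefficients in the expansion of the product over t of 1 - 1_Nul (if t is in b) or 1_Nul (if
   not); S collects the factors where the constant is chosen. *)
pose co (b S : {set T}) : R := \prod_t (if t \in S then (t \in b)%:R else if t \in b then -1 else 1).
pose NS (S : {set T}) := \bigcap_(t in [set t | t \notin S]) Nul t.
have mNS S : measurable (NS S) by apply: fin_bigcap_measurable => //; exact: finite_finset.
have ifM (b S : {set T}) (y : T -> R) :
    \prod_t (if t \in S then (t \in b)%:R else (if t \in b then -1 else 1) * y t) =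
    co b S * \prod_(t | t \notin S) y t.
  rewrite [X in _ * X]big_mkcond /co -big_split; apply: eq_bigr => t _ /=.
  by case: (t \in S); rewrite ?mulr1.
have E1 w : u (pattern w) = \sum_(bS : {set T} * {set T}) (u bS.1 * co bS.1 bS.2) * \1_(NS bS.2) w.
  rewrite -(pair_big xpredT xpredT (fun b S => u b * co b S * \1_(NS S) w)) /=.
  transitivity (\sum_b u b * \prod_t ((t \in b)%:R + (if t \in b then -1 else 1) * \1_(Nul t) w)).
    rewrite (bigD1 (pattern w))//= [X in _ * X]big1 ?mulr1; last first.
      move=> t _; rewrite indicE inE; case: eqP => h /=.
        by rewrite mem_set// add0r mulr1.
      by rewrite memNset// mulr0 addr0.
    rewrite big1 ?addr0// => b bw.
    have [t tb] : exists t, (t \in b) != (t \in pattern w).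
      apply/existsP; rewrite -negb_forall; apply: contra bw => /forallP h.
      by apply/eqP/setP => t; apply/eqP; exact: h.
    rewrite (bigD1 t)//= indicE; move: tb; rewrite inE.
    case hN : (eta w (cell t) == 0%E); case: (t \in b) => //= _.
      by rewrite mem_set ?mulN1r ?subrr ?mul0r ?mulr0//; exact/eqP.
    by rewrite memNset ?mulr0 ?addr0 ?mul0r ?mulr0// => /eqP; rewrite hN.
  apply: eq_bigr => b _; rewrite bigA_distr mulr_sumr; apply: eq_bigr => S _.
  rewrite ifM mulrA; congr (_ * _).
  have [h|h] := pselect (NS S w).
    by rewrite indicE mem_set// big1// => t tS; rewrite indicE mem_set//; exact: h.
  rewrite indicE memNset//.
  have [t tS ht] : exists2 t, t \notin S & ~ Nul t w.
    apply/not_exists2P => H; apply: h => t /= tS; have [/(_ tS)//|] := H t; exact: contrapT.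
  by rewrite (bigD1 t)//= indicE memNset// mul0r.
have E2 : Ex p u = \sum_(bS : {set T} * {set T}) (u bS.1 * co bS.1 bS.2) * \prod_(t | t \notin bS.2) expR (- m t).
  rewrite -(pair_big xpredT xpredT (fun b S => u b * co b S * \prod_(t | t \notin S) expR (- m t))) /=.
  rewrite /Ex; apply: eq_bigr => b _.
  transitivity (u b * \prod_t ((t \in b)%:R + (if t \in b then -1 else 1) * expR (- m t))).
    rewrite mulrC /bern_weight; congr (_ * _); apply: eq_bigr => t _.
    by rewrite /pattern_prob /hit_prob; case: (t \in b) => /=; ring.
  rewrite bigA_distr mulr_sumr; apply: eq_bigr => S _.
  by rewrite ifM mulrA.
rewrite E2 -sumEFin.
rewrite (eq_integral (fun w => \sum_(bS : {set T} * {set T}) ((u bS.1 * co bS.1 bS.2) * \1_(NS bS.2) w)%:E)%E); last first.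
  by move=> w _; rewrite E1 sumEFin.
have iN S : P.-integrable setT (EFin \o \1_(NS S)) by exact: integrable_indic.
rewrite integral_sum//; last first.
  move=> [b S]; rewrite (_ : (fun w => _) = (fun w => (u b * co b S)%:E * (\1_(NS S) w)%:E)%E); last first.
    by apply/funext => w; rewrite EFinM.
  by apply: integrableZl => //; exact: iN.
apply: eq_bigr => -[b S] _ /=.
under eq_integral do rewrite EFinM.
transitivity ((u b * co b S)%:E * \int[P]_x (\1_(NS S) x)%:E)%E.
  by apply: integralZl => //; exact: iN.
have -> : (\int[P]_x (\1_(NS S) x)%:E = (\prod_(t | t \notin S) expR (- m t))%:E)%E.
  by rewrite integral_indic// setIT; exact: void_probability.
by rewrite -EFinM.
Qed.

Variables (delta : R).
Hypothesis delta0 : 0 < delta.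
Hypothesis delta6 : delta <= 6^-1.
Hypothesis m_delta : forall t, m t <= delta.

Local Notation V t w := (fine (eta w (cell t))).
Let V0 t w : 0 <= V t w. Proof. exact: fine_ge0. Qed.

Let U : set Z := \bigcup_t cell t.

Let mU : measurable U.
Proof. by apply: fin_bigcup_measurable => //; exact: finite_finset. Qed.

Let muU : mu U = (\sum_t m t)%:E.
Proof. by rewrite /U measure_fin_union// -sumEFin; apply: eq_bigr => t _; exact: mE. Qed.

Definition integer_cells w := forall t, exists k : nat, eta w (cell t) = k%:R%:E.

Lemma ae_integer_cells : {ae P, forall w, integer_cells w}.
Proof. by apply: filter_forall => t; apply: (poisson_nat heta (mcell t)); rewrite mE ltry. Qed.

(* Since k - 1_(k > 0) <= 1_(k > 0) (2^k - 2)^2, only exponential moments and  *)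
(* void probabilities are needed to bound the probability of multiple points.  *)
Definition excess t w : R := (1 - \1_(Nul t) w) * (expR (ln 2 * V t w) - 2) ^+ 2.

Lemma excess_ge0 t w : 0 <= excess t w.
Proof. by rewrite mulr_ge0 ?sqr_ge0// subr_ge0 indicE; case: (_ \in _). Qed.

Let expln2 (k : nat) : expR (ln 2 * k%:R) = 2 ^+ k :> R.
Proof. by rewrite expRM_natr lnK// posrE. Qed.

Lemma excess_le t w : integer_cells w -> V t w - (t \in pattern w)%:R <= excess t w.
Proof.
move=> /(_ t)[k Vk]; rewrite /excess inE indicE Vk /= expln2.
case: k Vk => [|[|k]] Vk.
- by rewrite eqxx /= subr0 mulr_ge0 ?sqr_ge0// subr_ge0; case: (_ \in _).
- by rewrite eqe oner_eq0 /= subrr mulr_ge0 ?sqr_ge0// subr_ge0; case: (_ \in _).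
rewrite eqe pnatr_eq0 /= memNset ?subr0 ?mul1r; last by rewrite /Nul /= Vk => -[/eqP]; rewrite pnatr_eq0.
have h : k.+2%:R + 1 <= 2 ^+ k.+2 - 0 :> R.
  elim: k {Vk} => [|k IH]; first by rewrite subr0 expr2; lra.
  by rewrite subr0 exprS; move: IH; rewrite subr0 -(natr1 k.+2) => IH; have : 0 <= k.+2%:R :> R by []; lra.
rewrite subr0 in h; have h0 : 0 <= k%:R :> R by [].
by move: h; rewrite -(natr1 k.+1) -(natr1 k) mulr1n => h; nra.
Qed.

Let mfV t : measurable_fun setT (fun w => V t w).
Proof.
apply: (@measurableT_comp _ _ _ _ _ _ fine); first exact: fine_measurable.
exact: (poisson_measurable heta (mcell t)).
Qed.

Let mexp (a : R) t : measurable_fun setT (fun w => expR (a * V t w)).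
Proof.
apply: (@measurableT_comp _ _ _ _ _ _ (@expR R)) => //.
by apply: measurable_funM => //; exact: mfV.
Qed.

Lemma measurable_excess t : measurable_fun setT (excess t).
Proof.
apply: measurable_funM; first by apply: measurable_funB => //; exact: measurable_indic.
by apply: measurable_funX; apply: measurable_funB => //; exact: mexp.
Qed.

(** Since (2^V - 2)^2 is 1 at V = 0, the excess is 4^V - 4 2^V + 4 minus the void indicator, of mean
    e^(3m) - 4 e^m + 4 - e^(-m). The orders 0 and 1 cancel, and 3m <= 1/2 allows the quadratic bound
    of the first exponential. *)
Lemma excess_mean t : (\int[P]_w (excess t w)%:E <= (18 * m t ^+ 2)%:E)%E.
Proof.
have ln22 : expR (ln 2 * 2) = 4 :> R by have := expln2 2; rewrite expr2; lra.
have E1 : (\int[P]_w (expR (ln 2 * V t w))%:E = (expR (m t))%:E)%E.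
  rewrite (poisson_exp_moment heta (mcell t)); last by rewrite mE ltry.
  by rewrite lnK ?posrE// /cell_mass; congr (expR _)%:E; lra.
have E2 : (\int[P]_w (expR (ln 2 * 2 * V t w))%:E = (expR (3 * m t))%:E)%E.
  rewrite (poisson_exp_moment heta (mcell t)); last by rewrite mE ltry.
  by rewrite ln22 /cell_mass; congr (expR _)%:E; lra.
have key : (\int[P]_w (excess t w)%:E + (4 * expR (m t) + expR (- m t))%:E = (expR (3 * m t) + 4)%:E)%E.
  have E3 : (\int[P]_w (4 * expR (ln 2 * V t w) + \1_(Nul t) w)%:E = (4 * expR (m t) + expR (- m t))%:E)%E.
    under eq_integral do rewrite EFinD EFinM.
    rewrite ge0_integralD//; try (by move=> w _; rewrite mule_ge0// lee_fin expR_ge0);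
      try (by apply: emeasurable_funM => //; apply/measurable_EFinP; exact: mexp);
      try (by apply/measurable_EFinP; exact: measurable_indic).
    rewrite ge0_integralZl//; try (by apply/measurable_EFinP; exact: mexp);
      try (by move=> w _; rewrite lee_fin expR_ge0).
    have -> : (\int[P]_x (\1_(Nul t) x)%:E = (expR (- m t))%:E)%E.
      rewrite integral_indic// setIT; apply: (poisson_void heta (mcell t)).
      by rewrite mE ltry.
    by rewrite E1 -EFinM -EFinD.
  have E4 : (\int[P]_w (expR (ln 2 * 2 * V t w) + 4)%:E = (expR (3 * m t) + 4)%:E)%E.
    under eq_integral do rewrite EFinD.
    rewrite ge0_integralD//; try (by move=> w _; rewrite lee_fin expR_ge0);
      try (by apply/measurable_EFinP; exact: mexp).
    have -> : (\int[P]__ 4%:E = 4%:E :> \bar R)%E.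
      by rewrite integral_cst// -[RHS]mule1; congr (_ * _)%E; exact: probability_setT.
    by rewrite E2.
  have m3 : measurable_fun setT (fun w => (4 * expR (ln 2 * V t w) + \1_(Nul t) w)%:E).
    apply/measurable_EFinP; apply: measurable_funD; last exact: measurable_indic.
    by apply: measurable_funM => //; exact: mexp.
  have p3 w : (0 <= (4 * expR (ln 2 * V t w) + \1_(Nul t) w)%:E :> \bar R)%E.
    by rewrite lee_fin addr_ge0// mulr_ge0// expR_ge0.
  have m4 : measurable_fun setT (fun w => (excess t w)%:E) by apply/measurable_EFinP; exact: measurable_excess.
  have p4 w : (0 <= (excess t w)%:E)%E by rewrite lee_fin excess_ge0.
  rewrite -E3 -E4 -ge0_integralD//.
  apply: eq_integral => w _; rewrite -EFinD; congr (_%:E).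
  rewrite /excess indicE (mulrAC _ 2) mulrC.
  have -> : expR (ln 2 * V t w * 2) = expR (ln 2 * V t w) ^+ 2 by rewrite expRM_natr.
  have [h|h] := pselect (Nul t w); last by rewrite memNset//=; ring.
  by rewrite mem_set//= h /= mulr0 expR0; ring.
have fin : (\int[P]_w (excess t w)%:E)%E \is a fin_num.
  rewrite ge0_fin_numE; last by apply: integral_ge0 => w _; rewrite lee_fin excess_ge0.
  rewrite ltey; apply/eqP => h; by rewrite h in key.
move: key; rewrite -(fineK fin) -EFinD lee_fin => -[key].
have m1 := m_delta t; have m2 := m0 t; have d6 := delta6.
have h3 : expR (3 * m t) <= 1 + 3 * m t + 2 * (3 * m t) ^+ 2 by apply: expR_le_quadratic; apply/andP; split; lra.
have h4 := expR_ge1Dx (m t); have h5 := expR_ge1Dx (- m t).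
by lra.
Qed.

(** At least 1 and, at integer configurations, larger than every Poisson or Bernoulli increment over
    a union of cells ([increment_gap]). *)
Definition majorant w : R := 1 + 4 * (fine (eta w U) + fine (mu U)).

Lemma majorant_ge1 w : 1 <= majorant w.
Proof. by rewrite /majorant lerDl mulr_ge0// addr_ge0// fine_ge0. Qed.

Lemma measurable_majorant : measurable_fun setT majorant.
Proof.
apply: measurable_funD => //; apply: measurable_funM => //; apply: measurable_funD => //.
apply: (@measurableT_comp _ _ _ _ _ _ fine); first exact: fine_measurable.
exact: (poisson_measurable heta mU).
Qed.

Definition moment_constant (c : R) (n : nat) : R := n`!%:R * expR (1 + 4 * c) * expR (c * (expR 4 - 1)).

(** x^n <= n! e^x and the exponential moment of the Poisson count. *)
Lemma majorant_moment n : (\int[P]_w (majorant w ^+ n)%:E <= (moment_constant (fine (mu U)) n)%:E)%E.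
Proof.
apply: (@le_trans _ _ (\int[P]_w ((n`!%:R * expR (1 + 4 * fine (mu U)))%:E * (expR (4 * fine (eta w U)))%:E))%E).
  apply: ge0_le_integral => //.
  - by move=> w _; rewrite lee_fin exprn_ge0// (le_trans _ (majorant_ge1 w)).
  - by apply/measurable_EFinP; apply: measurable_funX; exact: measurable_majorant.
  - apply: emeasurable_funM => //; apply/measurable_EFinP; apply: (@measurableT_comp _ _ _ _ _ _ (@expR R)) => //.
    apply: measurable_funM => //; apply: (@measurableT_comp _ _ _ _ _ _ fine); first exact: fine_measurable.
    exact: (poisson_measurable heta mU).
  - move=> w _; rewrite -EFinM lee_fin -mulrA -expRD.
    have -> : 1 + 4 * fine (mu U) + 4 * fine (eta w U) = majorant w by rewrite /majorant; ring.
    have M0 : 0 <= majorant w by apply: (le_trans _ (majorant_ge1 w)).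
    case: n => [|n]; first by rewrite expr0 fact0 mul1r -expR0 ler_expR.
    rewrite -ler_pdivrMl ?ltr0n ?fact_gt0//.
    by have := expR_ge1Dxn n M0; rewrite mulrC; lra.
rewrite ge0_integralZl//.
- by rewrite (poisson_exp_moment heta mU) ?muU ?ltry// -EFinM.
- apply/measurable_EFinP; apply: (@measurableT_comp _ _ _ _ _ _ (@expR R)) => //.
  apply: measurable_funM => //; apply: (@measurableT_comp _ _ _ _ _ _ fine); first exact: fine_measurable.
  exact: (poisson_measurable heta mU).

Qed.

Variables (q : nat) (s : elementary Z R q).
Hypotheses (sok : elementary_ok mu s) (rs : refines_elementary kap s).
Local Notation X w t := (bern_var pattern_x1 pattern_x0 t (pattern w)).

Lemma refines_mem (c : R) (A : 'I_q -> set Z) : (c, A) \in s -> forall j, refines kap (A j).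
Proof.
move=> cA j; have : List.In (c, A) s.
  by elim: (s) cA => //= x s' IH; rewrite inE => /orP[/eqP ->|/IH]; [left|right].
by move=> h; exact: rs h j.
Qed.

Lemma prod_sub_le n (a b : 'I_n -> R) (M rho : R) : 1 <= M -> 0 <= rho -> (forall j, `|a j| <= M) ->
  (forall j, `|b j| <= M) -> (forall j, `|a j - b j| <= rho) ->
  `|\prod_j a j - \prod_j b j| <= n%:R * M ^+ n * rho.
Proof.
move=> M1 rho0; have M0 : 0 <= M by apply: (le_trans _ M1).
elim: n a b => [|n IH] a b aM bM ab; first by rewrite !big_ord0 subrr normr0 !mul0r.
rewrite !big_ord_recl.
set A := \prod_(i < n) _; set B := \prod_(i < n) _.
have -> : a ord0 * A - b ord0 * B = a ord0 * (A - B) + (a ord0 - b ord0) * B by ring.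
have hAB : `|A - B| <= n%:R * M ^+ n * rho by apply: IH.
have hB : `|B| <= M ^+ n.
  rewrite normr_prod -[Y in M ^+ Y]card_ord -prodr_const; apply: ler_prod => j _.
  by rewrite normr_ge0 bM.
apply: (le_trans (ler_normD _ _)); rewrite !normrM.
apply: (@le_trans _ _ (M * (n%:R * M ^+ n * rho) + rho * M ^+ n)).
  by apply: lerD; apply: ler_pM.
rewrite exprS -natr1; have : rho * M ^+ n <= rho * (M * M ^+ n).
  by rewrite ler_wpM2l// ler_peMl// exprn_ge0.
by lra.
Qed.

Lemma cells_sum (m' : {measure set Z -> \bar R}) (A : set Z) : refines kap A ->
  (forall t, m' (cell t) \is a fin_num) ->
  fine (m' A) = \sum_t (cells_of kap A t)%:R * fine (m' (cell t)).
Proof.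
move=> rA mfin.
have AE : A = \bigcup_(t in [set t | cells_of kap A t]) cell t.
  apply/seteqP; split => [z Az|z [t /= At]]; last by move=> kz; apply/(cells_ofP rA kz).
  have := rA.2 z Az; case kz : (kap z) => [t|//] _; exists t => //=.
  by apply/(cells_ofP rA kz).
rewrite {1}AE cells_union -sum_fine// [LHS]big_mkcond; apply: eq_bigr => t _.
by case: ifP => _; rewrite ?mul1r ?mul0r.
Qed.

Definition gap w : R := 2 * delta * majorant w + \sum_t (V t w - (t \in pattern w)%:R).

Let UE : U = \bigcup_(t in [set t | xpredT t]) cell t.
Proof. by apply/seteqP; split => z [t _ h]; exists t. Qed.

(** The errors of the single cells are added: one part is proportional to delta and to the masses,
    the other counts the points beyond the first in each cell. *)
Lemma increment_gap w (A : set Z) : integer_cells w -> refines kap A ->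
  [/\ 0 <= gap w /\ gap w <= 2 * majorant w, `|\sum_t (cells_of kap A t)%:R * X w t| <= majorant w,
   `|fine (eta w A) - fine (mu A)| <= majorant w &
   `|(fine (eta w A) - fine (mu A)) - \sum_t (cells_of kap A t)%:R * X w t| <= gap w].
Proof.
move=> nat_w rA.
have etafin t : eta w (cell t) \is a fin_num by have [k ->] := nat_w t.
have mufin t : mu (cell t) \is a fin_num by rewrite mE.
rewrite !cells_sum//.
pose chi t : R := (cells_of kap A t)%:R.
have chi01 t : 0 <= chi t <= 1 by rewrite /chi; case: cells_of; rewrite ?lexx ?ler01.
pose H := \sum_t V t w + \sum_t m t.
have MH : majorant w = 1 + 4 * H.
  rewrite /majorant muU /= /H; congr (1 + 4 * (_ + _)).
  by rewrite UE cells_union -sum_fine.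
have D0 t : 0 <= V t w - (t \in pattern w)%:R.
  rewrite subr_ge0 inE; have [k Vk] := nat_w t; rewrite Vk /=; case: k Vk => [|k] _; first by rewrite eqxx.
  by rewrite eqe pnatr_eq0 /= ler1n.
have D1 t : V t w - (t \in pattern w)%:R <= V t w by rewrite gerBl.
have d0 := delta0; have d6 := delta6.
have H0 : 0 <= H by rewrite addr_ge0// sumr_ge0.
(* The scale exceeds 1 by at most 2 delta, scale times probability differs from m t by at most 2
   delta m t, and the surplus points make up the rest. *)
have step t : `|(V t w - m t) - X w t| <= 2 * delta * V t w + (V t w - (t \in pattern w)%:R) + 2 * delta * m t.
  have m12 : 0 <= m t <= 2^-1 by rewrite m0 /=; have := m_delta t; have := delta6; lra.
  have /andP[s1 s2] := hit_scale_bounds m12; have := hit_scale_prob m12.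
  have md := m_delta t; have := m0 t.
  set ss := hit_scale (m t) in s1 s2 *; set pp := hit_prob (m t) => mt0.
  rewrite ler_norml => /andP[p1 p2].
  have XE : X w t = ss * (t \in pattern w)%:R - ss * pp.
    by rewrite /bern_var /pattern_x1 /pattern_x0 /pattern_scale /pattern_prob -/ss -/pp; case: (t \in pattern w) => /=; ring.
  have Vle : (t \in pattern w)%:R <= V t w by have := D0 t; lra.
  have i0 : 0 <= (t \in pattern w)%:R :> R by [].
  rewrite XE; set I := _%:R in Vle i0 *; set v := V t w in Vle *.
  have h1 : (ss - 1) * I <= 2 * delta * v by apply: ler_pM => //; lra.
  have h2 : 0 <= (ss - 1) * I by apply: mulr_ge0 => //; lra.
  have h3 : 2 * m t ^+ 2 <= 2 * delta * m t by rewrite expr2; nra.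
  have hV := V0 t w; rewrite -/v in hV.
  have hd : 0 <= 2 * delta * v by rewrite mulr_ge0//; lra.
  by rewrite ler_norml; apply/andP; split; lra.
have gE : \sum_t (2 * delta * V t w + (V t w - (t \in pattern w)%:R) + 2 * delta * m t) <= gap w.
  rewrite !big_split /= -!mulr_sumr -big_split /= /gap MH.
  have -> : 2 * delta * (1 + 4 * H) = 2 * delta * \sum_t V t w + 2 * delta * \sum_t m t + 2 * delta * (1 + 3 * H).
    by rewrite /H; ring.
  have : 0 <= 2 * delta * (1 + 3 * H) by rewrite mulr_ge0//; lra.
  lra.
have hat : `|\sum_t chi t * V t w - \sum_t chi t * m t| <= H.
  rewrite -sumrB; apply: (le_trans (ler_norm_sum _ _ _)); rewrite /H -big_split /=.
  apply: ler_sum => t _; rewrite -mulrBr normrM ger0_norm; last by have /andP[] := chi01 t.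
  apply: (@le_trans _ _ (1 * `|V t w - m t|)).
    by apply: ler_wpM2r => //; have /andP[] := chi01 t.
  rewrite mul1r; apply: (le_trans (ler_normB _ _)).
  by rewrite !ger0_norm.
have dif0 : `|(\sum_t chi t * V t w - \sum_t chi t * m t) - \sum_t chi t * X w t| <=
    \sum_t (2 * delta * V t w + (V t w - (t \in pattern w)%:R) + 2 * delta * m t).
  rewrite -!sumrB; apply: (le_trans (ler_norm_sum _ _ _)); apply: ler_sum => t _.
  rewrite -!mulrBr normrM ger0_norm; last by have /andP[] := chi01 t.
  apply: le_trans (step t); apply: (@le_trans _ _ (1 * `|V t w - m t - X w t|)); last by rewrite mul1r.
  by apply: ler_wpM2r => //; have /andP[] := chi01 t.
have g0 : 0 <= gap w.
  rewrite addr_ge0 ?sumr_ge0// mulr_ge0 ?(le_trans _ (majorant_ge1 w))//; lra.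
have sumle : \sum_t (2 * delta * V t w + (V t w - (t \in pattern w)%:R) + 2 * delta * m t) <= 2 * H.
  rewrite /H -big_split /= mulr_sumr; apply: ler_sum => t _.
  by have := D1 t; have := V0 t w; have := m0 t; nra.
split.
- split => //; rewrite /gap MH.
  have : \sum_t (V t w - (t \in pattern w)%:R) <= H.
    apply: (@le_trans _ _ (\sum_t V t w)); first by apply: ler_sum.
    by rewrite lerDl sumr_ge0.
  have : 2 * delta * (1 + 4 * H) <= 1 * (1 + 4 * H) by apply: ler_wpM2r; lra.
  lra.
- have := le_trans dif0 sumle; rewrite MH; move: hat.
  rewrite !ler_norml => /andP[a1 a2] /andP[b1 b2]; rewrite /chi in a1 a2 b1 b2.
  by apply/andP; split; lra.
- by apply: (le_trans hat); rewrite MH; lra.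
- by apply: le_trans gE.
Qed.

Local Notation chaos_s w := (chaos pattern_x1 pattern_x0 (fun S => q`!%:R * sym_coeff kap s S) (pattern w)).
Definition coefficient_norm : R := \sum_(cA <- s) `|cA.1|.

Lemma integral_gap w : integer_cells w ->
  `|elementary_integral mu eta s w - chaos_s w| <= coefficient_norm * (q%:R * majorant w ^+ q * gap w).
Proof.
move=> nat_w.
have -> : chaos_s w = \sum_(cA <- s) cA.1 * \prod_(j < q) \sum_t (cells_of kap (cA.2 j) t)%:R * X w t.
  by rewrite (elementary_chaos (fun t => X w t) sok rs).
rewrite /elementary_integral -sumrB /coefficient_norm mulr_suml.
rewrite big_seq [leRHS]big_seq; apply: (le_trans (ler_norm_sum _ _ _)); apply: ler_sum => -[c A] cA /=.
have rA := refines_mem cA.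
rewrite -mulrBr normrM ler_wpM2l//; apply: prod_sub_le.
- exact: majorant_ge1.
- case: q A rA {cA} => [|q'] A rA; last by have [[]] := increment_gap nat_w (rA ord0).
  by have [[]] := increment_gap (A := set0) nat_w ltac:(by split).
- by move=> j; have [] := increment_gap nat_w (rA j).
- by move=> j; have [] := increment_gap nat_w (rA j).
- by move=> j; have [] := increment_gap nat_w (rA j).
Qed.

Lemma measurable_elementary_integral : measurable_fun setT (elementary_integral mu eta s).
Proof.
rewrite /elementary_integral.
rewrite (_ : (fun w => _) = (fun w => \sum_(cA <- s) (if cA \in s then cA.1 * \prod_(j < q) (fine (eta w (cA.2 j)) - fine (mu (cA.2 j))) else 0))); last first.
  by apply/funext => w; rewrite -big_mkcondr /= big_seq_cond; apply: eq_bigl => x; rewrite andbT.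
apply: measurable_sum => -[c A] /=; have [cA|//] := boolP ((c, A) \in s).
apply: measurable_funM => //; apply: measurable_prod => j _.
apply: measurable_funB => //.
apply: (@measurableT_comp _ _ _ _ _ _ fine); first exact: fine_measurable.
apply: (poisson_measurable heta).
have sz : (index (c, A) s < size s)%N by rewrite index_mem.
by have [/(_ j)[]] := sok sz; rewrite nth_index.
Qed.

Lemma measurable_of_pattern (u : {set T} -> R) : measurable_fun setT (fun w => u (pattern w)).
Proof. by apply: measurable_finite_factor; exact: measurable_pattern. Qed.

(** The squared gap is at most 2 [majorant] times the gap. The surplus D satisfies D M^(2q+1) <= K D
    + D M^(4q+2) / K; the first D is bounded by the excess and the second by M, so that no joint
    moment of excess and majorant is needed. *)
Lemma elementary_approx (K : R) : 0 < K ->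
  (\int[P]_w ((elementary_integral mu eta s w - chaos_s w) ^+ 2)%:E <=
   (2 * (coefficient_norm * q%:R) ^+ 2 *
     ((2 * delta + K^-1) * moment_constant (fine (mu U)) (4 * q + 3) + K * \sum_t 18 * m t ^+ 2))%:E)%E.
Proof.
move=> K0; set C0 := 2 * _; have C00 : 0 <= C0 by rewrite mulr_ge0// sqr_ge0.
set L := (4 * q + 3)%N.
have dK : 0 <= 2 * delta + K^-1 by rewrite addr_ge0 ?invr_ge0 ?mulr_ge0// ltW.
have Mexp0 w n : 0 <= majorant w ^+ n by rewrite exprn_ge0// (le_trans _ (majorant_ge1 w)).
have ex0 w : 0 <= \sum_t excess t w by apply: sumr_ge0 => t _; exact: excess_ge0.
have mM n : measurable_fun setT (fun w => (majorant w ^+ n)%:E : \bar R).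
  by apply/measurable_EFinP; apply: measurable_funX; exact: measurable_majorant.
have mex : measurable_fun setT (fun w => (\sum_t excess t w)%:E).
  by apply/measurable_EFinP; apply: measurable_sum => t; exact: measurable_excess.
apply: (@le_trans _ _ (\int[P]_w (C0 * ((2 * delta + K^-1) * majorant w ^+ L + K * \sum_t excess t w))%:E)%E).
  apply: ae_ge0_le_integral => //.
  - by move=> w _; rewrite lee_fin sqr_ge0.
  - apply/measurable_EFinP; apply: measurable_funX; apply: measurable_funB.
      exact: measurable_elementary_integral.
    exact: (measurable_of_pattern (fun b => chaos pattern_x1 pattern_x0 _ b)).
  - move=> w _; rewrite lee_fin; apply: mulr_ge0 => //.
    by apply: addr_ge0; apply: mulr_ge0 => //; exact: ltW.
  - apply/measurable_EFinP; apply: measurable_funM => //; apply: measurable_funD; apply: measurable_funM => //.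
      exact/measurable_EFinP/mM.
    exact/measurable_EFinP/mex.
  apply: filterS ae_integer_cells => w nat_w _; rewrite lee_fin.
  have h := integral_gap nat_w.
  have [[g0 g2] _ _ _] := increment_gap (A := set0) nat_w ltac:(by split).
  have M1 := majorant_ge1 w; have M0 : 0 <= majorant w by apply: (le_trans _ M1).
  rewrite -real_normK ?num_real//.
  apply: (@le_trans _ _ ((coefficient_norm * (q%:R * majorant w ^+ q * gap w)) ^+ 2)).
    by rewrite lerXn2r ?nnegrE// (le_trans _ h).
  have -> : (coefficient_norm * (q%:R * majorant w ^+ q * gap w)) ^+ 2 =
     (coefficient_norm * q%:R) ^+ 2 * (majorant w ^+ q ^+ 2 * (gap w * gap w)) by ring.
  rewrite /C0 [2 * _]mulrC -[leRHS]mulrA; apply: ler_wpM2l; first exact: sqr_ge0.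
  set D := \sum_t (V t w - (t \in pattern w)%:R).
  have gE : gap w = 2 * delta * majorant w + D by [].
  have DG : D <= \sum_t excess t w by apply: ler_sum => t _; exact: excess_le.
  have D0 : 0 <= D.
    apply: sumr_ge0 => t _; rewrite subr_ge0 inE; have [k Vk] := nat_w t; rewrite Vk /=; case: k Vk => [|k] _; first by rewrite eqxx.
    by rewrite eqe pnatr_eq0 /= ler1n.
  have D2 : D <= majorant w.
    apply: (@le_trans _ _ (\sum_t V t w)); first by apply: ler_sum => t _; rewrite gerBl.
    have etafin t : eta w (cell t) \is a fin_num by have [k ->] := nat_w t.
    rewrite /majorant UE cells_union -sum_fine//.
    have : 0 <= \sum_t V t w by apply: sumr_ge0.
    have : 0 <= fine (mu (\bigcup_(t in [set t | xpredT t]) cell t)) by exact: fine_ge0.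
    lra.
  set M := majorant w in M1 M0 g2 gE D2 *; set G := \sum_t excess t w in DG *.
  have e1 : M ^+ q ^+ 2 * (gap w * gap w) <= M ^+ q ^+ 2 * (2 * M * gap w).
    by apply: ler_wpM2l; [rewrite sqr_ge0|apply: ler_wpM2r].
  apply: (le_trans e1); rewrite gE.
  have hexp a b : (a <= b)%N -> M ^+ a <= M ^+ b by exact: ler_weXn2l.
  clearbody M G D.
  have -> : M ^+ q ^+ 2 * (2 * M * (2 * delta * M + D)) =
     2 * (2 * delta * M ^+ (2 * q + 2) + D * M ^+ (2 * q + 1)).
    by rewrite -exprM [(q * 2)%N]mulnC !exprD expr2 expr1; ring.
  rewrite ler_pM2l// (mulrDl (2 * delta) K^-1) -addrA; apply: lerD.
    apply: ler_wpM2l; first by rewrite mulr_ge0// ltW.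
    by apply: hexp; exact: leq_add (leq_mul (isT : (2 <= 4)%N) (leqnn q)) (isT : (2 <= 3)%N).
  have amgm : M ^+ (2 * q + 1) <= K + K^-1 * (M ^+ (2 * q + 1)) ^+ 2.
    have := sqr_ge0 (M ^+ (2 * q + 1) - K / 2) => hs.
    rewrite -subr_ge0; set a := M ^+ _ in hs *.
    have -> : K + K^-1 * a ^+ 2 - a = K^-1 * ((a - K / 2) ^+ 2 + 3 / 4 * K ^+ 2) by field; rewrite gt_eqF.
    by rewrite mulr_ge0 ?invr_ge0 ?(ltW K0)// addr_ge0// mulr_ge0// sqr_ge0.
  apply: (@le_trans _ _ (D * (K + K^-1 * (M ^+ (2 * q + 1)) ^+ 2))); first exact: ler_wpM2l.
  rewrite mulrDr (addrC (D * K)); apply: lerD; last by rewrite (mulrC D K); apply: (ler_wpM2l (ltW K0)).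
  rewrite mulrCA; apply: ler_wpM2l; first by rewrite invr_ge0 ltW.
  apply: (@le_trans _ _ (M * (M ^+ (2 * q + 1)) ^+ 2)); first by apply: ler_wpM2r => //; rewrite sqr_ge0.
  by rewrite -exprM -exprS; apply: hexp; rewrite mulnDl mulnAC -addnS.
under eq_integral do rewrite EFinM.
rewrite ge0_integralZl//; last 2 first.
- apply/measurable_EFinP; apply: measurable_funD; apply: measurable_funM => //.
    exact/measurable_EFinP/mM.
  exact/measurable_EFinP/mex.
- by move=> w _; rewrite lee_fin; apply: addr_ge0; apply: mulr_ge0 => //; exact: ltW.
rewrite (EFinM C0); apply: lee_wpmul2l; first by rewrite lee_fin.
under eq_integral do rewrite EFinD.
have mA : measurable_fun setT (fun w => ((2 * delta + K^-1) * majorant w ^+ L)%:E).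
  by apply/measurable_EFinP; apply: measurable_funM => //; exact/measurable_EFinP/mM.
have mB : measurable_fun setT (fun w => (K * \sum_t excess t w)%:E).
  by apply/measurable_EFinP; apply: measurable_funM => //; exact/measurable_EFinP.
rewrite ge0_integralD//; try (by move=> w _; rewrite lee_fin mulr_ge0// ltW).
rewrite EFinD; apply: leeD.
  under eq_integral do rewrite EFinM.
  rewrite ge0_integralZl//; last by move=> w _; rewrite lee_fin.
  by rewrite (EFinM (2 * delta + K^-1)); apply: lee_wpmul2l; [rewrite lee_fin|exact: majorant_moment].
under eq_integral do rewrite EFinM.
rewrite ge0_integralZl//; [|by move=> w _; rewrite lee_fin|by rewrite lee_fin ltW].
rewrite (EFinM K); apply: lee_wpmul2l; first by rewrite lee_fin ltW.
rewrite (eq_integral (fun w => \sum_t (excess t w)%:E)%E); last by move=> w _; rewrite sumEFin.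
rewrite ge0_integral_sum//; last 2 first.
- by move=> t; apply/measurable_EFinP; exact: measurable_excess.
- by move=> t w _; rewrite lee_fin excess_ge0.
by rewrite -sumEFin; apply: lee_sum => t _; exact: excess_mean.
Qed.

End pattern.

Lemma sqrD_le (R : realFieldType) (a b : R) : (a + b) ^+ 2 <= 2 * (a ^+ 2 + b ^+ 2).
Proof. by have := sqr_ge0 (a - b); nra. Qed.

Lemma sum_sqr_le (R : realFieldType) (I : finType) (a : I -> R) :
  (\sum_i a i) ^+ 2 <= #|I|%:R * \sum_i a i ^+ 2.
Proof.
have h : 0 <= \sum_i \sum_j (a i - a j) ^+ 2.
  by apply: sumr_ge0 => i _; apply: sumr_ge0 => j _; exact: sqr_ge0.
have E : \sum_i \sum_j (a i - a j) ^+ 2 = 2 * (#|I|%:R * \sum_i a i ^+ 2 - (\sum_i a i) ^+ 2).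
  transitivity (\sum_i (#|I|%:R * a i ^+ 2 + \sum_j a j ^+ 2 - 2 * (a i * \sum_j a j))).
    apply: eq_bigr => i _.
    rewrite mulr_natl !mulr_sumr -sumr_const -big_split -sumrB /=; apply: eq_bigr => j _; ring.
  rewrite sumrB big_split /= -!mulr_sumr -mulr_suml sumr_const -[in RHS]mulr_natl.
  by rewrite -(mulr_natl _ #|I|) expr2; ring.
by rewrite E pmulr_rge0// subr_ge0 in h.
Qed.

(** * Approximation by elementary kernels and elementary integrals *)

Section approximation.
Context d (Z : measurableType d) (R : realType).
Variable mu : {sigma_finite_measure set Z -> \bar R}.
Local Notation tm := (tuple_measure mu).
Local Notation Iint := (tuple_integral mu).

Lemma measurable_elementary_kernel q (s : elementary Z R q) : elementary_ok mu s ->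
  measurable_fun setT (elementary_kernel s).
Proof.
move=> sok; rewrite /elementary_kernel.
rewrite (_ : (fun x => _) = (fun x => \sum_(cA <- s) (if cA \in s then cA.1 * \prod_(j < q) \1_(cA.2 j) (tnth x j) else 0))); last first.
  by apply/funext => x; rewrite -big_mkcondr /= big_seq_cond; apply: eq_bigl => y; rewrite andbT.
apply: measurable_sum => -[c A] /=; have [cA|//] := boolP ((c, A) \in s).
apply: measurable_funM => //; apply: measurable_prod => j _.
apply: (@measurableT_comp _ _ _ _ _ _ (\1_(A j) : Z -> R)); last exact: measurable_tnth.
apply: measurable_indic.
have sz : (index (c, A) s < size s)%N by rewrite index_mem.
by have [/(_ j)[]] := sok _ sz; rewrite nth_index.
Qed.

(* Jensen's inequality for the average over the permutations. *)
Lemma symmetrize_le q (f g : q.-tuple Z -> R) : measurable_fun setT f -> measurable_fun setT g ->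
  (forall (s : 'S_q) x, g (tperm_tuple s x) = g x) ->
  (\int[tm q]_x ((symmetrize f x - g x) ^+ 2)%:E <= \int[tm q]_x ((f x - g x) ^+ 2)%:E)%E.
Proof.
move=> mf mg sg; set h := fun x => ((f x - g x) ^+ 2)%:E.
have q0 : (0 : R) < q`!%:R by rewrite ltr0n fact_gt0.
have mh : measurable_fun setT h.
  by apply/measurable_EFinP; apply: measurable_funX; exact: measurable_funB.
have h0 x : (0 <= h x)%E by rewrite lee_fin sqr_ge0.
have mhs s : measurable_fun setT (h \o tperm_tuple s).
  by apply: measurableT_comp mh _; exact: measurable_tperm.
apply: (@le_trans _ _ (\int[tm q]_x ((q`!%:R^-1)%:E * \sum_(s : 'S_q) h (tperm_tuple s x)))%E).
  apply: ge0_le_integral => //.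
  - by move=> x _; rewrite lee_fin sqr_ge0.
  - apply/measurable_EFinP; apply: measurable_funX; apply: measurable_funB => //.
    apply: measurable_funM => //; apply: measurable_sum => s.
    exact: measurableT_comp mf (measurable_tperm s).
  - by apply: emeasurable_funM => //; apply: emeasurable_sum => s; exact: mhs.
  move=> x _; rewrite sumEFin -EFinM lee_fin.
  have -> : symmetrize f x - g x = q`!%:R^-1 * \sum_(s : 'S_q) (f (tperm_tuple s x) - g (tperm_tuple s x)).
    rewrite sumrB mulrBr /symmetrize; congr (_ - _).
    under eq_bigr do rewrite sg.
    by rewrite sumr_const -[#|_|]/(#|'S_q|) card_Sn -[g x *+ _]mulr_natl mulrA mulVf ?mul1r// gt_eqF.
  rewrite exprMn; apply: (@le_trans _ _ (q`!%:R^-1 ^+ 2 * (q`!%:R * \sum_(s : 'S_q) (f (tperm_tuple s x) - g (tperm_tuple s x)) ^+ 2))).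
    by apply: ler_wpM2l; [exact: sqr_ge0|rewrite -card_Sn; exact: sum_sqr_le].
  by rewrite mulrA expr2 -(mulrA _^-1) mulVf ?mulr1// gt_eqF.
rewrite ge0_integralZl//; last 2 first.
- by apply: emeasurable_sum => s; exact: mhs.
- by move=> x _; apply: sume_ge0.
rewrite ge0_integral_sum//.
rewrite (eq_bigr (fun=> \int[tm q]_x h x)%E); last by move=> s _; exact: integral_perm.
rewrite (eq_bigr (fun=> 1 * \int[tm q]_x h x)%E); last by move=> s _; rewrite mul1e.
rewrite -ge0_sume_distrl// sumEFin sumr_const -[#|_|]/(#|'S_q|) card_Sn.
by rewrite muleA -EFinM mulVf ?mul1e// gt_eqF.
Qed.

Lemma contr_energyZ (T : finType) (m : T -> R) (c c' : R) (g h : {set T} -> R) p q r l :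
  contr_energy m (fun S => c * g S) (fun S => c' * h S) p q r l =
  (c * c') ^+ 2 * contr_energy m g h p q r l.
Proof.
rewrite /contr_energy /energy mulr_sumr; apply: eq_bigr => x _.
have -> : contr m (fun S => c * g S) (fun S => c' * h S) x.1.1 x.1.2 x.2 =
   c * c' * contr m g h x.1.1 x.1.2 x.2.
  by rewrite /contr mulr_sumr; apply: eq_bigr => L _; ring.
by ring.
Qed.

Lemma contr_energy_ge0 (T : finType) (m : T -> R) (g h : {set T} -> R) p q r l : (forall t, 0 <= m t) ->
  0 <= contr_energy m g h p q r l.
Proof.
move=> m0; rewrite /contr_energy /energy; apply: sumr_ge0 => x _.
by rewrite mulr_ge0 ?sqr_ge0// /mu3 !mulr_ge0// prodr_ge0.
Qed.

Lemma finite_cover (L : seq (set Z)) : (forall B, B \in L -> measurable B /\ (mu B < +oo)%E) ->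
  exists U : set Z, [/\ measurable U, (mu U < +oo)%E & forall B, B \in L -> B `<=` U].
Proof.
elim: L => [|B L IH] hL.
  by exists set0; split => //; rewrite measure0 ltry.
have [|U [mU fU LU]] := IH; first by move=> C CL; apply: hL; rewrite inE CL orbT.
have [mB fB] := hL B (mem_head _ _).
exists (B `|` U); split.
- exact: measurableU.
- by apply: (@le_lt_trans _ _ (mu B + mu U)%E); [exact: measureU2|rewrite lte_add_pinfty].
- move=> C; rewrite inE => /orP[/eqP ->|/LU CU]; first exact: subsetUl.
  by apply: (subset_trans CU); exact: subsetUr.
Qed.

Lemma elementary_sequence dO (Omega : measurableType dO) (P : probability Omega R)
    (eta : Omega -> {measure set Z -> \bar R}) q (f : q.-tuple Z -> R) (X : Omega -> R) (e : R) :
  is_multiple_integral P mu eta f X -> 0 < e ->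
  exists s : elementary Z R q, [/\ elementary_ok mu s,
    (\int[tm q]_x ((elementary_kernel s x - f x) ^+ 2)%:E <= e%:E)%E &
    (\int[P]_w ((elementary_integral mu eta s w - X w) ^+ 2)%:E <= e%:E)%E].
Proof.
move=> [s [sok c1 c2]] e0.
(* A norm at most e', with e' <= 1 and e' <= e, has square at most e. *)
pose e' := Num.min 1 e; have e'0 : 0 < e' by rewrite lt_min ltr01.
near \oo => n; exists (s n); split => //.
- have h : ('N[tm q]_2%:E[(fun x => (elementary_kernel (s n) x - f x)%:E)] <= e'%:E)%E.
    by near: n; exact: ecvg0_near.
  have -> : (\int[tm q]_x ((elementary_kernel (s n) x - f x) ^+ 2)%:E =
    'N[tm q]_2%:E[(fun x => (elementary_kernel (s n) x - f x)%:E)] * 'N[tm q]_2%:E[(fun x => (elementary_kernel (s n) x - f x)%:E)])%E.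
    by rewrite Lnorm2_mul; apply: eq_integral => x _; rewrite expr2 EFinM.
  apply: (@le_trans _ _ (e'%:E * e'%:E)%E); first by apply: lee_pmul => //; exact: Lnorm_ge0.
  rewrite -EFinM lee_fin; apply: (@le_trans _ _ (1 * e)); last by rewrite mul1r.
  by apply: ler_pM; rewrite ?(ltW e'0)// ge_min lexx// orbT.
- have h : ('N[P]_2%:E[(fun w => (elementary_integral mu eta (s n) w - X w)%:E)] <= e'%:E)%E.
    by near: n; exact: ecvg0_near.
  have -> : (\int[P]_w ((elementary_integral mu eta (s n) w - X w) ^+ 2)%:E =
    'N[P]_2%:E[(fun w => (elementary_integral mu eta (s n) w - X w)%:E)] * 'N[P]_2%:E[(fun w => (elementary_integral mu eta (s n) w - X w)%:E)])%E.
    by rewrite Lnorm2_mul; apply: eq_integral => x _; rewrite expr2 EFinM.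
  apply: (@le_trans _ _ (e'%:E * e'%:E)%E); first by apply: lee_pmul => //; exact: Lnorm_ge0.
  rewrite -EFinM lee_fin; apply: (@le_trans _ _ (1 * e)); last by rewrite mul1r.
  by apply: ler_pM; rewrite ?(ltW e'0)// ge_min lexx// orbT.
Unshelve. all: by end_near. Qed.

End approximation.

(* A map pat whose law is that of the independent successes in [Ex].            *)
Record bernoulli_model (R : realType) dO (Omega : measurableType dO) (P : probability Omega R)
    (T : finType) (p x1 x0 m w : T -> R) (pat : Omega -> {set T}) : Prop := BernoulliModel {
  model_prob : forall t, 0 <= p t <= 1 ;
  model_mean : forall t, p t * x1 t + (1 - p t) * x0 t = 0 ;
  model_x1 : forall t, x1 t ^+ 2 = m t + w t * x1 t ;
  model_x0 : forall t, x0 t ^+ 2 = m t + w t * x0 t ;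
  model_bounds : forall t, [/\ `|w t| <= 3, `|x1 t| <= 3 & `|x0 t| <= 3] ;
  model_measurable : forall u : {set T} -> R, measurable_fun setT (fun o => u (pat o)) ;
  model_law : forall u : {set T} -> R, (\int[P]_o (u (pat o))%:E = (Ex p u)%:E)%E
}.

(** * From Poisson chaoses to Bernoulli chaoses *)

Section discretization.
Context dO (Omega : measurableType dO) d (Z : measurableType d) (R : realType).
Variables (P : probability Omega R) (mu : {sigma_finite_measure set Z -> \bar R}).
Variables (eta : Omega -> {measure set Z -> \bar R}) (heta : poisson_measure P mu eta).
Hypotheses (hZ : borel_space R Z) (hmu : atomless mu).
Local Notation tm := (tuple_measure mu).
Local Notation Iint := (tuple_integral mu).

(** The elementary kernels and V are fixed; a partition adapted to all their sides, with sum of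
    squared masses at most delta^2, then makes the error of [elementary_approx] as small as
    wanted. *)
Lemma poisson_model (k : nat) (q : 'I_k -> nat) (s : forall i, elementary Z R (q i)) (V : set Z) (e : R) :
  (forall i, elementary_ok mu (s i)) -> measurable V -> (mu V < +oo)%E -> 0 < e ->
  exists (T : finType) (kap : Z -> option T) (p x1 x0 w : T -> R) (pat : Omega -> {set T}),
  [/\ forall t, measurable (cell kap t), forall t, (mu (cell kap t) < +oo)%E,
     refines kap V, forall i, refines_elementary kap (s i) &
     bernoulli_model P p x1 x0 (cell_mass mu kap) w pat /\
     forall i, (\int[P]_w ((elementary_integral mu eta (s i) w -
       chaos x1 x0 (fun S => (q i)`!%:R * sym_coeff kap (s i) S) (pat w)) ^+ 2)%:E <= e%:E)%E].
Proof.
move=> sok mV fV e0.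
pose L := V :: flatten [seq flatten [seq [seq cA.2 j | j <- enum 'I_(q i)] | cA <- s i] | i <- enum 'I_k].
have sideL i cA j : cA \in s i -> cA.2 j \in L.
  move=> cs; rewrite inE; apply/orP; right.
  apply/flattenP; exists (flatten [seq [seq cA.2 j | j <- enum 'I_(q i)] | cA <- s i]).
    by apply/mapP; exists i => //; rewrite mem_enum.
  apply/flattenP; exists [seq cA.2 j | j <- enum 'I_(q i)]; first by apply/mapP; exists cA.
  by apply/mapP; exists j => //; rewrite mem_enum.
have finL B : B \in L -> measurable B /\ (mu B < +oo)%E.
  rewrite inE => /orP[/eqP ->//|/flattenP[_ /mapP[i _ ->]] /flattenP[_ /mapP[[c A] cs ->]] /mapP[j _ ->]].
  have sz : (index (c, A) (s i) < size (s i))%N by rewrite index_mem.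
  by have [/(_ j)] := sok i _ sz; rewrite nth_index.
have [U [mU fU LU]] := finite_cover finL.
pose A (i : 'I_(size L)) := nth set0 L i.
have mA i : measurable (A i) by have [] := finL (A i) (mem_nth _ (ltn_ord i)).
pose C i := 2 * (coefficient_norm (s i) * (q i)%:R) ^+ 2.
pose M i := moment_constant (fine (mu U)) (4 * q i + 3).
have C0 i : 0 <= C i by rewrite mulr_ge0// sqr_ge0.
have M0 i : 0 <= M i by rewrite !mulr_ge0// expR_ge0.
pose B := 1 + \sum_i (C i * M i + C i).
have B0 : 1 <= B by rewrite lerDl sumr_ge0// => i _; rewrite addr_ge0// mulr_ge0.
have BC i : C i * M i <= B /\ C i <= B.
  have h : C i * M i + C i <= B.
    by rewrite /B (bigD1 i)//= addrCA lerDl addr_ge0// sumr_ge0// => j _; rewrite addr_ge0// mulr_ge0.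
  by have := C0 i; have := mulr_ge0 (C0 i) (M0 i); split; lra.
have Bp : 0 < B by lra.
pose K := 3 * B / e; have K0 : 0 < K by rewrite divr_gt0// mulr_gt0.
(* The three contributions B 2 delta, B / K and 18 B K delta are at most e / 3 each, and 1/6 is
   required by [elementary_approx]. *)
pose delta := Num.min 6^-1 (Num.min (e / (6 * B)) (e / (54 * B * K))).
have delta0 : 0 < delta.
  have b1 : 0 < 6 * B by lra.
  have b2 : 0 < 54 * B * K by apply: mulr_gt0 => //; lra.
  by rewrite !lt_min invr_gt0 ltr0n /=; apply/andP; split; exact: divr_gt0.
have [d6 d1 d2] : [/\ delta <= 6^-1, delta <= e / (6 * B) & delta <= e / (54 * B * K)].
  by rewrite /delta !ge_min !lexx !orbT.
have [T [kap [mcell kapU kapA small]]] := fine_partition hZ hmu mU fU mA (exprn_gt0 2 delta0).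
have fcell t : (mu (cell kap t) < +oo)%E.
  apply: le_lt_trans fU; apply: le_measure; rewrite ?inE//; first exact: mcell.
  by move=> z /= kz; apply/kapU; rewrite kz.
have refL D : D \in L -> refines kap D.
  move=> DL; have iL : (index D L < size L)%N by rewrite index_mem.
  have AD : A (Ordinal iL) = D by rewrite /A /= nth_index.
  split=> [z z' zz' Dz|z Dz]; last by apply/kapU; exact: LU DL _ Dz.
  rewrite -AD; apply: (kapA _ z) => //; last by rewrite AD.
  by apply/kapU; exact: LU DL _ Dz.
have m_delta t : cell_mass mu kap t <= delta.
  rewrite -(@ler_pXn2r _ 2) ?nnegrE ?cell_mass_ge0 ?(ltW delta0)//.
  by apply: le_trans small; rewrite (bigD1 t)//= lerDl sumr_ge0// => t' _; exact: sqr_ge0.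
have rs i : refines_elementary kap (s i).
  move=> c D cD j; apply: refL; apply: (@sideL i (c, D)).
  by elim: (s i) cD => //= x s' IH [->|/IH]; rewrite inE ?eqxx// => ->; rewrite orbT.
exists T, kap, (pattern_prob mu kap), (pattern_x1 mu kap), (pattern_x0 mu kap), (pattern_w mu kap), (pattern eta kap).
split => //; first exact/refL/mem_head.
split.
  split.
  - exact: pattern_prob01.
  - exact: pattern_mean.
  - exact: pattern_x1E.
  - exact: pattern_x0E.
  - by move=> t; apply: pattern_bounds; apply: (le_trans (m_delta t)); lra.
  - by move=> u; apply: (measurable_of_pattern heta).
  - by move=> u; apply: (pattern_law heta).
move=> i; apply: le_trans (elementary_approx heta mcell fcell delta0 d6 m_delta (sok i) (rs i) K0) _.
have -> : \bigcup_t cell kap t = U.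
  apply/seteqP; split => [z [t _ kz]|z Uz]; first by apply/kapU; rewrite kz.
  by have /kapU := Uz; case kz : (kap z) => [t|//] _; exists t.
rewrite lee_fin -/(C i) -/(M i) -mulr_sumr.
have [b1 b2] := BC i.
set sm := \sum_t _ in small *.
have sm0 : 0 <= sm by apply: sumr_ge0 => t _; exact: sqr_ge0.
have h1 : C i * M i * (2 * delta + K^-1) <= B * (2 * delta + K^-1).
  by apply: ler_wpM2r => //; rewrite addr_ge0 ?invr_ge0 ?(ltW K0)//; lra.
have h2 : C i * (K * (18 * sm)) <= B * (K * (18 * delta)).
  apply: ler_pM => //; first by apply: mulr_ge0; [exact: ltW|apply: mulr_ge0].
  rewrite ler_pM2l// ler_pM2l//; apply: (le_trans small); rewrite expr2; nra.
have h3 : B * (2 * delta) <= e / 3.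
  apply: (@le_trans _ _ (B * (2 * (e / (6 * B))))); first by rewrite !ler_pM2l//.
  by rewrite le_eqVlt; apply/orP; left; apply/eqP; field; rewrite gt_eqF.
have h4 : B * K^-1 = e / 3 by rewrite /K; field; rewrite !gt_eqF.
have h5 : B * (K * (18 * delta)) <= e / 3.
  apply: (@le_trans _ _ (B * (K * (18 * (e / (54 * B * K)))))); first by rewrite !ler_pM2l//.
  by rewrite le_eqVlt; apply/orP; left; apply/eqP; field; rewrite !gt_eqF.
have -> : C i * ((2 * delta + K^-1) * M i + K * (18 * sm)) = C i * M i * (2 * delta + K^-1) + C i * (K * (18 * sm)) by ring.
lra.
Qed.

Lemma inV_cells (T : finType) (kap : Z -> option T) (V : set Z) (t : seq Z) : refines kap V ->
  None \notin map kap t -> inV V t = all (cells_of kap V) (pmap id (map kap t)).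
Proof.
move=> rV; elim: t => //= z t IH; rewrite inE negb_or => /andP[zN /IH ->].
case kz : (kap z) zN => [a|]//= _; congr (_ && _).
have [h|h] := boolP (cells_of kap V a); first by rewrite mem_set//; apply/(cells_ofP rV kz).
by rewrite memNset// => /(cells_ofP rV kz); exact/negP.
Qed.

Lemma lee_sqr_fin (x : \bar R) (a : R) : (0 <= x)%E -> 0 <= a -> (x * x <= (a ^+ 2)%:E)%E -> (x <= a%:E)%E.
Proof.
case: x => [x| |]; [|by move=> _ _; rewrite mulyy leye_eq|by []].
by rewrite !lee_fin => x0 a0; rewrite -expr2 ler_pXn2r// nnegrE.
Qed.

(** Order of choices: a tolerance for contractions, a truncation level, elementary kernels close in
    L^2, and finally the cells. Symmetrizing and truncating the elementary kernel gives a step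
    function [v] whose blocks, hence contractions, are close to those of f, while in L^2 it
    represents nearly the same integral. *)
Lemma discrete_approximation (k : nat) (q : 'I_k -> nat) (f : forall i, (q i).-tuple Z -> R)
    (F : 'I_k -> Omega -> R) (e : R) :
  (forall i, measurable_fun setT (f i)) -> (forall i, psym (kernel_at (f i))) ->
  (forall i a, (a <= q i)%N -> (sqr_block mu a (q i) (kernel_at (f i)) < +oo)%E) ->
  (forall i, measurable_fun setT (F i)) -> (forall i, is_multiple_integral P mu eta (f i) (F i)) -> 0 < e ->
  exists (T : finType) (p x1 x0 m w : T -> R) (pat : Omega -> {set T}) (g : 'I_k -> {set T} -> R),
  [/\ bernoulli_model P p x1 x0 m w pat, forall i, homogeneous (q i) (g i),
    forall i, (\int[P]_o ((F i o - chaos x1 x0 (g i) (pat o)) ^+ 2)%:E <= e%:E)%E,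
    forall i j r l, (l <= r)%N -> (r <= q i)%N -> (r <= q j)%N ->
      ((contr_energy m (g i) (g j) (q i) (q j) r l)%:E <= (12 * (\prod_i (q i)`!)%:R ^+ 4)%:E *
        (Iint (q i + q j - r - l) (fun x => star mu (q i) (kernel_at (f i)) (kernel_at (f j)) r l x *
            star mu (q i) (kernel_at (f i)) (kernel_at (f j)) r l x) + e%:E))%E &
    forall i, (Iint (q i) (fun s => (kernel_at (f i) s ^+ 2)%:E) <=
      (2 * (\sum_S weight m S * g i S ^+ 2 + e))%:E)%E /\
     ((\sum_S weight m S * g i S ^+ 4)%:E <= (12 * (\prod_i (q i)`!)%:R ^+ 4)%:E *
        (Iint (q i) (fun s => (kernel_at (f i) s ^+ 4)%:E) + e%:E))%E].
Proof.
move=> mf sf fin mF hF e0.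
have e_thirds (y : R) : 0 <= y -> 3 * (y / 12 + (y / 12 + y / 12)) <= y by lra.
pose u i := kernel_at (f i).
have mu_ i : smeas (u i) by exact: smeas_kernel_at.
set Q : R := (\prod_i (q i)`!)%:R.
have Q1 i : 1 <= (q i)`!%:R :> R /\ (q i)`!%:R <= Q.
  rewrite ler1n fact_gt0 ler_nat (bigD1 i)//= leq_pmulr ?prodn_gt0// => j; exact: fact_gt0.
pose B := \sum_i \sum_(a < (q i).+1) fine (sqr_block mu a (q i) (u i)).
have blk0 a n (v : seq Z -> R) : (0 <= sqr_block mu a n v)%E.
  by apply: Iint_ge0 => s; apply: mule_ge0; apply: Iint_ge0 => t; rewrite lee_fin sqr_ge0.
have B0 : 0 <= B by apply: sumr_ge0 => i _; apply: sumr_ge0 => a _; exact: fine_ge0.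
have blkB i a : (a <= q i)%N -> (sqr_block mu a (q i) (u i) <= B%:E)%E.
  move=> aq; rewrite -(@fineK _ (sqr_block mu a (q i) (u i))); last by rewrite ge0_fin_numE// fin.
  rewrite lee_fin /B (bigD1 i)//= (bigD1 (Ordinal (aq : (a < (q i).+1)%N)))//= -addrA lerDl.
  by rewrite addr_ge0 ?sumr_ge0// => j _; rewrite ?sumr_ge0// => *; exact: fine_ge0.
have [eta0 eta0_gt0 hcontr] := contraction_approx mu B0 e0.
pose Q2 := 1 + Q ^+ 2.
have Q20 : 0 < Q2 by rewrite ltr_pwDl// sqr_ge0.
(* Discarding the part cut off by the truncation costs at most 4 Q2 e1 = e / 12. Below, e2 <= e1^2
   because the block with a = 0 is the square of the squared L^2 norm. *)
pose e1 := e / (48 * Q2); have e1_gt0 : 0 < e1 by rewrite divr_gt0// mulr_gt0.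
pose e2 := Num.min (Num.min eta0 e) (e1 ^+ 2).
have e2_gt0 : 0 < e2 by rewrite !lt_min eta0_gt0 e0 exprn_gt0.
have [e2a e2b e2c] : [/\ e2 <= eta0, e2 <= e & e2 <= e1 ^+ 2].
  by rewrite /e2 !ge_min !lexx !orbT.
have [c [V [dl [c0 mV fV dl0 [_ htr]]]]] := exists_truncation e2_gt0 mu_ sf fin.
pose e3 := Num.min dl (Num.min e1 (e / 12)).
have e3_gt0 : 0 < e3 by rewrite !lt_min dl0 e1_gt0 divr_gt0.
have [e3a e3b e3c] : [/\ e3 <= dl, e3 <= e1 & e3 <= e / 12].
  by rewrite /e3 !ge_min !lexx !orbT.
have /(_ _)/cid-/all_sig[s hs] i := elementary_sequence (hF i) e3_gt0.
have sok i : elementary_ok mu (s i) by have [] := hs i.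
have e12 : 0 < e / 12 by rewrite divr_gt0.
have [T [kap [p [x1 [x0 [w [pat [mcell fcell rV rs [model hel]]]]]]]]] := poisson_model sok mV fV e12.
pose sE i := symmetrize (elementary_kernel (s i)).
(* Truncation acts directly on the coefficients; the factor q! in [g] is the one of
   [elementary_chaos]. *)
pose g0 i (S : {set T}) := if [forall t in S, cells_of kap V t] then clip c (sym_coeff kap (s i) S) else 0.
pose g i (S : {set T}) := (q i)`!%:R * g0 i S.
pose v i := trunc c V (kernel_at (sE i)).
have msE i : measurable_fun setT (sE i).
  apply: measurable_funM => //; apply: measurable_sum => t.
  exact: measurableT_comp (measurable_elementary_kernel (sok i)) (measurable_tperm t).
have clip0 : clip c 0 = 0 by rewrite clip_id// normr0.
have hg0 i : homogeneous (q i) (g0 i).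
  move=> S Sq; by rewrite /g0 (homogeneous_sym_coeff kap (s i) Sq) clip0; case: ifP.
have vE i t : v i t = stepf kap (g0 i) t.
  have [sq|sq] := eqVneq (size t) (q i); last first.
    rewrite /v /trunc kernel_at_size// clip0; rewrite if_same /stepf /ocoeff; case: ifPn => // hN.
    rewrite /coeff; case: ifP => // ut; rewrite hg0// cardsE (card_uniqP ut).
    by have := congr1 size (map_some_pmap hN); rewrite !size_map => <-.
  rewrite /v /trunc -[t in kernel_at _ t]/(tval (Tuple (introT eqP sq))) kernel_atE.
  rewrite /sE (sym_kernel_step _ (sok i) (rs i)) /stepf /=.
  rewrite /ocoeff; have [hN|hN] := boolP (None \in map kap t); first by rewrite clip0 if_same.
  rewrite /coeff; have [ut|ut] := boolP (uniq (pmap id (map kap t))); last by rewrite clip0 if_same.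
  rewrite /g0; congr (if _ then _ else _).
  rewrite (inV_cells rV hN); apply/allP/forall_inP => h x; first by rewrite inE; exact: h.
  by move=> xs; apply: h; rewrite inE.
(* Symmetrization does not increase the distance to the symmetric kernel f. *)
have sEu j : (\int[tm (q j)]_x ((kernel_at (sE j) x - u j x) ^+ 2)%:E <= e3%:E)%E.
  under eq_integral do rewrite /u !kernel_atE.
  apply: (@le_trans _ _ (\int[tm (q j)]_x ((elementary_kernel (s j) x - f j x) ^+ 2)%:E)%E).
    apply: symmetrize_le => //; first exact: measurable_elementary_kernel.
    move=> t x; rewrite -!(kernel_atE (f j)); apply: sf.
    by apply/tuple_permP; exists t.
  by have [_ h _] := hs j.
have vu i a : (a <= q i)%N -> (sqr_block mu a (q i) (fun t => v i t - u i t)%R <= e2%:E)%E.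
  apply: htr.
  - by move=> j; apply: smeas_trunc => //; exact: smeas_kernel_at.
  - by move=> j; apply: psym_trunc; apply: psym_kernel_at => t x; exact: symmetrize_perm.
  - by move=> j t; exact: trunc_le.
  move=> j; apply: (@le_trans _ _ (\int[tm (q j)]_x ((kernel_at (sE j) x - u j x) ^+ 2)%:E)%E).
    apply: ge0_le_integral => //.
    + by move=> x _; rewrite lee_fin sqr_ge0.
    + apply: (smeas_sqr (smeas_sub _ _)) => //; apply: smeas_trunc => //; exact: smeas_kernel_at.
    + by apply: (smeas_sqr (smeas_sub _ _)) => //; exact: smeas_kernel_at.
    move=> x _; rewrite lee_fin /v /trunc /u !kernel_atE; case: ifP => _; last by rewrite subrr expr0n sqr_ge0.
    by rewrite -(real_normK (num_real (clip _ _ - _))) -(real_normK (num_real (sE _ _ - _))) lerXn2r ?nnegrE// clip_lip.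
  by apply: (le_trans (sEu j)); rewrite lee_fin.
exists T, p, x1, x0, (cell_mass mu kap), w, pat, g.
have vfE i : v i = stepf kap (g0 i) by apply/funext => t; exact: vE.
have mv i : smeas (v i) by apply: smeas_trunc => //; exact: smeas_kernel_at.
have sv i : psym (v i) by apply: psym_trunc; apply: psym_kernel_at => t x; exact: symmetrize_perm.
have Q0 : 0 <= Q by rewrite ler0n.
have Qfact i : 0 <= (q i)`!%:R :> R /\ (q i)`!%:R <= Q by split; [exact: ler0n|have [] := Q1 i].
have e1e : e1 <= e.
  rewrite /e1 ler_pdivrMr ?mulr_gt0// ler_peMr ?(ltW e0)//.
  apply: (@le_trans _ _ (1 * 1)); first by rewrite mulr1.
  by apply: ler_pM => //; rewrite ?ler1n// lerDl sqr_ge0.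
have Iv i : (Iint (q i) (fun t => ((v i t - u i t) ^+ 2)%:E) <= e1%:E)%E.
  apply: lee_sqr_fin => //; first by apply: Iint_ge0 => t; rewrite lee_fin sqr_ge0.
    exact: ltW.
  rewrite -sqr_block_full; last exact: smeas_sub.
  by apply: (le_trans (vu i _ (leq0n _))); rewrite lee_fin.
split => //.
- by move=> i S Sq; rewrite /g hg0// mulr0.
- move=> i; have [_ h1 h2] := hs i.
  pose ch (h : {set T} -> R) o := chaos x1 x0 h (pat o).
  pose h3 S := (q i)`!%:R * (sym_coeff kap (s i) S - g0 i S).
  have mch (h : {set T} -> R) : measurable_fun setT (ch h) by exact: (model_measurable model (chaos x1 x0 h)).
  have mel := measurable_elementary_integral heta (sok i).
  have third : (\int[P]_o (ch h3 o ^+ 2)%:E <= (e / 12)%:E)%E.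
    have -> : (\int[P]_o (ch h3 o ^+ 2)%:E = (Ex p (fun b => chaos x1 x0 h3 b ^+ 2))%:E)%E.
      exact: (model_law model (fun b => chaos x1 x0 h3 b ^+ 2)).
    rewrite (chaos_sqr (model_mean model) (model_x1 model) (model_x0 model)).
    pose df S := sym_coeff kap (s i) S - g0 i S.
    have hdf : homogeneous (q i) df.
      by move=> S Sq; rewrite /df (hg0 i S Sq) (homogeneous_sym_coeff kap (s i) Sq) subrr.
    have st := step_moment_ge mcell fcell (Phi := fun y => y ^+ 2) hdf (expr0n _ _) (fun y => sqr_ge0 y).
    have dfE t : size t = q i -> stepf kap df t = (kernel_at (sE i) t - u i t) - (v i t - u i t).
      move=> sq; have sq' : size t == q i by apply/eqP.
      have -> : kernel_at (sE i) t = stepf kap (sym_coeff kap (s i)) t.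
        by rewrite -[t in kernel_at _ t]/(tval (Tuple sq')) kernel_atE /sE (sym_kernel_step _ (sok i) (rs i)).
      rewrite vE /stepf /ocoeff /coeff /df; case: ifP => _; first ring.
      by case: ifP => _; ring.
    have IsE : (Iint (q i) (fun t => ((kernel_at (sE i) t - u i t) ^+ 2)%:E) <= e1%:E)%E.
      by apply: (le_trans (sEu i)); rewrite lee_fin.
    have ms1 : smeas (fun t => ((kernel_at (sE i) t - u i t) ^+ 2)%:E).
      by apply: smeas_sqr; apply: smeas_sub => //; exact: smeas_kernel_at.
    have ms2 : smeas (fun t => ((v i t - u i t) ^+ 2)%:E).
      by apply: smeas_sqr; exact: smeas_sub.
    have sq0 (y : seq Z -> R) t : (0 <= (y t ^+ 2)%:E)%E by rewrite lee_fin sqr_ge0.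
    have Idf : (Iint (q i) (fun t => (stepf kap df t ^+ 2)%:E) <= (4 * e1)%:E)%E.
      apply: (@le_trans _ _ (Iint (q i) (fun t => 2%:E * (((kernel_at (sE i) t - u i t) ^+ 2)%:E + ((v i t - u i t) ^+ 2)%:E))%E)).
        apply: le_Iint.
        - by apply: smeas_sqr; exact: smeas_step.
        - move=> n; apply: emeasurable_funM => //; exact: (smeas_addE ms1 ms2).
        - exact: sq0.
        move=> t sq; rewrite -EFinD -EFinM lee_fin dfE//.
        by apply: (le_trans (sqrD_le _ _)); rewrite sqrrN.
      rewrite IintZl//; last 2 first.
      - exact: smeas_addE.
      - by move=> t; apply: adde_ge0; rewrite lee_fin sqr_ge0.
      rewrite Iint_add//; try (by move=> t; rewrite lee_fin sqr_ge0).
      have -> : 4 * e1 = 2 * (e1 + e1) by ring.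
      by rewrite (EFinM 2) (EFinD e1); apply: lee_wpmul2l => //; exact: (leeD IsE (Iv i)).
    have -> : \sum_S weight (cell_mass mu kap) S * h3 S ^+ 2 =
       (q i)`!%:R ^+ 2 * \sum_S weight (cell_mass mu kap) S * df S ^+ 2.
      by rewrite mulr_sumr; apply: eq_bigr => S _; rewrite /h3 /df; ring.
    have := le_trans st Idf; rewrite !lee_fin => sm4.
    apply: (@le_trans _ _ (Q2 * (4 * e1))).
      apply: ler_pM; [exact: sqr_ge0| | |exact: sm4].
        apply: sumr_ge0 => S _; rewrite mulr_ge0 ?sqr_ge0//; apply: prodr_ge0 => t _; exact: cell_mass_ge0.
      have [a1 a2] := Qfact i; rewrite /Q2; apply: (@le_trans _ _ (Q ^+ 2)); last by rewrite lerDr.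
      by rewrite lerXn2r ?nnegrE.
    by rewrite le_eqVlt; apply/orP; left; apply/eqP; rewrite /e1; field; rewrite gt_eqF.
  have mel2 : measurable_fun setT (fun o => ((elementary_integral mu eta (s i) o - F i o) ^+ 2)%:E).
    by apply/measurable_EFinP; apply: measurable_funX; exact: measurable_funB.
  have mel3 : measurable_fun setT (fun o => ((elementary_integral mu eta (s i) o - ch (fun S => (q i)`!%:R * sym_coeff kap (s i) S) o) ^+ 2)%:E).
    by apply/measurable_EFinP; apply: measurable_funX; exact: measurable_funB.
  have mel4 : measurable_fun setT (fun o => (ch h3 o ^+ 2)%:E).
    by apply/measurable_EFinP; exact: measurable_funX.
  have sq0 (y : Omega -> R) o : (0 <= (y o ^+ 2)%:E)%E by rewrite lee_fin sqr_ge0.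
  apply: (@le_trans _ _ (\int[P]_o (3%:E * (((elementary_integral mu eta (s i) o - F i o) ^+ 2)%:E +
     (((elementary_integral mu eta (s i) o - ch (fun S => (q i)`!%:R * sym_coeff kap (s i) S) o) ^+ 2)%:E + (ch h3 o ^+ 2)%:E))))%E).
    apply: ge0_le_integral => //.
    + by move=> o _; rewrite lee_fin sqr_ge0.
    + apply/measurable_EFinP; apply: measurable_funX; apply: measurable_funB => //; exact: mch.
    + by apply: emeasurable_funM => //; apply: emeasurable_funD => //; exact: emeasurable_funD.
    move=> o _; rewrite -!EFinD -EFinM lee_fin.
    have -> : F i o - chaos x1 x0 (g i) (pat o) = - (elementary_integral mu eta (s i) o - F i o) +
      ((elementary_integral mu eta (s i) o - ch (fun S => (q i)`!%:R * sym_coeff kap (s i) S) o) + ch h3 o).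
      have -> : ch h3 o = ch (fun S => (q i)`!%:R * sym_coeff kap (s i) S) o - ch (g i) o.
        by rewrite /ch -chaosB; congr chaos; apply/funext => S; rewrite /h3 /g; ring.
      by rewrite /ch; ring.
    move: (elementary_integral _ _ _ _ - F i o) (_ - ch _ o) (ch h3 o) => a b z.
    by have := sqr_ge0 (a + b); have := sqr_ge0 (a + z); have := sqr_ge0 (b - z); nra.
  have nn (a b z : R) : (0 <= (a ^+ 2)%:E + ((b ^+ 2)%:E + (z ^+ 2)%:E))%E.
    by rewrite -!EFinD lee_fin !addr_ge0 ?sqr_ge0.
  have m34 := emeasurable_funD mel3 mel4; have m234 := emeasurable_funD mel2 m34.
  rewrite ge0_integralZl//; try exact: m234.
  rewrite ge0_integralD//; try exact: m34; try (by move=> o _; rewrite -?EFinD lee_fin ?addr_ge0 ?sqr_ge0).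
  rewrite ge0_integralD//; try (by move=> o _; rewrite lee_fin sqr_ge0).
  apply: (@le_trans _ _ (3%:E * ((e / 12)%:E + ((e / 12)%:E + (e / 12)%:E)))%E).
    apply: lee_wpmul2l => //; apply: leeD; first by apply: (le_trans h2); rewrite lee_fin.
    by apply: leeD => //; exact: hel.
  by rewrite -!EFinD -EFinM lee_fin; exact/e_thirds/ltW.
- move=> i j r l lr rp rq; have [r0 r1] : (r - l <= q i)%N /\ (r - l <= q j)%N.
    by split; apply: leq_trans (leq_subr _ _) _.
  have h := hcontr (q i) (q j) r l (u i) (u j) (v i) (v j) lr rp rq (mu_ i) (mu_ j) (mv i) (mv j)
    (sf i) (sf j) (sv i) (sv j) (blkB i _ r0) (blkB j _ r1)
    (le_trans (vu i _ r0) _) (le_trans (vu j _ r1) _).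
  have {}h := h ltac:(by rewrite lee_fin) ltac:(by rewrite lee_fin).
  have m0 t : 0 <= cell_mass mu kap t by exact: cell_mass_ge0.
  have st := step_energy mcell fcell (g0 j) (hg0 i) lr rp rq.
  rewrite -!vfE in st.
  have {st} := le_trans st h; set ce := contr_energy _ (g0 i) _ _ _ _ _ => st.
  have ce0 : 0 <= ce by exact: contr_energy_ge0.
  have cel : (ce%:E <= (l`!%:R ^+ 2 * ce)%:E)%E.
    by rewrite lee_fin ler_peMl// exprn_ege1// ler1n fact_gt0.
  rewrite contr_energyZ -/ce.
  apply: (@le_trans _ _ ((Q ^+ 4)%:E * ce%:E)%E).
    rewrite -EFinM lee_fin; apply: ler_wpM2r => //.
    have -> : Q ^+ 4 = (Q * Q) ^+ 2 by ring.
    have [a1 a2] := Qfact i; have [b1 b2] := Qfact j.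
    by rewrite lerXn2r ?nnegrE ?mulr_ge0// ler_pM.
  apply: (@le_trans _ _ ((Q ^+ 4)%:E * (3%:E * (Iint (q i + q j - r - l) (fun x => star mu (q i) (u i) (u j) r l x *
            star mu (q i) (u i) (u j) r l x) + e%:E)))%E).
    by apply: lee_wpmul2l; [rewrite lee_fin exprn_ge0|exact: le_trans cel st].
  rewrite muleA -EFinM; apply: lee_wpmul2r.
    apply: adde_ge0; last by rewrite lee_fin ltW.
    by apply: Iint_ge0 => t; case: (star _ _ _ _ _ _ _) => [y| |] //; rewrite lee_fin -expr2 sqr_ge0.
  by rewrite lee_fin mulrC ler_wpM2r ?exprn_ge0//; lra.
- move=> i.
  have m0 S : 0 <= weight (cell_mass mu kap) S by apply: prodr_ge0 => t _; exact: cell_mass_ge0.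
  split.
    have sq0 (y : seq Z -> R) t : (0 <= (y t ^+ 2)%:E)%E by rewrite lee_fin sqr_ge0.
    apply: (@le_trans _ _ (Iint (q i) (fun t => 2%:E * ((v i t ^+ 2)%:E + ((v i t - u i t) ^+ 2)%:E)%E)%E)).
      apply: le_Iint => //; first exact: smeas_sqr (mu_ i).
        move=> n; apply: emeasurable_funM => //.
        exact: (smeas_addE (smeas_sqr (mv i)) (smeas_sqr (smeas_sub (mv i) (mu_ i)))).
      move=> t _; rewrite -EFinD -EFinM lee_fin -/(u i t).
      have -> : u i t = v i t + - (v i t - u i t) by ring.
      apply: (le_trans (sqrD_le _ _)); rewrite sqrrN.
      by have -> : v i t - (v i t + - (v i t - u i t)) = v i t - u i t by ring.
    rewrite IintZl//; last 2 first.
    - exact: (smeas_addE (smeas_sqr (mv i)) (smeas_sqr (smeas_sub (mv i) (mu_ i)))).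
    - by move=> t; rewrite -EFinD lee_fin addr_ge0// sqr_ge0.
    rewrite Iint_add//; try (by move=> t; rewrite lee_fin sqr_ge0); try exact: (smeas_sqr (mv i)); try exact: (smeas_sqr (smeas_sub (mv i) (mu_ i))).
    rewrite (EFinM 2) (EFinD (\sum_S _)); apply: lee_wpmul2l => //; apply: leeD; last first.
      by apply: (le_trans (Iv i)); rewrite lee_fin.
    rewrite vfE (step_moment mcell fcell (Phi := fun y => y ^+ 2) (hg0 i) (expr0n _ _) (fun y => sqr_ge0 y)).
    rewrite lee_fin [leRHS](_ : _ = (q i)`!%:R * ((q i)`!%:R * \sum_S weight (cell_mass mu kap) S * g0 i S ^+ 2)); last first.
      by rewrite !mulr_sumr; apply: eq_bigr => S _; rewrite /g; ring.
    rewrite ler_peMl//; last by have [] := Q1 i.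
    by apply: mulr_ge0 => //; apply: sumr_ge0 => S _; rewrite mulr_ge0 ?sqr_ge0.
  have st := step_moment_ge mcell fcell (Phi := fun y => y ^+ 4) (hg0 i) (expr0n _ _) (fun y => exprn_even_ge0 (n := 4) y isT).
  rewrite -vfE -(sqr_block_diag mu (q i) (mv i)) in st.
  have ba : (sqr_block mu (q i) (q i) (v i) <= 12%:E * (sqr_block mu (q i) (q i) (u i) +
      sqr_block mu (q i) (q i) (fun t => (v i t - u i t)%R)))%E.
    apply: block_add => //; first exact: smeas_sub.
    by move=> t; rewrite -{1}(subrK (u i t) (v i t)) addrC ler_normD.
  have -> : \sum_S weight (cell_mass mu kap) S * g i S ^+ 4 = (q i)`!%:R ^+ 4 * \sum_S weight (cell_mass mu kap) S * g0 i S ^+ 4.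
    by rewrite mulr_sumr; apply: eq_bigr => S _; rewrite /g; ring.
  set sm := \sum_S _ in st *.
  have sm0 : 0 <= sm.
    apply: sumr_ge0 => S _; rewrite mulr_ge0 ?exprn_even_ge0//; apply: prodr_ge0 => t _; exact: cell_mass_ge0.
  apply: (@le_trans _ _ ((Q ^+ 4)%:E * sm%:E)%E).
    rewrite -EFinM lee_fin; apply: ler_wpM2r => //.
    by have [a1 a2] := Qfact i; rewrite lerXn2r ?nnegrE.
  rewrite (mulrC 12) (EFinM (Q ^+ 4)) -muleA; apply: lee_wpmul2l; first by rewrite lee_fin exprn_ge0.
  apply: (le_trans st); apply: (le_trans ba); apply: lee_wpmul2l => //.
  apply: leeD; first by rewrite (sqr_block_diag mu (q i) (mu_ i)).
  by apply: (le_trans (vu i _ (leqnn _))); rewrite lee_fin.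
Qed.

End discretization.

(** * Stein's identity for the normal law on the line *)

Section gaussian_stein.
Context (R : realType).
Variable s : R.
Hypothesis s0 : 0 < s.
Local Notation leb := (@lebesgue_measure R).
Local Notation p := (normal_pdf 0 s).

Let sN0 : s != 0. Proof. by rewrite gt_eqF. Qed.

Let pE x : p x = normal_peak s * expR (- x ^+ 2 / (2 * s ^+ 2)).
Proof. by rewrite normal_pdfE// /normal_fun subr0 -[s ^+ 2 *+ 2]mulr_natl. Qed.

(** (1 + |x|)^4 <= 24 e^(1 + |x|), and completing the square absorbs the exponential into a density
    with doubled standard deviation. *)
Lemma normal_pdf_poly : exists2 C : R, 0 <= C &
  forall x, (1 + `|x|) ^+ 4 * p x <= C * normal_pdf 0 (2 * s) x.
Proof.
have s20 : 2 * s != 0 by rewrite gt_eqF// mulr_gt0.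
have q0 := normal_peak_gt0 s20; have p0 := normal_peak_gt0 sN0.
exists (24 * expR (1 + s ^+ 2) * (normal_peak s / normal_peak (2 * s))).
  by apply: mulr_ge0; [rewrite mulr_ge0 ?expR_ge0|rewrite divr_ge0// ltW].
move=> x; rewrite pE normal_pdfE// /normal_fun subr0.
have -> : 24 * expR (1 + s ^+ 2) * (normal_peak s / normal_peak (2 * s)) *
   (normal_peak (2 * s) * expR (- x ^+ 2 / ((2 * s) ^+ 2 *+ 2))) =
   normal_peak s * (24 * expR (1 + s ^+ 2 - x ^+ 2 / (8 * s ^+ 2))).
  have -> : - x ^+ 2 / ((2 * s) ^+ 2 *+ 2) = - (x ^+ 2 / (8 * s ^+ 2)) by field.
  by rewrite (expRD (1 + s ^+ 2)); field; rewrite gt_eqF.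
rewrite mulrCA; apply: ler_wpM2l; first exact: ltW.
have h4 : (1 + `|x|) ^+ 4 <= 24 * expR (1 + `|x|).
  have x1 : 0 <= 1 + `|x| by rewrite addr_ge0.
  have := expR_ge1Dxn 3 x1; rewrite -[4`!]/24%N => h.
  have : (1 + `|x|) ^+ 4 / 24 <= expR (1 + `|x|) by apply: le_trans h; rewrite lerDr.
  by rewrite ler_pdivrMr// mulrC.
apply: (@le_trans _ _ (24 * expR (1 + `|x|) * expR (- x ^+ 2 / (2 * s ^+ 2)))).
  by apply: ler_wpM2r => //; exact: expR_ge0.
rewrite -mulrA -expRD ler_pM2l// ler_expR.
have h : 0 <= (`|x| / (2 * s) - s) ^+ 2 := sqr_ge0 _.
have e1 : (`|x| / (2 * s) - s) ^+ 2 = x ^+ 2 / (4 * s ^+ 2) - `|x| + s ^+ 2.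
  by rewrite -(real_normK (num_real x)); field.
have e2 : x ^+ 2 / (8 * s ^+ 2) = x ^+ 2 / (4 * s ^+ 2) / 2 by field.
have e3 : - x ^+ 2 / (2 * s ^+ 2) = - (2 * (x ^+ 2 / (4 * s ^+ 2))) by field.
have h3 : 0 <= x ^+ 2 / (4 * s ^+ 2) by rewrite divr_ge0 ?sqr_ge0// mulr_ge0// sqr_ge0.
by rewrite e2 e3; rewrite e1 in h; lra.
Qed.

Lemma integral_normal_ge0 (u : R -> R) : measurable_fun setT u -> (forall x, 0 <= u x) ->
  (\int[normal_prob 0 s]_x (u x)%:E = \int[leb]_x (u x * p x)%:E)%E.
Proof.
move=> mu u0.
have dom := normal_prob_dominates 0 s.
rewrite -(Radon_Nikodym_SigmaFinite.change_of_variables dom)//; last exact/measurable_EFinP.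
apply: ae_eq_integral => //.
- apply: emeasurable_funM; first exact/measurable_EFinP.
  apply: (measurable_int leb); exact: Radon_Nikodym_SigmaFinite.f_integrable.
- apply/measurable_EFinP; apply: measurable_funM => //; exact: measurable_normal_pdf.
apply: (@filterS _ _ _ (fun x => setT x -> Radon_Nikodym_SigmaFinite.f (normal_prob 0 s) leb x = (p x)%:E)); last first.
  apply: integral_ae_eq => //.
  - exact: Radon_Nikodym_SigmaFinite.f_integrable.
  - by apply/measurable_EFinP; exact: measurable_normal_pdf.
  - by move=> A _ mA; rewrite -Radon_Nikodym_SigmaFinite.f_integral.
by move=> x h xT; rewrite h// EFinM.
Qed.

Lemma integral_normal (u : R -> R) : measurable_fun setT u ->
  (\int[normal_prob 0 s]_x (u x)%:E = \int[leb]_x (u x * p x)%:E)%E.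
Proof.
move=> mu.
have pp x : 0 <= p x := normal_pdf_ge0 0 s x.
rewrite integralE [RHS]integralE; congr (_ - _)%E.
- transitivity (\int[normal_prob 0 s]_x (Num.max (u x) 0)%:E)%E.
    by apply: eq_integral => x _; rewrite funeposE -EFin_max.
  rewrite integral_normal_ge0//; last 2 first.
  - by apply: measurable_maxr.
  - by move=> x; rewrite le_max lexx orbT.
  by apply: eq_integral => x _; rewrite funeposE -EFin_max maxr_pMl// mul0r.
- transitivity (\int[normal_prob 0 s]_x (Num.max (- u x) 0)%:E)%E.
    by apply: eq_integral => x _; rewrite funenegE -EFinN -EFin_max.
  rewrite integral_normal_ge0//; last 2 first.
  - by apply: measurable_maxr => //; exact: measurableT_comp.
  - by move=> x; rewrite le_max lexx orbT.
  by apply: eq_integral => x _; rewrite funenegE -EFinN -EFin_max maxr_pMl// mul0r mulNr.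
Qed.

Lemma normal_moment : (\int[normal_prob 0 s]_x ((1 + `|x|) ^+ 4)%:E < +oo)%E.
Proof.
have m4 : measurable_fun setT (fun x : R => (1 + `|x|) ^+ 4).
  by apply: measurable_funX; apply: measurable_funD => //; exact: normr_measurable.
rewrite integral_normal_ge0//.
have [C C0 hC] := normal_pdf_poly.
apply: (@le_lt_trans _ _ (\int[leb]_x (C%:E * (normal_pdf 0 (2 * s) x)%:E))%E).
  apply: ge0_le_integral => //.
  - by move=> x _; rewrite lee_fin mulr_ge0 ?normal_pdf_ge0// exprn_ge0// addr_ge0.
  - by apply/measurable_EFinP; apply: measurable_funM => //; exact: measurable_normal_pdf.
  - by apply/measurable_EFinP; apply: measurable_funM => //; exact: measurable_normal_pdf.
  - by move=> x _; rewrite -EFinM lee_fin hC.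
rewrite ge0_integralZl//; last 2 first.
- by apply/measurable_EFinP; exact: measurable_normal_pdf.
- by move=> x _; rewrite lee_fin normal_pdf_ge0.
by rewrite integral_normal_pdf mule1 ltry.
Qed.

Let dp (x : R) : is_derive x (1 : R) (p : R -> R) (- x / s ^+ 2 * p x).
Proof.
have pF : p = normal_peak s \*: (@expR R \o (- (2 * s ^+ 2)^-1 \*: (id ^+ 2 : R -> R))).
  apply/funext => y; rewrite pE; congr (_ * expR _) => /=.
  by rewrite exprfctE [RHS]mulNr mulNr mulrC.
rewrite {1}pF.
have d1 : is_derive x 1 (- (2 * s ^+ 2)^-1 \*: (id ^+ 2 : R -> R)) (- x / s ^+ 2).
  apply: is_derive_eq; rewrite /GRing.scale /= expr1 mulr1; field.
  by rewrite gt_eqF.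
apply: is_derive_eq; rewrite pE /GRing.scale /= exprfctE.
have -> : - (2 * s ^+ 2)^-1 *: (x ^+ 2) = - x ^+ 2 / (2 * s ^+ 2).
  by rewrite /GRing.scale /= mulrC mulrN mulNr.
by ring.
Qed.

Variables (psi h : R -> R) (A : R).
Hypothesis A0 : 0 <= A.
Hypothesis psi_taylor : forall x y, `|psi (x + y) - psi x - h x * y| <= A * y ^+ 2.
Hypothesis h_bounded : forall x, `|h x| <= A.
Hypothesis h_lipschitz : forall x y, `|h (x + y) - h x| <= A * `|y|.

Let small e (t : R) : `|t| <= e / (A + 1) -> A * `|t| <= e.
Proof.
rewrite ler_pdivlMr; last by rewrite ltr_wpDl.
by apply: le_trans; rewrite mulrC ler_wpM2l// lerDl.
Qed.

(** The Taylor bound divided by the increment identifies h as the derivative of psi. *)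
Let dpsi (x : R) : is_derive x (1 : R) psi (h x).
Proof.
have c : (fun t => t^-1 *: (psi (t *: (1 : R) + x) - psi x)) @ (0 : R)^' --> h x.
  apply/cvgrPdist_le => e e0; near=> t.
  have t0 : t != 0 by near: t; exact: nbhs_dnbhs_neq.
  have te : `|t| <= e / (A + 1).
    by near: t; apply: dnbhs0_le; rewrite divr_gt0// ltr_wpDl.
  have t1 : 0 < `|t| by rewrite normr_gt0.
  rewrite [t *: 1]mulr1 distrC -[t^-1 *: _]/(t^-1 * _) (addrC t).
  have -> : t^-1 * (psi (x + t) - psi x) - h x = t^-1 * (psi (x + t) - psi x - h x * t).
    by field.
  rewrite normrM normfV; apply: (@le_trans _ _ (`|t|^-1 * (A * t ^+ 2))).
    by apply: ler_wpM2l; rewrite ?invr_ge0.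
  have -> : `|t|^-1 * (A * t ^+ 2) = A * `|t|.
    by rewrite -(real_normK (num_real t)); field; rewrite gt_eqF.
  exact: small.
have d : derivable psi x 1 by apply/cvg_ex; exists (h x).
by apply: DeriveDef => //; exact/cvg_lim.
Unshelve. all: by end_near. Qed.

(** The integrand times the density is the derivative of G = - s^2 psi p, which vanishes at
    infinity. *)
Lemma stein_identity_normal : (\int[normal_prob 0 s]_x (x * psi x - s ^+ 2 * h x)%:E = 0)%E.
Proof.
pose f x := (x * psi x - s ^+ 2 * h x) * p x.
pose G x := - s ^+ 2 * (psi x * p x).
have dG x : is_derive x (1 : R) (G : R -> R) (f x).
  have := dpsi x; have := dp x => d1 d2.
  rewrite (_ : G = - s ^+ 2 \*: (psi * p)); last by apply/funext.
  apply: is_derive_eq; rewrite /GRing.scale /= /f.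
  by field; rewrite gt_eqF.
have [C C0 hC] := normal_pdf_poly.
pose K := `|psi 0| + A + s ^+ 2 * A.
have K0 : 0 <= K by rewrite !addr_ge0// mulr_ge0// sqr_ge0.
have psiK x : `|psi x| <= (`|psi 0| + A) * (1 + `|x|) ^+ 2.
  have h1 := psi_taylor 0 x; rewrite add0r in h1.
  have h2 := h_bounded 0.
  have h3 : `|h 0 * x| <= A * `|x| by rewrite normrM ler_wpM2r.
  have h4 : `|psi x| <= `|psi 0| + A * `|x| + A * `|x| ^+ 2.
    have -> : psi x = (psi x - psi 0 - h 0 * x) + (psi 0 + h 0 * x) by ring.
    rewrite real_normK ?num_real//.
    apply: (le_trans (ler_normD _ _)); rewrite addrC; apply: lerD => //.
    by apply: (le_trans (ler_normD _ _)); rewrite lerD2l.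
  apply: (le_trans h4).
  have x0 : 0 <= `|x| by []. have p0 : 0 <= `|psi 0| by [].
  have e1 : 0 <= `|psi 0| * (2 * `|x| + `|x| ^+ 2) by rewrite mulr_ge0// addr_ge0 ?mulr_ge0// sqr_ge0.
  have e2 : 0 <= A * (1 + `|x|) by rewrite mulr_ge0// addr_ge0.
  have -> : (`|psi 0| + A) * (1 + `|x|) ^+ 2 = (`|psi 0| + A * `|x| + A * `|x| ^+ 2) + (`|psi 0| * (2 * `|x| + `|x| ^+ 2)) + A * (1 + `|x|) by ring.
  by rewrite -[leRHS]addrA lerDl addr_ge0.
have gf x : `|x * psi x - s ^+ 2 * h x| <= K * (1 + `|x|) ^+ 3.
  have x1 : 1 <= 1 + `|x| by rewrite lerDl.
  apply: (le_trans (ler_normB _ _)); rewrite !normrM.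
  rewrite /K mulrDl; apply: lerD.
    rewrite exprS mulrCA; apply: ler_pM => //.
    by rewrite lerDr.
  rewrite -expr2 real_normK ?num_real// -[leRHS]mulrA; apply: ler_wpM2l; first exact: sqr_ge0.
  by apply: (le_trans (h_bounded x)); rewrite ler_peMr// exprn_ege1.
have pp x : 0 <= p x := normal_pdf_ge0 0 s x.
have fb x : (1 + `|x|) * `|f x| <= K * C * normal_pdf 0 (2 * s) x.
  rewrite /f normrM (ger0_norm (pp x)).
  apply: (@le_trans _ _ ((1 + `|x|) * (K * (1 + `|x|) ^+ 3 * p x))).
    by apply: ler_wpM2l; [rewrite addr_ge0|apply: ler_wpM2r].
  have -> : (1 + `|x|) * (K * (1 + `|x|) ^+ 3 * p x) = K * ((1 + `|x|) ^+ 4 * p x) by ring.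
  by rewrite -mulrA; apply: ler_wpM2l.
have Gb x : (1 + `|x|) * `|G x| <= s ^+ 2 * (K * C) * normal_peak (2 * s).
  have s20 : 2 * s != 0 by rewrite gt_eqF// mulr_gt0.
  have x1 : 1 <= 1 + `|x| by rewrite lerDl.
  rewrite /G normrM normrN (ger0_norm (sqr_ge0 s)) mulrCA -[leRHS]mulrA -(mulrA K); apply: ler_wpM2l; first exact: sqr_ge0.
  rewrite normrM (ger0_norm (pp x)).
  apply: (@le_trans _ _ (K * (C * normal_pdf 0 (2 * s) x))); last first.
    by do 2 (apply: ler_wpM2l => //); exact: normal_pdf_ub.
  apply: (@le_trans _ _ (K * ((1 + `|x|) ^+ 4 * p x))); last by apply: ler_wpM2l.
  rewrite (mulrA (1 + _)) (mulrA K); apply: ler_wpM2r => //.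
  apply: (@le_trans _ _ ((1 + `|x|) * (K * (1 + `|x|) ^+ 2))).
    apply: ler_wpM2l; first by rewrite addr_ge0.
    apply: (le_trans (psiK x)); apply: ler_wpM2r; first exact: sqr_ge0.
    by rewrite /K lerDl mulr_ge0// sqr_ge0.
  have -> : (1 + `|x|) * (K * (1 + `|x|) ^+ 2) = K * (1 + `|x|) ^+ 3 by ring.
  by apply: ler_wpM2l => //; apply: ler_weXn2l.
have cpsi : continuous psi.
  by move=> x; have /derivable1_diffP/differentiable_continuous := @ex_derive _ _ _ _ _ _ _ (dpsi x).
have ch : continuous h.
  move=> x; apply/cvgrPdist_le => e e0; near=> t.
  have := h_lipschitz x (t - x); rewrite (addrC x) subrK distrC => hl; apply: (le_trans hl); apply: small.
  rewrite distrC; near: t; apply: cvgr_dist_le => //.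
  by rewrite divr_gt0// ltr_wpDl.
have cf : continuous f.
  move=> x; apply: cvgM; last exact: continuous_normal_pdf.
  apply: cvgB; apply: cvgM; [exact: cvg_id|exact: cpsi|exact: cvg_cst|exact: ch].
have mf : measurable_fun setT f by exact: continuous_measurable_fun.
have cG : continuous G.
  by move=> x; have /derivable1_diffP/differentiable_continuous := @ex_derive _ _ _ _ _ _ _ (dG x).
pose B n : set R := `[(- n.+1%:R), n.+1%:R]%classic.
have ftc (n : nat) : (\int[leb]_(x in B n) (f x)%:E = (G n.+1%:R - G (- n.+1%:R))%R%:E)%E.
  rewrite (@continuous_FTC2 _ f G)//.
  - by rewrite (@lt_trans _ _ 0)// oppr_lt0.
  - exact: continuous_subspaceT.
  - split; [by move=> x _; exact: ex_derive|by apply: cvg_at_right_filter; exact: cG|by apply: cvg_at_left_filter; exact: cG].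
  - by move=> x _; rewrite derive1E derive_val.
pose D := 2 * (s ^+ 2 * (K * C) * normal_peak (2 * s)) + K * C.
have KC0 : 0 <= K * C by rewrite mulr_ge0.
have D0 : 0 <= D by apply: addr_ge0 => //; apply: mulr_ge0 => //; apply: mulr_ge0; [apply: mulr_ge0 => //; exact: sqr_ge0|exact: normal_peak_ge0].
(* On the interval the integral is a difference of values of G, of order 1 / n by [Gb]; outside, 1 +
   |x| > n + 1 makes the tail of order 1 / n by [fb]. *)
have key (n : nat) : (`|\int[leb]_x (f x)%:E| <= (D / n.+1%:R)%:E)%E.
  have mB : measurable (B n) by exact: measurable_itv.
  have n0 : 0 < n.+1%:R :> R by rewrite ltr0n.
  rewrite -(setUv (B n)) integral_setU//; last 3 first.
  - exact: measurableC.
  - by rewrite setUv; exact/measurable_EFinP.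
  - by rewrite disj_set2E setICr.
  apply: (le_trans (lee_abs_add _ _)); rewrite /D mulrDl EFinD; apply: leeD.
    rewrite ftc lee_fin; apply: (le_trans (ler_normB _ _)).
    have gn (y : R) : `|y| = n.+1%:R -> `|G y| <= s ^+ 2 * (K * C) * normal_peak (2 * s) / n.+1%:R.
      move=> yn; rewrite ler_pdivlMr// mulrC; apply: le_trans (Gb y).
      by apply: ler_wpM2r => //; rewrite yn lerDr.
    rewrite -mulrA mulr_natl mulr2n; apply: lerD; apply: gn; rewrite ?normrN ger0_norm//.
  apply: (@le_trans _ _ (\int[leb]_(x in ~` B n) `|(f x)%:E|)%E).
    by apply: le_abse_integral; [exact: measurableC|exact/measurable_funTS/measurable_EFinP].
  apply: (@le_trans _ _ (\int[leb]_(x in ~` B n) ((K * C / n.+1%:R)%:E * (normal_pdf 0 (2 * s) x)%:E))%E).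
    apply: ge0_le_integral => //.
    - exact: measurableC.
    - by apply/measurable_funTS/measurable_EFinP; apply: measurableT_comp.
    - by apply/measurable_funTS/measurable_EFinP; apply: measurable_funM => //; exact: measurable_normal_pdf.
    move=> x; rewrite /B /= in_itv /= => /negP xB; rewrite -EFinM lee_fin.
    rewrite mulrAC ler_pdivlMr// mulrC; apply: le_trans (fb x).
    apply: ler_wpM2r => //.
    have : n.+1%:R < `|x| by rewrite ltNge ler_norml.
    lra.
  apply: (@le_trans _ _ (\int[leb]_x ((K * C / n.+1%:R)%:E * (normal_pdf 0 (2 * s) x)%:E))%E).
    apply: ge0_subset_integral => //.
    - exact: measurableC.
    - by apply/measurable_EFinP; apply: measurable_funM => //; exact: measurable_normal_pdf.
    - by move=> x _; rewrite -EFinM lee_fin mulr_ge0 ?normal_pdf_ge0// divr_ge0.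
  rewrite ge0_integralZl//; last 3 first.
  - by apply/measurable_EFinP; exact: measurable_normal_pdf.
  - by move=> x _; rewrite lee_fin normal_pdf_ge0.
  - by rewrite lee_fin divr_ge0.
  by rewrite integral_normal_pdf mule1.
have mg : measurable_fun setT (fun x : R => x * psi x - s ^+ 2 * h x).
  by apply: measurable_funB; apply: measurable_funM => //; exact: continuous_measurable_fun.
rewrite integral_normal//; apply/eqP; rewrite -abse_eq0 eq_le abse_ge0 andbT.
apply/lee_addgt0Pr => e e0; rewrite add0e; apply: (le_trans (key (Num.bound (D / e)))).
rewrite lee_fin ler_pdivrMr// mulrC -ler_pdivrMr// (le_trans (ltW (archi_boundP _)))//.
  by rewrite divr_ge0// ltW.
by rewrite ler_nat.
Unshelve. all: by end_near. Qed.

End gaussian_stein.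

Lemma measurable_countable_factor d (X : measurableType d) (I : countType) (h : X -> I)
    d' (V : measurableType d') (F : I -> V) :
  (forall i, measurable (h @^-1` [set i])) -> measurable_fun setT (fun x => F (h x)).
Proof.
move=> mh _ B mB; rewrite setTI.
rewrite (_ : _ @^-1` _ = \bigcup_n (if unpickle n is Some i then
    if F i \in B then h @^-1` [set i] else set0 else set0)).
  apply: bigcup_measurable => n _; case: (unpickle n) => [i|]; last exact: measurable0.
  by case: ifP => _; [exact: mh|exact: measurable0].
apply/seteqP; split => [x Bx|x [n _]].
  by exists (pickle (h x)) => //; rewrite pickleK mem_set.
by case: (unpickle n) => [i|//]; case: ifP => // /set_mem Bi hx; rewrite /preimage /= (hx : h x = i).
Qed.

(** * Measurability and growth of functions of a random row *)

Section row_functions.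
Context (R : realType) (k : nat).
Implicit Types (u : 'rV[R]_k -> R) (x y : 'rV[R]_k).

Definition locally_lipschitz u := forall x, exists C, forall y, norm1 y <= 1 ->
  `|u (x + y) - u x| <= C * norm1 y.

(** The coordinates are rounded to the grid of mesh 1 / (n + 1): the resulting functions take
    countably many values, and the local Lipschitz property makes them converge. *)
Lemma measurable_row u d (X : measurableType d) (c : 'I_k -> X -> R) : locally_lipschitz u ->
  (forall i, measurable_fun setT (c i)) -> measurable_fun setT (fun o : X => u (\row_i c i o)).
Proof.
move=> lu mc.
pose gr (n : nat) (o : X) : {ffun 'I_k -> int} := [ffun i => Num.floor (n.+1%:R * c i o)].
pose F n (j : {ffun 'I_k -> int}) : R := u (\row_i ((j i)%:~R / n.+1%:R)).
apply: (@measurable_fun_cvg _ _ _ _ (fun n (o : X) => F n (gr n o))).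
  move=> n; apply: measurable_countable_factor => j.
  rewrite (_ : _ @^-1` _ = \bigcap_(i in [set: 'I_k]) ((fun o : X => n.+1%:R * c i o) @^-1` `[(j i)%:~R, (j i + 1)%:~R[)).
    apply: fin_bigcap_measurable => [|i _]; first exact: finite_finset.
    rewrite -[X in measurable X]setTI; apply: measurable_funM => //; exact: measurable_itv.
  apply/seteqP; split => [x /= <- i _|x h].
    by rewrite /= in_itv /= ffunE floor_itv.
  apply/ffunP => i; rewrite ffunE; apply: floor_def.
  by have := h i Logic.I; rewrite /= in_itv.
move=> x _; have [C hC] := lu (\row_i c i x).
apply/cvgrPdist_le => e e0.
have gap n : norm1 (\row_i ((gr n x i)%:~R / n.+1%:R) - \row_i c i x) <= k%:R / n.+1%:R.
  rewrite /norm1; apply: (@le_trans _ _ (\sum_(i < k) n.+1%:R^-1)); last first.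
    by rewrite sumr_const card_ord mulr_natl.
  apply: ler_sum => i _; rewrite !mxE ffunE.
  have n0 : 0 < n.+1%:R :> R by rewrite ltr0n.
  have := floor_itv (n.+1%:R * c i x); rewrite intrD => /andP[f1 f2].
  have -> : (Num.floor (n.+1%:R * c i x))%:~R / n.+1%:R - c i x =
    ((Num.floor (n.+1%:R * c i x))%:~R - n.+1%:R * c i x) / n.+1%:R.
    by field; rewrite gt_eqF.
  rewrite normrM (ger0_norm (_ : 0 <= n.+1%:R^-1))// -[leRHS]mul1r ler_wpM2r//.
  rewrite ler_norml; apply/andP; split; lra.
have C1 : 0 < `|C| + 1 by rewrite ltr_wpDl.
pose bd := Num.bound (k%:R * (1 + (`|C| + 1) / e)).
have bd0 : k%:R * (1 + (`|C| + 1) / e) < bd%:R.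
  by apply: archi_boundP; rewrite mulr_ge0// addr_ge0// divr_ge0// ltW.
exists bd => // n /= bn.
have n0 : 0 < n.+1%:R :> R by rewrite ltr0n.
have kn : k%:R * (1 + (`|C| + 1) / e) <= n.+1%:R.
  by apply: (le_trans (ltW bd0)); rewrite ler_nat leqW.
have k1 : k%:R <= n.+1%:R :> R.
  by apply: le_trans kn; rewrite ler_peMr// lerDl divr_ge0// ltW.
have k2 : k%:R * ((`|C| + 1) / e) <= n.+1%:R.
  by apply: le_trans kn; rewrite ler_wpM2l// lerDr.
have := gap n; set y := (X in norm1 X <= _) => yn.
have -> : F n (gr n x) = u (\row_i c i x + y) by rewrite /F /y addrC subrK.
rewrite distrC; apply: (le_trans (hC y _)).
  by apply: (le_trans yn); rewrite ler_pdivrMr// mul1r.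
apply: (@le_trans _ _ ((`|C| + 1) * (k%:R / n.+1%:R))).
  apply: (@le_trans _ _ ((`|C| + 1) * norm1 y)); last by apply: ler_wpM2l => //; exact: ltW.
  by apply: ler_wpM2r; [exact: norm1_ge0|rewrite (le_trans (ler_norm _))// lerDl].
rewrite mulrA ler_pdivrMr// mulrC -ler_pdivrMl//.
by have -> : e^-1 * (k%:R * (`|C| + 1)) = k%:R * ((`|C| + 1) / e) by ring.
Qed.

Variables (A : R) (phi : 'rV[R]_k -> R) (g : 'I_k -> 'rV[R]_k -> R) (H : 'I_k -> 'I_k -> 'rV[R]_k -> R).
Hypothesis A0 : 0 <= A.
Hypothesis cl : stein_class A phi g H.

Lemma stein_gradient_diff i x y : `|g i (x + y) - g i x| <= A * norm1 y + A * norm1 y ^+ 2.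
Proof.
have [hH _ hg _] := cl.
have -> : g i (x + y) - g i x = \sum_l H i l x * y 0 l + (g i (x + y) - g i x - \sum_l H i l x * y 0 l) by ring.
apply: (le_trans (ler_normD _ _)); apply: lerD; last exact: hg.
apply: (le_trans (ler_norm_sum _ _ _)); rewrite /norm1 mulr_sumr; apply: ler_sum => l _.
by rewrite normrM ler_wpM2r.
Qed.

Lemma stein_function_diff x y : `|phi (x + y) - phi x| <=
  (\sum_i `|g i x|) * norm1 y + A * norm1 y ^+ 2 + A * norm1 y ^+ 3.
Proof.
have [hH _ _ hphi] := cl.
set Q := \sum_i \sum_l H i l x * y 0 i * y 0 l; set L := \sum_i g i x * y 0 i.
have -> : phi (x + y) - phi x = L + 2^-1 * Q + (phi (x + y) - phi x - L - 2^-1 * Q) by ring.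
apply: (le_trans (ler_normD _ _)); apply: lerD; last exact: hphi.
apply: (le_trans (ler_normD _ _)); apply: lerD.
  rewrite mulr_suml; apply: (le_trans (ler_norm_sum _ _ _)); apply: ler_sum => i _.
  by rewrite normrM ler_wpM2l// norm1_coord.
rewrite normrM ger0_norm ?invr_ge0//.
have hQ : `|Q| <= A * norm1 y ^+ 2.
  have -> : A * norm1 y ^+ 2 = \sum_i A * `|y 0 i| * norm1 y.
    by rewrite -mulr_suml -mulr_sumr expr2 mulrA.
  apply: (le_trans (ler_norm_sum _ _ _)); apply: ler_sum => i _.
  rewrite /norm1 mulr_sumr; apply: (le_trans (ler_norm_sum _ _ _)); apply: ler_sum => l _.
  by rewrite !normrM ler_wpM2r// ler_wpM2r.
apply: (@le_trans _ _ (1 * `|Q|)); last by rewrite mul1r.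
by apply: ler_wpM2r => //; rewrite invf_le1 ?ler1n.
Qed.

Lemma stein_locally_lipschitz :
  [/\ locally_lipschitz phi, forall i, locally_lipschitz (g i) & forall i l, locally_lipschitz (H i l)].
Proof.
have [_ hL _ _] := cl.
have sq y : norm1 y <= 1 -> norm1 y ^+ 2 <= norm1 y.
  by move=> y1; rewrite expr2 ler_piMr// norm1_ge0.
have cb y : norm1 y <= 1 -> norm1 y ^+ 3 <= norm1 y.
  by move=> y1; apply: le_trans (sq y y1); rewrite exprS ler_piMl// exprn_ge0// norm1_ge0.
split=> [x|i x|i l x].
- exists ((\sum_i `|g i x|) + A + A) => y y1; apply: (le_trans (stein_function_diff x y)).
  by rewrite !mulrDl !lerD// ler_wpM2l//; [exact: sq|exact: cb].
- exists (A + A) => y y1; apply: (le_trans (stein_gradient_diff i x y)).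
  by rewrite mulrDl lerD// ler_wpM2l//; exact: sq.
- by exists A => y _; exact: hL.
Qed.

Lemma stein_growth : exists2 C : R, 0 <= C & forall x,
  [/\ `|phi x| <= C * (1 + norm1 x) ^+ 3, forall i, `|x 0 i * g i x| <= C * (1 + norm1 x) ^+ 3 &
      forall i l, `|H i l x| <= C * (1 + norm1 x) ^+ 3].
Proof.
have [hH _ _ _] := cl.
pose G := \sum_i `|g i 0|; have G0 : 0 <= G by apply: sumr_ge0.
have p0 : 0 <= `|phi 0| by [].
exists (`|phi 0| + G + A); first by rewrite !addr_ge0.
move=> x; have n0 := norm1_ge0 x; set n := norm1 x in n0 *.
have gx i : `|g i x| <= G + A * n + A * n ^+ 2.
  have := stein_gradient_diff i 0 x; rewrite add0r => h.
  have gi : `|g i 0| <= G by rewrite /G (bigD1 i)//= lerDl sumr_ge0.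
  have -> : g i x = g i 0 + (g i x - g i 0) by ring.
  by apply: (le_trans (ler_normD _ _)); rewrite -addrA; apply: lerD.
have e3 : 1 <= (1 + n) ^+ 3 by rewrite exprn_ege1// lerDl.
have n2 : 0 <= n ^+ 2 by rewrite exprn_ge0. have n3 : 0 <= n ^+ 3 by rewrite exprn_ge0.
split.
- have := stein_function_diff 0 x; rewrite add0r -/G => h.
  have -> : phi x = phi 0 + (phi x - phi 0) by ring.
  apply: (le_trans (ler_normD _ _)).
  rewrite -/n in h; apply: (@le_trans _ _ (`|phi 0| + (G * n + A * n ^+ 2 + A * n ^+ 3))); first by rewrite lerD2l.
  have -> : (`|phi 0| + G + A) * (1 + n) ^+ 3 = `|phi 0| + (G * n + A * n ^+ 2 + A * n ^+ 3) +
     (`|phi 0| * (3 * n + 3 * n ^+ 2 + n ^+ 3) + G * (1 + 2 * n + 3 * n ^+ 2 + n ^+ 3) +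
      A * (1 + 3 * n + 2 * n ^+ 2)) by ring.
  by rewrite lerDl; do ?[apply: addr_ge0 | apply: mulr_ge0].
- move=> i; rewrite normrM; apply: (@le_trans _ _ (n * (G + A * n + A * n ^+ 2))).
    by apply: ler_pM => //; exact: norm1_coord.
  have -> : n * (G + A * n + A * n ^+ 2) = G * n + A * n ^+ 2 + A * n ^+ 3 by ring.
  have -> : (`|phi 0| + G + A) * (1 + n) ^+ 3 = G * n + A * n ^+ 2 + A * n ^+ 3 +
     (`|phi 0| * (1 + 3 * n + 3 * n ^+ 2 + n ^+ 3) + G * (1 + 2 * n + 3 * n ^+ 2 + n ^+ 3) +
      A * (1 + 3 * n + 2 * n ^+ 2)) by ring.
  by rewrite lerDl; do ?[apply: addr_ge0 | apply: mulr_ge0].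
- move=> i l; apply: (le_trans (hH i l x)); apply: (@le_trans _ _ (A * (1 + n) ^+ 3)).
    by rewrite ler_peMr.
  by apply: ler_wpM2r; [exact: le_trans ler01 e3|rewrite lerDr addr_ge0].

Qed.

End row_functions.

(** * The independent Gaussian vector satisfies Stein's identity exactly *)

Section gaussian_vector.
Context dO (Omega : measurableType dO) (R : realType) (P : probability Omega R) (k : nat).
Variables (N : 'I_k -> {RV P >-> R}) (s : 'I_k -> R).
Hypothesis s0 : forall i, 0 < s i.
Hypothesis hindep : independent_RVs P (fun i => N i : Omega -> R).
Hypothesis hlaw : forall i (A : set R), measurable A -> P (N i @^-1` A) = normal_prob 0 (s i) A.
Local Notation vec w := (\row_i N i w).

Let gauss_moment i : (\int[P]_w ((1 + `|N i w|) ^+ 4)%:E < +oo)%E.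
Proof.
apply: le_lt_trans (normal_moment (s0 i)).
pose Ni : Omega -> measurableTypeR R := N i.
have mN : measurable_fun setT Ni by exact: (measurable_funP (N i)).
have m4 : measurable_fun setT (fun x : measurableTypeR R => ((1 + `|x|) ^+ 4)%:E).
  apply/measurable_EFinP; apply: measurable_funX; apply: measurable_funD => //; exact: normr_measurable.
have <- : (\int[pushforward P Ni]_x ((1 + `|x|) ^+ 4)%:E = \int[normal_prob 0 (s i)]_x ((1 + `|x|) ^+ 4)%:E)%E.
  by apply: eq_measure_integral => A mA _; exact: hlaw.
by rewrite ge0_integral_pushforward.
Qed.

Lemma gaussian_cube_integrable (C : R) : 0 <= C -> P.-integrable setT (fun w => (C * (1 + norm1 (vec w)) ^+ 3)%:E).
Proof.
move=> C0.
have mN i : measurable_fun setT (fun w => 1 + `|N i w|).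
  by apply: measurable_funD => //; exact: measurableT_comp.
have mn : measurable_fun setT (fun w => norm1 (vec w)).
  by apply: measurable_sum => i; under eq_fun do rewrite mxE; exact: measurableT_comp.
apply/integrableP; split.
  apply/measurable_EFinP; apply: measurable_funM => //; apply: measurable_funX; exact: measurable_funD.
apply: (@le_lt_trans _ _ (\int[P]_w ((8 * C)%:E * (1 + (k%:R ^+ 3)%:E * \sum_i ((1 + `|N i w|) ^+ 4)%:E)))%E).
  apply: ge0_le_integral => //.
  - apply: measurableT_comp => //; apply/measurable_EFinP; apply: measurable_funM => //; apply: measurable_funX; exact: measurable_funD.
  - apply: emeasurable_funM => //; apply: emeasurable_funD => //; apply: emeasurable_funM => //.
    by apply: emeasurable_sum => i; apply/measurable_EFinP; exact: measurable_funX.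
  move=> w _; rewrite sumEFin [leRHS](_ : _ = (8 * C * (1 + k%:R ^+ 3 * \sum_i (1 + `|N i w|) ^+ 4))%:E)// lee_fin.
  set n := norm1 _; have n0 : 0 <= n := norm1_ge0 _.
  rewrite ger0_norm; last by rewrite mulr_ge0// exprn_ge0// addr_ge0.
  have h1 : (1 + n) ^+ 3 <= 8 * (1 + n ^+ 4).
    have e1 : (1 + n) ^+ 3 <= 4 * (1 + n ^+ 3).
      have : 0 <= (1 + n) * (1 - n) ^+ 2 by rewrite mulr_ge0 ?addr_ge0 ?sqr_ge0.
      rewrite !exprS expr0; lra.
    have e2 : n ^+ 3 <= 1 + n ^+ 4.
      have [n1|n1] := leP n 1.
        by apply: (@le_trans _ _ 1); [rewrite exprn_ile1|rewrite lerDl exprn_ge0].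
      by apply: (@le_trans _ _ (n ^+ 4)); [apply: ler_weXn2l => //; exact: ltW|rewrite lerDr].
    have n4 : 0 <= n ^+ 4 by rewrite exprn_ge0.
    lra.
  have h2 : n ^+ 4 <= k%:R ^+ 3 * \sum_i (1 + `|N i w|) ^+ 4.
    have nE : n = \sum_i `|N i w| by apply: eq_bigr => i _; rewrite mxE.
    have q1 := sum_sqr_le (fun i => `|N i w|); have q2 := sum_sqr_le (fun i => `|N i w| ^+ 2).
    rewrite card_ord in q1 q2; rewrite -nE in q1.
    have k0 : 0 <= k%:R :> R by [].
    have s20 : 0 <= \sum_i `|N i w| ^+ 2 by apply: sumr_ge0 => i _; exact: sqr_ge0.
    have -> : n ^+ 4 = (n ^+ 2) ^+ 2 by rewrite -exprM.
    apply: (@le_trans _ _ ((k%:R * \sum_i `|N i w| ^+ 2) ^+ 2)).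
      by rewrite lerXn2r ?nnegrE ?sqr_ge0// mulr_ge0.
    rewrite exprMn [_ ^+ 3]exprSr -mulrA; apply: ler_wpM2l; first exact: sqr_ge0.
    apply: (le_trans q2); apply: ler_wpM2l => //; apply: ler_sum => i _.
    by rewrite -exprM lerXn2r ?nnegrE ?addr_ge0// lerDr.
  move: (k%:R ^+ 3 * _) h2 => S h2; have -> : 8 * C * (1 + S) = C * (8 * (1 + S)) by ring.
  apply: ler_wpM2l => //.
  by apply: (le_trans h1); rewrite ler_pM2l// lerD2l.
have m4 i : measurable_fun setT (fun w => ((1 + `|N i w|) ^+ 4)%:E).
  by apply/measurable_EFinP; exact: measurable_funX.
have p4 i w : (0 <= ((1 + `|N i w|) ^+ 4)%:E)%E by rewrite lee_fin exprn_ge0// addr_ge0.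
have ms : measurable_fun setT (fun w => \sum_i ((1 + `|N i w|) ^+ 4)%:E)%E by exact: emeasurable_sum.
have ps w : (0 <= \sum_i ((1 + `|N i w|) ^+ 4)%:E)%E by exact: sume_ge0.
have k3 : (0 <= (k%:R ^+ 3)%:E :> \bar R)%E by rewrite lee_fin exprn_ge0.
rewrite ge0_integralZl//; last 3 first.
- by apply: emeasurable_funD => //; exact: emeasurable_funM.
- by move=> w _; rewrite adde_ge0// mule_ge0.
- by rewrite lee_fin mulr_ge0.
rewrite ge0_integralD//; last 2 first.
- by move=> w _; rewrite mule_ge0.
- exact: emeasurable_funM.
rewrite ge0_integralZl// ge0_integral_sum//.
apply: lte_mul_pinfty => //; first by rewrite lee_fin mulr_ge0.
apply: lte_add_pinfty; first by rewrite integral_cst// mul1e [X in (X < _)%E](probability_setT P) ltry.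
apply: lte_mul_pinfty => //.
by apply: lte_sum_pinfty => i _; exact: gauss_moment.
Qed.

Definition gaussian_dom (u : 'rV[R]_k -> R) := P.-integrable setT (fun w => (u (vec w))%:E).
Definition gaussian_exp (u : 'rV[R]_k -> R) := fine (\int[P]_w (u (vec w))%:E).

Lemma gaussian_functional : expectation_functional gaussian_dom gaussian_exp.
Proof.
have cube (u : 'rV[R]_k -> R) C : 0 <= C -> measurable_fun setT (fun w => u (vec w)) ->
    (forall x, `|u x| <= C * (1 + norm1 x) ^+ 3) -> gaussian_dom u.
  move=> C0 mu uC; apply: le_integrable (gaussian_cube_integrable C0) => //.
    exact/measurable_EFinP.
  by move=> w _; rewrite /= lee_fin (le_trans (uC _))// ler_norm.
split.
- move=> u v c Du Dv; rewrite /gaussian_dom.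
  rewrite (_ : (fun w => _) = (fun w => (u (vec w))%:E + c%:E * (v (vec w))%:E)%E); last by apply/funext => w; rewrite -EFinM.
  by apply: integrableD => //; exact: integrableZl.
- move=> u v c Du Dv; rewrite /gaussian_exp.
  under eq_integral do rewrite EFinD EFinM.
  rewrite integralD//; last exact: integrableZl.
  rewrite integralZl// fineD ?fineM//; try exact: integrable_fin_num.
  by rewrite fin_numM// integrable_fin_num.
- move=> u v Du Dv uv; apply: fine_le; [exact: integrable_fin_num|exact: integrable_fin_num|].
  by apply: le_integral => // w _; rewrite lee_fin.
- exact: finite_measure_integrable_cst.
- have PT : P setT = 1%E := probability_setT P.
  by rewrite /gaussian_exp integral_cst//= mul1e [X in fine X]PT.
- move=> A phi g H A0 cl; have [C C0 hC] := stein_growth A0 cl.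
  have [l1 l2 l3] := stein_locally_lipschitz A0 cl.
  have mr u : locally_lipschitz u -> measurable_fun setT (fun w => u (vec w)).
    by move=> lu; apply: (measurable_row lu) => i.
  split=> [|i|i l].
  + by apply: (cube _ C) => //; [exact: mr|move=> x; have [] := hC x].
  + apply: (cube _ C) => //; last by move=> x; have [_ ? _] := hC x.
    by under eq_fun do rewrite mxE; apply: measurable_funM => //; exact: mr.
  + by apply: (cube _ C) => //; [exact: mr|move=> x; have [_ _ ?] := hC x].
- move=> c c0; apply: (cube _ ((1 + c) ^+ 3)).
  + by rewrite exprn_ge0// addr_ge0.
  + apply: measurable_funX; apply: measurable_funD => //.
    apply: measurable_sum => i; under eq_fun do rewrite mxE; exact: measurableT_comp.
  + move=> x; have n0 := norm1_ge0 x; rewrite ger0_norm ?exprn_ge0 ?addr_ge0// -exprMn.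
    by rewrite lerXn2r ?nnegrE ?mulr_ge0 ?addr_ge0//; nra.
Qed.

Section coordinate.
Variables (A : R) (phi : 'rV[R]_k -> R) (g : 'I_k -> 'rV[R]_k -> R) (H : 'I_k -> 'I_k -> 'rV[R]_k -> R) (i : 'I_k).
Hypotheses (A0 : 0 <= A) (cl : stein_class A phi g H).

(** The vector with coordinate i replaced by 0; as a tuple it fits the product measure on tuples. *)
Definition others w : k.-tuple (measurableTypeR R) := [tuple if j == i then 0 else N j w | j < k].

Lemma measurable_others : measurable_fun setT others.
Proof.
apply/measurable_fun_tnthP => j.
rewrite (_ : _ \o _ = (fun w => if j == i then 0 else N j w)); last by apply/funext => w /=; rewrite tnth_mktuple.
by case: (j == i); [exact: measurable_cst|exact: (measurable_funP (N j))].
Qed.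

HB.instance Definition _ := isMeasurableFun.Build _ _ _ _ others measurable_others.

Let m1 : probability (measurableTypeR R) R := normal_prob 0 (s i).
Let m2 : probability (k.-tuple (measurableTypeR R)) R := distribution P others.
Let joint w : k.+1.-tuple (measurableTypeR R) := [tuple of N i w :: others w].

Let mjoint : measurable_fun setT joint.
Proof. by apply: measurable_cons; [exact: (measurable_funP (N i))|exact: measurable_others]. Qed.

Lemma tuple_cons_measure_rect d (X : measurableType d) n (mu : {sigma_finite_measure set X -> \bar R})
    (nu : {sigma_finite_measure set (n.-tuple X) -> \bar R}) (B : 'I_n.+1 -> set X) :
  (forall j, measurable (B j)) ->
  tuple_cons_measure mu nu [set x | forall j, B j (tnth x j)] =
  (mu (B ord0) * nu [set x | forall j, B (lift ord0 j) (tnth x j)])%E.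
Proof.
move=> mB; rewrite /tuple_cons_measure /pushforward -product_measure1E//; last first.
  exact: (@measurable_rect _ _ _ (fun j => B (lift ord0 j))).
congr ((mu \x _)%E _); apply/seteqP; split => [[z x] h|[z x] [h1 h2] j].
  split; first by have := h ord0; rewrite (tnth_nth z).
  by move=> j; have := h (lift ord0 j); rewrite tnthS.
case: (unliftP ord0 j) => [j' ->|->]; first by rewrite tnthS; exact: h2.
by rewrite (tnth_nth z).
Qed.

(** Independence gives the product formula when slot i of the rectangle contains 0; otherwise both
    sides are 0, because that slot of [others] is always 0. *)
Let joint_rect (B : 'I_k.+1 -> set R) : (forall j, measurable (B j)) ->
  pushforward P joint [set x | forall j, B j (tnth x j)] =
  (m1 (B ord0) * m2 [set x | forall j, B (lift ord0 j) (tnth x j)])%E.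
Proof.
move=> mB; rewrite /pushforward.
have jE w : joint w \in [set x | forall j, B j (tnth x j)] ->
   B ord0 (N i w) /\ forall j, B (lift ord0 j) (tnth (others w) j).
  move=> /set_mem h; split; first by have := h ord0; rewrite (tnth_nth 0).
  by move=> j; have := h (lift ord0 j); rewrite tnthS.
have [c|c] := pselect (B (lift ord0 i) 0); last first.
  rewrite (_ : joint @^-1` _ = set0); last first.
    apply/seteqP; split => // w h; have [_ /(_ i)] := jE w (mem_set h).
    by rewrite tnth_mktuple eqxx.
  rewrite measure0 (_ : m2 _ = 0%E) ?mule0//.
  rewrite -[LHS]/(P (others @^-1` _)) (_ : others @^-1` _ = set0) ?measure0//.
  by apply/seteqP; split => // w /= /(_ i); rewrite tnth_mktuple eqxx.
pose C (D : set R) j := if j == i then D else B (lift ord0 j).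
have mC D : measurable D -> forall j, measurable (C D j).
  by move=> mD j; rewrite /C; case: ifP.
have CE D w : (forall j, C D j (N j w)) <-> D (N i w) /\ forall j, B (lift ord0 j) (tnth (others w) j).
  split=> [h|[h1 h2] j].
    split; first by have := h i; rewrite /C eqxx.
    move=> j; rewrite tnth_mktuple; have := h j; rewrite /C.
    by case: eqP => [->|].
  rewrite /C; case: eqP => [->//|/eqP/negPf ji].
  by have := h2 j; rewrite tnth_mktuple ji.
rewrite (_ : joint @^-1` _ = [set w | forall j, C (B ord0) j (N j w)]); last first.
  apply/seteqP; split => w h; first by apply/CE; exact: jE (mem_set h).
  have [h1 h2] := (CE _ _).1 h => j.
  case: (unliftP ord0 j) => [j' ->|->]; first by rewrite tnthS; exact: h2.
  by rewrite (tnth_nth 0).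
rewrite (_ : m2 _ = P [set w | forall j, C setT j (N j w)]); last first.
  rewrite /m2 /= /distribution /pushforward; congr (P _); apply/seteqP; split => w h.
    by apply/CE; split.
  by have [_] := (CE _ _).1 h.
rewrite !hindep; [|exact: mC|exact: mC].
rewrite (bigD1 i)//= [in RHS](bigD1 i)//= {1 3}/C eqxx preimage_setT probability_setT mul1e.
congr (_ * _)%E; first exact: hlaw.
by apply: eq_bigr => j ji; rewrite /C (negPf ji).
Qed.

Let joint_law B : measurable B -> pushforward P joint B = tuple_cons_measure m1 m2 B.
Proof.
apply: (measure_unique (@rectangles _ (measurableTypeR R) k.+1) (fun=> setT)).
- exact: measurable_rectangles.
- move=> _ _ [C mC ->] [C' mC' ->]; exists (fun j => C j `&` C' j).
    by move=> j; exact: measurableI.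
  apply/seteqP; split => [x [h1 h2] j|x h]; first by split.
  by split=> j; have [] := h j.
- by move=> n; exists (fun=> setT) => //; apply/seteqP; split.
- by apply/seteqP; split => // x _; exists 0%N.
- by move=> _ [C mC ->]; apply: etrans (joint_rect mC) _; apply/esym/tuple_cons_measure_rect.
- by move=> n; rewrite -[X in (X < _)%E]/(P (joint @^-1` setT)) preimage_setT [X in (X < _)%E](probability_setT P) ltry.
Qed.

Let merge (x : k.+1.-tuple (measurableTypeR R)) : 'rV[R]_k :=
  \row_j (if j == i then thead x else tnth x (lift ord0 j)).
Let F (x : k.+1.-tuple (measurableTypeR R)) : R :=
  thead x * g i (merge x) - s i ^+ 2 * H i i (merge x).

Let merge_joint w : merge (joint w) = vec w.
Proof.
apply/rowP => j; rewrite !mxE; case: eqP => [->|/eqP/negPf ji]; first by rewrite theadE.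
by rewrite tnthS tnth_mktuple ji.
Qed.

Let mF : measurable_fun setT (EFin \o F).
Proof.
have [_ lg lH] := stein_locally_lipschitz A0 cl.
have mth : measurable_fun setT (fun x : k.+1.-tuple (measurableTypeR R) => thead x : measurableTypeR R).
  exact: measurable_tnth.
have mm u : locally_lipschitz u -> measurable_fun setT (fun x : k.+1.-tuple (measurableTypeR R) => u (merge x)).
  move=> lu; apply: (measurable_row lu) => j; case: (j == i); first exact: mth.
  exact: (@measurable_tnth _ (measurableTypeR R)).
apply/measurable_EFinP; apply: measurable_funB; apply: measurable_funM => //.
- exact: mm.
- exact: mm.
Qed.

Let FE w : F (joint w) = vec w 0 i * g i (vec w) - s i ^+ 2 * H i i (vec w).
Proof. by rewrite /F merge_joint mxE theadE. Qed.

Let iF : P.-integrable setT ((EFin \o F) \o joint).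
Proof.
have [_ Dg DH] := exf_class gaussian_functional A0 cl.
have := exf_lin gaussian_functional (- s i ^+ 2) (Dg i) (DH i i).
rewrite /gaussian_dom; congr (_.-integrable _ _); apply/funext => w /=.
by rewrite FE mulNr.
Qed.

(** Fubini integrates N_i first with the other coordinates frozen; the restriction of the test
    function to such a line satisfies the hypotheses of [stein_identity_normal]. *)
Lemma gaussian_coordinate_gap :
  (\int[P]_w (vec w 0 i * g i (vec w) - s i ^+ 2 * H i i (vec w))%:E = 0)%E.
Proof.
transitivity (\int[P]_w ((EFin \o F) \o joint) w)%E.
  by apply: eq_integral => w _; rewrite /= FE.
have iFj : (pushforward P joint).-integrable setT (EFin \o F).
  by apply: integrable_pushforward => //; rewrite preimage_setT.
have -> : (\int[P]_w ((EFin \o F) \o joint) w = \int[pushforward P joint]_x (EFin \o F) x)%E.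
  by rewrite integral_pushforward.
have eqm (G : k.+1.-tuple (measurableTypeR R) -> \bar R) :
    (\int[pushforward P joint]_x G x = \int[tuple_cons_measure m1 m2]_x G x)%E.
  by apply: eq_measure_integral => B mB _; exact: joint_law.
have mc : measurable_fun setT (fun x : measurableTypeR R * k.-tuple (measurableTypeR R) => [tuple of x.1 :: x.2]).
  exact: measurable_cons.
have iFp : (m1 \x m2)%E.-integrable setT (fun x => (F [tuple of x.1 :: x.2])%:E).
  apply/integrableP; split; first exact: measurableT_comp mF mc.
  have /integrableP[_] := iFj; rewrite eqm.
  by rewrite [X in (X < _)%E -> _](@ge0_integral_pushforward _ _ _ _ _ _ mc (m1 \x m2)%E setT)//; exact: measurableT_comp.
rewrite eqm.
transitivity (\int[(m1 \x m2)%E]_x (F [tuple of x.1 :: x.2])%:E)%E.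
  by rewrite [LHS](@integral_pushforward _ _ _ _ _ _ mc (m1 \x m2)%E setT).
rewrite -integral21_prod_meas1//.
rewrite integral0_eq// => t _.
pose r z := merge [tuple of z :: t].
have rD z y : r (z + y) = r z + y *: delta_mx 0 i.
  apply/rowP => j; rewrite !mxE eqxx /=; have [ji|ji] := eqVneq j i; first by rewrite !theadE mulr1.
  by rewrite mulr0 addr0 !tnthS.
have dn y : norm1 (y *: delta_mx 0 i : 'rV[R]_k) = `|y|.
  rewrite /norm1 (bigD1 i)//= !mxE !eqxx mulr1 big1 ?addr0// => j /negPf ji.
  by rewrite !mxE ji andbF mulr0 normr0.
have [hH hL hg _] := cl.
rewrite /= -(@stein_identity_normal _ _ (s0 i) (fun z => g i (r z)) (fun z => H i i (r z)) A A0).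
- by apply: eq_integral => z _; rewrite /F /= theadE.
- move=> z y; rewrite rD; have := hg i (r z) (y *: delta_mx 0 i); rewrite dn real_normK ?num_real//.
  rewrite (bigD1 i)//= !mxE !eqxx mulr1 big1 ?addr0// => j /negPf ji.
  by rewrite !mxE ji andbF !mulr0.
- by move=> z; exact: hH.
- by move=> z y; rewrite rD; have := hL i i (r z) (y *: delta_mx 0 i); rewrite dn.
Qed.

End coordinate.

Lemma gaussian_gap A phi g H : 0 <= A -> stein_class A phi g H -> gaussian_exp (stein_gap s g H) = 0.
Proof.
move=> A0 cl; have DE := gaussian_functional; have [_ Dg DH] := exf_class DE A0 cl.
pose w i (x : 'rV[R]_k) := x 0 i * g i x + (- s i ^+ 2) * H i i x.
have Dw i : gaussian_dom (w i) by exact: (exf_lin DE).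
have Ew i : gaussian_exp (w i) = 0.
  rewrite /gaussian_exp -[RHS]/(fine 0%E) -(gaussian_coordinate_gap i A0 cl); congr fine.
  by apply: eq_integral => o _; rewrite /w mulNr.
have key (r : seq 'I_k) : gaussian_dom (fun x => \sum_(i <- r) (-1) * w i x) /\
    gaussian_exp (fun x => \sum_(i <- r) (-1) * w i x) = 0.
  elim: r => [|i r [IH1 IH2]].
    by split; under eq_fun do rewrite big_nil; [exact: (exf_D0 DE)|exact: (exf_E0 DE)].
  have e : (fun x => \sum_(j <- i :: r) -1 * w j x) = (fun x => \sum_(j <- r) -1 * w j x + (-1) * w i x).
    by apply/funext => x; rewrite big_cons addrC.
  by rewrite e; split; [exact: (exf_lin DE)|rewrite (exf_linE DE)// IH2 Ew mulr0 addr0].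
have -> : stein_gap s g H = (fun x => \sum_(i <- index_enum 'I_k) (-1) * w i x).
  by apply/funext => x; rewrite /stein_gap -sumrB; apply: eq_bigr => i _; rewrite /w; ring.
by have [] := key (index_enum 'I_k).
Qed.

End gaussian_vector.

(** The cubic growth provided by [stein_class] would call for third moments of the F_i. A bounded
    Hessian gives a gradient of linear growth, so approximation in L^2 suffices. *)
Lemma smooth_growth (R : realType) (k : nat) (f : 'rV[R]_k -> R) (A : R) : thrice_differentiable f ->
  0 <= A -> (forall i l x, `|partial l (partial i f) x| <= A) ->
  exists2 L : R, 0 <= L & forall x y, `|f (x + y) - f x| <= L * ((1 + norm1 x + norm1 y) * norm1 y).
Proof.
move=> [d0 d1 _] A0 hA; pose G := \sum_i `|partial i f 0|.
have G0 : 0 <= G by apply: sumr_ge0.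
exists (G + A); first exact: addr_ge0.
have lin i z : `|partial i f z| <= G + A * norm1 z.
  have [c _ e] := mvt_line 0 z (d1 i); rewrite add0r in e.
  rewrite -(subrK (partial i f 0) (partial i f z)) addrC; apply: (le_trans (ler_normD _ _)).
  apply: lerD; first by rewrite /G (bigD1 i)//= lerDl sumr_ge0.
  rewrite e; apply: (le_trans (ler_norm_sum _ _ _)); rewrite /norm1 mulr_sumr; apply: ler_sum => l _.
  by rewrite normrM mulrC ler_wpM2r.
move=> x y; have [c /andP[c0 c1] ->] := mvt_line x y d0.
have nx := norm1_ge0 x; have ny := norm1_ge0 y.
apply: (le_trans (ler_norm_sum _ _ _)); rewrite mulrA {2}/norm1 mulr_sumr; apply: ler_sum => i _.
rewrite normrM mulrC ler_wpM2r//; apply: (le_trans (lin i _)).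
have h : norm1 (x + c *: y) <= norm1 x + norm1 y.
  apply: (le_trans (norm1D _ _)); rewrite lerD2l norm1Z gtr0_norm//.
  by rewrite ler_piMl// ltW.
apply: (@le_trans _ _ (G + A * (norm1 x + norm1 y))); first by rewrite lerD2l ler_wpM2l.
have -> : (G + A) * (1 + norm1 x + norm1 y) = G + A * (norm1 x + norm1 y) + (G * (norm1 x + norm1 y) + A) by ring.
by rewrite lerDl addr_ge0// mulr_ge0// addr_ge0.
Qed.

Lemma chaos_functional (R : realType) (T : finType) (p : T -> R) (k : nat) (V : {set T} -> 'rV[R]_k) :
  (forall t, 0 <= p t <= 1) ->
  expectation_functional (fun=> True) (fun u => Ex p (fun b => u (V b))).
Proof.
move=> p01; split => //.
- by move=> u v c _ _; rewrite ExD ExZ.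
- by move=> u v _ _ uv; apply: (ler_Ex p01) => b.
- exact: Ex_cst.
Qed.

(** * Expectations under perturbations small in L^2 *)

Section second_moments.
Context dO (Omega : measurableType dO) (R : realType) (P : probability Omega R).
Implicit Types X Y : Omega -> R.

Lemma sqr_perturb (x y t : R) : 0 < t -> y ^+ 2 <= (1 + t) * x ^+ 2 + (1 + t^-1) * (x - y) ^+ 2.
Proof.
move=> t0; rewrite -subr_ge0.
have -> : (1 + t) * x ^+ 2 + (1 + t^-1) * (x - y) ^+ 2 - y ^+ 2 = t^-1 * (t * x + (x - y)) ^+ 2.
  by field; rewrite gt_eqF.
by rewrite mulr_ge0 ?sqr_ge0// invr_ge0 ltW.
Qed.

Lemma measurable_quadratic (I J : finType) (X : I -> Omega -> R) (Y : J -> Omega -> R) (c0 c1 c2 : R) :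
  (forall i, measurable_fun setT (X i)) -> (forall j, measurable_fun setT (Y j)) ->
  measurable_fun setT (fun w => (c0 + c1 * (\sum_i X i w ^+ 2) + c2 * (\sum_j Y j w ^+ 2))%:E).
Proof.
move=> mX mY; apply/measurable_EFinP; apply: measurable_funD; first apply: measurable_funD => //;
  by apply: measurable_funM => //; apply: measurable_sum => i; exact: measurable_funX.
Qed.

Lemma integral_quadratic (I J : finType) (X : I -> Omega -> R) (Y : J -> Omega -> R) (c0 c1 c2 : R) :
  0 <= c0 -> 0 <= c1 -> 0 <= c2 -> (forall i, measurable_fun setT (X i)) -> (forall j, measurable_fun setT (Y j)) ->
  (\int[P]_w (c0 + c1 * (\sum_i X i w ^+ 2) + c2 * (\sum_j Y j w ^+ 2))%:E =
   c0%:E + c1%:E * (\sum_i \int[P]_w (X i w ^+ 2)%:E) + c2%:E * (\sum_j \int[P]_w (Y j w ^+ 2)%:E))%E.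
Proof.
move=> h0 h1 h2 mX mY.
have ms (K : finType) (W : K -> Omega -> R) : (forall i, measurable_fun setT (W i)) ->
    measurable_fun setT (fun w => \sum_i W i w ^+ 2).
  by move=> mW; apply: measurable_sum => i; exact: measurable_funX.
have s0 (K : finType) (W : K -> Omega -> R) w : 0 <= \sum_i W i w ^+ 2 by apply: sumr_ge0 => i _; exact: sqr_ge0.
have part (K : finType) (W : K -> Omega -> R) (c : R) : 0 <= c -> (forall i, measurable_fun setT (W i)) ->
    (\int[P]_w (c * (\sum_i W i w ^+ 2))%:E = c%:E * (\sum_i \int[P]_w (W i w ^+ 2)%:E))%E.
  move=> hc mW; under eq_integral do rewrite EFinM.
  have msW : measurable_fun setT (fun w => (\sum_i W i w ^+ 2)%:E) by apply/measurable_EFinP; exact: ms.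
  rewrite ge0_integralZl//; last by move=> w _; rewrite lee_fin.
  congr (_ * _)%E; under eq_integral do rewrite -sumEFin.
  rewrite ge0_integral_sum//.
  - by move=> i; apply/measurable_EFinP; exact: measurable_funX.
  - by move=> i w _; rewrite lee_fin sqr_ge0.
have ms1 (K : finType) (W : K -> Omega -> R) c : (forall i, measurable_fun setT (W i)) ->
    measurable_fun setT (fun w => (c * \sum_i W i w ^+ 2)%:E).
  by move=> mW; apply/measurable_EFinP; apply: measurable_funM => //; exact: ms.
have mc : measurable_fun setT (fun w => (c0%:E + (c1 * \sum_i X i w ^+ 2)%:E)%E).
  by apply: emeasurable_funD => //; exact: ms1.
under eq_integral do rewrite !EFinD.
rewrite ge0_integralD//; try exact: ms1; try (by move=> w _; rewrite -?EFinD lee_fin ?addr_ge0 ?mulr_ge0).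
rewrite ge0_integralD//; try exact: ms1; try (by move=> w _; rewrite lee_fin mulr_ge0).
rewrite !part//; congr (_ + _ + _)%E.
by rewrite integral_cst// [X in (_ * X)%E](probability_setT P) mule1.
Qed.

Lemma second_moment_perturb X Y (t e : R) : measurable_fun setT X -> measurable_fun setT Y -> 0 < t ->
  (\int[P]_w ((X w - Y w) ^+ 2)%:E <= e%:E)%E ->
  (\int[P]_w (Y w ^+ 2)%:E <= (1 + t)%:E * (\int[P]_w (X w ^+ 2)%:E) + ((1 + t^-1) * e)%:E)%E.
Proof.
move=> mX mY t0 h.
have m2 (W : Omega -> R) : measurable_fun setT W -> measurable_fun setT (fun w => (W w ^+ 2)%:E).
  by move=> mW; apply/measurable_EFinP; exact: measurable_funX.
have mD : measurable_fun setT (fun w => ((X w - Y w) ^+ 2)%:E) by apply: (m2 (fun w => X w - Y w)); exact: measurable_funB.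
have ti : 0 <= t^-1 by rewrite invr_ge0 ltW.
have t1 : 0 <= 1 + t by rewrite addr_ge0// ltW.
have t2 : 0 <= 1 + t^-1 by rewrite addr_ge0.
have sq0 (W : Omega -> R) w : (0 <= (W w ^+ 2)%:E)%E by rewrite lee_fin sqr_ge0.
apply: (@le_trans _ _ (\int[P]_w ((1 + t)%:E * (X w ^+ 2)%:E + (1 + t^-1)%:E * ((X w - Y w) ^+ 2)%:E))%E).
  apply: ge0_le_integral => //.
  - exact: m2.
  - by apply: emeasurable_funD; apply: emeasurable_funM => //; exact: m2.
  - by move=> w _; rewrite -!EFinM -EFinD lee_fin sqr_perturb.
rewrite ge0_integralD//; last 4 first.
- by move=> w _; rewrite mule_ge0// lee_fin.
- by apply: emeasurable_funM => //; exact: m2.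
- by move=> w _; rewrite mule_ge0// lee_fin ?sqr_ge0.
- by apply: emeasurable_funM.
rewrite !ge0_integralZl//; try exact: m2; try (by move=> w _; rewrite lee_fin sqr_ge0).
by rewrite EFinM; apply: leeD => //; apply: lee_wpmul2l => //; rewrite lee_fin.
Qed.

Lemma integrable_quadratic (I : finType) (X : I -> Omega -> R) (u : Omega -> R) (c0 c1 : R) :
  0 <= c0 -> 0 <= c1 -> (forall i, measurable_fun setT (X i)) -> measurable_fun setT u ->
  (forall i, (\int[P]_w (X i w ^+ 2)%:E < +oo)%E) ->
  (forall w, `|u w| <= c0 + c1 * (\sum_i X i w ^+ 2)) -> P.-integrable setT (EFin \o u).
Proof.
move=> h0 h1 mX mu fX uX; apply/integrableP; split; first exact/measurable_EFinP.
apply: (@le_lt_trans _ _ (\int[P]_w (c0 + c1 * (\sum_i X i w ^+ 2) + 0 * (\sum_i X i w ^+ 2))%:E)%E).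
  apply: ge0_le_integral => //.
  - by apply: measurableT_comp => //; exact/measurable_EFinP.
  - exact: measurable_quadratic.
  - by move=> w _; rewrite /= lee_fin mul0r addr0.
rewrite integral_quadratic// mul0e adde0; apply: lte_add_pinfty; first exact: ltry.
apply: lte_mul_pinfty => //.
by apply: lte_sum_pinfty.
Qed.

Lemma expectation_diff (I J : finType) (X : I -> Omega -> R) (Y : J -> Omega -> R) (u v : Omega -> R)
    (c0 c1 c2 : R) (a : I -> R) (b : J -> R) :
  0 <= c0 -> 0 <= c1 -> 0 <= c2 -> (forall i, measurable_fun setT (X i)) -> (forall j, measurable_fun setT (Y j)) ->
  P.-integrable setT (EFin \o u) -> P.-integrable setT (EFin \o v) ->
  (forall i, (\int[P]_w (X i w ^+ 2)%:E <= (a i)%:E)%E) -> (forall j, (\int[P]_w (Y j w ^+ 2)%:E <= (b j)%:E)%E) ->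
  (forall w, `|u w - v w| <= c0 + c1 * (\sum_i X i w ^+ 2) + c2 * (\sum_j Y j w ^+ 2)) ->
  `|fine (\int[P]_w (u w)%:E) - fine (\int[P]_w (v w)%:E)| <= c0 + c1 * (\sum_i a i) + c2 * (\sum_j b j).
Proof.
move=> h0 h1 h2 mX mY iu iv Xa Yb uv.
have fu : (\int[P]_w (u w)%:E)%E \is a fin_num by exact: integrable_fin_num iu.
have fv : (\int[P]_w (v w)%:E)%E \is a fin_num by exact: integrable_fin_num iv.
have fuv : (\int[P]_w (u w)%:E - \int[P]_w (v w)%:E)%E \is a fin_num.
  by rewrite (fin_numB (\int[P]_w (u w)%:E)%E) fu fv.
rewrite -fineB// -lee_fin -fine_abse// fineK; last by rewrite abse_fin_num.
have <- := integralB measurableT iu iv.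
have iuv := integrableB measurableT iu iv; have /integrableP[muv _] := iuv.
apply: (le_trans (le_abse_integral _ measurableT muv)).
apply: (@le_trans _ _ (\int[P]_w (c0 + c1 * (\sum_i X i w ^+ 2) + c2 * (\sum_j Y j w ^+ 2))%:E)%E).
  apply: ge0_le_integral => //.
  - exact: measurableT_comp.
  - exact: measurable_quadratic.
  - by move=> w _; rewrite /= lee_fin.
rewrite integral_quadratic// !EFinD !EFinM -!sumEFin; apply: leeD; first (apply: leeD => //); apply: lee_wpmul2l;
  by [rewrite lee_fin|apply: lee_sum].
Qed.

End second_moments.

Lemma le_limit0 (R : realFieldType) (x a M : R) : 0 <= M ->
  (forall t, 0 < t -> t <= 1 -> x <= a + t * M) -> x <= a.
Proof.
move=> M0 h; rewrite leNgt; apply/negP => ax.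
pose t := Num.min 1 ((x - a) / (2 * (M + 1))).
have M1 : 0 < 2 * (M + 1) by rewrite mulr_gt0// ltr_wpDl.
have t0 : 0 < t by rewrite lt_min ltr01 divr_gt0// subr_gt0.
have := h t t0; rewrite {1}/t ge_min lexx => /(_ isT).
have : t * (2 * (M + 1)) <= x - a by rewrite -ler_pdivlMr// /t ge_min lexx orbT.
nra.
Qed.

(** * Comparison with a law satisfying Stein's identity exactly *)

Section comparison.
Context dO (Omega : measurableType dO) (R : realType) (P : probability Omega R) (k : nat) (q : 'I_k -> nat).
Hypothesis q_gt0 : forall i, (0 < q i)%N.
Hypothesis q_lt : forall i j : 'I_k, (i < j)%N -> (q i < q j)%N.
Variables (F : 'I_k -> Omega -> R) (beta : R).
Hypothesis mF : forall i, measurable_fun setT (F i).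
Hypothesis beta0 : 0 < beta.

(* The kernels g of the discrete chaos satisfy the bounds of B3 up to a        *)
(* constant, while the L2 error e is arbitrarily small.                        *)
Definition approximable (e : R) : Prop :=
  exists (T : finType) (p x1 x0 m w : T -> R) (pat : Omega -> {set T}) (g : 'I_k -> {set T} -> R),
  [/\ bernoulli_model P p x1 x0 m w pat, forall i, homogeneous (q i) (g i),
    forall i, (\int[P]_o ((F i o - chaos x1 x0 (g i) (pat o)) ^+ 2)%:E <= e%:E)%E,
    (forall i r l, (0 < l)%N -> (l <= r)%N -> (r <= q i)%N -> (l < q i)%N ->
      contr_energy m (g i) (g i) (q i) (q i) r l <= beta ^+ 2) /\
    (forall (i j : 'I_k) (r l : nat), (i < j)%N -> (0 < l)%N -> (l <= r)%N -> (r <= q i)%N ->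
      contr_energy m (g i) (g j) (q i) (q j) r l <= beta ^+ 2) &
    forall i, \sum_S weight m S * g i S ^+ 4 <= beta ^+ 2].

Hypothesis approx : forall e, 0 < e -> approximable e.

(** Chaoses of different degrees have no monomial in common. *)
Lemma chaos_orthogonal (T : finType) (p x1 x0 m w : T -> R) (pat : Omega -> {set T}) (g : 'I_k -> {set T} -> R) :
  bernoulli_model P p x1 x0 m w pat -> (forall i, homogeneous (q i) (g i)) ->
  Ex p (fun b => (\sum_i chaos x1 x0 (g i) b) ^+ 2) = \sum_i chaos_var m g i.
Proof.
move=> md hg.
under [X in Ex p X]eq_fun do rewrite expr2 big_distrlr /=.
rewrite Ex_sum; apply: eq_bigr => i _; rewrite Ex_sum (bigD1 i)//= big1 ?addr0.
  rewrite (chaos_inner (model_mean md) (model_x1 md) (model_x0 md)); apply: eq_bigr => S _.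
  by rewrite expr2 mulrA.
move=> j ji; rewrite (chaos_inner (model_mean md) (model_x1 md) (model_x0 md)) big1// => S _.
have qij : q j != q i.
  move: ji; rewrite -val_eqE neq_ltn => /orP[/q_lt|/q_lt] h; first by rewrite ltn_eqF.
  by rewrite gtn_eqF.
have [Si|Si] := eqVneq #|S| (q i); last by rewrite (hg i S Si) mulr0 mul0r.
by rewrite (hg j S) ?mulr0// Si eq_sym.
Qed.

Lemma approximable_square_integrable i : (\int[P]_w (F i w ^+ 2)%:E < +oo)%E.
Proof.
have [T [p [x1 [x0 [m [w [pat [g [md hg close _ _]]]]]]]]] := approx ltr01.
have mch : measurable_fun setT (fun o => chaos x1 x0 (g i) (pat o)) by exact: (model_measurable md (chaos x1 x0 (g i))).
have := @second_moment_perturb _ _ _ P (fun o => chaos x1 x0 (g i) (pat o)) (F i) 1 1 mch (mF i) ltr01.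
have -> : (\int[P]_w ((chaos x1 x0 (g i) (pat w) - F i w) ^+ 2)%:E = \int[P]_w ((F i w - chaos x1 x0 (g i) (pat w)) ^+ 2)%:E)%E.
  by apply: eq_integral => o _; rewrite -sqrrN opprB.
move=> /(_ (close i)) h; apply: (le_lt_trans h).
by rewrite (model_law md (fun b => chaos x1 x0 (g i) b ^+ 2)) -EFinM -EFinD ltry.
Qed.

Definition variance_of i : R := fine (\int[P]_w (F i w ^+ 2)%:E).
Definition total_variance : R := fine (\int[P]_w ((\sum_i F i w) ^+ 2)%:E).
Local Notation sg := variance_of.

Let sgE i : (\int[P]_w (F i w ^+ 2)%:E = (sg i)%:E)%E.
Proof.
rewrite fineK// ge0_fin_numE ?approximable_square_integrable//.
by apply: integral_ge0 => w _; rewrite lee_fin sqr_ge0.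
Qed.

Let sg0 i : 0 <= sg i.
Proof. by apply: fine_ge0; apply: integral_ge0 => w _; rewrite lee_fin sqr_ge0. Qed.

Let mS : measurable_fun setT (fun w => \sum_i F i w).
Proof. exact: measurable_sum. Qed.

Let tvE : (\int[P]_w ((\sum_i F i w) ^+ 2)%:E = total_variance%:E)%E.
Proof.
rewrite fineK// ge0_fin_numE; last by apply: integral_ge0 => w _; rewrite lee_fin sqr_ge0.
apply: (@le_lt_trans _ _ (\int[P]_w (0 + k%:R * (\sum_i F i w ^+ 2) + 0 * (\sum_i F i w ^+ 2))%:E)%E).
  apply: ge0_le_integral => //.
  - by move=> w _; rewrite lee_fin sqr_ge0.
  - by apply/measurable_EFinP; exact: measurable_funX.
  - exact: measurable_quadratic.
  - by move=> w _; rewrite lee_fin mul0r addr0 add0r -[X in X%:R * _](card_ord k) sum_sqr_le.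
rewrite integral_quadratic// mul0e adde0 add0e; apply: lte_mul_pinfty => //.
by apply: lte_sum_pinfty => i _; exact: approximable_square_integrable.
Qed.

Let tv0 : 0 <= total_variance.
Proof. by apply: fine_ge0; apply: integral_ge0 => w _; rewrite lee_fin sqr_ge0. Qed.

Variables (A L : R) (phi : 'rV[R]_k -> R) (G : 'I_k -> 'rV[R]_k -> R) (H : 'I_k -> 'I_k -> 'rV[R]_k -> R).
Hypotheses (A0 : 0 <= A) (L0 : 0 <= L) (cl : stein_class A phi G H).
Hypothesis growth : forall x y, `|phi (x + y) - phi x| <= L * ((1 + norm1 x + norm1 y) * norm1 y).

Let sqr_norm1 (c : 'I_k -> R) : norm1 (\row_i c i) ^+ 2 <= k%:R * \sum_i c i ^+ 2.
Proof.
rewrite /norm1; under eq_bigr do rewrite mxE.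
apply: (le_trans (sum_sqr_le _)); rewrite card_ord ler_wpM2l//.
by apply: ler_sum => i _; rewrite real_normK ?num_real.
Qed.

Lemma growth_integrable (X : 'I_k -> Omega -> R) : (forall i, measurable_fun setT (X i)) ->
  (forall i, (\int[P]_w (X i w ^+ 2)%:E < +oo)%E) -> P.-integrable setT (fun w => (phi (\row_i X i w))%:E).
Proof.
move=> mX fX; have [lp _ _] := stein_locally_lipschitz A0 cl.
apply: (@integrable_quadratic _ _ _ _ _ X _ (`|phi 0| + L) (2 * L * k%:R)) => //.
- exact: addr_ge0.
- by rewrite !mulr_ge0.
- exact: (measurable_row lp).
move=> w; set x := \row_i _; have n0 := norm1_ge0 x.
have := growth 0 x; rewrite add0r /norm1 big1 ?addr0; last by move=> i _; rewrite mxE normr0.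
rewrite -/(norm1 x) => h.
have -> : phi x = phi 0 + (phi x - phi 0) by ring.
apply: (le_trans (ler_normD _ _)); rewrite -addrA lerD2l; apply: (le_trans h).
have sq := sqr_norm1 (X ^~ w); rewrite -/x in sq.
rewrite -!mulrA (mulrCA 2) -[X in _ <= X + _]mulr1 -mulrDr ler_wpM2l//.
by have := sqr_ge0 (norm1 x - 1); nra.
Qed.

(** A model with L^2 error t^2 is used: since (1 + 1/t) t^2 = t + t^2, variances and the expectation
    of phi move by O(t) only. *)
Let bound_t (t : R) : 0 < t -> t <= 1 -> exists2 V : R, V <= total_variance + t * (total_variance + 2 * k%:R ^+ 2) &
  exists2 kap : R, kap <= gap_constant R q * beta * (1 + V) * 2 + t * \sum_i (2 * sg i + 4) &
  exists D1 E1, [/\ expectation_functional D1 E1, forall A phi g H, 0 <= A -> stein_class A phi g H ->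
      `|E1 (stein_gap (fun i => Num.sqrt (sg i)) g H)| <= kap * A, 0 <= kap &
    `|fine (\int[P]_w (phi (\row_i F i w))%:E) - E1 phi| <=
       t * (L * (2 + 2 * k%:R * \sum_i sg i + 2 * k%:R * k%:R))].
Proof.
move=> t0 t1.
have [T [p [x1 [x0 [m [w [pat [g [md hg close [diag offd] four]]]]]]]]] := approx (exprn_gt0 2 t0).
pose ch i o := chaos x1 x0 (g i) (pat o); pose v := chaos_var m g.
have mch i : measurable_fun setT (ch i) by exact: (model_measurable md (chaos x1 x0 (g i))).
have hv i : (\int[P]_o (ch i o ^+ 2)%:E = (v i)%:E)%E.
  rewrite (model_law md (fun b => chaos x1 x0 (g i) b ^+ 2)).
  by rewrite (chaos_sqr (model_mean md) (model_x1 md) (model_x0 md)).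
have hV : (\int[P]_o ((\sum_i ch i o) ^+ 2)%:E = (\sum_i v i)%:E)%E.
  by rewrite (model_law md (fun b => (\sum_i chaos x1 x0 (g i) b) ^+ 2)) (chaos_orthogonal md hg).
have v0 i : 0 <= v i.
  by rewrite -lee_fin -hv; apply: integral_ge0 => o _; rewrite lee_fin sqr_ge0.
have close' i : (\int[P]_o ((ch i o - F i o) ^+ 2)%:E <= (t ^+ 2)%:E)%E.
  apply: le_trans (close i); rewrite le_eqVlt; apply/orP; left; apply/eqP.
  by apply: eq_integral => o _; rewrite -sqrrN opprB.
have tt : t ^+ 2 <= t by rewrite expr2 ler_piMr// ltW.
have e1 : (1 + t^-1) * t ^+ 2 = t ^+ 2 + t by field; rewrite gt_eqF.
have up i : v i <= (1 + t) * sg i + (t ^+ 2 + t).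
  by have := second_moment_perturb (mF i) (mch i) t0 (close i); rewrite hv sgE -EFinM -EFinD lee_fin e1.
have lo i : sg i <= (1 + t) * v i + (t ^+ 2 + t).
  by have := second_moment_perturb (mch i) (mF i) t0 (close' i); rewrite hv sgE -EFinM -EFinD lee_fin e1.
have ab i : `|sg i - v i| <= t * (2 * sg i + 4).
  have := up i; have := lo i; have := sg0 i; have := v0 i; move: (sg i) (v i) => a b b0 a0 h1 h2.
  have b2 : b <= 2 * a + 2 by have : t * a <= 1 * a by [exact: ler_wpM2r]; lra.
  have tb : t * b <= t * (2 * a + 2) by rewrite ler_pM2l.
  have ta : 0 <= t * a by rewrite mulr_ge0// ltW.
  by rewrite ler_norml; apply/andP; split; lra.
have kk0 : 0 <= k%:R * k%:R :> R by rewrite mulr_ge0.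
have upV : \sum_i v i <= total_variance + t * (total_variance + 2 * k%:R ^+ 2).
  have D : (\int[P]_o ((\sum_i F i o - \sum_i ch i o) ^+ 2)%:E <= (k%:R * k%:R * t ^+ 2)%:E)%E.
    have mD i : measurable_fun setT (fun o => F i o - ch i o) by exact: measurable_funB.
    apply: (@le_trans _ _ (\int[P]_w (0 + k%:R * (\sum_i (F i w - ch i w) ^+ 2) + 0 * (\sum_i F i w ^+ 2))%:E)%E).
      apply: ge0_le_integral => //.
      - by move=> o _; rewrite lee_fin sqr_ge0.
      - apply/measurable_EFinP; apply: measurable_funX; apply: measurable_funB => //; exact: measurable_sum.
      - exact: (measurable_quadratic _ _ _ mD mF).
      - move=> o _; rewrite lee_fin mul0r addr0 add0r -sumrB -[X in X%:R * _](card_ord k); exact: sum_sqr_le.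
    rewrite (integral_quadratic _ _ _ _ mD mF)// mul0e adde0 add0e -mulrA (EFinM k%:R); apply: lee_wpmul2l => //.
    apply: (@le_trans _ _ (\sum_(i < k) (t ^+ 2)%:E)%E); first by apply: lee_sum => i _; exact: close.
    by rewrite sumEFin sumr_const card_ord -[t ^+ 2 *+ k]mulr_natl.
  have mSch : measurable_fun setT (fun o => \sum_i ch i o) by exact: measurable_sum.
  have := second_moment_perturb mS mSch t0 D; rewrite hV tvE -EFinM -EFinD lee_fin => h.
  apply: (le_trans h).
  have -> : (1 + t^-1) * (k%:R * k%:R * t ^+ 2) = k%:R * k%:R * (t ^+ 2 + t) by rewrite -e1; ring.
  have : k%:R * k%:R * (t ^+ 2 + t) <= k%:R * k%:R * (2 * t) by apply: ler_wpM2l => //; lra.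
  by rewrite expr2; lra.
exists (\sum_i v i) => //.
exists (gap_constant R q * beta * (1 + \sum_i v i) * 2 + \sum_i `|sg i - v i|).
  by rewrite lerD2l mulr_sumr; apply: ler_sum => i _.
exists (fun=> True), (fun u => Ex p (fun b => u (chaos_vec x1 x0 g b))); split.
- exact: (chaos_functional _ (model_prob md)).
- move=> A' phi' g' H' A'0 cl'.
  have w3 j : `|w j| <= 3 by have [] := model_bounds md j.
  have x13 j : `|x1 j| <= 3 by have [] := model_bounds md j.
  have x03 j : `|x0 j| <= 3 by have [] := model_bounds md j.
  have := chaos_gap q_gt0 (model_prob md) (model_mean md) (model_x1 md) (model_x0 md) w3 x13 x03 hg beta0 diag offd four q_lt cl' (fun i => Num.sqrt (sg i)).
  by under [X in _ + X]eq_bigr do rewrite sqr_sqrtr ?sg0//.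
- apply: addr_ge0; last by apply: sumr_ge0.
  apply: mulr_ge0 => //; apply: mulr_ge0; last by rewrite addr_ge0// sumr_ge0.
  by apply: mulr_ge0; [exact: gap_constant_ge0|exact: ltW].
have -> : Ex p (fun b => phi (chaos_vec x1 x0 g b)) = fine (\int[P]_o (phi (\row_i ch i o))%:E).
  by rewrite (model_law md (fun b => phi (chaos_vec x1 x0 g b))).
have ti : 0 <= t^-1 by rewrite invr_ge0 ltW.
have t0' := ltW t0; have ti1 : 0 <= t^-1 + 1 by rewrite addr_ge0.
have mFc i : measurable_fun setT (fun o => F i o - ch i o) by exact: measurable_funB.
have iF : P.-integrable setT (EFin \o (fun w => phi (\row_i F i w))).
  by apply: growth_integrable => // i; exact: approximable_square_integrable.
have ich : P.-integrable setT (EFin \o (fun w => phi (\row_i ch i w))).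
  by apply: growth_integrable => // i; rewrite hv ltry.
have sgle i : (\int[P]_w (F i w ^+ 2)%:E <= (sg i)%:E)%E by rewrite sgE.
apply: (le_trans (expectation_diff (c0 := L * (2 * t)) (c1 := L * (2 * t * k%:R)) (c2 := L * ((t^-1 + 1) * k%:R))
  _ _ _ mF mFc iF ich sgle close _)); try (by rewrite !mulr_ge0).
- move=> o; rewrite distrC.
  set x := \row_i F i o; set y : 'rV[R]_k := \row_i (ch i o - F i o).
  have -> : \row_i ch i o = x + y by apply/rowP => i; rewrite !mxE; ring.
  apply: (le_trans (growth x y)); rewrite -!mulrA -!mulrDr; apply: ler_wpM2l => //.
  have hx := sqr_norm1 (F ^~ o); have hy := sqr_norm1 (fun i => ch i o - F i o).
  have -> : \sum_i (F i o - ch i o) ^+ 2 = \sum_i (ch i o - F i o) ^+ 2.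
    by apply: eq_bigr => i _; rewrite -sqrrN opprB.
  rewrite -/x -/y in hx hy; move: (norm1_ge0 x) (norm1_ge0 y) hx hy.
  move: (norm1 x) (norm1 y) (k%:R * _) (k%:R * _) => a d' SX SY a0 d0 hx hy.
  apply: (@le_trans _ _ (2 * t + 2 * t * a ^+ 2 + (t^-1 + 1) * d' ^+ 2)); last first.
    apply: lerD; last exact: ler_wpM2l.
    have -> : 2 * t + 2 * t * a ^+ 2 = 2 * (t + t * a ^+ 2) by ring.
    by rewrite ler_pM2l// lerD2l; apply: ler_wpM2l.
  have s1 : 0 <= t^-1 * (t * (1 + a) - d') ^+ 2 by rewrite mulr_ge0 ?sqr_ge0.
  have s2 : t^-1 * (t * (1 + a) - d') ^+ 2 = t * (1 + a) ^+ 2 - 2 * ((1 + a) * d') + t^-1 * d' ^+ 2.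
    by field; rewrite gt_eqF.
  have s3 : 0 <= t * (1 - a) ^+ 2 by rewrite mulr_ge0 ?sqr_ge0.
  have s4 : 0 <= t^-1 * d' ^+ 2 by rewrite mulr_ge0 ?sqr_ge0.
  have s5 : 0 <= (1 + a) * d' by rewrite mulr_ge0// addr_ge0.
  have s6 : t * (1 - a) ^+ 2 = t - 2 * (t * a) + t * a ^+ 2 by ring.
  have s7 : t * (1 + a) ^+ 2 = t + 2 * (t * a) + t * a ^+ 2 by ring.
  have -> : (1 + a + d') * d' = (1 + a) * d' + d' ^+ 2 by ring.
  rewrite mulrDl mul1r s2 in s1 *; rewrite s6 in s3; rewrite s7 in s1.
  by lra.
rewrite sumr_const card_ord -[t ^+ 2 *+ k]mulr_natl.
have -> : L * ((t^-1 + 1) * k%:R) * (k%:R * t ^+ 2) = L * (k%:R * k%:R * ((1 + t^-1) * t ^+ 2)) by ring.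
rewrite e1.
have -> : t * (L * (2 + 2 * k%:R * \sum_i sg i + 2 * k%:R * k%:R)) =
  L * (2 * t) + L * (2 * t * k%:R) * (\sum_i sg i) + L * (k%:R * k%:R * (2 * t)) by ring.
by rewrite lerD2l; apply: ler_wpM2l => //; apply: ler_wpM2l => //; lra.
Qed.

(** The finite model is compared with the exact law by [stein_comparison]; letting t tend to 0 with
    beta fixed leaves only the term in beta. *)
Lemma model_comparison D2 E2 : expectation_functional D2 E2 ->
  (forall A phi g H, 0 <= A -> stein_class A phi g H -> E2 (stein_gap (fun i => Num.sqrt (sg i)) g H) = 0) ->
  `|fine (\int[P]_w (phi (\row_i F i w))%:E) - E2 phi| <=
  A * (gap_constant R q * beta * (1 + total_variance) * 2).
Proof.
move=> DE2 gap2; have gc0 : 0 <= gap_constant R q := gap_constant_ge0 R q.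
set S1 := \sum_i (2 * sg i + 4); set M3 := L * (2 + 2 * k%:R * \sum_i sg i + 2 * k%:R * k%:R).
have S10 : 0 <= S1 by apply: sumr_ge0 => i _; rewrite addr_ge0// mulr_ge0.
have M30 : 0 <= M3 by rewrite mulr_ge0// !addr_ge0// !mulr_ge0// sumr_ge0.
set W := total_variance + 2 * k%:R ^+ 2.
have W0 : 0 <= W by rewrite addr_ge0// mulr_ge0// sqr_ge0.
set c := gap_constant R q * beta.
have c0 : 0 <= c by rewrite mulr_ge0// ltW.
apply: (@le_limit0 _ _ _ (M3 + A * (c * W * 2 + S1))).
  by apply: addr_ge0 => //; apply: mulr_ge0 => //; apply: addr_ge0 => //; apply: mulr_ge0 => //; exact: mulr_ge0.
move=> t t0 t1; have [V Vle [kap kle [D1 [E1 [DE1 gap1 kap0 close]]]]] := bound_t t0 t1.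
have gap2' A' phi' g' H' : 0 <= A' -> stein_class A' phi' g' H' ->
    `|E2 (stein_gap (fun i => Num.sqrt (sg i)) g' H')| <= 0 * A'.
  by move=> A'0 c'; rewrite (gap2 A' phi' g' H')// normr0 mul0r.
have h := stein_comparison DE1 DE2 kap0 (lexx 0) gap1 gap2' A0 cl.
rewrite -(subrK (E1 phi) (fine _)) -addrA; apply: (le_trans (ler_normD _ _)).
have kb : kap <= c * (1 + total_variance) * 2 + t * (c * W * 2 + S1).
  apply: (le_trans kle).
  have -> : c * (1 + total_variance) * 2 + t * (c * W * 2 + S1) = c * (1 + (total_variance + t * W)) * 2 + t * S1 by ring.
  by rewrite lerD2r ler_wpM2r// ler_wpM2l// lerD2l.
have -> : A * (c * (1 + total_variance) * 2) + t * (M3 + A * (c * W * 2 + S1)) =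
  t * M3 + A * (c * (1 + total_variance) * 2 + t * (c * W * 2 + S1)) by ring.
apply: lerD => //; apply: (le_trans h); rewrite addr0; exact: ler_wpM2l.
Qed.

End comparison.

(** * Poisson chaoses under the assumptions of the theorem *)

Section chaos_family.
Context dO (Omega : measurableType dO) d (Z : measurableType d) (R : realType).
Variables (P : probability Omega R) (mu : {sigma_finite_measure set Z -> \bar R}).
Variables (eta : Omega -> {measure set Z -> \bar R}) (heta : poisson_measure P mu eta).
Hypotheses (hZ : borel_space R Z) (hmu : atomless mu).
Local Notation tm := (tuple_measure mu).
Local Notation Iint := (tuple_integral mu).

Lemma star_norm_sqr p q (f : p.-tuple Z -> R) (g : q.-tuple Z -> R) r l :
  (star_contraction_norm mu f g r l * star_contraction_norm mu f g r l =
   Iint (p + q - r - l) (fun x => star mu p (kernel_at f) (kernel_at g) r l x *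
     star mu p (kernel_at f) (kernel_at g) r l x))%E.
Proof. by rewrite /star_contraction_norm Lnorm2_mul. Qed.

(** With r = q the contraction of f with itself is the partial integral of f^2. *)
Lemma sqr_block_star q (f : q.-tuple Z -> R) a : (a <= q)%N ->
  sqr_block mu a q (kernel_at f) =
  (star_contraction_norm mu f f q (q - a) * star_contraction_norm mu f f q (q - a))%E.
Proof.
move=> aq; rewrite star_norm_sqr (_ : (q + q - q - (q - a))%N = a); last by rewrite addnK subKn.
rewrite /sqr_block /block_energy; apply: eq_Iint => x xa.
have -> : star mu q (kernel_at f) (kernel_at f) q (q - a) x = Iint (q - a) (fun z => (kernel_at f (z ++ x) ^+ 2)%:E).
  rewrite /star subKn// -xa take_size drop_size; apply: eq_integral => z _.
  by rewrite cats0 expr2.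
by [].
Qed.

Context (k : nat) (q : 'I_k -> nat).
Hypothesis q_gt0 : forall i, (0 < q i)%N.
Variables (f : forall i : 'I_k, (q i).-tuple Z -> R) (F : 'I_k -> Omega -> R).
Arguments f : clear implicits.
Hypothesis f_L2 : forall i, f i \in Lfun (tm (q i)) 2%:E.
Hypothesis f_sym : forall i, ae_symmetric mu (f i).
Hypothesis f_tech : technical_assumptions mu f.
Hypothesis mF : forall i, measurable_fun setT (F i).
Hypothesis hF : forall i, is_multiple_integral P mu eta (f i) (F i).

Let mf i : measurable_fun setT (f i).
Proof. exact: set_mem (sub_Lfun_mfun (f_L2 i)). Qed.
Arguments mf : clear implicits.

Lemma symmetric_family : exists ft : forall i : 'I_k, (q i).-tuple Z -> R,
  [/\ forall i, measurable_fun setT (ft i), forall i, psym (kernel_at (ft i)) &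
      forall i, {ae tm (q i), forall x, f i x = ft i x}].
Proof.
have /(_ _)/cid-/all_sig[ft hft] i := symmetric_version (mf i) (@f_sym i).
by exists ft; split => i; have [] := hft i.
Qed.

Lemma kernel_integral (Phi : R -> R) i (ft : (q i).-tuple Z -> R) : measurable_fun setT Phi ->
  measurable_fun setT ft -> {ae tm (q i), forall x, f i x = ft x} ->
  Iint (q i) (fun s => (Phi (kernel_at ft s))%:E) = (\int[tm (q i)]_x (Phi (f i x))%:E)%E.
Proof.
move=> mPhi mft ff; rewrite /tuple_integral; under eq_integral do rewrite kernel_atE.
apply: ae_eq_integral => //.
- by apply/measurable_EFinP; exact: measurableT_comp mPhi mft.
- by apply/measurable_EFinP; exact: measurableT_comp mPhi (mf i).
- by apply: filterS ff => x -> _.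
Qed.

(** Square integrability gives a = 0, and assumption (i) gives a >= 1. *)
Lemma block_finite i (ft : (q i).-tuple Z -> R) a : measurable_fun setT ft ->
  {ae tm (q i), forall x, f i x = ft x} -> (a <= q i)%N -> (sqr_block mu a (q i) (kernel_at ft) < +oo)%E.
Proof.
move=> mft ff aq; case: a aq => [|a] aq.
  rewrite sqr_block_full; last exact: smeas_kernel_at.
  rewrite (kernel_integral (Phi := fun y => y ^+ 2) _ mft ff)//.
  have fin : ('N[tm (q i)]_2%:E[EFin \o f i] < +oo)%E by exact: set_mem (sub_Lfun_finLfun (f_L2 i)).
  have -> : (\int[tm (q i)]_x (f i x ^+ 2)%:E = 'N[tm (q i)]_2%:E[EFin \o f i] * 'N[tm (q i)]_2%:E[EFin \o f i])%E.
    by rewrite Lnorm2_mul; apply: eq_integral => x _; rewrite /= expr2 EFinM.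
  have N0 := Lnorm_ge0 (tm (q i)) 2%:E (EFin \o f i).
  by rewrite !lte_mul_pinfty ?ge0_fin_numE ?mule_ge0// lte_mul_pinfty ?ge0_fin_numE.
rewrite sqr_block_star//.
have -> : star_contraction_norm mu ft ft (q i) (q i - a.+1) = star_contraction_norm mu (f i) (f i) (q i) (q i - a.+1).
  apply/esym/eq_star_norm => //; exact: leq_subr.
have fin := technical_i f_tech (i := i) (r := a.+1) aq.
have N0 : (0 <= star_contraction_norm mu (f i) (f i) (q i) (q i - a.+1))%E := Lnorm_ge0 _ _ _.
by rewrite lte_mul_pinfty ?ge0_fin_numE.
Qed.

Lemma multiple_integral_ae i (ft : (q i).-tuple Z -> R) : measurable_fun setT ft ->
  {ae tm (q i), forall x, f i x = ft x} -> is_multiple_integral P mu eta ft (F i).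
Proof.
move=> mft ff; have [s [sok c1 c2]] := hF i; exists s; split => //.
suff -> : (fun n => 'N[tm (q i)]_2%:E[(fun x => (elementary_kernel (s n) x - ft x)%:E)]%E) =
          (fun n => 'N[tm (q i)]_2%:E[(fun x => (elementary_kernel (s n) x - f i x)%:E)]%E) by [].
apply/funext => n; have ms := measurable_elementary_kernel (sok n).
apply: eq_Lnorm2_ae; [by apply/measurable_EFinP; exact: (measurable_funB ms mft)|by apply/measurable_EFinP; exact: (measurable_funB ms (mf i))|].
by apply: filterS ff => x ->.
Qed.

Let sqr_le (x : \bar R) (b : R) : (0 <= x)%E -> (x <= b%:E)%E -> (x * x <= (b ^+ 2)%:E)%E.
Proof. by move=> x0 xb; rewrite expr2 EFinM; apply: lee_pmul. Qed.

Definition model_scale : R := Num.sqrt (2 * (12 * (\prod_i (q i)`!)%:R ^+ 4)).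

(** With K the constant of [discrete_approximation] and an error at most b^2, every energy is at
    most 2 K b^2, the square of [model_scale] times b. *)
Lemma chaos_approximable (b e : R) : 0 < b ->
  (forall i r l, (0 < l)%N -> (l <= r)%N -> (r <= q i)%N -> (l < q i)%N ->
    (star_contraction_norm mu (f i) (f i) r l <= b%:E)%E) ->
  (forall (i j : 'I_k) r l, (i < j)%N -> (0 < l)%N -> (l <= r)%N -> (r <= q i)%N -> (r <= q j)%N ->
    (star_contraction_norm mu (f i) (f j) r l <= b%:E)%E) ->
  (forall i, ('N[tm (q i)]_4%:E[EFin \o f i] ^+ 2 <= b%:E)%E) ->
  (forall i j : 'I_k, (i < j)%N -> (q i < q j)%N) ->
  0 < e -> approximable P q F (model_scale * b) e.
Proof.
move=> b0 hd ho h4 q_lt e0.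
have [ft [mft sft ff]] := symmetric_family.
pose e' := Num.min e (b ^+ 2); have e'0 : 0 < e' by rewrite lt_min e0 exprn_gt0.
have [e'e e'b] : e' <= e /\ e' <= b ^+ 2 by rewrite /e' !ge_min !lexx orbT.
have [T [p [x1 [x0 [m [w [pat [g [md hg close en mo]]]]]]]]] :=
  discrete_approximation heta hZ hmu mft sft (fun i a => @block_finite i (ft i) a (mft i) (ff i)) mF
    (fun i => multiple_integral_ae (mft i) (ff i)) e'0.
set K := 12 * _ in en mo; have K0 : 0 <= K by rewrite mulr_ge0// exprn_ge0.
have betaE : (model_scale * b) ^+ 2 = K * (b ^+ 2 + b ^+ 2).
  by rewrite exprMn sqr_sqrtr ?mulr_ge0// -/K; ring.
have fin (x : \bar R) (y : R) : (y%:E <= K%:E * (x + e'%:E))%E -> (x <= (b ^+ 2)%:E)%E -> y <= (model_scale * b) ^+ 2.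
  move=> yx xb; rewrite betaE -lee_fin; apply: (le_trans yx); rewrite (EFinM K); apply: lee_wpmul2l; first by rewrite lee_fin.
  by rewrite EFinD; apply: leeD.
exists T, p, x1, x0, m, w, pat, g; split => //.
- by move=> i; apply: (le_trans (close i)); rewrite lee_fin.
- split=> [i r l l0 lr rq lq|i j r l ij l0 lr rq].
    apply: (fin _ _ (en i i r l lr rq rq)); rewrite -star_norm_sqr; apply: sqr_le; first exact: Lnorm_ge0.
    by rewrite -(eq_star_norm lr rq rq (mf i) (mft i) (mf i) (mft i) (ff i) (ff i)); exact: hd.
  have rj : (r <= q j)%N by apply: (leq_trans rq); exact: ltnW (q_lt _ _ ij).
  apply: (fin _ _ (en i j r l lr rq rj)); rewrite -star_norm_sqr; apply: sqr_le; first exact: Lnorm_ge0.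
  by rewrite -(eq_star_norm lr rq rj (mf i) (mft i) (mf j) (mft j) (ff i) (ff j)); exact: ho.
- move=> i; have [_ h] := mo i; apply: (fin _ _ h).
  rewrite (kernel_integral (Phi := fun y => y ^+ 4) _ (mft i) (ff i))// -Lnorm4_mul.
  by apply: sqr_le => //; apply: sqre_ge0.
Qed.

(** If the variance were 0, a model with error e would have squared kernel norm at most 2e, and f
    would satisfy a bound 2 (2e + e) = 6e for every e > 0. Positivity is needed for the normal law
    with this variance to be meaningful. *)
Lemma chaos_variance_gt0 i : ~ {ae tm (q i), forall x, f i x = 0} -> (\int[P]_w (F i w ^+ 2)%:E < +oo)%E ->
  0 < fine (\int[P]_w (F i w ^+ 2)%:E).
Proof.
move=> fnz fin; rewrite lt_neqAle fine_ge0 ?andbT; last by apply: integral_ge0 => o _; rewrite lee_fin sqr_ge0.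
apply/negP => /eqP v0; apply: fnz.
have FE : (\int[P]_w (F i w ^+ 2)%:E = 0)%E.
  by rewrite -(@fineK _ (\int[P]_w (F i w ^+ 2)%:E)%E) -?v0// ge0_fin_numE//; apply: integral_ge0 => o _; rewrite lee_fin sqr_ge0.
have [ft [mft sft ff]] := symmetric_family.
have small (e : R) : 0 < e -> (Iint (q i) (fun s => (kernel_at (ft i) s ^+ 2)%:E) <= (6 * e)%:E)%E.
  move=> e0; have [T [p [x1 [x0 [m [w [pat [g [md hg close en mo]]]]]]]]] :=
    discrete_approximation heta hZ hmu mft sft (fun i a => @block_finite i (ft i) a (mft i) (ff i)) mF
    (fun i => multiple_integral_ae (mft i) (ff i)) e0.
  have [h _] := mo i; apply: (le_trans h); rewrite lee_fin.
  have mch : measurable_fun setT (fun o => chaos x1 x0 (g i) (pat o)) by exact: (model_measurable md (chaos x1 x0 (g i))).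
  have := second_moment_perturb (mF i) mch ltr01 (close i).
  rewrite FE mule0 add0e (model_law md (fun b => chaos x1 x0 (g i) b ^+ 2)).
  rewrite (chaos_sqr (model_mean md) (model_x1 md) (model_x0 md)) lee_fin invr1; lra.
have I0 : Iint (q i) (fun s => (kernel_at (ft i) s ^+ 2)%:E) = 0%E.
  apply/eqP; rewrite eq_le Iint_ge0 ?andbT; last by move=> s; rewrite lee_fin sqr_ge0.
  apply/lee_addgt0Pr => e e0; rewrite add0e.
  by apply: (le_trans (small (e / 6) _)); rewrite ?divr_gt0// lee_fin mulrC divfK.
have z : {ae tm (q i), forall x : (q i).-tuple Z, (kernel_at (ft i) x ^+ 2)%:E = 0%E}.
  by apply: (ae_zero (smeas_sqr (smeas_kernel_at (mft i))) _ I0) => s; rewrite lee_fin sqr_ge0.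
apply: filterS2 (ff i) z => x -> /=; rewrite kernel_atE => -[/eqP].
by rewrite sqrf_eq0 => /eqP.
Qed.

End chaos_family.

(** * Extracting the individual norms from B_3 *)

Section B3_bounds.
Context d (Z : measurableType d) (R : realType) (mu : {sigma_finite_measure set Z -> \bar R}).
Variables (k : nat) (q : 'I_k -> nat) (f : forall i, (q i).-tuple Z -> R).
Arguments f : clear implicits.

Lemma B3_bound (s e : R) : 0 < s -> (B3 mu f s <= e%:E)%E ->
  [/\ forall i r l, (0 < l)%N -> (l <= r)%N -> (r <= q i)%N -> (l < q i)%N ->
        (star_contraction_norm mu (f i) (f i) r l <= (s * e)%:E)%E,
      forall (i j : 'I_k) r l, (i < j)%N -> (0 < l)%N -> (l <= r)%N -> (r <= q i)%N -> (r <= q j)%N ->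
        (star_contraction_norm mu (f i) (f j) r l <= (s * e)%:E)%E &
      forall i, ('N[tuple_measure mu (q i)]_4%:E[EFin \o f i] ^+ 2 <= (s * e)%:E)%E].
Proof.
move=> s0; rewrite /B3 lee_pdivrMl//.
set M1 := \big[_/_]_(i < k | _) _; set M2 := \big[_/_]_(i < k) \big[_/_]_(j < k | _) _; set M4 := \big[_/_]_(i < k) _.
have M10 : (0 <= M1)%E by exact: bigmax_ge_id.
have M20 : (0 <= M2)%E by exact: bigmax_ge_id.
have M40 : (0 <= M4)%E by exact: bigmax_ge_id.
rewrite -EFinM => h.
have h1 : (M1 <= (s * e)%:E)%E by apply: le_trans h; rewrite -addeA leeDl// adde_ge0.
have h2 : (M2 <= (s * e)%:E)%E by apply: le_trans h; rewrite addeAC leeDr// adde_ge0.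
have h4 : (M4 <= (s * e)%:E)%E by apply: le_trans h; rewrite leeDr// adde_ge0.
split=> [i r l l0 lr rq lq|i j r l ij l0 lr rqi rqj|i].
- have q1 : (1 < q i)%N by exact: leq_ltn_trans lq.
  apply: le_trans h1.
  apply: (le_trans _ (@le_bigmax_cond _ _ _ _ i (fun i => (1 < q i)%N) _ q1)).
  apply: (@bigmax_sup_seq _ _ _ _ _ r) => //; first by rewrite mem_index_iota ltnS rq andbT (leq_trans l0).
  apply: (@bigmax_sup_seq _ _ _ _ _ l) => //; rewrite mem_index_iota l0 ltnS leq_min lr /=.
  by rewrite subn1 -ltnS prednK// (leq_trans _ q1).
- apply: le_trans h2.
  apply: (le_trans _ (@le_bigmax _ _ _ _ _ i)).
  apply: (le_trans _ (@le_bigmax_cond _ _ _ _ j (fun j : 'I_k => (i < j)%N) _ ij)).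
  apply: (@bigmax_sup_seq _ _ _ _ _ r) => //; first by rewrite mem_index_iota ltnS rqi andbT (leq_trans l0).
  by apply: (@bigmax_sup_seq _ _ _ _ _ l) => //; rewrite mem_index_iota l0 ltnS lr.
- by apply: le_trans h4; exact: (le_bigmax _ _ i).
Qed.

End B3_bounds.

(** * The bound at fixed n and the limit *)

Section gaussian_comparison.
Context dO (Omega : measurableType dO) d (Z : measurableType d) (R : realType).
Variables (P : probability Omega R) (mu : {sigma_finite_measure set Z -> \bar R}).
Variables (eta : Omega -> {measure set Z -> \bar R}) (heta : poisson_measure P mu eta).
Hypotheses (hZ : borel_space R Z) (hmu : atomless mu).
Context (k : nat) (q : 'I_k -> nat).
Hypothesis q_gt0 : forall i, (0 < q i)%N.
Hypothesis q_lt : forall i j : 'I_k, (i < j)%N -> (q i < q j)%N.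
Variables (f : forall i : 'I_k, (q i).-tuple Z -> R) (F : 'I_k -> {RV P >-> R}).
Arguments f : clear implicits.
Hypothesis f_L2 : forall i, f i \in Lfun (tuple_measure mu (q i)) 2%:E.
Hypothesis f_sym : forall i, ae_symmetric mu (f i).
Hypothesis f_nz : forall i, ~ {ae tuple_measure mu (q i), forall x, f i x = 0}.
Hypothesis f_tech : technical_assumptions mu f.
Hypothesis hF : forall i, is_multiple_integral P mu eta (f i) (F i).
Context dN (OmegaN : measurableType dN) (PN : probability OmegaN R) (N : 'I_k -> {RV PN >-> R}).
Hypothesis N_indep : independent_RVs PN (fun i => N i : OmegaN -> R).
Hypothesis N_law : forall i, centered_gaussian PN (N i) (fine ('E_P[(fun w => F i w ^+ 2)%R])%E).
Variables (A L : R) (phi : 'rV[R]_k -> R) (G : 'I_k -> 'rV[R]_k -> R) (H : 'I_k -> 'I_k -> 'rV[R]_k -> R).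
Hypotheses (A0 : 0 <= A) (L0 : 0 <= L) (cl : stein_class A phi G H).
Hypothesis growth : forall x y, `|phi (x + y) - phi x| <= L * ((1 + norm1 x + norm1 y) * norm1 y).

Lemma chaos_gaussian_comparison (s e : R) : 0 < s -> 0 < e -> (B3 mu f s <= e%:E)%E ->
  ('E_P[(fun w => phi (\row_i F i w))%R] - 'E_PN[(fun w => phi (\row_i N i w))%R])%E \is a fin_num /\
  `|fine ('E_P[(fun w => phi (\row_i F i w))%R] - 'E_PN[(fun w => phi (\row_i N i w))%R])%E| <=
    A * (gap_constant R q * (model_scale R q * (s * e)) *
      (1 + fine ('E_P[(fun w => (\sum_i F i w) ^+ 2)%R])%E) * 2).
Proof.
move=> s0 e0 /(B3_bound s0)[h1 h2 h4]; have b0 : 0 < s * e by exact: mulr_gt0.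
have mF i : measurable_fun setT (F i) by [].
have approx t (t0 : 0 < t) := chaos_approximable heta hZ hmu f_L2 f_sym f_tech mF hF b0 h1 h2 h4 q_lt t0.
have sc0 : 0 < model_scale R q * (s * e).
  have p0 : 0 < (\prod_i (q i)`!)%:R :> R by rewrite ltr0n prodn_gt0// => i; exact: fact_gt0.
  by rewrite mulr_gt0// sqrtr_gt0 mulr_gt0// mulr_gt0// exprn_gt0.
have sq := approximable_square_integrable mF approx.
have EF2 i : fine ('E_P[(fun w => F i w ^+ 2)%R])%E = variance_of P F i by rewrite unlock.
have v0 i : 0 < variance_of P F i by exact: (chaos_variance_gt0 heta hZ hmu f_L2 f_sym f_tech mF hF (@f_nz i) (sq i)).
have s1 i : 0 < Num.sqrt (variance_of P F i) by rewrite sqrtr_gt0.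
have law i B : measurable B -> PN (N i @^-1` B) = normal_prob 0 (Num.sqrt (variance_of P F i)) B.
  by move=> mB; rewrite (N_law i mB) EF2.
have DE := gaussian_functional s1 law.
have := model_comparison q_gt0 q_lt mF sc0 approx A0 L0 cl growth DE
  (fun A phi g H A0 cl => gaussian_gap s1 N_indep law A0 cl).
have iF := growth_integrable A0 L0 cl growth mF sq.
have [iN _ _] := exf_class DE A0 cl.
have fF := integrable_fin_num measurableT iF.
have fN := integrable_fin_num measurableT iN.
have EE d' (O : measurableType d') (Q : probability O R) (u : O -> R) : ('E_Q[u] = \int[Q]_w (u w)%:E)%E by rewrite unlock.
rewrite !EE => h; split; first by rewrite (fin_numB (\int[P]_w (phi (\row_i F i w))%:E)%E) fF fN.
by rewrite fineB.
Qed.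

End gaussian_comparison.

Theorem proposition3p14 (R : realType)
  (d : measure_display) (Z : measurableType d) (hZ : borel_space R Z)
  (k : nat) (hk : (1 <= k)%N)
  (q : 'I_k -> nat) (hq1 : forall i, (1 <= q i)%N)
  (hq : forall i j : 'I_k, (i < j)%N -> (q i < q j)%N)
  (mu : nat -> {sigma_finite_measure set Z -> \bar R})
  (hmu : forall n, atomless (mu n))
  (dO : nat -> measure_display) (Omega : forall n, measurableType (dO n))
  (P : forall n, probability (Omega n) R)
  (eta : forall n, Omega n -> {measure set Z -> \bar R})
  (heta : forall n, poisson_measure (P n) (mu n) (eta n))
  (f : forall (n : nat) (i : 'I_k), (q i).-tuple Z -> R)
  (hf_L2 : forall n i, f n i \in Lfun (tuple_measure (mu n) (q i)) 2%:E)
  (hf_sym : forall n i, ae_symmetric (mu n) (f n i))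
  (hf_nz : forall n i, ~ {ae tuple_measure (mu n) (q i), forall x, f n i x = 0})
  (hf_tech : forall n, technical_assumptions (mu n) (f n))
  (F : forall (n : nat) (i : 'I_k), {RV P n >-> R})
  (hF : forall n i,
    is_multiple_integral (P n) (mu n) (eta n) (f n i) (F n i))
  (sigma : R) (hsigma : 0 < sigma)
  (hvar : ('E_(P n)[(fun w => (\sum_(i < k) F n i w) ^+ 2)%R])%E @[n --> \oo]
            --> (sigma ^+ 2)%:E)
  (hB3 : B3 (mu n) (f n) sigma @[n --> \oo] --> 0%E)
  (dN : nat -> measure_display) (OmegaN : forall n, measurableType (dN n))
  (PN : forall n, probability (OmegaN n) R)
  (N : forall (n : nat) (i : 'I_k), {RV PN n >-> R})
  (hN_indep : forall n, independent_RVs (PN n) (fun i => N n i : OmegaN n -> R))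
  (hN_law : forall n i,
    centered_gaussian (PN n) (N n i) (fine ('E_(P n)[(fun w => F n i w ^+ 2)%R])%E))
  (phi : 'rV[R]_k -> R) (hphi : thrice_differentiable phi)
  (hphi2 : (norm_D2 phi < +oo)%E) (hphi3 : (norm_D3 phi < +oo)%E) :
  ('E_(P n)[(fun w => phi (\row_i F n i w))%R]
     - 'E_(PN n)[(fun w => phi (\row_i N n i w))%R])%E @[n --> \oo] --> 0%E.
Proof.
have [A A0 cl] := smooth_stein_class hphi hphi2 hphi3.
have [L L0 growth] : exists2 L : R, 0 <= L & forall x y, `|phi (x + y) - phi x| <= L * ((1 + norm1 x + norm1 y) * norm1 y).
  by apply: (smooth_growth hphi A0); case: cl.
have step n e (e0 : 0 < e) := chaos_gaussian_comparison (heta n) hZ (hmu n) hq1 hq (@hf_L2 n) (@hf_sym n) (@hf_nz n)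
  (hf_tech n) (@hF n) (hN_indep n) (@hN_law n) A0 L0 cl growth hsigma e0.
have /fine_cvgP[_ cvV] := hvar.
(* The total variance converges, so it is eventually at most 1 + sigma^2; the bound at rank n then
   becomes C times e with C independent of n. *)
pose C := A * (gap_constant R q * (model_scale R q * sigma) * (2 + sigma ^+ 2) * 2).
have C0 : 0 <= C.
  rewrite !mulr_ge0 ?gap_constant_ge0 ?sqrtr_ge0 ?addr_ge0 ?sqr_ge0//; exact: ltW.
have small e : 0 < e -> \forall n \near \oo,
  ('E_(P n)[(fun w => phi (\row_i F n i w))%R] - 'E_(PN n)[(fun w => phi (\row_i N n i w))%R])%E \is a fin_num /\
  `|fine ('E_(P n)[(fun w => phi (\row_i F n i w))%R] - 'E_(PN n)[(fun w => phi (\row_i N n i w))%R])%E| <= C * e.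
  move=> e0; near=> n.
  have Be : (B3 (mu n) (f n) sigma <= e%:E)%E by near: n; exact: ecvg0_near.
  have [fin bd] := step n e e0 Be; split=> //; apply: (le_trans bd).
  have V : fine ('E_(P n)[(fun w => (\sum_i F n i w) ^+ 2)%R])%E <= 1 + sigma ^+ 2.
    have : `|sigma ^+ 2 - fine ('E_(P n)[(fun w => (\sum_i F n i w) ^+ 2)%R])%E| <= 1.
      by near: n; exact: (cvgrPdist_le _ _).1 cvV 1 ltr01.
    by rewrite ler_norml => /andP[+ _]; rewrite lerBrDl lerBlDr addrC.
  have {}V : 1 + fine ('E_(P n)[(fun w => (\sum_(i < k) F n i w) ^+ 2)%R])%E <= 2 + sigma ^+ 2.
    by rewrite -[X in X + _ ^+ 2]/(1 + 1) -addrA lerD2l.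
  have -> : C * e = A * (gap_constant R q * (model_scale R q * (sigma * e)) * (2 + sigma ^+ 2) * 2).
    by rewrite /C; ring.
  rewrite ler_wpM2l// ler_wpM2r// ler_wpM2l//.
  by rewrite !mulr_ge0 ?gap_constant_ge0 ?sqrtr_ge0//; exact: ltW.
apply/fine_cvgP; split; first by apply: filterS (small 1 ltr01) => n [].
apply/cvgrPdist_le => e e0; have C1 : 0 < C + 1 by rewrite ltr_wpDl.
apply: filterS (small (e / (C + 1)) (divr_gt0 e0 C1)) => n [_ h].
rewrite sub0r normrN /=; apply: (le_trans h); rewrite mulrCA ler_piMr ?(ltW e0)//.
by rewrite ler_pdivrMr// mul1r lerDl.
Unshelve. all: by end_near.
Qed.
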